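(* Let $N\ge 2$ be an integer and let $\{Q_1,Q_2\}$ be a basis of $\mathbf{Z}/N\mathbf{Z}\oplus\mathbf{Z}/N\mathbf{Z}$. Then the function $C_N\Lambda(\tau;Q_1,Q_2)$ is integral over $\mathbf{Z}[j]$. Moreover, if $\theta$ is a point of the complex upper half plane such that $\mathbf{Q}(\theta)$ is an imaginary quadratic field, then $C_N\Lambda(\theta;Q_1,Q_2)$ is an algebraic integer.
   Context: For $\tau$ in the complex upper half plane, $L_\tau=\mathbf{Z}+\mathbf{Z}\tau$ and $\wp(z;L_\tau)$ is the Weierstrass $\wp$-function of $L_\tau$. For $(r,s)\in\mathbf{Z}/N\mathbf{Z}\oplus\mathbf{Z}/N\mathbf{Z}$ put $\varphi_\tau((r,s))\equiv(r\tau+s)/N \pmod{L_\tau}$, and for a basis $\{Q_1,Q_2\}$ define $$\Lambda(\tau;Q_1,Q_2)=\frac{\wp(\varphi_\tau(Q_1);L_\tau)-\wp(\varphi_\tau(Q_1+Q_2);L_\tau)}{\wp(\varphi_\tau(Q_2);L_\tau)-\wp(\varphi_\tau(Q_1+Q_2);L_\tau)}.$$ $j$ is the elliptic modular invariant. The integer $C_N$ is defined by: $C_2=2^4$; for $N>2$, $C_N=p^2$ if $N$ is a power of $p\in\{2,3\}$, $C_N=p$ if $N$ is a power of a prime $p>3$, and $C_N=1$ if $N$ is not a prime power. *)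

(* Defs.v *)
From HB Require Import structures.
From mathcomp Require Import all_boot all_order all_algebra.
From mathcomp Require Import complex.
From mathcomp Require Import all_classical all_reals all_analysis.
From mathcomp Require Import summability.

Set Implicit Arguments.
Unset Strict Implicit.
Unset Printing Implicit Defensive.

Import Order.TTheory GRing.Theory Num.Theory.
Import numFieldNormedType.Exports.

Local Open Scope classical_set_scope.
Local Open Scope ring_scope.
Local Open Scope complex_scope.

Section WeierstrassFunctions.
Variable R : realType.
Local Notation C := R[i].

Definition lattice (tau : C) : set C :=
  [set w | exists m n : int, w = m%:~R + n%:~R * tau].

(* The unordered sum of f over the nonzero elements of L. The regular module
   C^o carries the normed topology of C. *)
Definition lattice_sum (L : set C) (f : C -> C) : C :=
  summability.sum
    ((fun w => if (w \in L) && (w != 0) then f w else 0) : C -> C^o).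

Definition wp (L : set C) (z : C) : C :=
  (z ^+ 2)^-1
  + lattice_sum L (fun w => ((z - w) ^+ 2)^-1 - (w ^+ 2)^-1).

Definition g2 (L : set C) : C := 60%:R * lattice_sum L (fun w => (w ^+ 4)^-1).

Definition g3 (L : set C) : C := 140%:R * lattice_sum L (fun w => (w ^+ 6)^-1).

Definition jinv (tau : C) : C :=
  let L := lattice tau in
  1728%:R * g2 L ^+ 3 / (g2 L ^+ 3 - 27%:R * g3 L ^+ 2).

End WeierstrassFunctions.

Section UpperHalfPlane.
Variable R : realType.

Definition upper_half_plane := {tau : R[i] | 0 < complex.Im tau}.

HB.instance Definition _ := Choice.on upper_half_plane.

Fact i_in_upper_half_plane : 0 < complex.Im ('i : R[i]).
Proof. exact: ltr01. Qed.

(* A base point makes the functions from the upper half plane to R[i] an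
   nzRingType, as integralOver requires. *)
HB.instance Definition _ := isPointed.Build upper_half_plane
  (exist (fun tau : R[i] => 0 < complex.Im tau) 'i i_in_upper_half_plane).

(* The image of this map is the ring Z[j] of functions on the upper half
   plane. *)
Definition poly_in_j (p : {poly int}) : upper_half_plane -> R[i] :=
  fun tau => (map_poly intr p).[jinv (val tau)].

End UpperHalfPlane.

Section TorsionPoints.
Variable N : nat.

(* Z/NZ + Z/NZ as a module over Z/NZ; 'Z_N is Z/NZ for 1 < N only. *)
Definition ZNxZN := (('Z_N)^o * ('Z_N)^o)%type.

Definition is_basis (Q1 Q2 : ZNxZN) : Prop :=
  forall Q : ZNxZN, exists! ab : 'Z_N * 'Z_N, Q = ab.1 *: Q1 + ab.2 *: Q2.

Variable R : realType.

(* phi is defined modulo the lattice only; this is the representative with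
   0 <= r, s < N. It is only used as an argument of wp, which is periodic. *)
Definition phi (tau : R[i]) (Q : ZNxZN) : R[i] :=
  ((Q.1 : nat)%:R * tau + (Q.2 : nat)%:R) / N%:R.

Definition Lambda (tau : R[i]) (Q1 Q2 : ZNxZN) : R[i] :=
  let wpQ Q := wp (lattice tau) (phi tau Q) in
  (wpQ Q1 - wpQ (Q1 + Q2)) / (wpQ Q2 - wpQ (Q1 + Q2)).

End TorsionPoints.

(* N > 1 is a power of the prime p iff primes N = [:: p]. *)
Definition CN (N : nat) : nat :=
  (if N == 2 then 2 ^ 4
   else if primes N is [:: p] then (if p <= 3 then p ^ 2 else p) else 1)%N.

Section Numbers.
Variable R : realType.
Local Notation C := R[i].

Definition algebraic_integer (z : C) : Prop := integralOver (intr : int -> C) z.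

(* Q(theta): the smallest subfield of the complex numbers containing theta. *)
Definition Q_adjoin (theta : C) : set C :=
  smallest [set K : set C | divring_closed [in K]] [set theta].

Definition is_Q_basis2 (K : set C) (u v : C) : Prop :=
  [/\ K u, K v & forall z, K z ->
    exists! ab : rat * rat, z = ratr ab.1 * u + ratr ab.2 * v].

(* A subfield of degree 2 over Q that is not contained in the reals. *)
Definition imaginary_quadratic_field (K : set C) : Prop :=
  [/\ divring_closed [in K],
      exists u v, is_Q_basis2 K u v &
      exists2 z, K z & complex.Im z != 0].

End Numbers.

(* Main.v *)
Require Import Defs.
From HB Require Import structures.
From mathcomp Require Import all_boot all_order all_algebra.
From mathcomp Require Import complex.
From mathcomp Require Import all_classical all_reals all_analysis.
From mathcomp Require Import ring lra zify ssrAC.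
From mathcomp Require Import finmap summability.

Set Implicit Arguments.
Unset Strict Implicit.
Unset Printing Implicit Defensive.

Import Order.TTheory GRing.Theory Num.Theory.
Import numFieldNormedType.Exports.
Local Open Scope ring_scope.

(** The points of C/L up to sign carry Kummer coordinates (X : Z), where X / Z is
the value of the Weierstrass function, and the pair {P + Q, P - Q} is given by
biquadratic forms in the coordinates of P and Q; this "Kummer law" is all that
is used of the group law, and it makes sense over any field.

Integrality over Z[j].  The functions on the upper half plane form a von
Neumann regular ring, so if C_N Lambda were not integral over Z[j] there would
be a field K, a morphism to K under which no monic polynomial over Z[j]
vanishes at C_N Lambda, and a valuation ring V of K containing the image of
Z[j] but not that of C_N Lambda.  Since j is in V, a Legendre or Deuring model
has good reduction.  Normalizing coordinates to have content 1, one gets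
|x1 z2 - x2 z1|^2 = |Z(P+Q) Z(P-Q)|, and for P of exact order N the division
polynomials give |C_N| <= |Z(P)|^2, whence C_N Lambda is in V.

Complex multiplication.  If j(theta) were not in V, the reduction would be
multiplicative.  The points of the Tate curve behave like K^*/(V^* k^Z) up to
inversion, and the multiplication by a quadratic integer would induce, on
points whose N-th power is k, a root modulo every N of a quadratic polynomial
of negative discriminant, which is impossible.

The Kummer law for the Weierstrass function itself, the surjectivity of that
function and the rationality of complex multiplication come from Liouville's
theorem applied to explicit periodic functions without poles. *)

(** * Valuation rings and Kummer coordinates *)

Section Valuation.
Variable K : fieldType.

(** An integral equation must hold with the same coefficients for all tau, so Lambda is one element
    of the ring of all functions on the upper half plane. A point is then a family (r tau + s) / (6
    N) indexed by integers r, s: the factor 6 provides the 2-torsion of the Legendre model and the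
    3-torsion of the Deuring model besides the points of the basis. The obstacle in the estimate is
    that the Kummer law sees a difference of x-coordinates only through its square, of the size of
    Z(P+Q) Z(P-Q). The denominator of Lambda thus involves Z(Q_1) and Z(Q_1 + 2 Q_2), both points of
    order N, and it is the fourth power of C_N Lambda that gets bounded. The shape of C_N comes from
    lower bounds in the kernel of reduction: |4| for |Z(P)| in order 2, |2| in order 4, |3| in order
    3, and |p| for |Z(P)|^2 when p > 3, where Z(P) and Z(2P) are two different roots of one
    polynomial with constant term p. For the second assertion it suffices that j(theta) is an
    algebraic integer, as C_N Lambda(theta) is integral over Z[j(theta)] by the first. *)

Definition valuation_ring (V : K -> Prop) : Prop :=
  [/\ V 1, forall x y, V x -> V y -> V (x - y),
      forall x y, V x -> V y -> V (x * y) & forall x, V x \/ V x^-1].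

Variable V : K -> Prop.
Hypothesis hV : valuation_ring V.

Lemma val1 : V 1. Proof. by case: hV. Qed.
Lemma valB x y : V x -> V y -> V (x - y). Proof. by case: hV => _ + _ _; apply. Qed.
Lemma valM x y : V x -> V y -> V (x * y). Proof. by case: hV => _ _ + _; apply. Qed.
Lemma val0 : V 0. Proof. by rewrite -(subrr 1); apply: valB val1 val1. Qed.
Lemma valN x : V x -> V (- x).
Proof. by move=> hx; rewrite -(sub0r x); apply: valB val0 hx. Qed.
Lemma valD x y : V x -> V y -> V (x + y).
Proof. by move=> hx hy; rewrite -(opprK y); apply: valB hx (valN hy). Qed.
Lemma valX x n : V x -> V (x ^+ n).
Proof. by move=> hx; elim: n => [|n ih]; [exact: val1 | rewrite exprS; exact: valM]. Qed.
Lemma valMn x n : V x -> V (x *+ n).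
Proof. by move=> hx; elim: n => [|n ih]; [exact: val0 | rewrite mulrS; exact: valD]. Qed.
Lemma val_nat n : V n%:R. Proof. exact: valMn val1. Qed.

(* [vle a b] is |a| <= |b| for the absolute value attached to V, and [vlt]
   the strict version *)
Definition vle a b := exists2 c, V c & a = c * b.
Definition vlt a b := ~ vle b a.
Definition veq a b := vle a b /\ vle b a.

Lemma vle_refl a : vle a a.
Proof. by exists 1; [exact: val1 | rewrite mul1r]. Qed.

Lemma vle_trans b a c : vle a b -> vle b c -> vle a c.
Proof.
move=> [u hu ->] [w hw ->]; exists (u * w); [exact: valM | by rewrite mulrA].
Qed.

Lemma vle0 a : vle 0 a. Proof. by exists 0; [exact: val0 | rewrite mul0r]. Qed.

Lemma vle_total a b : vle a b \/ vle b a.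
Proof.
have [->|b0] := eqVneq b 0; first by right; apply: vle0.
have [->|a0] := eqVneq a 0; first by left; apply: vle0.
have [_ _ _ /(_ (a / b))[h|h]] := hV.
  by left; exists (a / b) => //; rewrite divfK.
by right; exists (a / b)^-1 => //; rewrite invf_div divfK.
Qed.

Lemma vltW a b : vlt a b -> vle a b.
Proof. by move=> h; case: (vle_total a b). Qed.

Lemma vle1 a : V a <-> vle a 1.
Proof.
split=> [h|[c hc ->]]; first by exists a; rewrite ?mulr1.
by rewrite mulr1.
Qed.

Lemma vle_div a b : b != 0 -> vle a b <-> V (a / b).
Proof.
move=> b0; split=> [[c hc ->]|h]; first by rewrite mulfK.
by exists (a / b) => //; rewrite divfK.
Qed.

Lemma vle_mul a b c d : vle a b -> vle c d -> vle (a * c) (b * d).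
Proof.
by move=> [u hu ->] [w hw ->]; exists (u * w); [exact: valM | ring].
Qed.

Lemma vle_exp a b n : vle a b -> vle (a ^+ n) (b ^+ n).
Proof. by move=> [u hu ->]; exists (u ^+ n); [exact: valX | rewrite exprMn]. Qed.

Lemma vle_add a b c : vle a c -> vle b c -> vle (a + b) c.
Proof.
by move=> [u hu ->] [w hw ->]; exists (u + w); [exact: valD | rewrite mulrDl].
Qed.

Lemma vle_oppl a b : vle a b -> vle (- a) b.
Proof. by move=> [u hu ->]; exists (- u); [exact: valN | rewrite mulNr]. Qed.

Lemma vle_sub a b c : vle a c -> vle b c -> vle (a - b) c.
Proof. by move=> ha /vle_oppl; apply: vle_add. Qed.

Lemma vle_cancel c a b : c != 0 -> vle (a * c) (b * c) -> vle a b.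
Proof.
move=> c0 [u hu e]; exists u => //; apply: (mulIf c0); by rewrite e mulrA.
Qed.

Lemma vle_cancell c a b : c != 0 -> vle (c * a) (c * b) -> vle a b.
Proof. by rewrite ![c * _]mulrC; apply: vle_cancel. Qed.

Lemma vle_eq0 a b : vle a b -> b = 0 -> a = 0.
Proof. by move=> [u _ ->] ->; rewrite mulr0. Qed.

Lemma vlt_neq0 a b : vlt a b -> b != 0.
Proof. by move=> h; apply/eqP => b0; apply: h; rewrite b0; apply: vle0. Qed.

Lemma vlt_le_trans b a c : vlt a b -> vle b c -> vlt a c.
Proof. by move=> h h1 h2; apply: h; apply: vle_trans h1 h2. Qed.

Lemma vle_lt_trans b a c : vle a b -> vlt b c -> vlt a c.
Proof. by move=> h1 h h2; apply: h; apply: vle_trans h2 h1. Qed.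

Lemma vlt_mul a b c d : vlt a b -> vle c d -> d != 0 -> vlt (a * c) (b * d).
Proof.
move=> h h1 d0 h2; apply: h; apply: (vle_cancel d0).
apply: vle_trans h2 _; exact: vle_mul (vle_refl _) h1.
Qed.

Lemma vlt_exp a b n : (0 < n)%N -> vlt a b -> vlt (a ^+ n) (b ^+ n).
Proof.
case: n => // n _ h; elim: n => [|n ih]; first by rewrite !expr1.
rewrite exprSr [X in vlt _ X]exprSr; apply: vlt_mul ih (vltW h) (vlt_neq0 h).
Qed.

Lemma vle_expI a b n : (0 < n)%N -> vle (a ^+ n) (b ^+ n) -> vle a b.
Proof.
move=> n0 h; have [//|hlt] : vle a b \/ vlt b a by apply: EM.
by have := vlt_exp n0 hlt.
Qed.

Lemma vle_or_lt a b : vle a b \/ vlt b a. Proof. exact: EM. Qed.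

Lemma vlt_add a b c : vlt a c -> vlt b c -> vlt (a + b) c.
Proof.
move=> ha hb; have [h|h] := vle_total a b.
  apply: vle_lt_trans hb; exact: vle_add h (vle_refl _).
apply: vle_lt_trans ha; exact: vle_add (vle_refl _) h.
Qed.

Lemma vle_oppr a b : vle a b -> vle a (- b).
Proof. by move=> h; apply: vle_trans h _; rewrite -{1}(opprK b); apply/vle_oppl/vle_refl. Qed.

Lemma vlt_oppl a b : vlt a b -> vlt (- a) b.
Proof. by move=> h /vle_oppr h1; apply: h; rewrite -(opprK a). Qed.

Lemma veq_refl a : veq a a. Proof. by split; apply: vle_refl. Qed.
Lemma veq_sym a b : veq a b -> veq b a. Proof. by case. Qed.
Lemma veq_trans b a c : veq a b -> veq b c -> veq a c.
Proof. by move=> [h1 h2] [h3 h4]; split; [exact: vle_trans h1 h3|exact: vle_trans h4 h2]. Qed.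
Lemma veq_mul a b c d : veq a b -> veq c d -> veq (a * c) (b * d).
Proof. by move=> [h1 h2] [h3 h4]; split; apply: vle_mul. Qed.
Lemma veq_exp a b n : veq a b -> veq (a ^+ n) (b ^+ n).
Proof. by move=> [h1 h2]; split; apply: vle_exp. Qed.
Lemma veqN a : veq (- a) a.
Proof. split; [exact/vle_oppl/vle_refl | exact/vle_oppr/vle_refl]. Qed.

Lemma veq_dom a b : vlt b a -> veq (a + b) a.
Proof.
move=> h; split; first exact: vle_add (vle_refl _) (vltW h).
have [//|h1] := vle_or_lt a (a + b); exfalso.
have : vlt a a by rewrite -{1}(addrK b a); apply: vlt_add => //; apply: vlt_oppl.
by apply; apply: vle_refl.
Qed.

Lemma veq_domr a b : vlt b a -> veq (b + a) a.
Proof. by rewrite addrC; apply: veq_dom. Qed.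

Lemma veq_inv a b : a != 0 -> b != 0 -> veq a b -> veq a^-1 b^-1.
Proof.
move=> a0 b0 [h1 h2]; split.
  by apply: (vle_cancel (c := a * b)); rewrite ?mulf_neq0 // mulrA mulVf // mul1r
     [a * b]mulrC mulrA mulVf // mul1r.
by apply: (vle_cancel (c := a * b)); rewrite ?mulf_neq0 // [a * b]mulrC mulrA mulVf // mul1r
  [b * a]mulrC mulrA mulVf // mul1r.
Qed.

Lemma veq_neq0 a b : veq a b -> a != 0 -> b != 0.
Proof. by move=> [h _] a0; apply/eqP => /(vle_eq0 h) /eqP; rewrite (negPf a0). Qed.

Lemma vlt_eql a b c : veq a b -> vlt b c -> vlt a c.
Proof. by move=> [h _]; apply: vle_lt_trans. Qed.
Lemma vlt_eqr a b c : veq b c -> vlt a b -> vlt a c.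
Proof. by move=> [h _] h1; apply: vlt_le_trans h1 h. Qed.

Lemma vlt01 : vlt 0 1.
Proof. by move=> /vle_eq0 /(_ erefl) /eqP; rewrite oner_eq0. Qed.

Lemma vltxx a : ~ vlt a a.
Proof. by move/(_ (vle_refl a)). Qed.

Lemma veq1P u : veq u 1 <-> [/\ V u, V u^-1 & u != 0].
Proof.
split=> [h|[h1 h2 h3]].
  have u0 : u != 0 by apply: veq_neq0 (oner_neq0 K); apply: veq_sym.
  split=> //; first exact/vle1/(proj1 h).
  by apply/vle1; have [+ _] := veq_inv u0 (oner_neq0 K) h; rewrite invr1.
by split; [exact/vle1|exists u^-1 => //; rewrite mulVf].
Qed.

Lemma veq1_neq0 u : veq u 1 -> u != 0. Proof. by case/veq1P. Qed.

Lemma nat_unit_or_lt n : veq n%:R 1 \/ vlt n%:R 1.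
Proof.
have [h|h] := vle_or_lt 1 n%:R; last by right.
by left; split => //; apply/vle1/val_nat.
Qed.

Lemma not_val_inv a : ~ V a -> vlt a^-1 1.
Proof.
move=> h [u hu e]; apply: h.
have a0 : a != 0 by apply/eqP => a0; move: e; rewrite a0 invr0 mulr0 => /eqP; rewrite oner_eq0.
by have -> : a = u by rewrite -[u](mulfVK a0) -e mul1r.
Qed.

Lemma val_expI a n : (0 < n)%N -> V (a ^+ n) -> V a.
Proof. by move=> n0 h; apply/vle1; apply: (vle_expI n0); rewrite expr1n; apply/vle1. Qed.

End Valuation.

(** * Roots of polynomials with coefficients in a valuation ring *)

Section IntegralPolynomials.
Variables (K : fieldType) (V : K -> Prop).
Hypothesis hV : valuation_ring V.

Definition val_poly (p : {poly K}) := forall i, V p`_i.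

Lemma val_sum (I : Type) (r : seq I) (P : pred I) (F : I -> K) :
  (forall i, P i -> V (F i)) -> V (\sum_(i <- r | P i) F i).
Proof.
by move=> h; apply: (big_ind V) => //; [exact: val0 | exact: valD].
Qed.

Lemma val_polyC c : V c -> val_poly c%:P.
Proof. by move=> h i; rewrite coefC; case: ifP => // _; apply: val0. Qed.

Lemma val_polyX : val_poly 'X.
Proof. by move=> i; rewrite coefX; case: eqP => // _; [exact: val1 | exact: val0]. Qed.

Lemma val_polyD p q : val_poly p -> val_poly q -> val_poly (p + q).
Proof. by move=> hp hq i; rewrite coefD; apply: valD. Qed.

Lemma val_polyB p q : val_poly p -> val_poly q -> val_poly (p - q).
Proof. by move=> hp hq i; rewrite coefB; apply: valB. Qed.

Lemma val_polyM p q : val_poly p -> val_poly q -> val_poly (p * q).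
Proof. by move=> hp hq i; rewrite coefM; apply: val_sum => j _; apply: valM. Qed.

Lemma val_poly_exp p n : val_poly p -> val_poly (p ^+ n).
Proof.
move=> hp; elim: n => [|n ih]; last by rewrite exprS; apply: val_polyM.
by rewrite expr0; apply: val_polyC; apply: val1.
Qed.

Lemma val_horner p a : val_poly p -> V a -> V p.[a].
Proof.
move=> hp ha; rewrite horner_coef; apply: val_sum => i _.
by apply: valM => //; apply: valX.
Qed.

Lemma val_poly_divXsubC p a : val_poly p -> V a ->
  exists2 q, val_poly q & p = q * ('X - a%:P) + (p.[a])%:P.
Proof.
move=> + ha; elim/poly_ind: p => [|p c ih] hp.
  by exists 0; [move=> i; rewrite coef0; apply: val0 | rewrite mul0r horner0 add0r].
have hp' : val_poly p by move=> i; have := hp i.+1; rewrite coefD coefMX coefC /= addr0.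
have [q hq e] := ih hp'.
exists (q * 'X + (p.[a])%:P).
  by apply: val_polyD; [apply: val_polyM => //; exact: val_polyX |
                        apply: val_polyC; exact: val_horner].
rewrite hornerMXaddC polyCD polyCM {1}e; ring.
Qed.

Lemma val_poly_root p t : val_poly p -> V t -> p.[t] = 0 -> vle V p.[0] t.
Proof.
move=> hp ht e; have [q hq ->] := val_poly_divXsubC hp ht.
rewrite e addr0 hornerM hornerXsubC sub0r mulrN -mulNr.
exists (- q.[0]) => //; apply: valN => //; apply: val_horner => //; exact: val0.
Qed.

Lemma val_poly_root2 p t u : val_poly p -> V t -> V u -> t != u ->
  p.[t] = 0 -> p.[u] = 0 -> vle V p.[0] (t * u).
Proof.
move=> hp ht hu tu e1 e2; have [q hq e] := val_poly_divXsubC hp ht.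
have q0 : q.[u] = 0.
  move: e2; rewrite e e1 addr0 hornerM hornerXsubC => /eqP.
  by rewrite mulf_eq0 subr_eq0 [u == t]eq_sym (negPf tu) orbF => /eqP.
rewrite e e1 addr0 hornerM hornerXsubC sub0r mulrN mulrC.
apply: vle_oppl => //.
apply: vle_mul; [exact: hV|exact: vle_refl|exact: val_poly_root].
Qed.

Lemma val_poly_near0 p t : val_poly p -> V t -> vle V (p.[t] - p.[0]) t.
Proof.
move=> hp ht; have [q hq e] := val_poly_divXsubC hp (val0 hV).
rewrite {1}e hornerD hornerM hornerXsubC subr0 hornerC addrK.
by exists q.[t] => //; apply: val_horner.
Qed.

End IntegralPolynomials.

(* The data b2, b4, b6, b8 of a Weierstrass equation
   (2 y + a1 x + a3)^2 = 4 x^3 + b2 x^2 + 2 b4 x + b6. *)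
Record weierstrass (K : fieldType) :=
  Weierstrass { wb2 : K; wb4 : K; wb6 : K; wb8 : K }.

(** * The Kummer law and changes of Weierstrass model *)

Section Kummer.
Variable K : fieldType.
Implicit Type w : weierstrass K.

Definition wdisc w := - wb2 w ^+ 2 * wb8 w - 8 * wb4 w ^+ 3 - 27 * wb6 w ^+ 2
  + 9 * wb2 w * wb4 w * wb6 w.
Definition wc4 w := wb2 w ^+ 2 - 24 * wb4 w.

Definition kumF w x1 z1 x2 z2 := 2 * x1 * x2 * (x1 * z2 + x2 * z1)
  + wb2 w * x1 * x2 * z1 * z2 + wb4 w * (x1 * z2 + x2 * z1) * z1 * z2
  + wb6 w * z1 ^+ 2 * z2 ^+ 2.
Definition kumG w x1 z1 x2 z2 := x1 ^+ 2 * x2 ^+ 2 - wb4 w * x1 * x2 * z1 * z2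
  - wb6 w * (x1 * z2 + x2 * z1) * z1 * z2 - wb8 w * z1 ^+ 2 * z2 ^+ 2.
Definition kumD (x1 z1 x2 z2 : K) := (x1 * z2 - x2 * z1) ^+ 2.

(* (X P : Z P) is the x-coordinate, as a point of the projective line, of the
   image of P under a homomorphism from A to the elliptic curve: the pair
   {x(P + Q), x(P - Q)} is the root set of the form D T^2 - F T + G. *)
Definition kummer w (A : zmodType) (X Z : A -> K) : Prop :=
  [/\ 4 * wb8 w = wb2 w * wb6 w - wb4 w ^+ 2, wdisc w != 0, Z 0 = 0,
      forall P, X P != 0 \/ Z P != 0 &
      forall P Q, exists2 c, c != 0 &
      [/\ X (P + Q) * X (P - Q) = c * kumG w (X P) (Z P) (X Q) (Z Q),
          X (P + Q) * Z (P - Q) + X (P - Q) * Z (P + Q)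
            = c * kumF w (X P) (Z P) (X Q) (Z Q) &
          Z (P + Q) * Z (P - Q) = c * kumD (X P) (Z P) (X Q) (Z Q)]].

(** On the diagonal [kumG] and [kumF] are the numerator and denominator of the duplication formula.
    With this Bezout relation a unit discriminant keeps them from vanishing together modulo the
    maximal ideal. *)
Lemma kum_bezout w x : 4 * wb8 w = wb2 w * wb6 w - wb4 w ^+ 2 ->
  (12 * x ^+ 3 - wb2 w * x ^+ 2 - 10 * wb4 w * x + wb2 w * wb4 w - 27 * wb6 w)
    * kumF w x 1 x 1
  - (48 * x ^+ 2 + 8 * wb2 w * x + 32 * wb4 w - wb2 w ^+ 2) * kumG w x 1 x 1
  = wdisc w.
Proof.
move=> h; apply/eqP; rewrite -subr_eq0; apply/eqP; rewrite /kumF /kumG /wdisc.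
transitivity ((4 * wb8 w - (wb2 w * wb6 w - wb4 w ^+ 2)) *
   (12 * x ^+ 2 + 2 * wb2 w * x + 8 * wb4 w)); last by rewrite h subrr mul0r.
ring.
Qed.

Lemma kummer_rescale w (A : zmodType) (X Z : A -> K) (l : A -> K) :
  (forall P, l P != 0) -> kummer w X Z ->
  kummer w (fun P => l P * X P) (fun P => l P * Z P).
Proof.
move=> l0 [h8 hd h0 hn hl]; split=> //; first by rewrite h0 mulr0.
  by move=> P; rewrite !mulf_eq0 (negPf (l0 P)) /=; apply: hn.
move=> P Q; have [c c0 [e1 e2 e3]] := hl P Q.
exists (c * l (P + Q) * l (P - Q) / (l P ^+ 2 * l Q ^+ 2)).
  by rewrite !mulf_neq0 ?invr_neq0 ?mulf_neq0 ?expf_neq0.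
move: (l0 P) (l0 Q) => lP lQ.
split.
- transitivity (l (P + Q) * l (P - Q) * (X (P + Q) * X (P - Q))); first by ring.
  by rewrite e1 /kumG; field; rewrite lP lQ.
- transitivity (l (P + Q) * l (P - Q) *
    (X (P + Q) * Z (P - Q) + X (P - Q) * Z (P + Q))); first by ring.
  by rewrite e2 /kumF; field; rewrite lP lQ.
- transitivity (l (P + Q) * l (P - Q) * (Z (P + Q) * Z (P - Q))); first by ring.
  by rewrite e3 /kumD; field; rewrite lP lQ.
Qed.

(** The data of the curve after x = U x' + r. [U] stands for the usual u^2: since only x-coordinates
    occur, any nonzero scalar is allowed. *)
Definition wchange w (r U : K) := Weierstrass
  ((wb2 w + 12 * r) / U)
  ((wb4 w + r * wb2 w + 6 * r ^+ 2) / U ^+ 2)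
  ((wb6 w + 2 * r * wb4 w + r ^+ 2 * wb2 w + 4 * r ^+ 3) / U ^+ 3)
  ((wb8 w + 3 * r * wb6 w + 3 * r ^+ 2 * wb4 w + r ^+ 3 * wb2 w + 3 * r ^+ 4) / U ^+ 4).

Lemma wchange_b8 w r U : U != 0 -> 4 * wb8 w = wb2 w * wb6 w - wb4 w ^+ 2 ->
  let w' := wchange w r U in 4 * wb8 w' = wb2 w' * wb6 w' - wb4 w' ^+ 2.
Proof.
move=> U0 h /=.
transitivity ((4 * wb8 w + 4 * (3 * r * wb6 w + 3 * r ^+ 2 * wb4 w + r ^+ 3 * wb2 w + 3 * r ^+ 4)) / U ^+ 4).
  by field.
by rewrite h; field.
Qed.

Lemma wchange_c4 w r U : U != 0 -> wc4 (wchange w r U) = wc4 w / U ^+ 2.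
Proof. by move=> U0; rewrite /wc4 /=; field. Qed.

Lemma wchange_disc w r U : U != 0 -> 4 * wb8 w = wb2 w * wb6 w - wb4 w ^+ 2 ->
  wdisc (wchange w r U) = wdisc w / U ^+ 6.
Proof.
move=> U0 h; apply/eqP; rewrite -subr_eq0; apply/eqP; rewrite /wdisc /=.
transitivity ((4 * wb8 w - (wb2 w * wb6 w - wb4 w ^+ 2)) *
  (- 6 * r * wb2 w - 36 * r ^+ 2) / U ^+ 6); last by rewrite h subrr !mul0r.
by field.
Qed.

Lemma kummer_change w (A : zmodType) (X Z : A -> K) r U :
  U != 0 -> kummer w X Z ->
  kummer (wchange w r U) (fun P => X P - r * Z P) (fun P => U * Z P).
Proof.
move=> U0 [h8 hd h0 hn hl]; split; first exact: wchange_b8.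
- by rewrite wchange_disc // mulf_neq0 ?invr_neq0 ?expf_neq0.
- by rewrite h0 mulr0.
- move=> P; have [Z0|Z0] := eqVneq (Z P) 0; last by right; rewrite mulf_neq0.
  by left; case: (hn P); rewrite Z0 ?eqxx // mulr0 subr0.
move=> P Q; have [c c0 [e1 e2 e3]] := hl P Q.
exists c => //; split.
- transitivity (X (P + Q) * X (P - Q) - r * (X (P + Q) * Z (P - Q) + X (P - Q) * Z (P + Q))
    + r ^+ 2 * (Z (P + Q) * Z (P - Q))); first by ring.
  by rewrite e1 e2 e3 /kumG /kumF /kumD /=; field.
- transitivity (U * ((X (P + Q) * Z (P - Q) + X (P - Q) * Z (P + Q))
    - 2 * r * (Z (P + Q) * Z (P - Q)))); first by ring.
  by rewrite e2 e3 /kumF /kumD /=; field.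
- transitivity (U ^+ 2 * (Z (P + Q) * Z (P - Q))); first by ring.
  by rewrite e3 /kumD /=; field.
Qed.

End Kummer.

(** * Coordinates of content 1 *)

Section Normalized.
Variables (K : fieldType) (V : K -> Prop).
Hypothesis hV : valuation_ring V.

(** With this choice the smallness of z alone tells whether a point lies in the kernel of reduction,
    and there x is exactly 1. *)
Definition normal_pt (x z : K) := (z = 1 /\ V x) \/ (x = 1 /\ vlt V z 1).
Definition normalized (A : zmodType) (X Z : A -> K) := forall P, normal_pt (X P) (Z P).

Lemma normal_val x z : normal_pt x z -> V x /\ V z.
Proof.
case=> [[-> h]|[-> h]]; split => //; try exact: val1.
by apply/vle1; apply: vltW.
Qed.

Lemma normal_small x z : normal_pt x z -> vlt V z 1 -> x = 1.
Proof. by case=> [[-> _]|[-> _]] // /(vltxx hV). Qed.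

Lemma normal_unit x z : normal_pt x z -> ~ vlt V z 1 -> z = 1.
Proof. by case=> [[]|[_ h]]. Qed.

Lemma exists_normalized (w : weierstrass K) (A : zmodType) (X Z : A -> K) :
  kummer w X Z -> exists l : A -> K, (forall P, l P != 0) /\
  normalized (fun P => l P * X P) (fun P => l P * Z P).
Proof.
case=> _ _ _ hn _.
have ex P : exists l, l != 0 /\ normal_pt (l * X P) (l * Z P).
  have [Z0|Z0] := eqVneq (Z P) 0.
    have X0 : X P != 0 by case: (hn P); rewrite ?Z0 ?eqxx.
    exists (X P)^-1; rewrite invr_eq0; split => //; right.
    by rewrite mulVf // Z0 mulr0; split => //; apply: vlt01.
  case: (EM (V (X P / Z P))) => [h|h].
    exists (Z P)^-1; rewrite invr_eq0; split => //; left.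
    by rewrite mulVf // mulrC.
  have X0 : X P != 0.
    by apply/eqP => X0; apply: h; rewrite X0 mul0r; apply: val0.
  exists (X P)^-1; rewrite invr_eq0; split => //; right.
  rewrite mulVf //; split => //.
  by have := not_val_inv h; rewrite invf_div mulrC.
have [l hl] := choice ex.
by exists l; split=> P; case: (hl P).
Qed.

Variable w : weierstrass K.
Hypotheses (V2 : V (wb2 w)) (V4 : V (wb4 w)) (V6 : V (wb6 w)) (V8 : V (wb8 w)).

Ltac vtac := repeat first [assumption | apply: (valB hV) | apply: (valD hV) |
  apply: (valM hV) | apply: (valN hV) | apply: (valX hV) | apply: (val_nat hV)
  | apply: (val1 hV) | apply: (val0 hV)].

Lemma val_kumG x1 z1 x2 z2 : V x1 -> V z1 -> V x2 -> V z2 -> V (kumG w x1 z1 x2 z2).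
Proof. by move=> *; rewrite /kumG; vtac. Qed.
Lemma val_kumF x1 z1 x2 z2 : V x1 -> V z1 -> V x2 -> V z2 -> V (kumF w x1 z1 x2 z2).
Proof. by move=> *; rewrite /kumF; vtac. Qed.
Lemma val_kumD x1 z1 x2 z2 : V x1 -> V z1 -> V x2 -> V z2 -> V (kumD x1 z1 x2 z2).
Proof. by move=> *; rewrite /kumD; vtac. Qed.

Lemma kumG_small z1 z2 : vlt V z1 1 -> vlt V z2 1 -> veq V (kumG w 1 z1 1 z2) 1.
Proof.
move=> h1 h2; have v1 := proj2 (vle1 V _) (vltW hV h1).
have v2 := proj2 (vle1 V _) (vltW hV h2).
have -> : kumG w 1 z1 1 z2 = 1 + - (z1 * (wb4 w * z2 + wb6 w * (z1 + z2) * z2 + wb8 w * z1 * z2 ^+ 2)).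
  by rewrite /kumG; ring.
apply: (veq_dom hV); apply: (vlt_oppl hV); rewrite -[X in vlt _ _ X]mulr1.
apply: (vlt_mul hV) => //; last exact: oner_neq0.
by apply/(vle1 V); vtac.
Qed.

Lemma kumF_small z1 z2 : vlt V z1 1 -> vlt V z2 1 -> vlt V (kumF w 1 z1 1 z2) 1.
Proof.
move=> h1 h2; have v1 := proj2 (vle1 V _) (vltW hV h1).
have v2 := proj2 (vle1 V _) (vltW hV h2).
have -> : kumF w 1 z1 1 z2 = z1 * (2 + wb2 w * z2 + wb4 w * (z1 + z2) * z2 + wb6 w * z1 * z2 ^+ 2) + z2 * 2.
  by rewrite /kumF; ring.
by apply: (vlt_add hV); rewrite -[X in vlt _ _ X]mulr1; apply: (vlt_mul hV) => //;
  try exact: oner_neq0; apply/(vle1 V); vtac.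
Qed.

(** Gauss's lemma for the product of two primitive linear forms. *)
Lemma pair_content x z x' z' : normal_pt x z -> normal_pt x' z' ->
  [\/ veq V (x * x') 1, veq V (x * z' + x' * z) 1 | veq V (z * z') 1].
Proof.
have one := veq_refl hV 1.
case=> [[-> hx]|[-> hz]]; case=> [[-> hx']|[-> hz']].
- by apply: Or33; rewrite mulr1.
- apply: Or32; rewrite mulr1; apply: (veq_domr hV).
  by rewrite mulrC -[X in vlt _ _ X]mulr1; apply: (vlt_mul hV) => //;
    [exact/(vle1 V)|exact: oner_neq0].
- apply: Or32; rewrite mulr1; apply: (veq_dom hV).
  by rewrite mulrC -[X in vlt _ _ X]mulr1; apply: (vlt_mul hV) => //;
    [exact/(vle1 V)|exact: oner_neq0].
- by apply: Or31; rewrite mulr1.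
Qed.

(** For two affine points, if D is not a unit then x1 and x2 are congruent, F and G are congruent to
    their values on the diagonal, and [kum_bezout] forbids both to be small. If exactly one point is
    in the kernel of reduction D is a unit; if both are, G is. *)
Lemma kum_content x1 z1 x2 z2 : 4 * wb8 w = wb2 w * wb6 w - wb4 w ^+ 2 ->
  veq V (wdisc w) 1 -> normal_pt x1 z1 -> normal_pt x2 z2 ->
  [\/ veq V (kumG w x1 z1 x2 z2) 1, veq V (kumF w x1 z1 x2 z2) 1
    | veq V (kumD x1 z1 x2 z2) 1].
Proof.
move=> h8 hd.
case=> [[-> hx]|[-> hz]]; case=> [[-> hx']|[-> hz']].
- have vD : V (x1 - x2) by vtac.
  have [h|h] := vle_or_lt V 1 (x1 - x2).
    apply: Or33; rewrite /kumD !mulr1 -[X in veq _ _ X](expr1n _ 2).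
    by apply: veq_exp => //; split => //; apply/(vle1 V).
  have [hF|hF] := vle_or_lt V 1 (kumF w x1 1 x2 1).
    by apply: Or32; split => //; apply/(vle1 V); apply: val_kumF; vtac.
  have [hG|hG] := vle_or_lt V 1 (kumG w x1 1 x2 1).
    by apply: Or31; split => //; apply/(vle1 V); apply: val_kumG; vtac.
  exfalso.
  suff : vlt V (wdisc w) 1 by case: hd => _ h1 /(_ h1).
  have lt_mul a b : V a -> vlt V b 1 -> vlt V (a * b) 1.
    move=> ha hb; rewrite mulrC -[X in vlt _ _ X]mulr1; apply: (vlt_mul hV) => //.
      exact/(vle1 V).
    exact: oner_neq0.
  rewrite -(kum_bezout x1 h8); apply: (vlt_add hV); last apply: (vlt_oppl hV).
    apply: (lt_mul _ _); first by vtac.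
    have -> : kumF w x1 1 x1 1 = (4 * x1 ^+ 2 + 2 * x1 * x2 + wb2 w * x1 + wb4 w) * (x1 - x2) + kumF w x1 1 x2 1.
      by rewrite /kumF; ring.
    apply: (vlt_add hV); last exact: hF.
    by apply: (lt_mul _ _); last exact: h; vtac.
  apply: (lt_mul _ _); first by vtac.
  have -> : kumG w x1 1 x1 1 = (x1 ^+ 2 * (x1 + x2) - wb4 w * x1 - wb6 w) * (x1 - x2) + kumG w x1 1 x2 1.
    by rewrite /kumG; ring.
  apply: (vlt_add hV); last exact: hG.
  by apply: (lt_mul _ _); last exact: h; vtac.
- apply: Or33; rewrite /kumD !mulr1 -[X in veq _ _ X](expr1n _ 2); apply: veq_exp => //.
  rewrite -opprB; apply: (veq_trans hV (veqN hV _)). apply: (veq_dom hV).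
  apply: (vlt_oppl hV); rewrite mulrC -[X in vlt _ _ X]mulr1; apply: (vlt_mul hV) => //.
    exact/(vle1 V).
  exact: oner_neq0.
- apply: Or33; rewrite /kumD !mulr1 -[X in veq _ _ X](expr1n _ 2); apply: veq_exp => //.
  apply: (veq_dom hV).
  apply: (vlt_oppl hV); rewrite mulrC -[X in vlt _ _ X]mulr1; apply: (vlt_mul hV) => //.
    exact/(vle1 V).
  exact: oner_neq0.
- by apply: Or31; apply: kumG_small.
Qed.

End Normalized.

(** * Good reduction: multiples of a point in the kernel of reduction *)

Section GoodReduction.
Variables (K : fieldType) (V : K -> Prop).
Hypothesis hV : valuation_ring V.
Variables (w : weierstrass K) (A : zmodType) (X Z : A -> K).
Hypotheses (V2 : V (wb2 w)) (V4 : V (wb4 w)) (V6 : V (wb6 w)) (V8 : V (wb8 w)).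
Hypotheses (hd : veq V (wdisc w) 1) (hk : kummer w X Z) (hn : normalized V X Z).

Ltac vtac := repeat first [assumption | apply: (valB hV) | apply: (valD hV) |
  apply: (valM hV) | apply: (valN hV) | apply: (valX hV) | apply: (val_nat hV)
  | apply: (val1 hV) | apply: (val0 hV)].

Let b8E : 4 * wb8 w = wb2 w * wb6 w - wb4 w ^+ 2. Proof. by case: hk. Qed.
Let VX P : V (X P). Proof. by case: (normal_val hV (hn P)). Qed.
Let VZ P : V (Z P). Proof. by case: (normal_val hV (hn P)). Qed.
Let Z0 : Z 0 = 0. Proof. by case: hk. Qed.
Let X0 : X 0 = 1.
Proof. by apply: (normal_small hV (hn 0)); rewrite Z0; apply: vlt01. Qed.

(** Both triples have content 1, by [pair_content] and [kum_content], so the scalar between them is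
    a unit. *)
Lemma good_law P Q : exists c, [/\ veq V c 1,
   X (P + Q) * X (P - Q) = c * kumG w (X P) (Z P) (X Q) (Z Q),
   X (P + Q) * Z (P - Q) + X (P - Q) * Z (P + Q) = c * kumF w (X P) (Z P) (X Q) (Z Q) &
   Z (P + Q) * Z (P - Q) = c * kumD (X P) (Z P) (X Q) (Z Q)].
Proof.
have [_ _ _ _ /(_ P Q) [c c0 [e1 e2 e3]]] := hk.
exists c; split => //; split.
  have V_of u t : V t -> veq V u 1 -> t = c * u -> V c.
    move=> ht hu e; have u0 := veq1_neq0 hu.
    have -> : c = t * u^-1 by rewrite e mulfK.
    by apply: (valM hV) => //; case/(veq1P V): hu.
  apply/(vle1 V); have [h|h|h] := kum_content hV V2 V4 V6 V8 b8E hd (hn P) (hn Q).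
  - by apply: (V_of _ _ _ h e1); vtac.
  - by apply: (V_of _ _ _ h e2); vtac.
  - by apply: (V_of _ _ _ h e3); vtac.
have low u t : V u -> veq V t 1 -> t = c * u -> vle V 1 c.
  move=> hu [_ ht] e; apply: vle_trans ht _ => //; exists u => //; by rewrite mulrC.
have [h|h|h] := pair_content hV (hn (P + Q)) (hn (P - Q)).
- by apply: (low _ _ _ h e1); apply: val_kumG.
- by apply: (low _ _ _ h e2); apply: val_kumF.
- by apply: (low _ _ _ h e3); apply: val_kumD.
Qed.

Lemma good_dist P Q : veq V (Z (P + Q) * Z (P - Q)) ((X P * Z Q - X Q * Z P) ^+ 2).
Proof.
have [c [hc _ _ ->]] := good_law P Q.
rewrite -[X in veq _ _ X]mul1r; apply: veq_mul => //; exact: veq_refl.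
Qed.

(* [m_seq n] holds numerator and denominator of Z(nP)/Z(P) and Z((n+1)P)/Z(P) as
   functions of t = Z(P) when P is in the kernel of reduction. *)
Definition m_num (a B : {poly K}) := 2%:P * (a + B) * B + (wb2 w)%:P * a * 'X * B
  + (wb4 w)%:P * a * 'X ^+ 2 * (a + B) + (wb6 w)%:P * a ^+ 2 * 'X ^+ 3.
Definition m_den (a B : {poly K}) := B ^+ 2 - (wb4 w)%:P * a * B * 'X ^+ 2
  - (wb6 w)%:P * a * 'X ^+ 3 * (a + B) - (wb8 w)%:P * a ^+ 2 * 'X ^+ 4.
Fixpoint m_seq n : ({poly K} * {poly K}) * ({poly K} * {poly K}) :=
  if n is n'.+1 then
    let p := m_seq n' in
    (p.2, (m_num p.2.1 p.2.2 * p.1.2 - p.1.1 * m_den p.2.1 p.2.2,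
           m_den p.2.1 p.2.2 * p.1.2))
  else ((0, 1), (1, 1)).

Lemma val_poly_nat n : val_poly V n%:R.
Proof. by rewrite -polyC_natr; apply: val_polyC => //; apply: val_nat. Qed.

Ltac vptac := repeat first [assumption | apply: (val_polyB hV) | apply: (val_polyD hV) |
  apply: (val_polyM hV) | apply: (val_poly_exp hV) | apply: val_poly_nat |
  apply: (val_polyC hV) | apply: (val_polyX hV)].

Lemma m_seq_val n : let p := m_seq n in
  [/\ val_poly V p.1.1, val_poly V p.1.2, val_poly V p.2.1 & val_poly V p.2.2].
Proof.
elim: n => [|n /= [h1 h2 h3 h4]] /=.
  split; [exact: (val_poly_nat 0) | exact: (val_poly_nat 1)..].
by split => //; rewrite /m_num /m_den; vptac; try exact: (val_nat hV 2); exact: val1.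
Qed.

(** On the formal group Z is to first order the square of the parameter, and multiplication by n
    scales the parameter by n, hence Z by n^2. *)
Lemma m_seq0 n : let p := m_seq n in
  [/\ p.1.1.[0] = n%:R ^+ 2, p.1.2.[0] = 1, p.2.1.[0] = n.+1%:R ^+ 2 & p.2.2.[0] = 1].
Proof.
elim: n => [|n /= [h1 h2 h3 h4]] /=.
  by rewrite !hornerE expr0n /= expr1n.
rewrite /m_num /m_den !hornerE h1 h2 h3 h4 /=.
by split => //; rewrite ?(mulrS, natrD); ring.
Qed.

Variable P : A.
Hypothesis hP : vlt V (Z P) 1.
Let t := Z P.
Let Vt : V t. Proof. exact: VZ. Qed.

Lemma m_seq_den n : veq V (m_seq n).1.2.[t] 1.
Proof.
have [h1 h2 _ _] := m_seq_val n; have [_ h3 _ _] := m_seq0 n.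
have -> : (m_seq n).1.2.[t] = 1 + ((m_seq n).1.2.[t] - (m_seq n).1.2.[0]).
  by rewrite h3; ring.
apply: (veq_dom hV); apply: vle_lt_trans hP => //.
exact: val_poly_near0.
Qed.

(** Where X = 1 the law reads c G = 1 and c F = Z((n+2)P) + Z(nP), so Z((n+2)P) = F/G - Z(nP);
    clearing denominators gives the recursion of [m_seq]. *)
Lemma m_seqP n : let p := m_seq n in
  [/\ vlt V (Z (P *+ n)) 1, vlt V (Z (P *+ n.+1)) 1,
      Z (P *+ n) * p.1.2.[t] = t * p.1.1.[t] &
      Z (P *+ n.+1) * p.2.2.[t] = t * p.2.1.[t]].
Proof.
elim: n => [|n /= [h1 h2 h3 h4]] /=.
  rewrite !mulr0n !mulr1n Z0 !hornerE; split; [exact: vlt01|exact: hP| |]; by rewrite ?(mul0r, mulr0, mulr1).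
have x1 := normal_small hV (hn _) h1; have x2 := normal_small hV (hn _) h2.
have xP := normal_small hV (hn _) hP.
have [c [hc e1 e2 e3]] := good_law (P *+ n.+1) P.
move: e1 e2 e3; rewrite -mulrSr [P *+ n.+1]mulrSr addrK -mulrSr x1 x2 xP !mulr1 !mul1r -/t.
move=> e1 e2 e3.
have G1 := kumG_small hV V4 V6 V8 h2 hP.
(* Otherwise Z((n+2)P) = 1, and the second law exhibits 1 as a combination of the small quantities F
   and Z(nP). *)
have small : vlt V (Z (P *+ n.+2)) 1.
  have [//|hz] := EM (vlt V (Z (P *+ n.+2)) 1).
  have z1 := normal_unit (hn _) hz.
  have : vlt V 1 1.
    have e : 1 = c * kumF w 1 (Z (P *+ n.+1)) 1 t + - (X (P *+ n.+2) * Z (P *+ n)).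
      by rewrite -e2 z1; ring.
    rewrite {1}e; apply: (vlt_add hV); last apply: (vlt_oppl hV).
      rewrite mulrC -[X in vlt _ _ X]mulr1; apply: (vlt_mul hV);
        [exact: kumF_small | by case: hc | exact: oner_neq0].
    rewrite mulrC -[X in vlt _ _ X]mulr1; apply: (vlt_mul hV) => //.
      exact/(vle1 V).
    exact: oner_neq0.
  by move/(vltxx hV).
have X2 := normal_small hV (hn _) small.
split => //.
move: e1 e2; rewrite X2 mul1r; move=> e1 e2.
have B0 := veq1_neq0 (m_seq_den n); have B1 := veq1_neq0 (m_seq_den n.+1).
move: B0 B1 h3 h4 => /=; move: (m_seq n) => [[a0 b0] [a b]] /= B0 B1 h3 h4.
have c0 : c != 0 := veq1_neq0 hc.
have ez0 : Z (P *+ n) = t * a0.[t] / b0.[t] by rewrite -h3 mulfK.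
have ez1 : Z (P *+ n.+1) = t * a.[t] / b.[t] by rewrite -h4 mulfK.
have G0 : kumG w 1 (Z (P *+ n.+1)) 1 t != 0 := veq1_neq0 G1.
have e : Z (P *+ n.+2) * kumG w 1 (Z (P *+ n.+1)) 1 t =
    kumF w 1 (Z (P *+ n.+1)) 1 t - Z (P *+ n) * kumG w 1 (Z (P *+ n.+1)) 1 t.
  apply: (mulfI c0); set G := kumG _ _ _ _ _ in e1 *; set F := kumF _ _ _ _ _ in e2 *.
  transitivity (Z (P *+ n.+2) * (c * G)); first by ring.
  transitivity (c * F - Z (P *+ n) * (c * G)); last by ring.
  by rewrite -e1 -e2; ring.
have den : (m_den a b).[t] = kumG w 1 (Z (P *+ n.+1)) 1 t * b.[t] ^+ 2.
  by rewrite ez1 /m_den /kumG !(hornerD, hornerN, hornerM, horner_exp, hornerC, hornerX); field.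
have num : t * (m_num a b).[t] = kumF w 1 (Z (P *+ n.+1)) 1 t * b.[t] ^+ 2.
  by rewrite ez1 /m_num /kumF !(hornerD, hornerN, hornerM, horner_exp, hornerC, hornerX); field.
move: (m_den a b) (m_num a b) den num => dn nm den num.
rewrite !(hornerM, hornerD, hornerN) den.
set G := kumG _ _ _ _ _ in e num *; set F := kumF _ _ _ _ _ in e num *.
transitivity (Z (P *+ n.+2) * G * b.[t] ^+ 2 * b0.[t]); first by ring.
transitivity (t * nm.[t] * b0.[t] - t * a0.[t] * (G * b.[t] ^+ 2)); last by ring.
by rewrite e num ez0; field.
Qed.

End GoodReduction.

(** * Good reduction: torsion points and the constant C_N *)

Section GoodTorsion.
Variables (K : fieldType) (V : K -> Prop).
Hypothesis hV : valuation_ring V.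
Variables (w : weierstrass K) (A : zmodType) (X Z : A -> K).
Hypotheses (V2 : V (wb2 w)) (V4 : V (wb4 w)) (V6 : V (wb6 w)) (V8 : V (wb8 w)).
Hypotheses (hd : veq V (wdisc w) 1) (hk : kummer w X Z) (hn : normalized V X Z).

Ltac vtac := repeat first [assumption | apply: (valB hV) | apply: (valD hV) |
  apply: (valM hV) | apply: (valN hV) | apply: (valX hV) | apply: (val_nat hV)
  | apply: (val1 hV) | apply: (val0 hV)].

Let b8E : 4 * wb8 w = wb2 w * wb6 w - wb4 w ^+ 2. Proof. by case: hk. Qed.
Let VX P : V (X P). Proof. by case: (normal_val hV (hn P)). Qed.
Let VZ P : V (Z P). Proof. by case: (normal_val hV (hn P)). Qed.
Let Z0 : Z 0 = 0. Proof. by case: hk. Qed.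
Let X0 : X 0 = 1.
Proof. by apply: (normal_small hV (hn 0)); rewrite Z0; apply: vlt01. Qed.
Let law := good_law hV V2 V4 V6 V8 hd hk hn.
Let dist := good_dist hV V2 V4 V6 V8 hd hk hn.
Let mP P hP n := @m_seqP K V hV w A X Z V2 V4 V6 V8 hd hk hn P hP n.
Let mden P hP n := @m_seq_den K V hV w A X Z V2 V4 V6 V8 hn P hP n.

Lemma kernel_mul P n : vlt V (Z P) 1 ->
  vlt V (Z (P *+ n)) 1 /\ vle V (Z (P *+ n)) (Z P).
Proof.
move=> hP; have [h1 _ h2 _] := mP hP n; split => //.
have hb := mden hP n; have b0 := veq1_neq0 hb; have [_ vb _] := proj1 (veq1P V _) hb.
have [va _ _ _] := m_seq_val hV V2 V4 V6 V8 n.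
exists ((m_seq w n).1.1.[Z P] / (m_seq w n).1.2.[Z P]); last first.
  by rewrite mulrAC [_ * Z P]mulrC -h2 mulfK.
by apply: valM => //; apply: val_horner.
Qed.

(** Z(P) is a root of an integral polynomial with constant term l^2, so a unit l would force |Z(P)|
    >= 1. *)
Lemma kernel_order_lt P l : vlt V (Z P) 1 -> Z P != 0 -> Z (P *+ l) = 0 -> vlt V l%:R 1.
Proof.
move=> hP P0 hl hlt.
have [_ _ h _] := mP hP l; move: h; rewrite hl mul0r => /esym/eqP.
rewrite mulf_eq0 (negPf P0) /= => /eqP ra.
have [va _ _ _] := m_seq_val hV V2 V4 V6 V8 l.
have [e _ _ _] := m_seq0 w l.
have := val_poly_root hV va (VZ P) ra; rewrite e => h.
apply: hP; apply: (vle_trans hV _ h); rewrite -[X in vle _ X _](expr1n _ 2); exact: vle_exp.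
Qed.

(** The numerator of (Z((m+1)P) - Z(mP)) / Z(P). It vanishes when 2m+1 kills P, and its constant
    term is (m+1)^2 - m^2 = 2m+1, a better bound than the (2m+1)^2 obtained from Z((2m+1)P). *)
Definition odd_poly_of m := (m_seq w m).2.1 * (m_seq w m).1.2 - (m_seq w m).1.1 * (m_seq w m).2.2.

Lemma odd_poly_of_val m : val_poly V (odd_poly_of m).
Proof.
have [h1 h2 h3 h4] := m_seq_val hV V2 V4 V6 V8 m.
by apply: (val_polyB hV); apply: (val_polyM hV).
Qed.

Lemma odd_poly_of0 m : (odd_poly_of m).[0] = (m + m.+1)%:R.
Proof.
have [h1 h2 h3 h4] := m_seq0 w m.
rewrite /odd_poly_of hornerD hornerN !hornerM h1 h2 h3 h4.
by rewrite natrD -natr1; ring.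
Qed.

Lemma odd_poly_of_root m P : vlt V (Z P) 1 -> Z P != 0 -> Z (P *+ (m + m.+1)) = 0 ->
  (odd_poly_of m).[Z P] = 0.
Proof.
move=> hP P0 hm; have [h1 h2 h3 h4] := mP hP m.
have := dist (P *+ m.+1) (P *+ m).
rewrite -mulrnDr addnC hm mul0r (normal_small hV (hn _) h1) (normal_small hV (hn _) h2) !mul1r.
move=> [_ /vle_eq0 /(_ erefl) /eqP]; rewrite expf_eq0 /= subr_eq0 => /eqP e.
apply: (mulfI P0); rewrite mulr0 /odd_poly_of hornerD hornerN !hornerM.
transitivity (Z P * (m_seq w m).2.1.[Z P] * (m_seq w m).1.2.[Z P] -
  Z P * (m_seq w m).1.1.[Z P] * (m_seq w m).2.2.[Z P]); first by ring.
by rewrite -h3 -h4 e; ring.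
Qed.

Lemma kernel_odd P m : vlt V (Z P) 1 -> Z P != 0 -> Z (P *+ (m + m.+1)) = 0 ->
  vle V (m + m.+1)%:R (Z P).
Proof.
move=> hP P0 hm; rewrite -odd_poly_of0; apply: val_poly_root => //.
  exact: odd_poly_of_val.
exact: odd_poly_of_root.
Qed.

(* Z(P) and Z(2P) are different roots of the same polynomial *)
Lemma kernel_odd2 P m : vlt V (Z P) 1 -> Z P != 0 -> Z (P *+ 2) != 0 -> Z (P *+ 3) != 0 ->
  Z (P *+ (m + m.+1)) = 0 -> vle V (m + m.+1)%:R (Z P ^+ 2).
Proof.
move=> hP P0 P2 P3 hm.
have [h2 le2] := kernel_mul 2 hP.
apply: (@vle_trans _ _ hV (Z P * Z (P *+ 2))); last first.
  by rewrite expr2; apply: vle_mul => //; apply: vle_refl.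
rewrite -odd_poly_of0; apply: val_poly_root2 => //.
- exact: odd_poly_of_val.
- apply/eqP => e; have := dist (P *+ 2) P.
  rewrite -mulrSr mulr2n addrK -mulr2n (normal_small hV (hn _) hP) (normal_small hV (hn _) h2).
  rewrite -e subrr expr0n /= => -[/vle_eq0 /(_ erefl) /eqP].
  by rewrite mulf_eq0 (negPf P3) (negPf P0).
- exact: odd_poly_of_root.
- apply: odd_poly_of_root => //.
  have [_ lem] := kernel_mul 2 (proj1 (kernel_mul (m + m.+1) hP)).
  by rewrite -mulrnA mulnC mulrnA; apply: vle_eq0 lem hm.
Qed.

Lemma double_law P : vlt V (Z P) 1 ->
  Z (P *+ 2) * kumG w 1 (Z P) 1 (Z P) = kumF w 1 (Z P) 1 (Z P).
Proof.
move=> hP; have [c [hc]] := law P P.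
rewrite subrr X0 Z0 !mulr1 !mulr0 !add0r !mul1r -mulr2n (normal_small hV (hn _) hP).
have [h2 _] := kernel_mul 2 hP; rewrite (normal_small hV (hn _) h2) => e1 e2 _.
apply: (mulfI (veq1_neq0 hc)); rewrite -e2.
by rewrite mulrCA -e1 mulr1.
Qed.

Lemma kernel_two P : vlt V (Z P) 1 -> Z P != 0 -> Z (P *+ 2) = 0 ->
  4 + wb2 w * Z P + 2 * wb4 w * Z P ^+ 2 + wb6 w * Z P ^+ 3 = 0.
Proof.
move=> hP P0 h2; have := double_law hP; rewrite h2 mul0r => e.
apply: (mulfI P0); rewrite mulr0 e /kumF; ring.
Qed.

(** The 2-division cubic in Z has constant term 4. Squared, this is C_2 = 2^4. *)
Lemma kernel_two_le P : vlt V (Z P) 1 -> Z P != 0 -> Z (P *+ 2) = 0 -> vle V 4 (Z P).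
Proof.
move=> hP P0 h2; have e := kernel_two hP P0 h2.
exists (- (wb2 w + 2 * wb4 w * Z P + wb6 w * Z P ^+ 2)); first by vtac.
by apply/eqP; rewrite -subr_eq0 -e; apply/eqP; ring.
Qed.

(** The halves of the 2-torsion point R = 2P coincide in pairs up to sign, as P + R = -P, so the
    equation relating t = Z(P) to r = Z(R) is a perfect square; [sq] is its root. If |t| < |2| it
    yields |r| = |2t|, while |4| <= |r| because R has order 2; hence |2| <= |t| after all. *)
Lemma kernel_four P : 2 != 0 :> K -> vlt V (Z P) 1 -> Z (P *+ 2) != 0 ->
  Z (P *+ 4) = 0 -> vle V 2 (Z P).
Proof.
move=> two0 hP P2 P4; have [hR leR] := kernel_mul 2 hP.
have P0 : Z P != 0 by apply/eqP => /(vle_eq0 leR) /eqP; rewrite (negPf P2).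
have e4 : Z (P *+ 2 *+ 2) = 0 by rewrite -mulrnA.
have e1 := kernel_two hR P2 e4; have e2 := double_law hP.
have le4 := kernel_two_le hR P2 e4.
have [//|hlt] := vle_or_lt V 2 (Z P); exfalso; apply: (hlt).
set t := Z P in hP P0 hlt e2 *; set r := Z (P *+ 2) in P2 hR leR e1 e2 le4 *.
have Vt : V t by exact: VZ.
have Vr : V r by exact: VZ.
have sq : 2 * r - 4 * t + (wb4 w + wb6 w * r) * r * t ^+ 2 = 0.
  suff /eqP : (2 * r - 4 * t + (wb4 w + wb6 w * r) * r * t ^+ 2) ^+ 2 = 0.
    by rewrite expf_eq0 /= => /eqP.
  (* The square is a combination of the duplication law for t, the cubic satisfied by r, and the
     relation between the b_i. *)
  transitivity (4 * r * (r * kumG w 1 t 1 t - kumF w 1 t 1 t)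
    + (4 * t ^+ 2 + wb6 w * r * t ^+ 4) *
      (4 + wb2 w * r + 2 * wb4 w * r ^+ 2 + wb6 w * r ^+ 3)
    + r ^+ 2 * t ^+ 4 * (4 * wb8 w - (wb2 w * wb6 w - wb4 w ^+ 2))).
    by rewrite /kumG /kumF; ring.
  by rewrite e1 e2 b8E !subrr !mulr0 !addr0.
have [s Vs es] : vle V t 2 by exact: vltW.
have hs : vlt V s 1 by move=> h; apply: hlt; rewrite es -[X in vle _ X _]mul1r; apply: vle_mul => //; exact: vle_refl.
pose u := 1 + (wb4 w + wb6 w * r) * t * s.
have eu : 2 * t = r * u.
  apply: (mulfI two0).
  transitivity (2 * r + (wb4 w + wb6 w * r) * r * t * t); last by rewrite /u {2}es; ring.
  by apply/eqP; rewrite -subr_eq0; apply/eqP; move: sq => /(congr1 -%R); rewrite oppr0 => <-; ring.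
have hu : veq V u 1.
  apply: (veq_dom hV); rewrite mulrC -[X in vlt _ _ X]mulr1; apply: (vlt_mul hV) => //.
    by apply/(vle1 V); vtac.
  exact: oner_neq0.
have u0 := veq1_neq0 hu; have [_ Vu _] := proj1 (veq1P V _) hu.
have hr : vle V r (2 * t).
  by exists u^-1 => //; rewrite eu mulrC mulfK.
have : vle V (2 * 2) (2 * t).
  by apply: vle_trans hr => //; move: le4; rewrite -natrM.
by apply: vle_cancell.
Qed.

(** By [kernel_order_lt] every prime divisor of the order has absolute value less than 1, and two
    different primes generate 1. *)
Lemma kernel_prime_unique P p q N : vlt V (Z P) 1 ->
  (forall n, (Z (P *+ n) == 0) = (N %| n)%N) -> (0 < N)%N ->
  prime p -> prime q -> (p %| N)%N -> (q %| N)%N -> p = q.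
Proof.
move=> hP ho N0 pp pq dp dq.
have lt1 l : prime l -> (l %| N)%N -> vlt V l%:R 1.
  move=> pl dl; apply: (@kernel_order_lt (P *+ (N %/ l)) l).
  - exact: (proj1 (kernel_mul _ hP)).
  - rewrite ho; apply/negP => /dvdn_leq.
    rewrite divn_gt0 ?prime_gt0 // (dvdn_leq N0 dl) => /(_ isT).
    by rewrite leqNgt ltn_Pdiv // prime_gt1.
  - by apply/eqP; rewrite -mulrnA divnK // ho.
have [//|npq] := eqVneq p q.
have /coprimeP : coprime p q by rewrite prime_coprime // dvdn_prime2.
rewrite prime_gt0 // => /(_ isT) [[u v] /= e].
have e1 : 1 = p%:R * u%:R + - (q%:R * v%:R) :> K.
  have : (u * p = 1 + v * q)%N by lia.
  by move/(congr1 (fun n => n%:R : K)); rewrite natrD !natrM => h; rewrite [p%:R * _]mulrC h; ring.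
exfalso; apply: (@vltxx _ _ hV 1); rewrite {1}e1.
by apply: (vlt_add hV); last apply: (vlt_oppl hV);
  rewrite -[X in vlt _ _ X]mulr1; apply: (vlt_mul hV); try exact: lt1;
  try exact: oner_neq0; apply/(vle1 V); exact: val_nat.
Qed.

(** Outside the kernel of reduction Z(P) = 1 and any integer will do. Inside, N is a power of one
    prime p, and the bound is proved for a multiple of P of order p, or of order 4 if p = 2 and N >
    2. Since |Z(nP)| <= |Z(P)|, it passes to P. *)
Lemma torsion_bound P N : 2 != 0 :> K -> (1 < N)%N ->
  (forall n, (Z (P *+ n) == 0) = (N %| n)%N) -> vle V (CN N)%:R (Z P ^+ 2).
Proof.
move=> two0 N1 ho.
have N0 : (0 < N)%N by lia.
have [hP|hP] := EM (vlt V (Z P) 1); last first.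
  by rewrite (normal_unit (hn P) hP) expr1n; apply/(vle1 V); apply: val_nat.
have uniqp := kernel_prime_unique hP ho N0.
have nz k : (0 < k)%N -> (k < N)%N -> Z (P *+ k) != 0.
  by move=> k0 kN; rewrite ho; apply/negP => /dvdn_leq; lia.
have ZN : Z (P *+ N) = 0 by apply/eqP; rewrite ho.
have P0 : Z P != 0 by rewrite -(mulr1n P); apply: nz; lia.
have sqle (a : nat) Q n : Q = P *+ n -> vle V a%:R (Z Q) -> vle V (a ^ 2)%:R (Z P ^+ 2).
  move=> -> h; rewrite natrX; apply: vle_exp => //; apply: vle_trans h _ => //.
  exact: (proj2 (kernel_mul _ hP)).
rewrite /CN; case: ifP => [/eqP N2|/eqP N2].
  have : vle V 4 (Z P) by apply: kernel_two_le => //; rewrite -N2.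
  exact: (sqle 4%N P 1%N).
case E : (primes N) => [|p [|q s]].
- have : pdiv N \in primes N by rewrite mem_primes pdiv_prime // N0 pdiv_dvd.
  by rewrite E.
- have : p \in primes N by rewrite E inE.
  rewrite mem_primes => /and3P[pp _ dp].
  have mulK : (N %/ p * p = N)%N by rewrite divnK.
  have pN : (p <= N)%N by apply: dvdn_leq.
  have Np0 : (0 < N %/ p)%N by rewrite divn_gt0 // prime_gt0.
  set R := P *+ (N %/ p).
  have [hR leR] := kernel_mul (N %/ p) hP.
  have Rp : R *+ p = P *+ N by rewrite /R -mulrnA divnK.
  have Rnz k : (0 < k < p)%N -> Z (R *+ k) != 0.
    move=> /andP[k0 kp]; rewrite /R -mulrnA; apply: nz.
      by rewrite muln_gt0 k0 Np0.
    by move: kp; rewrite -(ltn_pmul2l Np0) mulK.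
  have R1 : Z R != 0 by rewrite -(mulr1n R); apply: Rnz; rewrite prime_gt1.
  have [p3|p3] := leqP p 3.
    have : (p == 2%N) || (p == 3%N) by have := prime_gt1 pp; lia.
    case/orP => /eqP e; rewrite e in dp mulK Rp pp *.
      have M1 : (1 < N %/ 2)%N by move: mulK N2 N1; set M := (N %/ 2)%N; lia.
      have d2 : (2 %| N %/ 2)%N.
        have e2 : pdiv (N %/ 2) = 2%N.
          apply: uniqp => //; first exact: pdiv_prime.
          by apply: (dvdn_trans (pdiv_dvd _)); rewrite -[X in (_ %| X)%N]mulK; apply: dvdn_mulr.
        by rewrite -{1}e2 pdiv_dvd.
      have M4 : (N %/ 2 %/ 2 * 4 = N)%N by rewrite -[4%N]/(2 * 2)%N mulnA divnK // mulK.
      apply: (sqle 2%N (P *+ (N %/ 2 %/ 2)) (N %/ 2 %/ 2)%N) => //.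
      apply: kernel_four => //.
      - exact: (proj1 (kernel_mul _ hP)).
      - by rewrite -mulrnA divnK //; move: R1; rewrite /R e.
      - by rewrite -mulrnA M4.
    apply: (sqle 3%N R (N %/ p)%N) => //.
    by apply: (@kernel_odd R 1) => //; rewrite Rp.
  have odd_p : odd p by case/even_prime: pp => // p2; rewrite p2 in p3.
  (* The argument with two roots needs 2R and 3R nonzero, hence p at least 5; p = 3 only gets |3| <=
     |Z|, which is why C_N is then a square. *)
  have p5 : (4 < p)%N.
    by have : p != 4%N by [apply: contraTneq odd_p => ->]; lia.
  have ep : (p./2 + p./2.+1 = p)%N by lia.
  apply: (@vle_trans _ _ hV (Z R ^+ 2)); last exact: vle_exp.
  rewrite -ep; apply: kernel_odd2 => //.
  - by apply: Rnz; lia.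
  - by apply: Rnz; lia.
  - by rewrite ep Rp.
- have : p \in primes N by rewrite E inE eqxx.
  have : q \in primes N by rewrite E !inE eqxx orbT.
  rewrite !mem_primes => /and3P[pq _ dq] /and3P[pp _ dp].
  have := primes_uniq N; rewrite E /= inE => /andP[]; rewrite negb_or.
  by rewrite (uniqp p q) // eqxx.
Qed.

(** The factor Z(Q1 + Q2) cancels in the quotient, which becomes - e1 Z(Q2) / (Z(Q1) e2) with e1
    integral, and |e2|^2 = |Z(Q1) Z(R)| for R = Q1 + 2 Q2. *)
Lemma lambda_bound (C : nat) Q1 Q2 : C%:R != 0 :> K ->
  Z Q1 != 0 -> Z Q2 != 0 -> Z (Q1 + Q2) != 0 ->
  vle V C%:R (Z Q1 ^+ 2) -> vle V C%:R (Z (Q1 + Q2 + Q2) ^+ 2) ->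
  V (C%:R * ((X Q1 / Z Q1 - X (Q1 + Q2) / Z (Q1 + Q2)) /
             (X Q2 / Z Q2 - X (Q1 + Q2) / Z (Q1 + Q2)))).
Proof.
move=> C0 Z1 Z2 Z3 h1 h2.
have := dist (Q1 + Q2) Q2; rewrite addrK.
have VX1 := VX Q1; have VX3 := VX (Q1 + Q2); have VZ1 := VZ Q1; have VZ3 := VZ (Q1 + Q2).
have VZ2 := VZ Q2.
set R := Q1 + Q2 + Q2 in h2 *; set Q3 := Q1 + Q2 in Z3 VX3 VZ3 *.
set e2 := X Q3 * Z Q2 - X Q2 * Z Q3 => he.
have ZR : Z R != 0.
  by apply/eqP => e; move: h2; rewrite e expr0n /= => /vle_eq0 /(_ erefl) /eqP; rewrite (negPf C0).
have e20 : e2 != 0.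
  have : Z R * Z Q1 != 0 by rewrite mulf_neq0.
  by move/(veq_neq0 he); rewrite expf_eq0.
set e1 := X Q1 * Z Q3 - X Q3 * Z Q1.
have Ve1 : V e1 by rewrite /e1; vtac.
have -> : C%:R * ((X Q1 / Z Q1 - X Q3 / Z Q3) / (X Q2 / Z Q2 - X Q3 / Z Q3)) =
   - (C%:R * e1 * Z Q2) / (Z Q1 * e2).
  have e2' : X Q2 * Z Q3 - X Q3 * Z Q2 != 0 by rewrite -oppr_eq0 opprB.
  by move: e20; rewrite /e1 /e2 => e20; field; rewrite e20 Z1 Z3 Z2 mulNr e2'.
(* Only squares are controlled, so the fourth power is estimated: |C|^4 <= |Z(Q1)|^6 |Z(R)|^2 =
   |Z(Q1) e2|^4, three factors C being spent on Q1 and one on R. *)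
apply: (@val_expI _ _ hV _ 4) => //; rewrite expr_div_n; apply/(vle_div V).
  by rewrite expf_neq0 // mulf_neq0.
apply: (@vle_trans _ _ hV (C%:R ^+ 4)).
  exists ((e1 * Z Q2) ^+ 4); first by vtac.
  ring.
apply: (@vle_trans _ _ hV ((Z Q1 ^+ 2) ^+ 3 * Z R ^+ 2)).
  by rewrite [_ ^+ 4]exprSr; apply: vle_mul => //; apply: vle_exp.
have -> : (Z Q1 ^+ 2) ^+ 3 * Z R ^+ 2 = Z Q1 ^+ 4 * (Z R * Z Q1) ^+ 2 by ring.
have -> : (Z Q1 * e2) ^+ 4 = Z Q1 ^+ 4 * (e2 ^+ 2) ^+ 2 by ring.
apply: vle_mul => //; first exact: vle_refl.
by apply: vle_exp => //; case: he.
Qed.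

End GoodTorsion.

(** * Integral j: models with good reduction *)

Section PotentiallyGood.
Variables (K : fieldType) (V : K -> Prop).
Hypothesis hV : valuation_ring V.
Hypothesis char0 : forall n, n.+1%:R != 0 :> K.
Variables (w : weierstrass K) (A : zmodType) (X Z : A -> K).
Hypothesis hk : kummer w X Z.

Ltac vtac := repeat first [assumption | apply: (valB hV) | apply: (valD hV) |
  apply: (valM hV) | apply: (valN hV) | apply: (valX hV) | apply: (val_nat hV)
  | apply: (val1 hV) | apply: (val0 hV)].

Lemma CN_gt0 N : (0 < CN N)%N.
Proof.
rewrite /CN; case: ifP => // _.
case E : (primes N) => [//|p [|//]].
have : p \in primes N by rewrite E inE.
rewrite mem_primes => /and3P[/prime_gt0 p0 _ _].
by case: ifP => // _; rewrite expn_gt0 p0.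
Qed.

Definition kum_x P := X P / Z P.

Variables (N : nat) (Q1 Q2 : A).
Hypotheses (N1 : (1 < N)%N) (o1 : forall n, (Z (Q1 *+ n) == 0) = (N %| n)%N).
Hypotheses (o2 : forall n, (Z ((Q1 + Q2 + Q2) *+ n) == 0) = (N %| n)%N).
Hypotheses (z2 : Z Q2 != 0) (z3 : Z (Q1 + Q2) != 0).

Let lam := (kum_x Q1 - kum_x (Q1 + Q2)) / (kum_x Q2 - kum_x (Q1 + Q2)).

Let z1 : Z Q1 != 0.
Proof. by rewrite -(mulr1n Q1) o1 dvdn1; move: N1; case: N => [|[|]]. Qed.

(** A ratio of differences of x-coordinates is unchanged by x = U x' + r, so the bound may be taken
    in any model with good reduction. *)
Lemma lambda_model r U : U != 0 -> let w' := wchange w r U in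
  V (wb2 w') -> V (wb4 w') -> V (wb6 w') -> V (wb8 w') -> veq V (wdisc w') 1 ->
  V ((CN N)%:R * lam).
Proof.
move=> U0 w' V2 V4 V6 V8 hd.
have hk' := kummer_change r U0 hk.
have [l [l0 hn]] := exists_normalized hV hk'.
have hk'' := kummer_rescale l0 hk'.
set X2 := (fun P => l P * (X P - r * Z P)) in hk'' hn.
set Z2 := (fun P => l P * (U * Z P)) in hk'' hn.
have Z2E P : (Z2 P == 0) = (Z P == 0).
  by rewrite /Z2 !mulf_eq0 (negPf (l0 P)) (negPf U0).
have nz n : n.+1%:R != 0 :> K by apply: char0.
have C0 : (CN N)%:R != 0 :> K by have := CN_gt0 N; case: (CN N) => // k _; apply: nz.
have xE P : Z P != 0 -> X2 P / Z2 P = (kum_x P - r) / U.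
  by move=> ZP; rewrite /X2 /Z2 /kum_x; field; rewrite ZP U0 l0.
have -> : lam = (X2 Q1 / Z2 Q1 - X2 (Q1 + Q2) / Z2 (Q1 + Q2)) /
                (X2 Q2 / Z2 Q2 - X2 (Q1 + Q2) / Z2 (Q1 + Q2)).
  rewrite !xE // /lam.
  have [e|ne] := eqVneq (kum_x Q2) (kum_x (Q1 + Q2)).
    by rewrite e !subrr invr0 !mulr0.
  have sub p q : (p - r) / U - (q - r) / U = (p - q) / U by field.
  have ne' : kum_x Q2 - kum_x (Q1 + Q2) != 0 by rewrite subr_eq0.
  by rewrite !sub invf_div mulrA divfK.
apply: (@lambda_bound _ _ hV w' _ X2 Z2 V2 V4 V6 V8 hd hk'' hn) => //; rewrite ?Z2E //.
- by apply: (torsion_bound hV V2 V4 V6 V8 hd hk'' hn (nz 1%N) N1) => n; rewrite Z2E o1.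
- by apply: (torsion_bound hV V2 V4 V6 V8 hd hk'' hn (nz 1%N) N1) => n; rewrite Z2E o2.
Qed.

Let b8E : 4 * wb8 w = wb2 w * wb6 w - wb4 w ^+ 2. Proof. by case: hk. Qed.
Let Z0 : Z 0 = 0. Proof. by case: hk. Qed.
Let X0 : X 0 != 0. Proof. by case: hk => _ _ e /(_ 0); rewrite e eqxx => -[]. Qed.

Lemma two_torsion_root P : Z P != 0 -> Z (P + P) = 0 ->
  let e := kum_x P in 4 * e ^+ 3 + wb2 w * e ^+ 2 + 2 * wb4 w * e + wb6 w = 0.
Proof.
move=> ZP ZPP e; have [_ _ _ _ /(_ P P) [c c0 [_ + _]]] := hk.
rewrite ZPP subrr Z0 !mulr0 addr0 => /esym/eqP; rewrite mulf_eq0 (negPf c0) /= => /eqP F0.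
have -> : 4 * e ^+ 3 + wb2 w * e ^+ 2 + 2 * wb4 w * e + wb6 w
    = kumF w (X P) (Z P) (X P) (Z P) / Z P ^+ 4 by rewrite /e /kum_x /kumF; field.
by rewrite F0 mul0r.
Qed.

Lemma x_distinct P Q : Z P != 0 -> Z Q != 0 -> Z (P + Q) != 0 -> Z (P - Q) != 0 ->
  kum_x P != kum_x Q.
Proof.
move=> ZP ZQ h1 h2; have [_ _ _ _ /(_ P Q) [c c0 [_ _ e]]] := hk.
apply/eqP => exy; move: (mulf_neq0 h1 h2); rewrite e /kumD.
have -> : X P = kum_x P * Z P by rewrite divfK.
have -> : X Q = kum_x Q * Z Q by rewrite divfK.
by rewrite exy mulrAC subrr expr0n /= mulr0 eqxx.
Qed.

(** 3T = 0 means x(2T) = x(T), and x(2T) is G/F on the diagonal. *)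
Lemma three_torsion_root T : Z T != 0 -> Z (T *+ 3) = 0 ->
  let x := kum_x T in x * kumF w x 1 x 1 = kumG w x 1 x 1.
Proof.
move=> ZT Z3 x.
have [_ _ _ _ hl] := hk.
have [c c0 [eG eF _]] := hl T T.
have [d d0 [_ _ eD]] := hl (T + T) T.
move: eD; rewrite -mulr2n -mulrSr Z3 mul0r => /esym/eqP; rewrite mulf_eq0 (negPf d0) /=.
rewrite expf_eq0 /= subr_eq0 => /eqP e.
move: eG eF; rewrite subrr Z0 mulr0 add0r -mulr2n => eG eF.
have eFx : kumF w x 1 x 1 = kumF w (X T) (Z T) (X T) (Z T) / Z T ^+ 4.
  by rewrite /x /kum_x /kumF; field.
have eGx : kumG w x 1 x 1 = kumG w (X T) (Z T) (X T) (Z T) / Z T ^+ 4.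
  by rewrite /x /kum_x /kumG; field.
rewrite eFx eGx; apply: (mulfI c0); rewrite /x /kum_x.
transitivity (X T * (c * kumF w (X T) (Z T) (X T) (Z T)) / Z T ^+ 5); first by field.
transitivity (Z T * (c * kumG w (X T) (Z T) (X T) (Z T)) / Z T ^+ 5); last by field.
rewrite -eF -eG; congr (_ / _).
transitivity (X 0 * (X T * Z (T *+ 2))); first by ring.
by rewrite -e; ring.
Qed.

Lemma small_not_unit a b : veq V a 1 -> vlt V b 1 -> a <> b.
Proof. by move=> [_ h] h' e; apply: h'; rewrite -e. Qed.

Lemma lt_mulr a b : vlt V a 1 -> V b -> vlt V (a * b) 1.
Proof.
move=> ha hb; rewrite -[X in vlt _ _ X]mulr1; apply: (vlt_mul hV) => //.
  exact/(vle1 V).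
exact: oner_neq0.
Qed.

Variable j : K.
Hypotheses (Vj : V j) (hj : wc4 w ^+ 3 = j * wdisc w).

Lemma model_j r U : U != 0 -> wc4 (wchange w r U) ^+ 3 = j * wdisc (wchange w r U).
Proof. by move=> U0; rewrite wchange_c4 // wchange_disc // exprMn hj; field. Qed.

Variables (E1 E2 E3 : A).
Hypotheses (e1 : Z E1 != 0) (e2 : Z E2 != 0) (e3 : Z E3 != 0).
Hypotheses (d1 : Z (E1 + E1) = 0) (d2 : Z (E2 + E2) = 0) (d3 : Z (E3 + E3) = 0).
Hypotheses (p12 : Z (E1 + E2) != 0) (m12 : Z (E1 - E2) != 0).
Hypotheses (p13 : Z (E1 + E3) != 0) (m13 : Z (E1 - E3) != 0).
Hypotheses (p23 : Z (E2 + E3) != 0) (m23 : Z (E2 - E3) != 0).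

Lemma vieta : let x1 := kum_x E1 in let x2 := kum_x E2 in let x3 := kum_x E3 in
  [/\ wb2 w = - 4 * (x1 + x2 + x3), wb4 w = 2 * (x1 * x2 + x1 * x3 + x2 * x3),
      wb6 w = - 4 * (x1 * x2 * x3), x1 - x2 != 0 & x1 - x3 != 0 /\ x2 - x3 != 0].
Proof.
move=> x1 x2 x3.
have n12 : x1 - x2 != 0 by rewrite subr_eq0 x_distinct.
have n13 : x1 - x3 != 0 by rewrite subr_eq0 x_distinct.
have n23 : x2 - x3 != 0 by rewrite subr_eq0 x_distinct.
have r1 := two_torsion_root e1 d1; have r2 := two_torsion_root e2 d2.
have r3 := two_torsion_root e3 d3; rewrite -/x1 -/x2 -/x3 /= in r1 r2 r3.
have h12 : 4 * (x1 ^+ 2 + x1 * x2 + x2 ^+ 2) + wb2 w * (x1 + x2) + 2 * wb4 w = 0.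
  apply: (mulfI n12); rewrite mulr0 -(subrr 0) -{1}r1 -r2; ring.
have h13 : 4 * (x1 ^+ 2 + x1 * x3 + x3 ^+ 2) + wb2 w * (x1 + x3) + 2 * wb4 w = 0.
  apply: (mulfI n13); rewrite mulr0 -(subrr 0) -{1}r1 -r3; ring.
have b2 : wb2 w = - 4 * (x1 + x2 + x3).
  apply/eqP; rewrite -subr_eq0; apply/eqP; apply: (mulfI n23); rewrite mulr0 -(subrr 0) -{1}h12 -h13; ring.
have b4 : wb4 w = 2 * (x1 * x2 + x1 * x3 + x2 * x3).
  apply: (mulfI (char0 1)); apply/eqP; rewrite -subr_eq0 -h12 b2; apply/eqP; ring.
split => //.
by apply/eqP; rewrite -subr_eq0 -r1 b2 b4; apply/eqP; ring.
Qed.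

(** With 2 a unit, moving two 2-torsion points to x = 0 and x = 1 leaves the Legendre parameter L.
    The relation [jL] with j makes L integral and L (1 - L) a unit: otherwise the relation, divided
    by L^6 in the first case, would equate a unit with a nonunit. *)
Lemma legendre_model : veq V 2 1 -> V ((CN N)%:R * lam).
Proof.
move=> u2; have := vieta; cbv zeta.
set x1 := kum_x E1; set x2 := kum_x E2; set x3 := kum_x E3.
move=> [b2 b4 b6 n12 [n13 n23]].
have nz n : n.+1%:R != 0 :> K by apply: char0.
pose U := x2 - x1; have U0 : U != 0 by rewrite -oppr_eq0 opprB.
pose L := (x3 - x1) / U.
set w' := wchange w x1 U.
have b2' : wb2 w' = - 4 * (1 + L) by rewrite /w' /= b2 /L /U; field.
have b4' : wb4 w' = 2 * L by rewrite /w' /= b2 b4 /L /U; field.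
have b6' : wb6 w' = 0 by rewrite /w' /= b2 b4 b6 /L /U; field.
have b8' : wb8 w' = - L ^+ 2.
  apply: (mulfI (nz 3%N)); rewrite (wchange_b8 x1 U0 b8E) -/w' b2' b4' b6'; ring.
have disc' : wdisc w' = 16 * (L * (1 - L)) ^+ 2 by rewrite /wdisc b2' b4' b6' b8'; ring.
have c4' : wc4 w' = 16 * (1 - L * (1 - L)) by rewrite /wc4 b2' b4'; ring.
have jL : 16 ^+ 2 * (1 - L * (1 - L)) ^+ 3 = j * (L * (1 - L)) ^+ 2.
  apply: (mulfI (nz 15%N)).
  transitivity (wc4 w' ^+ 3); first by rewrite c4'; ring.
  by rewrite model_j // disc'; ring.
have L0 : L != 0 by rewrite mulf_neq0 ?invr_eq0 // -oppr_eq0 opprB.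
have u16 : veq V 16 1.
  have -> : 16 = 2 ^+ 4 :> K by ring.
  by rewrite -[X in veq _ _ X](expr1n _ 4); apply: veq_exp.
have VL : V L.
  have [//|hL] := EM (V L); exfalso.
  have hm := not_val_inv hL; set m := L^-1 in hm.
  have Lm : L * m = 1 by rewrite mulfV.
  have Vm : V m by apply/(vle1 V)/(vltW hV).
  apply: (@small_not_unit (16 ^+ 2 * (1 - m * (1 - m)) ^+ 3) (m ^+ 2 * (j * (1 - m) ^+ 2))).
  - rewrite -[X in veq _ _ X](mulr1 1); apply: veq_mul => //.
      by rewrite -[X in veq _ _ X](expr1n _ 2); apply: veq_exp.
    rewrite -[X in veq _ _ X](expr1n _ 3); apply: veq_exp => //.
    by apply: (veq_dom hV); apply: (vlt_oppl hV); apply: lt_mulr => //; vtac.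
  - by rewrite expr2 -mulrA; apply: lt_mulr => //; vtac.
  transitivity (16 ^+ 2 * (1 - L * (1 - L)) ^+ 3 * m ^+ 6).
    have -> : 1 - m * (1 - m) = (1 - L * (1 - L)) * m ^+ 2 by rewrite /m; field.
    by ring.
  by rewrite jL /m; field.
have uL y : V y -> vlt V (L * (1 - L)) 1 -> False.
  move=> _ h; apply: (@small_not_unit (16 ^+ 2 * (1 - L * (1 - L)) ^+ 3) (j * (L * (1 - L)) ^+ 2)) => //.
    rewrite -[X in veq _ _ X](mulr1 1); apply: veq_mul => //.
      by rewrite -[X in veq _ _ X](expr1n _ 2); apply: veq_exp.
    rewrite -[X in veq _ _ X](expr1n _ 3); apply: veq_exp => //.
    by apply: (veq_dom hV); apply: (vlt_oppl hV).
  by rewrite [j * _]mulrC expr2 -[_ * _ * j]mulrA; apply: lt_mulr => //; vtac.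
apply: (@lambda_model x1 U U0); rewrite -/w' ?b2' ?b4' ?b6' ?b8'; vtac.
rewrite disc' -[X in veq _ _ X](mulr1 1); apply: veq_mul => //.
rewrite -[X in veq _ _ X](expr1n _ 2); apply: veq_exp => //.
split; first by apply/(vle1 V); vtac.
by have [//|h] := vle_or_lt V 1 (L * (1 - L)); case: (uL 1 (val1 hV)).
Qed.

Variables (T : A) (U : K).
Hypotheses (t1 : Z T != 0) (t3 : Z (T *+ 3) = 0).
(** U^3 is the 2-division cubic at x(T), so scaling by U makes the new b6 equal to 1. *)
Hypothesis (hU : let x := kum_x T in
  U ^+ 3 = 4 * x ^+ 3 + wb2 w * x ^+ 2 + 2 * wb4 w * x + wb6 w).

(* the Deuring normal form y^2 + a x y + y = x^3 *)
Lemma deuring_model : vlt V 2 1 -> V ((CN N)%:R * lam).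
Proof.
move=> u2; have hx := hU; cbv zeta in hx; set x := kum_x T in hx.
have nz n : n.+1%:R != 0 :> K by apply: char0.
have u3 : veq V 3 1.
  have -> : 3 = 1 + 2 :> K by ring.
  exact: (veq_dom hV).
have r3 := three_torsion_root t1 t3; rewrite -/x /= in r3.
have U0 : U != 0.
  apply/eqP => U0; move: hx; rewrite U0 expr0n /= => h.
  have F0 : kumF w x 1 x 1 = 0 by apply: etrans (esym h); rewrite /kumF; ring.
  have G0 : kumG w x 1 x 1 = 0 by rewrite -r3 F0 mulr0.
  have := kum_bezout x b8E; rewrite F0 G0 !mulr0 subrr => /esym/eqP.
  by case: hk => _ /negPf -> _ _ _.
set w' := wchange w x U; set a := wb4 w'.
have b6' : wb6 w' = 1.
  by rewrite /w' /= hx; field; rewrite -hx expf_neq0.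
(* Once T is moved to x = 0, the numerator of b8 is x F - G, the 3-division polynomial at T. *)
have b8' : wb8 w' = 0.
  have := subrr (kumG w x 1 x 1); rewrite -{1}r3 => h.
  rewrite /w' /=; apply/eqP; rewrite mulf_eq0; apply/orP; left; rewrite -h; apply/eqP.
  by rewrite /kumF /kumG; ring.
have b2' : wb2 w' = a ^+ 2.
  have := wchange_b8 x U0 b8E; cbv zeta; rewrite -/w' b8' b6' mulr0 mulr1 => /esym/eqP.
  by rewrite subr_eq0 => /eqP.
have disc' : wdisc w' = a ^+ 3 - 27 by rewrite /wdisc b2' b6' b8' -/a; ring.
have c4' : wc4 w' = a * (a ^+ 3 - 24) by rewrite /wc4 b2' -/a; ring.
have ja := model_j x U0; rewrite -/w' c4' disc' in ja.
have Va : V a.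
  have [//|ha] := EM (V a); exfalso.
  have a0 : a != 0 by apply/eqP => a0; apply: ha; rewrite a0; apply: val0.
  have hm := not_val_inv ha; set m := a^-1 in hm.
  have Vm : V m by apply/(vle1 V)/(vltW hV).
  apply: (@small_not_unit ((1 - m * (24 * m ^+ 2)) ^+ 3) (m * (j * m ^+ 8 * (1 - 27 * m ^+ 3)))).
  - rewrite -[X in veq _ _ X](expr1n _ 3); apply: veq_exp => //.
    by apply: (veq_dom hV); apply: (vlt_oppl hV); apply: lt_mulr => //; vtac.
  - by apply: lt_mulr => //; vtac.
  transitivity ((a * (a ^+ 3 - 24)) ^+ 3 * m ^+ 12); first by rewrite /m; field.
  by rewrite ja /m; field.
apply: (@lambda_model x U U0); rewrite -/w' ?b2' ?b6' ?b8'; vtac.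
rewrite disc'; split; first by apply/(vle1 V); vtac.
have [//|h] := vle_or_lt V 1 (a ^+ 3 - 27); exfalso.
set t := a ^+ 3 - 27 in h ja.
have Vt : V t by rewrite /t; vtac.
(* In t = a^3 - 27 the cube of c4 is (t + 27) (t + 3)^3, whose constant term 3^6 is a unit in
   residue characteristic 2. *)
apply: (@small_not_unit (3 ^+ 6 + t * ((t + 3) ^+ 3 + 27 * (t ^+ 2 + 9 * t + 27))) (t * j)).
- apply: veq_trans (veq_dom hV _) _ => //.
    apply: (@vlt_eqr _ _ hV _ 1); last by apply: lt_mulr => //; vtac.
    apply: veq_sym; rewrite -[X in veq _ _ X](expr1n _ 6); exact: veq_exp.
  by rewrite -[X in veq _ _ X](expr1n _ 6); apply: veq_exp.
- exact: lt_mulr.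
by rewrite [t * j]mulrC -ja /t; ring.
Qed.

Theorem lambda_integral : V ((CN N)%:R * lam).
Proof.
by case: (nat_unit_or_lt hV 2); [exact: legendre_model | exact: deuring_model].
Qed.

End PotentiallyGood.

(** * Multiplicative reduction *)

Section MultiplicativeReduction.
Variables (K : fieldType) (V : K -> Prop).
Hypothesis hV : valuation_ring V.
Variable k : K.
Hypotheses (k0 : k != 0) (k1 : vlt V k 1).

(* The curve y^2 + x y = x^3 - 36 k x - k, whose j-invariant is 1728 + 1/k; its
   reduction has a node at (0, 0). *)
Definition tate_model := Weierstrass 1 (- 72 * k) (- 4 * k) (- k * (1 + 1296 * k)).
Let w := tate_model.

Variables (A : zmodType) (X Z : A -> K).
Hypotheses (hk : kummer w X Z) (hn : normalized V X Z).

Ltac vtac := repeat first [assumption | apply: (valB hV) | apply: (valD hV) |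
  apply: (valM hV) | apply: (valN hV) | apply: (valX hV) | apply: (val_nat hV)
  | apply: (val1 hV) | apply: (val0 hV)].

Let vxx := vle_refl hV.
Let exx := veq_refl hV.
Let VX P : V (X P). Proof. by case: (normal_val hV (hn P)). Qed.
Let VZ P : V (Z P). Proof. by case: (normal_val hV (hn P)). Qed.
Let Vk : V k. Proof. by apply/(vle1 V)/(vltW hV). Qed.
Let Z0 : Z 0 = 0. Proof. by case: hk. Qed.
Let X0 : X 0 = 1.
Proof. by apply: (normal_small hV (hn 0)); rewrite Z0; apply: vlt01. Qed.

Lemma vle_mulr1 a b : vle V b 1 -> vle V (a * b) a.
Proof. by move=> h; rewrite -[X in vle _ _ X]mulr1; apply: vle_mul. Qed.

Lemma vlt_mulr1 a b : vlt V a 1 -> vle V b 1 -> vlt V (a * b) 1.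
Proof.
by move=> ha hb; rewrite -[X in vlt _ _ X]mulr1; apply: (vlt_mul hV) => //; exact: oner_neq0.
Qed.

Lemma unit_mulP a b : V a -> V b -> veq V (a * b) 1 -> veq V a 1 /\ veq V b 1.
Proof.
move=> /(vle1 V) ha /(vle1 V) hb [_ h]; split; split => //; apply: (vle_trans hV h).
  exact: vle_mulr1.
by rewrite mulrC; apply: vle_mulr1.
Qed.

(* [comp_pt x a] means that x is the x-coordinate of a point u of the Tate curve
   K^* / q^Z with |u| = |a|, for |q| = |k| and |k|^(1/2) <= |a| <= 1. *)
Definition half_range a := [/\ a != 0, vle V a 1 & vle V k (a ^+ 2)].
Definition comp_pt x a := vle V x a /\ (vlt V k (a ^+ 2) -> vle V a x).
Definition comp P a := half_range a /\ comp_pt (X P) a.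

Lemma comp_pt_veq x y a : veq V x y -> comp_pt x a -> comp_pt y a.
Proof.
by move=> [h1 h2] [h3 h4]; split; [exact: (vle_trans hV h2 h3) | move/h4 => h5; exact: (vle_trans hV h5 h1)].
Qed.

(** A Newton polygon argument: |a + b| and |a b| determine |a| and |b|. In the middle of the range,
    where |u|^2 = |k|, the terms u and q/u of the Tate expansion of x may cancel, so only upper
    bounds are claimed there. *)
Lemma pair_comp (a b u v : K) : vle V b a -> u != 0 -> v != 0 -> vle V v u ->
  vle V (a * b) (u * v) -> vle V (a + b) u ->
  (vlt V k (v ^+ 2) -> vle V (u * v) (a * b)) ->
  (vlt V k (u ^+ 2) -> vle V u (a + b) \/ vle V u v) ->
  vle V k (v ^+ 2) -> comp_pt a u /\ comp_pt b v.
Proof.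
move=> ba u0 v0 vu abuv abu hv hu kv.
have au : vle V a u.
  have [//|lt] := vle_or_lt V a u; exfalso.
  have lt' := vle_lt_trans hV abu lt.
  have eb : veq V b a.
    have -> : b = - a + (a + b) by ring.
    apply: (veq_trans hV _ (veqN hV a)); apply: (veq_dom hV).
    by apply: (vlt_eqr hV) lt'; apply/veq_sym/veqN.
  have : vlt V (u * v) (a * b).
    apply: (vlt_eqr hV (b := a * a)); first by apply: veq_mul => //; apply: veq_sym.
    apply: (vle_lt_trans hV (b := u * u)); first exact: vle_mul.
    by apply: (vlt_mul hV) => //; [exact: vltW | exact: vlt_neq0 lt].
  by apply.
have a_ab c : vle V c (a + b) -> vle V c a.
  by move=> h; apply: (vle_trans hV h); apply: vle_add.
have lowb : vlt V k (v ^+ 2) -> vle V v b.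
  move=> /hv h; apply: (vle_cancell u0); apply: (vle_trans hV h).
  exact: vle_mul.
have [ku|ku] := vle_or_lt V (u ^+ 2) k.
  have uv : vle V u v by apply: (@vle_expI _ _ hV _ _ 2) => //; exact: (vle_trans hV ku kv).
  split; split => //.
    by apply: (vle_trans hV ba); exact: (vle_trans hV au uv).
have [h|h] := hu ku.
  split; split => //; first by move=> _; apply: a_ab.
  apply: (vle_cancell u0); apply: (vle_trans hV _ abuv).
  by apply: vle_mul => //; apply: a_ab.
have bv : vle V b v by apply: (vle_trans hV ba); exact: (vle_trans hV au h).
split; split => // _.
apply: (vle_cancel v0); apply: (vle_trans hV (hv _)).
  by apply: (vlt_le_trans hV ku); apply: vle_exp.
exact: vle_mul.
Qed.

Lemma pair_comp2 (a b u v : K) : u != 0 -> v != 0 -> vle V v u ->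
  vle V (a * b) (u * v) -> vle V (a + b) u ->
  (vlt V k (v ^+ 2) -> vle V (u * v) (a * b)) ->
  (vlt V k (u ^+ 2) -> vle V u (a + b) \/ vle V u v) ->
  vle V k (v ^+ 2) -> (comp_pt a u /\ comp_pt b v) \/ (comp_pt a v /\ comp_pt b u).
Proof.
move=> u0 v0 vu h1 h2 h3 h4 kv.
have [h|h] := vle_total hV b a; first by left; apply: pair_comp.
rewrite [a * b]mulrC in h1 h3; rewrite [a + b]addrC in h2 h4.
by right; have [] := pair_comp h u0 v0 vu h1 h2 h3 h4 kv.
Qed.

Section Law.
Variables (P Q : A).
Let x1 := X P. Let z1 := Z P. Let x2 := X Q. Let z2 := Z Q.
Let F := kumF w x1 z1 x2 z2.
Let G := kumG w x1 z1 x2 z2.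
Let D := kumD x1 z1 x2 z2.
Variables (c : K).
Hypotheses (eG : X (P + Q) * X (P - Q) = c * G)
  (eF : X (P + Q) * Z (P - Q) + X (P - Q) * Z (P + Q) = c * F)
  (eD : Z (P + Q) * Z (P - Q) = c * D).

(** [M] has the size of the content of (G, F, D), and the left-hand sides of the law have content
    1. *)
Lemma law_scale M : M != 0 -> vle V G M -> vle V F M -> vle V D M ->
  [\/ veq V G M, veq V F M | veq V D M] -> veq V (c * M) 1.
Proof.
move=> M0 hG hF hD h; split.
  have up t s : veq V t M -> V s -> s = c * t -> vle V (c * M) 1.
    by move=> [_ h1] /(vle1 V) h2 e; apply: (vle_trans hV _ h2); rewrite e; apply: vle_mul.
  case: h => h; [apply: (up _ _ h _ eG)|apply: (up _ _ h _ eF)|apply: (up _ _ h _ eD)];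
    by rewrite -?eG -?eF -?eD; vtac; try exact: VX; exact: VZ.
have low t s : veq V s 1 -> vle V t M -> s = c * t -> vle V 1 (c * M).
  by move=> [_ h1] h2 e; apply: (vle_trans hV h1); rewrite e; apply: vle_mul.
have [h1|h1|h1] := pair_content hV (hn (P + Q)) (hn (P - Q)).
- exact: (low _ _ h1 hG eG).
- exact: (low _ _ h1 hF eF).
- exact: (low _ _ h1 hD eD).
Qed.

Let g := 72 * x1 * x2 * z1 * z2 + 4 * (x1 * z2 + x2 * z1) * z1 * z2 + (1 + 1296 * k) * z1 ^+ 2 * z2 ^+ 2.
Let f := - 72 * (x1 * z2 + x2 * z1) * z1 * z2 - 4 * z1 ^+ 2 * z2 ^+ 2.
Let GE : G = x1 ^+ 2 * x2 ^+ 2 + k * g. Proof. by rewrite /G /kumG /g /=; ring. Qed.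
Let FE : F = x1 * x2 * (z1 * z2 + 2 * (x1 * z2 + x2 * z1)) + k * f.
Proof. by rewrite /F /kumF /f /=; ring. Qed.
Let Vx1 : V x1. Proof. exact: VX. Qed.
Let Vx2 : V x2. Proof. exact: VX. Qed.
Let Vz1 : V z1. Proof. exact: VZ. Qed.
Let Vz2 : V z2. Proof. exact: VZ. Qed.
Let kg : vle V (k * g) k. Proof. by apply: vle_mulr1; apply/(vle1 V); rewrite /g; vtac. Qed.
Let kf : vle V (k * f) k. Proof. by apply: vle_mulr1; apply/(vle1 V); rewrite /f; vtac. Qed.

Let small_z R : vlt V (X R) 1 -> Z R = 1.
Proof. by case: (hn R) => [[]|[-> _] /(vltxx hV)]. Qed.

Let g_unit : vlt V x1 1 -> vlt V x2 1 -> veq V (k * g) k.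
Proof.
move=> h1 h2; rewrite /g /z1 /z2 !small_z // -/x1 -/x2.
rewrite -[X in veq _ _ X]mulr1; apply: veq_mul => //.
have -> : 72 * x1 * x2 * 1 * 1 + 4 * (x1 * 1 + x2 * 1) * 1 * 1 + (1 + 1296 * k) * 1 ^+ 2 * 1 ^+ 2
  = 1 + (x1 * (72 * x2 + 4) + (x2 * 4 + k * 1296)) by ring.
apply: (veq_dom hV); apply: (vlt_add hV); last apply: (vlt_add hV);
  by apply: vlt_mulr1 => //; apply/(vle1 V); vtac.
Qed.

Let sqx a b : vle V x1 a -> vle V x2 b -> vle V (x1 ^+ 2 * x2 ^+ 2) ((a * b) ^+ 2).
Proof. by move=> h1 h2; rewrite -exprMn; apply: vle_exp => //; apply: vle_mul. Qed.

Let Gle M a b : vle V x1 a -> vle V x2 b -> vle V ((a * b) ^+ 2) M -> vle V k M -> vle V G M.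
Proof.
move=> h1 h2 h3 h4; rewrite GE; apply: vle_add => //.
  by apply: (vle_trans hV _ h3); apply: sqx.
exact: (vle_trans hV kg h4).
Qed.

Let Fle M a b : vle V x1 a -> vle V x2 b -> vle V (a * b) M -> vle V k M -> vle V F M.
Proof.
move=> h1 h2 h3 h4; rewrite FE; apply: vle_add => //; last exact: (vle_trans hV kf h4).
apply: (vle_trans hV (b := x1 * x2)); first by apply: vle_mulr1; apply/(vle1 V); vtac.
by apply: (vle_trans hV _ h3); apply: vle_mul.
Qed.

Let Glow a b : veq V x1 a -> veq V x2 b -> vlt V k ((a * b) ^+ 2) -> veq V G ((a * b) ^+ 2).
Proof.
move=> h1 h2 h3; have e : veq V (x1 ^+ 2 * x2 ^+ 2) ((a * b) ^+ 2).
  by rewrite -exprMn; apply: veq_exp => //; apply: veq_mul.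
rewrite GE; apply: (veq_trans hV _ e); apply: (veq_dom hV).
by apply: (vle_lt_trans hV kg); apply: (vlt_eqr hV) h3; apply: veq_sym.
Qed.

Let Gk a b : vle V x1 a -> vle V x2 b -> vlt V ((a * b) ^+ 2) k ->
  vlt V x1 1 -> vlt V x2 1 -> veq V G k.
Proof.
move=> h1 h2 h3 h4 h5; rewrite GE; have e := g_unit h4 h5.
apply: (veq_trans hV _ e); apply: (veq_domr hV).
apply: (vlt_eqr hV (b := k)); first exact: veq_sym.
by apply: (vle_lt_trans hV _ h3); apply: sqx.
Qed.

(** The two points have classes a/b and ab, the latter replaced by k/(ab) when it leaves the half
    range. The cases differ by which of G, F, D carries the content of the Kummer forms. *)
Lemma half_law a b v : comp P a -> comp Q b -> vle V a b ->
  (v = a * b /\ vle V k ((a * b) ^+ 2)) \/ (v = k / (a * b) /\ vle V ((a * b) ^+ 2) k) ->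
  (comp (P + Q) (a / b) /\ comp (P - Q) v) \/ (comp (P + Q) v /\ comp (P - Q) (a / b)).
Proof.
move=> [[a0 a1 ka] [xa ax]] [[b0 b1 kb] [xb bx]] ab hv; rewrite -/x1 -/x2 in xa ax xb bx.
have ab0 : a * b != 0 by rewrite mulf_neq0.
have b20 : b ^+ 2 != 0 by rewrite expf_neq0.
have v0 : v != 0 by case: hv => -[-> _] //; rewrite mulf_neq0 ?invr_eq0.
have u0 : a / b != 0 by rewrite mulf_neq0 ?invr_eq0.
have u1 : vle V (a / b) 1 by apply: (vle_cancel b0); rewrite divfK // mul1r.
have a_le_u : vle V a (a / b).
  by apply: (vle_cancel b0); rewrite divfK //; apply: vle_mulr1.
have ab1 : vle V (a * b) 1 by apply: (vle_trans hV _ b1); rewrite mulrC; apply: vle_mulr1.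
have hu : half_range (a / b).
  by split => //; apply: (vle_trans hV ka); apply: vle_exp.
have kab_v : v = k / (a * b) -> v * (a * b) = k by move=> ->; rewrite divfK.
have hv1 : half_range v.
  case: hv => -[e h]; first by rewrite e; split.
  have ev := kab_v e; split => //.
    apply: (vle_cancel ab0); rewrite ev mul1r; apply: (vle_trans hV ka).
    by rewrite expr2; apply: vle_mul.
  apply: (vle_cancel (c := (a * b) ^+ 2)); first by rewrite expf_neq0.
  by rewrite -exprMn ev [k ^+ 2]expr2; apply: vle_mul.
have vu : vle V v (a / b).
  apply: (vle_cancel b0); rewrite divfK //; case: hv => -[e h].
    by rewrite e -mulrA; apply: vle_mulr1; rewrite -(mulr1 1); apply: vle_mul.
  by apply: (vle_cancell a0); rewrite mulrCA kab_v // -expr2.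
have kv : vle V k (v ^+ 2) by case: hv1.
have uv_b2 : a / b * v * b ^+ 2 = a * b * v by field.
have hvab : vle V ((a * b) ^+ 2) (a * b * v) /\ vle V k (a * b * v).
  case: hv => -[e h]; first by rewrite e -expr2.
  by rewrite [a * b * v]mulrC kab_v.
have conclude : comp_pt (X (P + Q)) (a / b) /\ comp_pt (X (P - Q)) v \/
    comp_pt (X (P + Q)) v /\ comp_pt (X (P - Q)) (a / b) ->
  (comp (P + Q) (a / b) /\ comp (P - Q) v) \/ (comp (P + Q) v /\ comp (P - Q) (a / b)).
  by case=> -[h1 h2]; [left|right].
apply: conclude.
have k_lt b' : vle V 1 b' -> vlt V k (b' ^+ 2).
  move=> h; apply: (vlt_le_trans hV k1); rewrite -[X in vle _ X _](expr1n _ 2).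
  exact: vle_exp.
have Gv : vlt V x1 1 -> vlt V x2 1 -> vlt V k (v ^+ 2) -> veq V G (a * b * v).
  move=> s1 s2 lt; case: hv => -[e h].
    rewrite e -expr2; rewrite e in lt; apply: Glow => //; split => //.
      apply: ax; apply: (vlt_le_trans hV lt); apply: vle_exp => //; exact: vle_mulr1.
    apply: bx; apply: (vlt_le_trans hV lt); apply: vle_exp => //.
    by rewrite mulrC; apply: vle_mulr1.
  rewrite [a * b * v]mulrC kab_v //; apply: (Gk xa xb) => //.
  have [//|h'] := EM (vlt V ((a * b) ^+ 2) k).
  have {}h' : vle V k ((a * b) ^+ 2) by have [//|/h'] := vle_or_lt V k ((a * b) ^+ 2).
  exfalso; apply: lt; apply: (vle_cancel (c := (a * b) ^+ 2)); first by rewrite expf_neq0.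
  by rewrite -exprMn kab_v // expr2; apply: vle_mul.
have ZZunit : veq V (Z (P + Q) * Z (P - Q)) 1 -> forall u v,
   (comp_pt (X (P + Q) * Z (P - Q)) u /\ comp_pt (X (P - Q) * Z (P + Q)) v \/
    comp_pt (X (P + Q) * Z (P - Q)) v /\ comp_pt (X (P - Q) * Z (P + Q)) u) ->
    comp_pt (X (P + Q)) u /\ comp_pt (X (P - Q)) v \/
    comp_pt (X (P + Q)) v /\ comp_pt (X (P - Q)) u.
  move=> /(unit_mulP (VZ _) (VZ _)) [h1 h2] u v'.
  have e1 : veq V (X (P + Q) * Z (P - Q)) (X (P + Q)).
    by rewrite -[X in veq _ _ X]mulr1; apply: veq_mul.
  have e2 : veq V (X (P - Q) * Z (P + Q)) (X (P - Q)).
    by rewrite -[X in veq _ _ X]mulr1; apply: veq_mul.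
  by case=> -[h3 h4]; [left|right]; split; [exact: comp_pt_veq h3|exact: comp_pt_veq h4
     |exact: comp_pt_veq h3|exact: comp_pt_veq h4].
have prodE : X (P + Q) * Z (P - Q) * (X (P - Q) * Z (P + Q)) =
  (c * G) * (Z (P + Q) * Z (P - Q)) by rewrite -eG; ring.
(* Both points reduce to smooth points: G is a unit. *)
have [a_unit|a_lt] := vle_or_lt V 1 a.
  have ba : vle V b a by exact: (vle_trans hV b1 a_unit).
  have b_unit : vle V 1 b by exact: (vle_trans hV a_unit ab).
  have x1u : veq V x1 1.
    split; first exact/(vle1 V).
    by apply: (vle_trans hV a_unit); apply/ax/k_lt.
  have x2u : veq V x2 1.
    split; first exact/(vle1 V).
    by apply: (vle_trans hV b_unit); apply/bx/k_lt.
  have Gu : veq V G 1.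
    have := @Glow 1 1 x1u x2u; rewrite mulr1 expr1n; exact.
  have cu : veq V (c * 1) 1.
    apply: law_scale; [exact: oner_neq0 | by case: Gu | | | by apply: Or31].
      by apply/(vle1 V); rewrite FE /f; vtac.
    by apply/(vle1 V); rewrite /D /kumD; vtac.
  rewrite mulr1 in cu.
  have : veq V (X (P + Q) * X (P - Q)) 1.
    by rewrite eG -[X in veq _ _ X](mulr1 1); apply: veq_mul.
  move=> /(unit_mulP (VX _) (VX _)) [h1 h2].
  have unit_comp x y : veq V x 1 -> veq V y 1 -> comp_pt x y.
    move=> [e1 e2] [e3 e4]; split; first exact: (vle_trans hV e1 e4).
    by move=> _; exact: (vle_trans hV e3 e2).
  have uu : veq V (a / b) 1.
    by split => //; apply: (vle_cancel b0); rewrite divfK // mul1r.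
  have vv : veq V v 1.
    have ab_u : vle V 1 (a * b) by rewrite -(mulr1 1); apply: vle_mul.
    case: hv => -[e h]; first by rewrite e; split.
    by exfalso; apply: (k_lt _ ab_u).
  by left; split; apply: unit_comp.
have x1lt : vlt V x1 1 by exact: (vle_lt_trans hV xa a_lt).
have z1E : z1 = 1 by apply: small_z.
(* Only P reduces to the node: D is a unit. *)
have [b_unit|b_lt] := vle_or_lt V 1 b.
  have x2u : veq V x2 1.
    split; first exact/(vle1 V).
    by apply: (vle_trans hV b_unit); apply/bx/k_lt.
  have Du : veq V D 1.
    rewrite /D /kumD z1E mulr1 -[X in veq _ _ X](expr1n _ 2); apply: veq_exp => //.
    apply: (veq_trans hV _ x2u); apply: (veq_trans hV (b := - x2)); last exact: veqN.
    apply: (veq_domr hV); apply: (vlt_eqr hV (b := 1)).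
      by apply: veq_sym; apply: (veq_trans hV _ x2u); apply: veqN.
    by apply: vlt_mulr1 => //; apply/(vle1 V).
  have G1 : vle V G (a ^+ 2).
    apply: (Gle xa xb) => //; apply: vle_exp => //; exact: vle_mulr1.
  have a2a : vle V (a ^+ 2) a by rewrite expr2; apply: vle_mulr1.
  have F1 : vle V F a.
    apply: (Fle xa xb); first exact: vle_mulr1.
    exact: (vle_trans hV ka a2a).
  have cu : veq V (c * 1) 1.
    apply: law_scale; [exact: oner_neq0 | | exact: (vle_trans hV F1 a1) | by case: Du | by apply: Or33].
    by apply: (vle_trans hV G1); exact: (vle_trans hV a2a a1).
  rewrite mulr1 in cu.
  have Zu : veq V (Z (P + Q) * Z (P - Q)) 1.
    by rewrite eD -[X in veq _ _ X](mulr1 1); apply: veq_mul.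
  apply: (ZZunit Zu).
  have ea : veq V (a / b) a.
    split; last exact: a_le_u.
    by apply: (vle_cancel b0); rewrite divfK // -{1}(mulr1 a); apply: vle_mul.
  have ev : vle V a v.
    apply: (vle_cancel ab0); apply: (vle_trans hV (b := a * a)).
      by apply: vle_mul => //; apply: vle_mulr1.
    rewrite [v * _]mulrC; apply: (vle_trans hV _ (proj1 hvab)).
    by rewrite -expr2; apply: vle_exp => //; rewrite -{1}(mulr1 a); apply: vle_mul.
  have uv_a2 : vle V (a ^+ 2) (a / b * v) by rewrite expr2; apply: vle_mul.
  have uv_a2' : vle V (a / b * v) (a ^+ 2).
    by rewrite expr2; apply: vle_mul; [|case: ea|apply: (vle_trans hV vu); case: ea].
  have cG : veq V (c * G * (Z (P + Q) * Z (P - Q))) G.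
    rewrite -[X in veq _ _ X]mulr1 -[X in veq _ _ (X * _)]mul1r.
    by apply: (veq_mul hV) => //; apply: (veq_mul hV).
  apply: pair_comp2 => //.
  - rewrite prodE; apply: (vle_trans hV (proj1 cG)); exact: (vle_trans hV G1 uv_a2).
  - rewrite eF; apply: (vle_trans hV (b := F)).
      by rewrite mulrC; apply: vle_mulr1; case: cu.
    exact: (vle_trans hV F1 a_le_u).
  - move=> lt; rewrite prodE; apply: (vle_trans hV _ (proj2 cG)); apply: (vle_trans hV uv_a2').
    have lta : vlt V k (a ^+ 2).
      apply: (vlt_le_trans hV lt); apply: vle_exp => //.
      by apply: (vle_trans hV vu); case: ea.
    have x1a : veq V x1 a by split => //; apply: ax.
    have := Glow x1a x2u; rewrite mulr1 => /(_ lta) [].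
    by [].
  - by move=> _; right; apply: (vle_trans hV (proj1 ea)).
have x2lt : vlt V x2 1 by exact: (vle_lt_trans hV xb b_lt).
have z2E : z2 = 1 by apply: small_z.
(* Both reduce to the node and |a| < |b|: D carries the content, of size |b|^2. *)
have [ba|lab] := vle_or_lt V b a; last first.
  have kb' : vlt V k (b ^+ 2).
    by apply: (vle_lt_trans hV ka); apply: (vlt_exp hV).
  have x2b : veq V x2 b by split => //; apply: bx.
  have Db : veq V D (b ^+ 2).
    rewrite /D /kumD z1E z2E !mulr1; apply: veq_exp => //.
    apply: (veq_trans hV _ x2b); apply: (veq_trans hV (b := - x2)); last exact: veqN.
    apply: (veq_domr hV); apply: (vlt_eqr hV (b := b)).
      by apply: veq_sym; apply: (veq_trans hV _ x2b); apply: veqN.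
    exact: (vle_lt_trans hV xa lab).
  have abb2 : vle V (a * b) (b ^+ 2) by rewrite expr2; apply: vle_mul.
  have cb : veq V (c * b ^+ 2) 1.
    apply: law_scale => //; [| |by case: Db|by apply: Or33].
    - apply: (Gle xa xb) => //.
      by apply: vle_exp => //; rewrite mulrC; apply: vle_mulr1.
    - exact: (Fle xa xb).
  have Zu : veq V (Z (P + Q) * Z (P - Q)) 1.
    by rewrite eD; apply: (veq_trans hV _ cb); apply: veq_mul.
  apply: (ZZunit Zu).
  have cc t : veq V (c * t * b ^+ 2) t.
    by rewrite mulrAC -[X in veq _ _ X]mul1r; apply: veq_mul.
  have cG : veq V (c * G * (Z (P + Q) * Z (P - Q)) * b ^+ 2) G.
    apply: (veq_trans hV _ (cc G)); apply: veq_mul => //.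
    by rewrite -[X in veq _ _ X]mulr1; apply: veq_mul.
  apply: pair_comp2 => //.
  - rewrite prodE; apply: (vle_cancel b20); rewrite uv_b2; apply: (vle_trans hV (proj1 cG)).
    by apply: (Gle xa xb); case: hvab.
  - rewrite eF; apply: (vle_cancel b20); apply: (vle_trans hV (proj1 (cc F))).
    have -> : a / b * b ^+ 2 = a * b by field.
    apply: (Fle xa xb) => //; apply: (vle_trans hV ka).
    by rewrite expr2; apply: vle_mul.
  - move=> lt; rewrite prodE; apply: (vle_cancel b20); rewrite uv_b2.
    by apply: (vle_trans hV _ (proj2 cG)); case: (Gv x1lt x2lt lt).
  - move=> _; have [kla|kga] := vle_or_lt V (a ^+ 2) k.
      right; case: hv => -[e h].
        exfalso; apply: b_lt; apply: (@vle_expI _ _ hV _ _ 2) => //; rewrite expr1n.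
        apply: (vle_cancell (c := a ^+ 2)); first by rewrite expf_neq0.
        by rewrite mulr1 -exprMn; exact: (vle_trans hV kla h).
      apply: (vle_cancel ab0); rewrite kab_v //.
      by have -> : a / b * (a * b) = a ^+ 2 by field.
    left; rewrite eF; apply: (vle_cancel b20).
    have -> : a / b * b ^+ 2 = a * b by field.
    apply: (vle_trans hV _ (proj2 (cc F))).
    have x1a : veq V x1 a by split => //; apply: ax.
    suff : veq V F (a * b) by case.
    have e : veq V (x1 * x2 * (z1 * z2 + 2 * (x1 * z2 + x2 * z1))) (a * b).
      rewrite -[X in veq _ _ X]mulr1; apply: veq_mul => //; first exact: veq_mul.
      rewrite z1E z2E !mulr1; apply: (veq_dom hV); rewrite mulrC; apply: vlt_mulr1.
        exact: vlt_add.
      by apply/(vle1 V); vtac.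
    rewrite FE; apply: (veq_trans hV _ e); apply: (veq_dom hV).
    apply: (vle_lt_trans hV kf); apply: (vlt_eqr hV (b := a * b)); first exact: veq_sym.
    by apply: (vlt_le_trans hV kga); rewrite expr2; apply: vle_mul.
have eab : veq V (a / b) 1.
  by split => //; apply: (vle_cancel b0); rewrite divfK // mul1r.
have unit_comp x : veq V x 1 -> comp_pt x (a / b).
  move=> [e1 e2]; case: eab => e3 e4; split; first exact: (vle_trans hV e1 e4).
  by move=> _; exact: (vle_trans hV e3 e2).
(* Here |a| = |b| and |a|^2 = |k|, the middle of the range: G carries the content, of size |k|. *)
have [kla|kga] := vle_or_lt V (a ^+ 2) k.
  have abk : vle V (a * b) k by apply: (vle_trans hV _ kla); rewrite expr2; apply: vle_mul.
  have kk : vlt V (k ^+ 2) k.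
    rewrite expr2 -[X in vlt _ _ X]mul1r; apply: (vlt_mul hV) => //.
  have ab2 : vlt V ((a * b) ^+ 2) k by apply: (vle_lt_trans hV _ kk); apply: vle_exp.
  have Gkk : veq V G k by apply: (Gk xa xb).
  have ck : veq V (c * k) 1.
    apply: law_scale => //; [by case: Gkk| |  |by apply: Or31].
      exact: (Fle xa xb).
    rewrite /D /kumD z1E z2E !mulr1; apply: (vle_trans hV _ kla); apply: vle_exp => //.
    by apply: vle_sub => //; exact: (vle_trans hV xb ba).
  have : veq V (X (P + Q) * X (P - Q)) 1.
    by rewrite eG; apply: (veq_trans hV _ ck); apply: veq_mul.
  move=> /(unit_mulP (VX _) (VX _)) [h1 h2]; left; split; first exact: unit_comp.
  case: hv => -[e h]; first by exfalso; apply: ab2.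
  case: h2 => h2 h2'; have kab : vle V k (a * b) by apply: (vle_trans hV ka); rewrite expr2; apply: vle_mul.
  split.
    by apply: (vle_trans hV h2); apply: (vle_cancel ab0); rewrite kab_v // mul1r.
  move=> _; apply: (vle_trans hV _ h2').
  by apply: (vle_cancel ab0); rewrite kab_v // mul1r.
(* Here |a| = |b| and |a|^2 > |k|: F carries the content, of size |a|^2. *)
have x1a : veq V x1 a by split => //; apply: ax.
have x2a : veq V x2 a.
  split; first exact: (vle_trans hV xb ba).
  by apply: (vle_trans hV ab); apply: bx; apply: (vlt_le_trans hV kga); apply: vle_exp.
have a2a : vle V (a ^+ 2) a by rewrite expr2; apply: vle_mulr1.
have Fa : veq V F (a ^+ 2).
  have e : veq V (x1 * x2 * (z1 * z2 + 2 * (x1 * z2 + x2 * z1))) (a ^+ 2).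
    rewrite -[X in veq _ _ X]mulr1 expr2; apply: veq_mul => //; first exact: veq_mul.
    rewrite z1E z2E !mulr1; apply: (veq_dom hV); rewrite mulrC; apply: vlt_mulr1.
      exact: vlt_add.
    by apply/(vle1 V); vtac.
  rewrite FE; apply: (veq_trans hV _ e); apply: (veq_dom hV).
  apply: (vle_lt_trans hV kf); apply: (vlt_eqr hV) kga; exact: veq_sym.
have ca : veq V (c * a ^+ 2) 1.
  apply: law_scale; [by rewrite expf_neq0| |by case: Fa| |by apply: Or32].
    apply: (Gle xa (proj1 x2a)); last exact: vltW.
    by apply: vle_exp => //; apply: vle_mulr1.
  rewrite /D /kumD z1E z2E !mulr1; apply: vle_exp => //; apply: vle_sub => //.
  by case: x2a.
have a20 : a ^+ 2 != 0 by rewrite expf_neq0.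
have cc t : veq V (c * t * a ^+ 2) t.
  by rewrite mulrAC -[X in veq _ _ X]mul1r; apply: veq_mul.
have Su : veq V (X (P + Q) * Z (P - Q) + X (P - Q) * Z (P + Q)) 1.
  by rewrite eF; apply: (veq_trans hV _ ca); apply: veq_mul.
have aab : vle V (a ^+ 2) (a * b) by rewrite expr2; apply: vle_mul.
have aab' : vle V (a * b) (a ^+ 2) by rewrite expr2; apply: vle_mul.
have other x : veq V x (c * G) -> comp_pt x v.
  move=> [e1 e2]; split.
    apply: (vle_trans hV e1); apply: (vle_cancel a20); apply: (vle_trans hV (proj1 (cc G))).
    apply: (vle_trans hV (b := a * b * v)); first by apply: (Gle xa xb); case: hvab.
    by rewrite [v * _]mulrC; apply: vle_mul.
  move=> lt; apply: (vle_trans hV _ e2); apply: (vle_cancel a20).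
  apply: (vle_trans hV _ (proj2 (cc G))); apply: (vle_trans hV (b := a * b * v)).
    by rewrite [v * _]mulrC; apply: vle_mul.
  by case: (Gv x1lt x2lt lt).
have [h|h] := vle_or_lt V 1 (X (P + Q)).
  have Xu : veq V (X (P + Q)) 1 by split => //; apply/(vle1 V).
  left; split; first exact: unit_comp.
  apply: other; rewrite -eG -[X in veq _ X _]mul1r; apply: veq_mul => //; exact: veq_sym.
have [h'|h'] := vle_or_lt V 1 (X (P - Q)).
  have Xu : veq V (X (P - Q)) 1 by split => //; apply/(vle1 V).
  right; split; last exact: unit_comp.
  apply: other; rewrite -eG -[X in veq _ X _]mulr1; apply: veq_mul => //; exact: veq_sym.
exfalso; case: Su => _; suff h3 : vlt V (X (P + Q) * Z (P - Q) + X (P - Q) * Z (P + Q)) 1 by [].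
by apply: (vlt_add hV); apply: vlt_mulr1 => //; apply/(vle1 V).
Qed.

End Law.
End MultiplicativeReduction.

(** Remove the largest square r^2 from D; the quotient s is squarefree. If s = 1, then -1 is not a
    square modulo 4; otherwise a prime p dividing s divides it exactly once and -s is not a square
    modulo p^2. The factor r^2 of N carries this back to D. The bound N > 2 puts the N-th roots of k
    strictly inside the half range. *)
Lemma exists_nat_no_sqrt_opp (D : nat) : (0 < D)%N ->
  exists2 N, (2 < N)%N & forall m : nat, ~~ (N %| m ^ 2 + D)%N.
Proof.
move=> D0.
have ex : exists r, (r ^ 2 %| D)%N by exists 1%N; rewrite exp1n dvd1n.
have bd r : (r ^ 2 %| D)%N -> (r <= D)%N.
  move=> /(dvdn_leq D0) h; apply: leq_trans h; by case: r => // r; rewrite leq_pmulr.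
case: (ex_maxnP ex bd) => r rD rmax.
have r0 : (0 < r)%N by case: r rD {rmax} => //; rewrite dvd0n => /eqP e; rewrite e in D0.
have sE := divnK rD; set s := (D %/ r ^ 2)%N in sE.
have r20 : (0 < r ^ 2)%N by rewrite expn_gt0 r0.
have s0 : (0 < s)%N by rewrite divn_gt0 // dvdn_leq.
have red q m : (r ^ 2 * q %| m ^ 2 + D)%N -> exists m', (q %| m' ^ 2 + s)%N.
  move=> h; have : (r ^ 2 %| m ^ 2)%N.
    by rewrite -(dvdn_addl _ rD); apply: dvdn_trans h; apply: dvdn_mulr.
  rewrite dvdn_pexp2r // => /dvdnP[m' e]; exists m'.
  by move: h; rewrite e -sE expnMn -mulnDl mulnC dvdn_pmul2r.
have [s1|s1] := eqVneq s 1%N.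
  exists (r ^ 2 * 4)%N; first by apply: (leq_trans (n := 4)) => //; rewrite leq_pmull.
  move=> m; apply/negP => /red [m']; rewrite s1 => h.
  have := odd_double_half m'; set q := m'./2; case: (odd m') => /= e.
    have e2 : (m' ^ 2 + 1 = 4 * (q ^ 2 + q) + 2)%N by rewrite -e; lia.
    by move: h; rewrite e2 dvdn_addr // dvdn_mulr.
  have e2 : (m' ^ 2 + 1 = 4 * (q ^ 2) + 1)%N by rewrite -e; lia.
  by move: h; rewrite e2 dvdn_addr // dvdn_mulr.
have ps : prime (pdiv s) by apply: pdiv_prime; lia.
set p := pdiv s in ps.
exists (r ^ 2 * p ^ 2)%N.
  apply: (leq_trans (n := p ^ 2)); last by rewrite leq_pmull.
  by have := prime_gt1 ps; move: p {ps} => [|[|p]] // _; rewrite expnS expn1; lia.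
move=> m; apply/negP => /red [m' h].
have pm : (p %| m')%N.
  have : (p %| m' ^ 2)%N.
    rewrite -(dvdn_addl _ (pdiv_dvd s)); apply: dvdn_trans h.
    by rewrite expnS dvdn_mulr.
  by rewrite Euclid_dvdX // => /andP[].
have p2s : (p ^ 2 %| s)%N by rewrite -(dvdn_addr s (m := m' ^ 2)) // dvdn_exp2r.
have : (r * p <= r)%N by apply: rmax; rewrite expnMn -sE mulnC dvdn_pmul2r.
by rewrite -{2}(muln1 r) leq_pmul2l // leqNgt prime_gt1.
Qed.

(** * Component classes, and the contradiction with complex multiplication *)

Section ComponentGroup.
Variables (K : fieldType) (V : K -> Prop).
Hypothesis hV : valuation_ring V.
Variable k : K.
Hypotheses (k0 : k != 0) (k1 : vlt V k 1).
Variables (A : zmodType) (X Z : A -> K).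
Hypotheses (hk : kummer (tate_model k) X Z) (hn : normalized V X Z).
Variable sk : K.
Hypothesis skE : sk ^+ 2 = k.

Let vxx := vle_refl hV.
Let exx := veq_refl hV.
Let VX P : V (X P). Proof. by case: (normal_val hV (hn P)). Qed.
Let Z0 : Z 0 = 0. Proof. by case: hk. Qed.
Let X0 : X 0 = 1.
Proof. by apply: (normal_small hV (hn 0)); rewrite Z0; apply: vlt01. Qed.
Let cmp := comp V k X.

(* equality in K^* / (V^* k^Z), and equality up to inversion *)
Definition kcls (a b : K) := exists n m : nat, veq V (k ^+ n * a) (k ^+ m * b).
Definition ksim a b := kcls a b \/ kcls a b^-1.

Lemma kcls_refl a : kcls a a. Proof. by exists 0%N, 0%N. Qed.
Lemma kcls_sym a b : kcls a b -> kcls b a.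
Proof. by move=> [n [m h]]; exists m, n; apply: veq_sym. Qed.
Lemma kcls_trans b a c : kcls a b -> kcls b c -> kcls a c.
Proof.
move=> [n [m h]] [p [q h']]; exists (p + n)%N, (m + q)%N.
rewrite !exprD; apply: (veq_trans hV (b := k ^+ p * (k ^+ m * b))).
  by rewrite -mulrA; apply: veq_mul.
have -> : k ^+ p * (k ^+ m * b) = k ^+ m * (k ^+ p * b) by ring.
by rewrite -mulrA; apply: veq_mul.
Qed.
Lemma kcls_mul a b c d : kcls a b -> kcls c d -> kcls (a * c) (b * d).
Proof.
move=> [n [m h]] [p [q h']]; exists (n + p)%N, (m + q)%N.
have -> : k ^+ (n + p) * (a * c) = (k ^+ n * a) * (k ^+ p * c) by rewrite exprD; ring.
have -> : k ^+ (m + q) * (b * d) = (k ^+ m * b) * (k ^+ q * d) by rewrite exprD; ring.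
exact: veq_mul.
Qed.
Lemma kcls_inv a b : a != 0 -> b != 0 -> kcls a b -> kcls a^-1 b^-1.
Proof.
move=> a0 b0 [n [m h]]; exists m, n.
have -> : k ^+ m * a^-1 = (k ^+ m * b) * (a^-1 * b^-1) by field; rewrite a0 b0.
have -> : k ^+ n * b^-1 = (k ^+ n * a) * (a^-1 * b^-1) by field; rewrite a0 b0.
by apply: veq_mul => //; apply: veq_sym.
Qed.
Lemma kcls_veq a b : veq V a b -> kcls a b.
Proof. by move=> h; exists 0%N, 0%N; rewrite !mul1r. Qed.
Lemma kcls_k n : kcls (k ^+ n) 1.
Proof. by exists 0%N, n; rewrite mul1r mulr1. Qed.

Lemma ksim_refl a : ksim a a. Proof. by left; apply: kcls_refl. Qed.
Lemma ksim_sym a b : a != 0 -> b != 0 -> ksim a b -> ksim b a.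
Proof.
move=> a0 b0 [h|h]; [left|right]; first exact: kcls_sym.
by apply: kcls_sym; rewrite -[b]invrK; apply: kcls_inv => //; rewrite invr_eq0.
Qed.
Lemma ksim_trans b a c : b != 0 -> c != 0 -> ksim a b -> ksim b c -> ksim a c.
Proof.
move=> b0 c0 [h|h] [h'|h'].
- by left; apply: kcls_trans h h'.
- by right; apply: kcls_trans h h'.
- by right; apply: kcls_trans h _; apply: kcls_inv.
left; apply: kcls_trans h _; rewrite -[c]invrK; apply: kcls_inv => //.
by rewrite invr_eq0.
Qed.

Lemma kexp_lt1 d : vlt V (k ^+ d.+1) 1.
Proof. by rewrite -[X in vlt _ _ X](expr1n _ d.+1); apply: (vlt_exp hV). Qed.
Lemma kexp_le1 d : vle V (k ^+ d) 1.
Proof. by rewrite -[X in vle _ _ X](expr1n _ d); apply: (vle_exp hV); apply: vltW. Qed.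

Lemma half_cls a b n m : half_range V k a -> half_range V k b -> (m <= n)%N ->
  veq V (k ^+ n * a) (k ^+ m * b) -> veq V a b.
Proof.
move=> [a0 a1 ka] [b0 b1 kb] mn.
rewrite -(subnK mn) addnC exprD -mulrA => -[h1 h2].
have km0 : k ^+ m != 0 by rewrite expf_neq0.
have e : veq V (k ^+ (n - m) * a) b by split; apply: (vle_cancell km0).
case: (n - m)%N e => [|d] e; first by move: e; rewrite mul1r.
exfalso; case: e => _ h.
have bk : vle V b k.
  apply: (vle_trans hV h); rewrite exprS -mulrA; apply: (vle_mulr1 hV).
  by rewrite -(mulr1 1); apply: vle_mul => //; apply: kexp_le1.
have : vlt V (b ^+ 2) k.
  apply: (vle_lt_trans hV (vle_exp hV 2 bk)); rewrite expr2 -[X in vlt _ _ X]mul1r.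
  exact: (vlt_mul hV).
by apply.
Qed.

Lemma half_inv a b n m : half_range V k a -> half_range V k b -> (n <= m)%N ->
  veq V (k ^+ n * a) (k ^+ m * b^-1) -> veq V a b.
Proof.
move=> [a0 a1 ka] [b0 b1 kb] nm.
rewrite -(subnK nm) addnC exprD -mulrA => -[h1 h2].
have kn0 : k ^+ n != 0 by rewrite expf_neq0.
have e : veq V (a * b) (k ^+ (m - n)).
  have {}h1 := vle_cancell kn0 h1; have {}h2 := vle_cancell kn0 h2.
  by split; apply: (vle_cancel (c := b^-1)); rewrite ?invr_eq0 // mulfK.
have ab1 : vle V (a * b) 1 by rewrite -(mulr1 1); apply: vle_mul.
case: (m - n)%N e => [|[|d]] [e1 e2].
- rewrite expr0 in e2; split.
    apply: (vle_trans hV a1); apply: (vle_trans hV e2); rewrite mulrC; exact: (vle_mulr1 hV).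
  by apply: (vle_trans hV b1); apply: (vle_trans hV e2); apply: (vle_mulr1 hV).
- rewrite expr1 in e1 e2; split.
    apply: (vle_cancell a0); rewrite -expr2.
    have [h|h] := vle_total hV a b; first by rewrite expr2; apply: vle_mul.
    apply: (vle_cancel b0); rewrite expr2.
    have -> : a * a * b = a * (a * b) by ring.
    have -> : a * b * b = a * (b ^+ 2) by ring.
    by apply: vle_mul => //; apply: (vle_trans hV e1).
  apply: (vle_cancell b0); rewrite [b * a]mulrC; apply: (vle_trans hV (b := b * b)) => //.
  have [h|h] := vle_total hV b a; first by apply: vle_mul.
  apply: (vle_cancel a0).
  have -> : b * b * a = b * (a * b) by ring.
  have -> : a * b * a = b * (a ^+ 2) by ring.
  by apply: vle_mul => //; apply: (vle_trans hV e1).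
exfalso.
have abk : vle V (a * b) (k ^+ 2).
  apply: (vle_trans hV e1); rewrite -[d.+2]/(2 + d)%N exprD.
  by apply: (vle_mulr1 hV); apply: kexp_le1.
have h : vle V (k ^+ 2) ((a * b) ^+ 2) by rewrite exprMn expr2; apply: vle_mul.
have : vle V 1 (k ^+ 2).
  apply: (vle_cancel (c := k ^+ 2)); first by rewrite expf_neq0.
  by rewrite mul1r -expr2; apply: (vle_trans hV h); apply: vle_exp.
exact: kexp_lt1 1%N.
Qed.

(** The half range is a fundamental domain for multiplication by k and inversion. *)
Lemma half_sim a b : half_range V k a -> half_range V k b -> ksim a b -> veq V a b.
Proof.
move=> ha hb [] [n [m h]].
  have [mn|nm] := leqP m n; first exact: half_cls ha hb mn h.
  by apply: veq_sym; apply: half_cls hb ha (ltnW nm) _; apply: veq_sym.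
have [a0 a1 ka] := ha; have [b0 b1 kb] := hb.
have [nm|mn] := leqP n m; first exact: half_inv ha hb nm h.
exfalso; move: h; rewrite -(subnK (ltnW mn)) addnC exprD -mulrA => -[_ h].
have km0 : k ^+ m != 0 by rewrite expf_neq0.
have {h} := vle_cancell km0 h.
have : (0 < n - m)%N by rewrite subn_gt0.
case: (n - m)%N => // d _ h.
have : vle V 1 (k ^+ d.+1).
  apply: (vle_trans hV (b := k ^+ d.+1 * a * b)).
    by apply: (vle_cancel (c := b^-1)); rewrite ?invr_eq0 // mul1r mulfK.
  rewrite -mulrA; apply: (vle_mulr1 hV).
  by rewrite -(mulr1 1); apply: vle_mul.
exact: kexp_lt1 d.
Qed.

(** The representative is arbitrary here, so that classes can be multiplied and inverted freely,
    whereas [comp] insists on the half range. *)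
Definition cpt P a := a != 0 /\ exists2 b, cmp P b & ksim a b.

Lemma cmp_total P : exists a, cmp P a.
Proof.
have s0 : sk != 0 by apply/eqP => e; move: skE k0; rewrite e expr0n /= => <-; rewrite eqxx.
(* Once |X|^2 <= |k| the size of X no longer matters: the point lies in the middle of the range,
   where |u| = |sk|. *)
have [h|h] := vle_or_lt V (X P ^+ 2) k.
  exists sk; split; last first.
    split; last by rewrite skE => /(vltxx hV).
    by apply: (@vle_expI _ _ hV _ _ 2) => //; rewrite skE.
  split => //; last by rewrite skE.
  by apply: (@vle_expI _ _ hV _ _ 2) => //; rewrite skE expr1n; apply: vltW.
exists (X P); split; last by split.
split; last exact: vltW.
  by apply/eqP => e; move: h; rewrite e expr0n /= => h; apply: h; apply: vle0.
exact/(vle1 V).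
Qed.

Lemma cpt_total P : exists a, cpt P a.
Proof.
have [a h] := cmp_total P; exists a; split; first by case: h => -[].
by exists a => //; apply: ksim_refl.
Qed.

Lemma cpt_sim P a b : b != 0 -> cpt P a -> ksim a b -> cpt P b.
Proof.
move=> b0 [a0 [c hc h]] h'; split => //; exists c => //.
by apply: (ksim_trans a0) h => //; [case: hc => -[]|apply: ksim_sym].
Qed.

Lemma cmp_uniq P a b : cmp P a -> cmp P b -> veq V a b.
Proof.
move=> [[a0 a1 ka] [xa ax]] [[b0 b1 kb] [xb bx]].
have aux c d : vlt V k (c ^+ 2) -> vle V c (X P) -> vle V (X P) d -> vlt V k (d ^+ 2).
  by move=> h1 h2 h3; apply: (vlt_le_trans hV h1); apply: vle_exp => //; apply: (vle_trans hV h2).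
have [h|h] := vle_or_lt V (a ^+ 2) k; last first.
  have h' := aux _ _ h (ax h) xb.
  by split; [exact: (vle_trans hV (ax h) xb)|exact: (vle_trans hV (bx h') xa)].
have [h'|h'] := vle_or_lt V (b ^+ 2) k.
  by split; apply: (@vle_expI _ _ hV _ _ 2) => //; [exact: (vle_trans hV h kb)|exact: (vle_trans hV h' ka)].
by have := aux _ _ h' (bx h') xa.
Qed.

Lemma cpt_uniq P a b : cpt P a -> cpt P b -> ksim a b.
Proof.
move=> [a0 [c hc ha]] [b0 [d hd hb]].
have c0 : c != 0 by case: hc => -[].
have d0 : d != 0 by case: hd => -[].
apply: (ksim_trans c0) ha _ => //; apply: (ksim_trans d0) => //; last exact: ksim_sym.
by left; apply: kcls_veq; apply: cmp_uniq hc hd.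
Qed.

(** The Kummer law for 0 and P gives a quadratic form with zero discriminant, so P and -P have the
    same x; normalization turns this into equality of X. *)
Lemma XN P : X (- P) = X P.
Proof.
have [_ _ _ _ /(_ 0 P) [c c0 [e1 e2 e3]]] := hk.
move: e1 e2 e3; rewrite add0r sub0r X0 Z0 => e1 e2 e3.
have : (X P * Z (- P) - X (- P) * Z P) ^+ 2 = 0.
  transitivity ((X P * Z (- P) + X (- P) * Z P) ^+ 2 - 4 * (X P * X (- P)) * (Z P * Z (- P))).
    by ring.
  by rewrite e1 e2 e3 /kumF /kumG /kumD; ring.
move=> /eqP; rewrite expf_eq0 /= subr_eq0 => /eqP e.
have [[z1 h1]|[x1 h1]] := hn P; have [[z2 h2]|[x2 h2]] := hn (- P).
- by move: e; rewrite z1 z2 !mulr1.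
- exfalso; move: e; rewrite z1 x2 !mulr1 => e.
  have : vlt V 1 1.
    by rewrite -{1}e mulrC; apply: (vlt_mulr1 hV) => //; apply/(vle1 V).
  exact: vltxx.
- exfalso; move: e; rewrite z2 x1 !mulr1 => e.
  have : vlt V 1 1.
    by rewrite {1}e mulrC; apply: (vlt_mulr1 hV) => //; apply/(vle1 V).
  exact: vltxx.
- by rewrite x1 x2.
Qed.

Lemma cmpN P a : cmp P a -> cmp (- P) a.
Proof. by rewrite /cmp /comp XN. Qed.
Lemma cptN P a : cpt P a -> cpt (- P) a.
Proof. by move=> [a0 [b hb h]]; split => //; exists b => //; apply: cmpN. Qed.

Lemma cmp_law P Q a b : cmp P a -> cmp Q b ->
  (cpt (P + Q) (a * b) /\ cpt (P - Q) (a / b)) \/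
  (cpt (P + Q) (a / b) /\ cpt (P - Q) (a * b)).
Proof.
move=> ha hb; have [a0 _ _] := proj1 ha; have [b0 _ _] := proj1 hb.
have ab0 : a * b != 0 by rewrite mulf_neq0.
have adb0 : a / b != 0 by rewrite mulf_neq0 ?invr_eq0.
have exv : exists v, ((v = a * b /\ vle V k ((a * b) ^+ 2)) \/
   (v = k / (a * b) /\ vle V ((a * b) ^+ 2) k)) /\ ksim (a * b) v.
  have [h|h] := vle_total hV k ((a * b) ^+ 2).
    by exists (a * b); split; [left|exact: ksim_refl].
  exists (k / (a * b)); split; first by right.
  right; rewrite invf_div; exists 0%N, 1%N; rewrite expr0 mul1r expr1 mulrCA divff // mulr1.
  exact: exx.
have [v [hv abv]] := exv.
have mk R c d : cmp R c -> d != 0 -> ksim d c -> cpt R d by move=> h1 h2 h3; split => //; exists c.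
have [h|h] := vle_total hV a b.
  have [_ _ _ _ /(_ P Q) [c c0 [e1 e2 e3]]] := hk.
  have [[h1 h2]|[h1 h2]] := half_law hV k0 k1 hn e1 e2 e3 ha hb h hv.
    by right; split; [exact: (mk _ _ _ h1 adb0 (ksim_refl _))|exact: (mk _ _ _ h2 ab0 abv)].
  by left; split; [exact: (mk _ _ _ h1 ab0 abv)|exact: (mk _ _ _ h2 adb0 (ksim_refl _))].
have [_ _ _ _ /(_ Q P) [c c0 [e1 e2 e3]]] := hk.
have sba : ksim (a / b) (b / a) by right; rewrite invf_div; apply: kcls_refl.
rewrite [a * b]mulrC in hv.
have [[h1 h2]|[h1 h2]] := half_law hV k0 k1 hn e1 e2 e3 hb ha h hv.
  right; rewrite -[P - Q]opprB [P + Q]addrC; split; first exact: (mk _ _ _ h1 adb0 sba).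
  by apply: cptN; exact: (mk _ _ _ h2 ab0 abv).
left; rewrite -[P - Q]opprB [P + Q]addrC; split; first exact: (mk _ _ _ h1 ab0 abv).
by apply: cptN; exact: (mk _ _ _ h2 adb0 sba).
Qed.

Lemma cpt_law P Q a b : cpt P a -> cpt Q b ->
  (cpt (P + Q) (a * b) /\ cpt (P - Q) (a / b)) \/
  (cpt (P + Q) (a / b) /\ cpt (P - Q) (a * b)).
Proof.
move=> [a0 [a' ha sa]] [b0 [b' hb sb]].
have a'0 : a' != 0 by case: ha => -[].
have b'0 : b' != 0 by case: hb => -[].
have ab0 : a * b != 0 by rewrite mulf_neq0.
have adb0 : a / b != 0 by rewrite mulf_neq0 ?invr_eq0.
have ab0' : a' * b' != 0 by rewrite mulf_neq0.
have adb0' : a' / b' != 0 by rewrite mulf_neq0 ?invr_eq0.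
have main (c d : K) : c != 0 -> d != 0 -> ksim c (a' * b') -> ksim d (a' / b') ->
  (cpt (P + Q) c /\ cpt (P - Q) d) \/ (cpt (P + Q) d /\ cpt (P - Q) c).
  move=> c0 d0 hc hd; have [[h1 h2]|[h1 h2]] := cmp_law ha hb; [left|right]; split.
  - by apply: cpt_sim h1 _ => //; apply: ksim_sym.
  - by apply: cpt_sim h2 _ => //; apply: ksim_sym.
  - by apply: cpt_sim h1 _ => //; apply: ksim_sym.
  - by apply: cpt_sim h2 _ => //; apply: ksim_sym.
have swap c d : (cpt (P + Q) c /\ cpt (P - Q) d) \/ (cpt (P + Q) d /\ cpt (P - Q) c) ->
  (cpt (P + Q) d /\ cpt (P - Q) c) \/ (cpt (P + Q) c /\ cpt (P - Q) d).
  by case; [right|left].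
case: sa => sa; case: sb => sb.
- apply: main => //; left; apply: kcls_mul => //; exact: kcls_inv.
- apply/swap/main => //; left; apply: kcls_mul => //.
  by rewrite -[b']invrK; apply: kcls_inv => //; rewrite invr_eq0.
- apply/swap/main => //; right; rewrite invfM.
    by apply: kcls_mul => //; apply: kcls_inv.
  by rewrite invrK; apply: kcls_mul.
- apply: main => //; right; rewrite invfM; apply: kcls_mul => //.
  by apply: kcls_inv => //; rewrite invr_eq0.
Qed.

Lemma cpt_X P a : cpt P a -> half_range V k a -> vlt V k (a ^+ 2) -> veq V (X P) a.
Proof.
move=> [a0 [b hb s]] ha ka; have e := half_sim ha (proj1 hb) s.
have [_ [h1 h2]] := hb; apply: (veq_trans hV _ (veq_sym e)); split => //; apply: h2.
by apply: (vlt_le_trans hV ka); apply: vle_exp => //; case: e.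
Qed.

Lemma X_cpt P a : veq V (X P) a -> half_range V k a -> cpt P a.
Proof.
move=> [h1 h2] ha; split; first by case: ha.
by exists a; [split|exact: ksim_refl].
Qed.

Lemma half1 : half_range V k 1.
Proof.
split; [exact: oner_neq0|exact: vle_refl|].
by rewrite expr1n; apply: vltW.
Qed.

Lemma cpt1P P : cpt P 1 <-> veq V (X P) 1.
Proof.
split=> h; last exact: X_cpt h half1.
by apply: cpt_X h half1 _; rewrite expr1n.
Qed.

Lemma cpt0 : cpt 0 1. Proof. by apply/cpt1P; rewrite X0. Qed.

(** The law yields an unordered pair. If it attributes the class a^n to (n+2)P and a^(n+2) to nP,
    then nP has two classes, which must agree. *)
Lemma cptM P a n : cpt P a -> cpt (P *+ n) (a ^+ n).
Proof.
move=> hP; have [a0 _] := hP.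
suff : cpt (P *+ n) (a ^+ n) /\ cpt (P *+ n.+1) (a ^+ n.+1) by case.
elim: n => [|n [h1 h2]].
  by rewrite mulr0n mulr1n expr0 expr1; split => //; apply: cpt0.
split => //; have := cpt_law h2 hP.
have -> : a ^+ n.+1 / a = a ^+ n by rewrite exprSr mulfK.
rewrite -exprSr -mulrSr [P *+ n.+1]mulrSr addrK => -[[]//|[h3 h4]].
apply: cpt_sim h3 _; first by rewrite expf_neq0.
exact: cpt_uniq h1 h4.
Qed.

Lemma cpt1D P Q : cpt P 1 -> cpt Q 1 -> cpt (P + Q) 1.
Proof. by move=> hP hQ; case: (cpt_law hP hQ); rewrite divr1 mulr1 => -[]. Qed.
Lemma cpt1N P : cpt P 1 -> cpt (- P) 1. Proof. exact: cptN. Qed.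
Lemma cpt1Mn P n : cpt P 1 -> cpt (P *+ n) 1.
Proof. by move=> /(cptM n); rewrite expr1n. Qed.
Lemma cpt1Mz P (n : int) : cpt P 1 -> cpt (P *~ n) 1.
Proof.
move=> h; case: n => n; first by rewrite -pmulrn; apply: cpt1Mn.
by rewrite NegzE mulrNz -pmulrn; apply/cpt1N/cpt1Mn.
Qed.

Section Endomorphism.
Variables (alpha : A -> A) (b c : int).
Hypothesis alphaB : forall P Q, alpha (P - Q) = alpha P - alpha Q.
Hypothesis alpha_quad : forall P, alpha (alpha P) = - (alpha P *~ b) - P *~ c.
Hypothesis disc_neg : b ^+ 2 < 4 * c.
Hypothesis root_ex : forall (n : nat) y, (0 < n)%N -> exists s : K, s ^+ n = y.
Hypothesis surj : forall x, exists2 P, Z P != 0 & X P / Z P = x.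
Variable bad : seq K.
(** In the application [alpha] acts on x by a rational function, and [bad] lists the zeros of its
    numerator and denominator: away from their absolute values, |x(alpha P)| depends only on
    |x(P)|. *)
Hypothesis generic : forall P P', Z P != 0 -> Z P' != 0 ->
  veq V (X P / Z P) (X P' / Z P') -> (forall r, r \in bad -> ~ veq V r (X P / Z P)) ->
  [/\ Z (alpha P) != 0, Z (alpha P') != 0 &
    veq V (X (alpha P) / Z (alpha P)) (X (alpha P') / Z (alpha P'))].

Lemma X_ratio P P' : Z P != 0 -> Z P' != 0 ->
  veq V (X P / Z P) (X P' / Z P') -> veq V (X P) (X P').
Proof.
have big x z : x = 1 -> vlt V z 1 -> z != 0 -> vlt V 1 (x / z).
  move=> -> h z0 h'; apply: h; apply: (vle_cancel (c := z^-1)); first by rewrite invr_eq0.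
  by rewrite divff //; move: h'.
move=> z0 z0'; have [[z1 h1]|[x1 h1]] := hn P; have [[z2 h2]|[x2 h2]] := hn P'.
- by rewrite z1 z2 !divr1.
- rewrite z1 divr1 => -[_ h]; exfalso.
  by apply: (vle_lt_trans hV _ (big _ _ x2 h2 z0')) h; apply/(vle1 V).
- rewrite z2 divr1 => -[h _]; exfalso.
  by apply: (vle_lt_trans hV _ (big _ _ x1 h1 z0)) h; apply/(vle1 V).
- by rewrite x1 x2.
Qed.

Lemma point_with_X a : half_range V k a -> vlt V k (a ^+ 2) -> vlt V a 1 ->
  exists2 P, Z P = 1 /\ X P = a & cpt P a.
Proof.
move=> ha ka a1; have [P zP xP] := surj a.
have z1 : Z P = 1.
  have [[]//|[x1 h1]] := hn P; exfalso; move: xP; rewrite x1 => e.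
  have : vlt V 1 1.
    have e1 : 1 = Z P * a by rewrite -e mul1r mulfV.
    by rewrite {1}e1; apply: (vlt_mulr1 hV) => //; apply: vltW.
  exact: vltxx.
rewrite z1 divr1 in xP; exists P => //; apply: X_cpt => //; rewrite xP; exact: exx.
Qed.

Lemma root_half n a : (2 < n)%N -> a ^+ n = k ->
  [/\ half_range V k a, vlt V k (a ^+ 2) & vlt V a 1].
Proof.
move=> n2 an; have n0 : (0 < n)%N by lia.
have a0 : a != 0 by apply/eqP => e; move: k0; rewrite -an e expr0n; case: n n2 n0 {an} => // n; rewrite eqxx.
have a1 : vlt V a 1.
  have [h|//] := vle_or_lt V 1 a; exfalso; move: k1; rewrite -an; apply.
  by rewrite -[X in vle _ X _](expr1n _ n); apply: vle_exp.
have ka : vlt V k (a ^+ 2).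
  rewrite -an -(subnK n2) addnC exprD exprS.
  have -> : a * a ^+ 2 * a ^+ (n - 3) = a * a ^+ (n - 3) * a ^+ 2 by ring.
  rewrite -[X in vlt _ _ X]mul1r; apply: (vlt_mul hV) => //; last by rewrite expf_neq0.
  apply: (vlt_mulr1 hV) => //; rewrite -[X in vle _ _ X](expr1n _ (n - 3)).
  by apply: vle_exp => //; apply: vltW.
by split => //; split => //; apply: vltW.
Qed.

(** Roots of k of different orders have different absolute values, so the finite list [bad] cannot
    meet them all. *)
Lemma exists_generic : exists a, [/\ half_range V k a, vlt V k (a ^+ 2), vlt V a 1 &
  forall r, r \in bad -> ~ veq V r a].
Proof.
have [f hf] := choice (fun n : nat => root_ex k (ltn0Sn n.+2)).
apply: contrapT => no.
have hit n : exists i : 'I_(size bad), veq V (nth 0 bad i) (f n).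
  have [h1 h2 h3] := root_half (isT : (2 < n.+3)%N) (hf n).
  apply: contrapT => h; apply: no; exists (f n); split => // r rb e; apply: h.
  have ir : (index r bad < size bad)%N by rewrite index_mem.
  by exists (Ordinal ir); rewrite /= nth_index.
have [i hi] := choice hit.
have /injectivePn [x [y xy e]] : ~~ injectiveb (fun x : 'I_(size bad).+1 => i x).
  apply/negP => /injectiveP /leq_card; by rewrite !card_ord ltnn.
have exy : veq V (f x) (f y).
  by apply: (veq_trans hV (veq_sym (hi x))); rewrite e; apply: hi.
have aux (m n : nat) : (m < n)%N -> veq V (f m) (f n) -> False.
  move=> mn e'; have h := veq_exp hV n.+3 e'.
  have e3 : (n.+3 = m.+3 + (n - m).-1.+1)%N by lia.
  move: h; rewrite (hf n) e3 exprD (hf m) => -[_]; rewrite -{1}[k]mulr1 => /(vle_cancell k0).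
  have [_ _ f2] := root_half (isT : (2 < m.+3)%N) (hf m).
  suff : vlt V (f m ^+ (n - m).-1.+1) 1 by [].
  by rewrite -[X in vlt _ _ X](expr1n _ (n - m).-1.+1); apply: (vlt_exp hV).
have [h|h|h] := ltngtP (x : nat) y.
- exact: aux h exy.
- by apply: aux h _; apply: veq_sym.
- by move/eqP: xy; apply; apply: val_inj.
Qed.

(** Doubling kills a possible class of order two: for P of trivial class the argument below only
    shows that the class of alpha P has trivial square. *)
Definition beta P := alpha P + alpha P.

Let alpha0 : alpha 0 = 0. Proof. by have := alphaB 0 0; rewrite !subrr. Qed.
Let alphaN P : alpha (- P) = - alpha P. Proof. by have := alphaB 0 P; rewrite alpha0 !sub0r. Qed.
Let alphaD P Q : alpha (P + Q) = alpha P + alpha Q.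
Proof. by rewrite -{1}[Q]opprK alphaB alphaN opprK. Qed.

Lemma betaD P Q : beta (P + Q) = beta P + beta Q.
Proof. by rewrite /beta alphaD addrACA. Qed.
Lemma betaN P : beta (- P) = - beta P.
Proof. by rewrite /beta alphaN opprD. Qed.
Lemma betaMn P n : beta (P *+ n) = beta P *+ n.
Proof.
elim: n => [|n ih]; first by rewrite !mulr0n /beta alpha0 addr0.
by rewrite !mulrS betaD ih.
Qed.
Lemma betaMz P (n : int) : beta (P *~ n) = beta P *~ n.
Proof.
case: n => n; first by rewrite -!pmulrn betaMn.
by rewrite NegzE !mulrNz -!pmulrn betaN betaMn.
Qed.

(** For a generic z, the points z, z + P and z - P share a class, so their images share a class y.
    If alpha P has class d, both y d and y / d agree with y up to inversion, whence d or d^2 is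
    trivial. *)
Lemma beta_identity P : cpt P 1 -> cpt (beta P) 1.
Proof.
move=> hP; have [a [ha ka a1 hbad]] := exists_generic.
have [z [zz xz] hz] := point_with_X ha ka a1.
have same Q : cpt Q a -> [/\ Z (alpha z) != 0, Z (alpha Q) != 0 &
    veq V (X (alpha z) / Z (alpha z)) (X (alpha Q) / Z (alpha Q))].
  move=> hQ; have xQ := cpt_X hQ ha ka.
  have zQ : Z Q = 1.
    have [[]//|[x1 h1]] := hn Q; exfalso; move: xQ; rewrite x1 => -[h _]; exact: a1.
  apply: generic; rewrite ?zz ?zQ ?oner_neq0 // !divr1 xz //.
  exact: veq_sym.
have sameX Q : cpt Q a -> veq V (X (alpha Q)) (X (alpha z)).
  by move=> /same [h1 h2 h3]; apply: X_ratio => //; apply: veq_sym.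
have [y [hy hy']] := cmp_total (alpha z).
have cy Q : cpt Q a -> cpt (alpha Q) y.
  move=> /sameX h; split; first by case: hy.
  by exists y; [split => //; apply: comp_pt_veq hy' => //; apply: veq_sym | exact: ksim_refl].
have y0 : y != 0 by case: hy.
have [hp hm] : cpt (z + P) a /\ cpt (z - P) a.
  by case: (cpt_law hz hP); rewrite mulr1 divr1 => -[].
have {}hp : cpt (alpha z + alpha P) y by rewrite -alphaD; apply: cy.
have {}hm : cpt (alpha z - alpha P) y by rewrite -alphaB; apply: cy.
have [d hd] := cpt_total (alpha P); have [d0 _] := hd.
have d2 : cpt (beta P) (d ^+ 2) by rewrite /beta -mulr2n; apply: cptM.
suff h : kcls d 1 \/ kcls (d ^+ 2) 1.
  apply: cpt_sim d2 _; first exact: oner_neq0.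
  by left; case: h => // h; rewrite -(mulr1 1) expr2; apply: kcls_mul.
have yd0 : y * d != 0 by rewrite mulf_neq0.
have ydi0 : y / d != 0 by rewrite mulf_neq0 ?invr_eq0.
have core : ksim (y * d) y -> ksim (y / d) y -> kcls d 1 \/ kcls (d ^+ 2) 1.
  have mulV x u t : t != 0 -> kcls x u -> kcls (x * t) (u * t).
    by move=> _ h; apply: kcls_mul => //; apply: kcls_refl.
  case=> [h1|h1].
    move=> _; left; have := mulV _ _ y^-1 _ h1; rewrite invr_eq0 => /(_ y0).
    by rewrite mulrAC divff // mul1r.
  case=> [h2|h2].
    left; have := mulV _ _ (d / y) _ h2; rewrite mulf_neq0 ?invr_eq0 // => /(_ isT).
    have -> : y / d * (d / y) = 1 by field; rewrite y0 d0.
    have -> : y * (d / y) = d by field.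
    exact: kcls_sym.
  right; have := kcls_mul h1 (kcls_inv ydi0 (_ : y^-1 != 0) h2).
  rewrite invr_eq0 => /(_ y0).
  have -> : y * d / (y / d) = d ^+ 2 by field; rewrite y0 d0.
  by rewrite invrK mulVf.
have hz' : cpt (alpha z) y by apply: cy.
have [[h1 h2]|[h1 h2]] := cpt_law hz' hd.
  by apply: core; [exact: cpt_uniq h1 hp|exact: cpt_uniq h2 hm].
by apply: core; [exact: cpt_uniq h2 hm|exact: cpt_uniq h1 hp].
Qed.

(** A point P of class k^(1/N) generates a cyclic group of order N of classes. On it beta acts as an
    integer l up to trivial class, so N divides l^2 + 2 b l + 4 c = (l + b)^2 + D with D = 4 c -
    b^2, against the choice of N. *)
Lemma no_cm : False.
Proof.
have c4 : exists2 D : nat, (0 < D)%N & D%:Z = 4 * c - b ^+ 2.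
  exists (absz (4 * c - b ^+ 2)%R); first by rewrite absz_gt0 subr_eq0 gt_eqF.
  by rewrite gez0_abs // subr_ge0 ltW.
have [D D0 DE] := c4; have [N N2 hN] := exists_nat_no_sqrt_opp D0.
have N0 : (0 < N)%N by lia.
have [a aN] := root_ex k N0.
have [ha ka a1] := root_half N2 aN; have [a0 _ _] := ha.
have [P [_ _] hP] := point_with_X ha ka a1.
have hNP : cpt (P *+ N) 1.
  apply: cpt_sim (cptM N hP) _; first exact: oner_neq0.
  by rewrite aN; left; have := kcls_k 1; rewrite expr1.
have mult m : cpt (P *+ m) 1 -> (N %| m)%N.
  move=> h; have e : kcls (a ^+ m) 1.
    case: (cpt_uniq (cptM m hP) h) => //; by rewrite invr1.
  have expinj x y : veq V (a ^+ x) (a ^+ y) -> x = y.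
    have lt (x' y' : nat) : (x' < y')%N -> veq V (a ^+ x') (a ^+ y') -> False.
      move=> xy [h1 _]; have [d yE] : exists d, y' = (x' + d.+1)%N by exists (y' - x').-1; lia.
      move: h1; rewrite yE exprD -{1}[a ^+ x']mulr1 => /(vle_cancell (expf_neq0 _ a0)).
      suff : vlt V (a ^+ d.+1) 1 by [].
      by rewrite -[X in vlt _ _ X](expr1n _ d.+1); apply: (vlt_exp hV).
    move=> h'; have [h''|h''|//] := ltngtP x y; exfalso; first exact: lt h'' h'.
    by apply: lt h'' _; apply: veq_sym.
  move: e => [n [n' e]]; move: e; rewrite mulr1 -aN -!exprM -exprD => /expinj e.
  by rewrite -(dvdn_addr m (dvdn_mulr n (dvdnn N))) e dvdn_mulr.
have [d hd] := cpt_total (beta P); have [d0 _] := hd.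
(* N beta P has trivial class, so the class of beta P is an N-th root of a power of k, that is, a
   power of a. *)
have [i hi] : exists i, cpt (beta P) (a ^+ i).
  have h1 : cpt (beta P *+ N) 1 by rewrite -betaMn; apply: beta_identity.
  have e : kcls (d ^+ N) 1.
    case: (cpt_uniq (cptM N hd) h1) => //; by rewrite invr1.
  move: e => [n [m e]].
  have e2 : veq V (a ^+ n * d) (a ^+ m).
    by case: e; rewrite mulr1 -aN -!exprM ![(N * _)%N]mulnC !exprM -exprMn => e1 e2;
      split; apply: (@vle_expI _ _ hV _ _ N).
  have [nm|mn] := leqP n m.
    exists (m - n)%N; apply: cpt_sim hd _; first by rewrite expf_neq0.
    left; apply: kcls_veq; have an0 : a ^+ n != 0 by rewrite expf_neq0.
    by case: e2; rewrite -{1 2}(subnK nm) addnC exprD => e1 e3; split; apply: (vle_cancell an0).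
  exists (n - m)%N; apply: cpt_sim hd _; first by rewrite expf_neq0.
  right; apply: kcls_veq; have am0 : a ^+ m != 0 by rewrite expf_neq0.
  have anm0 : a ^+ (n - m) != 0 by rewrite expf_neq0.
  case: e2; rewrite -{1 2}(subnK (ltnW mn)) addnC exprD -mulrA -[X in vle V _ X -> _]mulr1.
  move=> /(vle_cancell am0) e1; rewrite -[X in vle V X _ -> _]mulr1 => /(vle_cancell am0) e3.
  by split; apply: (vle_cancell anm0); rewrite divff.
have [l hl] : exists l : int, cpt (beta P - P *~ l) 1.
  have := cpt_law hi (cptM i hP); rewrite divff ?expf_neq0 // => -[[_ h]|[h _]].
    by exists i%:Z; rewrite -pmulrn.
  by exists (- i%:Z); rewrite mulrNz opprK -pmulrn.
set e := beta P - P *~ l in hl.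
have bE : beta P = P *~ l + e by rewrite /e addrC subrK.
have quad : beta (beta P) = - (beta P *~ (2 * b)) - P *~ (4 * c).
  have -> : beta (beta P) = alpha (alpha P) *+ 4.
    by rewrite /beta alphaD -!mulr2n -mulrnA.
  rewrite alpha_quad mulrnBl mulNrn /beta -mulr2n; congr (- _ - _).
    by rewrite -[(_ *+ 2) *~ _]/(_) !pmulrn -!mulrzA; congr (_ *~ _); ring.
  by rewrite pmulrn -mulrzA; congr (_ *~ _); ring.
have key : P *~ (l ^+ 2 + 2 * b * l + 4 * c) = - (e *~ l + beta e + e *~ (2 * b)).
  move: quad; rewrite {1}bE betaD betaMz bE => /eqP; rewrite -subr_eq0 => /eqP q.
  apply/eqP; rewrite -subr_eq0 opprK -q; apply/eqP.
  have -> : l ^+ 2 + 2 * b * l + 4 * c = l * l + l * (2 * b) + 4 * c :> int by ring.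
  rewrite !mulrzDr !mulrzDl -!mulrzA opprB opprK.
  by rewrite [RHS](AC (3*(1*2)) ((1*5*4)*(2*3*6)))%AC.
have hM : cpt (P *~ (l ^+ 2 + 2 * b * l + 4 * c)) 1.
  rewrite key; apply: cpt1N; apply: cpt1D; last exact: cpt1Mz.
  by apply: cpt1D; [exact: cpt1Mz|exact: beta_identity].
set M := l ^+ 2 + 2 * b * l + 4 * c in hM.
have hM' : cpt (P *+ absz M) 1.
  have [h|h] := lerP 0 M; first by rewrite pmulrn gez0_abs.
  by rewrite pmulrn ltz0_abs // mulrNz; apply: cpt1N.
have dv := mult _ hM'.
have : (N %| absz (l + b)%R ^ 2 + D)%N.
  have -> : (absz (l + b)%R ^ 2 + D)%N = absz M; last by [].
  apply/eqP; rewrite -eqz_nat; apply/eqP.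
  have M0 : 0 <= M.
    have -> : M = (l + b) ^+ 2 + D%:Z by rewrite DE /M; ring.
    by rewrite addr_ge0 // sqr_ge0.
  by rewrite gez0_abs // PoszD -abszX gez0_abs ?sqr_ge0 // DE /M; ring.
exact/negP.
Qed.

End Endomorphism.
End ComponentGroup.

(** * Existence of valuation rings *)

Section ChevalleyExtension.
Variables (R : comNzRingType) (K : fieldType) (f : {rmorphism R -> K}).

Lemma integral_of_expansion (z : K) n (c : nat -> R) :
  z ^+ n.+1 = \sum_(i < n.+1) f (c i) * z ^+ i -> integralOver f z.
Proof.
move=> e; exists ('X^(n.+1) - \poly_(i < n.+1) c i).
  apply/monicP; rewrite lead_coefDl ?lead_coefXn // size_polyN size_polyXn ltnS.
  exact: size_poly.
rewrite rmorphB /= map_polyXn /root hornerD hornerN hornerXn subr_eq0 e.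
have -> : map_poly f (\poly_(i < n.+1) c i) = \poly_(i < n.+1) f (c i).
  by apply/polyP => i; rewrite coef_map !coef_poly; case: ifP => // _; exact: rmorph0.
by rewrite horner_poly.
Qed.

Definition subringP (B : set K) := [/\ B 1, forall x y, B x -> B y -> B (x - y) &
  forall x y, B x -> B y -> B (x * y)].

Definition polys_in (I : set K) (p : {poly K}) := forall i, I p`_i.
Definition adjoined (B : set K) (y : K) : set K :=
  [set u | exists2 p, polys_in B p & p.[y] = u].

Lemma subring_closed0 B : subringP B -> B 0.
Proof. by move=> [h1 hB _]; rewrite -(subrr 1); apply: hB. Qed.

Lemma subring_closedD B x y : subringP B -> B x -> B y -> B (x + y).
Proof.
move=> hB hx hy; have [_ hs _] := hB; rewrite -[y]opprK.
by apply: (hs _ _ hx); rewrite -sub0r; apply: (hs) => //; apply: subring_closed0.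
Qed.

Lemma subring_closed_sum B (I : Type) (r : seq I) (F : I -> K) :
  subringP B -> (forall i, B (F i)) -> B (\sum_(i <- r) F i).
Proof.
move=> hB h; apply: (big_ind B) => //; first exact: subring_closed0.
by move=> x y; apply: subring_closedD.
Qed.

Lemma adjoined_subring B y : subringP B -> subringP (adjoined B y).
Proof.
move=> hB; have [h1 hs hm] := hB; split.
- exists 1; last by rewrite hornerC.
  by move=> i; rewrite coefC; case: ifP => // _; apply: subring_closed0.
- move=> _ _ [p hp <-] [q hq <-]; exists (p - q); last by rewrite hornerD hornerN.
  by move=> i; rewrite coefB; apply: hs.
- move=> _ _ [p hp <-] [q hq <-]; exists (p * q); last by rewrite hornerM.
  by move=> i; rewrite coefM; apply: subring_closed_sum => // j; apply: hm.
Qed.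

Lemma adjoined_sub B y : subringP B -> (B `<=` adjoined B y)%classic.
Proof.
move=> hB u hu; exists u%:P; last by rewrite hornerC.
by move=> i; rewrite coefC; case: ifP => // _; apply: subring_closed0.
Qed.

Lemma adjoined_gen B y : subringP B -> adjoined B y y.
Proof.
move=> hB; exists 'X; last by rewrite hornerX.
by move=> i; rewrite coefX; case: eqP => _; [case: hB | apply: subring_closed0].
Qed.

(* If 1 = p(y) = q(1/y) with coefficients in a proper ideal I with 1 + I
   invertible, the lower order terms of q reduce the degree of p, or conversely. *)
Lemma no_two_relations (I : set K) :
  (forall x y, I x -> I y -> I (x + y)) -> (forall x y, I x -> I y -> I (x * y)) ->
  I 0 -> ~ I 1 -> (forall x, I x -> forall y, I y -> I (y / (1 - x))) ->
  forall s n m, (n + m <= s)%N -> forall y y' p q, y * y' = 1 ->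
  polys_in I p -> polys_in I q -> (size p <= n.+1)%N -> (size q <= m.+1)%N ->
  p.[y] = 1 -> q.[y'] = 1 -> False.
Proof.
move=> ID IM I0 I1 Iu; elim=> [|s ih] n m nms y y' p q yy Ip Iq sp sq py qy.
  have /eqP n0 : n == 0%N by lia.
  by apply: I1; rewrite -py (size1_polyC (_ : (size p <= 1)%N)) ?hornerC // -?n0.
wlog mn : n m nms y y' p q yy Ip Iq sp sq py qy / (m <= n)%N.
  move=> h; have [|/ltnW] := leqP m n; first exact: (h n m _ y y' p q).
  by apply: (h m n _ y' y q p) => //; rewrite 1?addnC // mulrC.
case: n nms sp mn => [|n] nms sp mn.
  by apply: I1; rewrite -py (size1_polyC sp) hornerC.
set u := 1 - q`_0.
have u0 : u != 0 by rewrite subr_eq0; apply/eqP => e; apply: I1; rewrite e.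
pose p' := \poly_(i < n.+1) (p`_i + p`_n.+1 * (q`_(n.+1 - i) / u)).
apply: (ih n m _ y y' p' q) => //.
- move=> i; rewrite coef_poly; case: ifP => // _; apply: (ID _ _) => //; apply: IM => //.
  exact: Iu.
- exact: size_poly.
have y0 : y != 0 by apply/eqP => e; move: yy; rewrite e mul0r => /eqP; rewrite eq_sym oner_eq0.
rewrite horner_poly.
have qE : \sum_(i < n.+1) q`_(n.+1 - i) * y ^+ i = y ^+ n.+1 * u.
  rewrite /u -qy (horner_coef_wide y' (leq_trans sq (_ : (m.+1 <= n.+2)%N))) //.
  rewrite [in RHS]big_ord_recl /= expr0 mulr1 [q`_0 + _]addrC addrK mulr_sumr.
  rewrite (reindex_inj rev_ord_inj) /=; apply: eq_bigr => i _.
  have -> : (n.+1 - (n.+1 - i.+1) = i.+1)%N by have := ltn_ord i; lia.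
  rewrite /bump /= add1n mulrCA; congr (_ * _).
  have -> : y' = y^-1 by rewrite -[y']mul1r -(mulVf y0) -mulrA yy mulr1.
  have -> : y ^+ n.+1 = y ^+ (n.+1 - i.+1) * y ^+ i.+1 by rewrite -exprD subnK.
  by rewrite exprVn mulfK // expf_neq0.
transitivity (\sum_(i < n.+1) p`_i * y ^+ i + p`_n.+1 / u * \sum_(i < n.+1) q`_(n.+1 - i) * y ^+ i).
  by rewrite mulr_sumr -big_split /=; apply: eq_bigr => i _; ring.
rewrite qE; have -> : p`_n.+1 / u * (y ^+ n.+1 * u) = p`_n.+1 * y ^+ n.+1 by field.
by rewrite -py (horner_coef_wide y sp) [in RHS]big_ord_recr.
Qed.

(** z is not in f(R)[1/z], since clearing denominators would give an integral equation. Let B be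
    maximal among the subrings containing f(R)[1/z] but not z. If neither y nor 1/y were in B,
    adjoining either would produce z, hence the two relations excluded by [no_two_relations]. *)
Lemma exists_valuation_ring (z : K) : ~ integralOver f z ->
  exists V : K -> Prop, [/\ valuation_ring V, forall r, V (f r) & ~ V z].
Proof.
move=> nz.
have z0 : z != 0.
  by apply/eqP => e; apply: nz; rewrite e; apply: mxpoly.integral0.
pose good (B : set K) := [/\ subringP B, forall r, B (f r), B z^-1 & ~ B z].
pose base := adjoined [set x | exists r, f r = x]%classic z^-1.
have srng : subringP [set x | exists r, f r = x]%classic.
  split; first by exists 1; rewrite rmorph1.
    by move=> _ _ [r <-] [s <-]; exists (r - s); rewrite rmorphB.
  by move=> _ _ [r <-] [s <-]; exists (r * s); rewrite rmorphM.
have good_base : good base.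
  split; first exact: adjoined_subring.
  - by move=> r; apply: adjoined_sub => //; exists r.
  - exact: adjoined_gen.
  move=> [p hp pz]; have [c hc] := choice hp; apply: nz.
  apply: (@integral_of_expansion z (size p) (fun i => c (size p - i)%N)).
  rewrite exprS -{1}pz (horner_coef_wide _ (leqnSn (size p))) mulr_suml.
  rewrite (reindex_inj rev_ord_inj) /=; apply: eq_bigr => i _.
  rewrite subSS hc -mulrA; congr (_ * _).
  have -> : z ^+ size p = z ^+ (size p - i) * z ^+ i by rewrite -exprD subnK // -ltnS.
  by rewrite exprVn mulKf // expf_neq0.
have [B [hB maxB]] : exists B, (B = set0 \/ good B) /\
    forall B', (B `<` B')%classic -> ~ (B' = set0 \/ good B').
  apply: (Zorn_bigcup (P := fun B => B = set0 \/ good B)) => F FP Ftot.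
  have [[B0 [FB0 gB0]]|no] := EM (exists B0, F B0 /\ good B0); last first.
    left; apply/seteqP; split=> // x [B FB Bx]; exfalso.
    by case: (FP _ FB) => [e|g]; [move: Bx; rewrite e | apply: no; exists B].
  have pair x y : (\bigcup_(X in F) X)%classic x -> (\bigcup_(X in F) X)%classic y ->
      exists B, [/\ F B, good B, B x & B y].
    move=> [B1 F1 h1] [B2 F2 h2].
    have g X u : F X -> X u -> good X.
      by move=> FX Xu; case: (FP _ FX) => // e; move: Xu; rewrite e.
    case: (Ftot _ _ F1 F2) => h; [exists B2|exists B1]; split => //; try exact: h.
      exact: g h2.
    exact: g h1.
  right; case: (gB0) => -[b1 _ _] bf bz nbz; split; [split| | |].
  - by exists B0.
  - by move=> x y hx hy; have [B [FB [[_ s _] _ _ _] Bx By]] := pair _ _ hx hy; exists B => //; apply: s.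
  - by move=> x y hx hy; have [B [FB [[_ _ s] _ _ _] Bx By]] := pair _ _ hx hy; exists B => //; apply: s.
  - by move=> r; exists B0.
  - by exists B0.
  - by move=> hz; have [B [FB [_ _ _ n] Bx _]] := pair _ _ hz hz.
have gB : good B.
  case: hB => // e; exfalso; apply: (maxB base); last by right.
  rewrite e; split; last by move/(_ z^-1); apply; case: good_base.
  by move=> x [].
have [sB Bf Bz nBz] := gB; have [B1 Bs Bm] := sB.
have B0 := subring_closed0 sB.
have ext y : ~ B y -> adjoined B y z.
  move=> nBy; apply: contrapT => h.
  apply: (maxB (adjoined B y)).
    split; first exact: adjoined_sub.
    by move=> /(_ y (adjoined_gen y sB)).
  right; split => //; first exact: adjoined_subring.
    by move=> r; apply: adjoined_sub.
  exact: adjoined_sub.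
(* The ideal generated by 1/z in B; it is proper because z is not in B. *)
pose I : set K := [set x | B (z * x)]%classic.
have IB x : I x -> B x by move=> h; have := Bm _ _ Bz h; rewrite mulKf.
have ID x y : I x -> I y -> I (x + y).
  by rewrite /I /= mulrDr => h1 h2; apply: subring_closedD.
have BI x y : I x -> B y -> I (x * y) by rewrite /I /= mulrA => h1 h2; apply: (Bm _ _).
(* Otherwise adjoining the inverse of u = 1 - x gives z u^n in B for some n; as u^n is 1 modulo I, z
   would lie in B. *)
have unitI x : I x -> B (1 - x)^-1.
  move=> Ix; apply: contrapT => /ext [p hp].
  have u0 : 1 - x != 0.
    by rewrite subr_eq0; apply/eqP => e; apply: nBz; have := Ix; rewrite /I /= -e mulr1.
  set u := 1 - x in u0 *.
  have Bu : B u by apply: (Bs _ _) => //; apply: IB.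
  move=> pz; have zu : B (z * u ^+ (size p)).
    rewrite -pz horner_coef mulr_suml; apply: subring_closed_sum => // i.
    rewrite -mulrA; apply: (Bm _ _); first exact: hp.
    have -> : u^-1 ^+ i * u ^+ size p = u ^+ (size p - i).
      have -> : u ^+ size p = u ^+ i * u ^+ (size p - i) by rewrite -exprD subnKC // ltnW.
      by rewrite exprVn mulKf // expf_neq0.
    by elim: (size p - i)%N => [|k ih]; rewrite ?expr0 // exprS; apply: (Bm _ _).
  have : forall k, I (1 - u ^+ k).
    elim=> [|k ih]; first by rewrite expr0 subrr /I /= mulr0.
    have -> : 1 - u ^+ k.+1 = (1 - u ^+ k) * u + x by rewrite exprSr /u; ring.
    by apply: (ID _ _) => //; apply: (BI _ _).
  move=> /(_ (size p)); rewrite /I /= mulrBr mulr1 => h.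
  by apply: nBz; rewrite -(subrK (z * u ^+ size p) z); apply: subring_closedD.
have rel y : adjoined B y z -> exists2 p, polys_in I p & p.[y] = 1.
  move=> [p hp pz]; exists (z^-1 *: p); last by rewrite hornerZ pz mulVf.
  by move=> i; rewrite coefZ /I /= mulVKf.
exists B; split => //; split => // y.
have [By|nBy] := EM (B y); first by left.
have [Bi|nBi] := EM (B y^-1); first by right.
have y0 : y != 0 by apply/eqP => e; apply: nBy; rewrite e.
have [p Ip py] := rel _ (ext _ nBy); have [q Iq qy] := rel _ (ext _ nBi).
exfalso; apply: (@no_two_relations I ID _ _ _ _ _ (size p) (size q) (leqnn _) y y^-1 p q) => //.
- by move=> u v hu hv; apply: (BI _ _) => //; apply: IB.
- by rewrite /I /= mulr0.
- by rewrite /I /= mulr1.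
- by move=> u hu v hv; apply: (BI _ _) => //; apply: unitI.
- by rewrite divff.
Qed.

End ChevalleyExtension.

(** * Prime quotients of von Neumann regular rings *)

Section RegularQuotient.
Variables (F : comNzRingType) (I : prime_idealr F).
Hypothesis regF : forall x : F, exists y, x * x * y = x.

(** The regularity proof is a phantom argument, so that the field structure declared on this alias
    can refer to it. *)
Definition regular_quot (_ : forall x : F, exists y, x * x * y = x) := {ideal_quot I}.
Local Notation Q := (regular_quot regF).
HB.instance Definition _ := GRing.ComNzRing.on Q.

Definition rq_inv (x : Q) : Q := xget 0 [set y : Q | y * x = 1]%classic.

(** From a a y = a follows a (y a - 1) = 0, and a prime ideal not containing a contains y a - 1. *)
Lemma rq_mulVf (x : Q) : x != 0 -> rq_inv x * x = 1.
Proof.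
move=> x0; rewrite /rq_inv; case: xgetP => [y _ //|no]; exfalso.
pose pi : {rmorphism F -> {ideal_quot I}} := \pi_{ideal_quot I}%qT.
have pi_eq u v : u - v \in I -> pi u = pi v.
  by move=> h; apply/eqP; rewrite -[_ == _]/(u == v %[mod {ideal_quot I}])%qT -Quotient.idealrBE.
have xE : x = pi (repr (x : {ideal_quot I})) by exact: (esym (reprK (x : {ideal_quot I}))).
move: (repr (x : {ideal_quot I})) xE => a xE; have [y yE] := regF a.
apply: (no (pi y)); rewrite /= xE.
transitivity (pi (y * a)); first by rewrite rmorphM.
transitivity (pi 1); last exact: rmorph1.
apply: (pi_eq _ _); have : a * (y * a - 1) \in I.
  have -> : a * (y * a - 1) = 0 by rewrite mulrBr mulr1 [y * a]mulrC mulrA yE subrr.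
  exact: idealr0.
rewrite prime_idealrM => /orP[ha|//]; exfalso.
move/eqP: x0; apply; rewrite xE; transitivity (pi 0); last exact: rmorph0.
by apply: (pi_eq _ _); rewrite subr0.
Qed.

Lemma rq_inv0 : rq_inv 0 = 0.
Proof.
rewrite /rq_inv; case: xgetP => // y _ /= /eqP; by rewrite mulr0 eq_sym oner_eq0.
Qed.

HB.instance Definition _ := GRing.ComNzRing_isField.Build Q rq_mulVf rq_inv0.

End RegularQuotient.

(** An ideal maximal among those disjoint from S is prime, and its quotient is a field by
    regularity. *)
Lemma exists_field_quotient (F : comNzRingType) (S : set F) :
  (forall x : F, exists y, x * x * y = x) -> S 1 -> (forall x y, S x -> S y -> S (x * y)) ->
  ~ S 0 -> exists (K : fieldType) (f : {rmorphism F -> K}), forall s, S s -> f s != 0.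
Proof.
move=> regF S1 SM S0.
pose ideal (J : set F) := [/\ J 0, forall x y, J x -> J y -> J (x + y) & forall a x, J x -> J (a * x)].
pose good (J : set F) := ideal J /\ forall s, S s -> ~ J s.
have [J [hJ maxJ]] : exists J, (J = set0 \/ good J) /\
    forall B', (J `<` B')%classic -> ~ (B' = set0 \/ good B').
  apply: (Zorn_bigcup (P := fun B => B = set0 \/ good B)) => G GP Gtot.
  have [[B0 [FB0 gB0]]|no] := EM (exists B0, G B0 /\ good B0); last first.
    left; apply/seteqP; split=> // x [B FB Bx]; exfalso.
    by case: (GP _ FB) => [e|g]; [move: Bx; rewrite e | apply: no; exists B].
  have g X u : G X -> X u -> good X.
    by move=> FX Xu; case: (GP _ FX) => // e; move: Xu; rewrite e.
  right; split; [split|].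
  - by exists B0 => //; case: gB0 => -[].
  - move=> x y [B1 F1 h1] [B2 F2 h2].
    case: (Gtot _ _ F1 F2) => h; [exists B2 => //|exists B1 => //].
      by case: (g _ _ F2 h2) => -[_ s _] _; apply: s => //; apply: h.
    by case: (g _ _ F1 h1) => -[_ s _] _; apply: s => //; apply: h.
  - by move=> a x [B FB Bx]; exists B => //; case: (g _ _ FB Bx) => -[_ _ s] _; apply: s.
  - by move=> s Ss [B FB Bs]; case: (g _ _ FB Bs) => _ /(_ s Ss).
have gJ : good J.
  case: hJ => // e; exfalso; apply: (maxJ [set 0]%classic).
    by rewrite e; split; [move=> x []|move=> /(_ 0); apply].
  right; split; first split => //=.
  - by move=> x y -> ->; rewrite addr0.
  - by move=> a x ->; rewrite mulr0.
  by move=> s Ss /= s0; apply: S0; rewrite -s0.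
have [[J0 JD JM] JS] := gJ.
have adj a : ~ J a -> exists s j b, [/\ S s, J j & s = j + b * a].
  move=> nJa; apply: contrapT => no.
  pose J' : set F := [set x | exists j b, J j /\ x = j + b * a]%classic.
  apply: (maxJ J').
    split; first by move=> x Jx; exists x, 0; rewrite mul0r addr0.
    by move=> /(_ a) h; apply: nJa; apply: h; exists 0, 1; rewrite mul1r add0r.
  right; split; first split.
  - by exists 0, 0; rewrite mul0r addr0.
  - move=> x y [j [b [h ->]]] [j' [b' [h' ->]]]; exists (j + j'), (b + b').
    by split; [exact: JD|rewrite mulrDl addrACA].
  - move=> c x [j [b [h ->]]]; exists (c * j), (c * b).
    by split; [exact: JM|rewrite mulrDr mulrA].
  by move=> s Ss [j [b [h e]]]; apply: no; exists s, j, b.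
pose I : {pred F} := fun x => `[< J x >].
have IE x : (x \in I) = `[< J x >] by [].
have hI : idealr_closed I.
  split; first by rewrite IE; apply/asboolP.
    by rewrite IE; apply/asboolP => h; apply: (JS 1).
  move=> a x y; rewrite !IE => /asboolP hx /asboolP hy; apply/asboolP.
  by apply: (JD _ _) => //; apply: JM.
have hp : prime_idealr_closed I.
  move=> x y; rewrite !IE => /asboolP hxy; apply/orP.
  have [hx|hx] := EM (J x); first by left; apply/asboolP.
  have [hy|hy] := EM (J y); first by right; apply/asboolP.
  exfalso; have [s [j [b [Ss Jj es]]]] := adj _ hx.
  have [t [j' [b' [St Jj' et]]]] := adj _ hy.
  apply: (JS (s * t)); first exact: SM.
  have -> : s * t = (j' + b' * y) * j + ((b * x) * j' + b * b' * (x * y)).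
    by rewrite es et; ring.
  by apply: (JD _ _); [exact: JM|apply: (JD _ _); exact: JM].
pose I1 := isIdealr.Build F I hI.
pose I2 := isPrimeIdealrClosed.Build F I hp.
pose PI : prime_idealr F := HB.pack I I1 I2.
exists (regular_quot PI regF).
exists (\pi_{ideal_quot PI}%qT : {rmorphism F -> {ideal_quot PI}}).
move=> s Ss; apply/eqP => e.
have : s - 0 \in (PI : {pred F}).
  rewrite Quotient.idealrBE; apply/eqP; apply: (etrans e).
  exact: (esym (rmorph0 (\pi_{ideal_quot PI}%qT : {rmorphism F -> {ideal_quot PI}}))).
by rewrite subr0 => /asboolP; apply: JS.
Qed.

(** * Complex multiplication where j is not integral *)

Section ComplexMultiplication.
Variable K : closedFieldType.
Hypothesis char0 : forall n, n.+1%:R != 0 :> K.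

Lemma closed_root_ex n (y : K) : (0 < n)%N -> exists s : K, s ^+ n = y.
Proof.
move=> n0; have [x hx] := @solve_monicpoly K n (fun i => if i == 0%N then y else 0) n0.
exists x; rewrite hx; case: n n0 {hx} => // n _.
by rewrite big_ord_recl /= expr0 mulr1 big1 ?addr0 // => i _; rewrite mul0r.
Qed.

Variables (V : K -> Prop).
Hypothesis hV : valuation_ring V.

Lemma veq_sub_generic x y r : veq V x y -> ~ veq V r x ->
  veq V (x - r) (y - r) /\ x - r != 0.
Proof.
move=> exy nrx; split; last first.
  by rewrite subr_eq0; apply/eqP => e; apply: nrx; rewrite e; apply: veq_refl.
have [h|h] := vle_or_lt V x r; last first.
  have e1 : veq V (x - r) x by apply: (veq_dom hV); apply: (vlt_oppl hV).
  have e2 : veq V (y - r) y.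
    apply: (veq_dom hV); apply: (vlt_oppl hV); exact: (vlt_eqr hV exy).
  by apply: (veq_trans hV e1); apply: (veq_trans hV exy); apply: veq_sym.
have lt : vlt V x r by move=> h'; apply: nrx.
have lty : vlt V y r by apply: (vlt_eql hV _ lt); apply: veq_sym.
have dom u : vlt V u r -> veq V (u - r) r.
  move=> hu; apply: (veq_trans hV (b := - r)); last exact: veqN.
  by apply: (veq_domr hV); apply: (vlt_eqr hV) hu; apply: veq_sym; apply: veqN.
by apply: (veq_trans hV (dom _ lt)); apply: veq_sym; apply: dom.
Qed.

(** Factor p over the algebraically closed K and treat each X - r by [veq_sub_generic]; the list
    consists of the roots. *)
Lemma veq_horner_generic (p : {poly K}) : exists rs : seq K, forall x y,
  veq V x y -> (forall r, r \in rs -> ~ veq V r x) ->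
  veq V p.[x] p.[y] /\ (p != 0 -> p.[x] != 0).
Proof.
have [rs e] := closed_field_poly_normal p; exists rs => x y exy hr.
suff [h1 h2] : veq V (\prod_(z <- rs) ('X - z%:P)).[x] (\prod_(z <- rs) ('X - z%:P)).[y]
    /\ (\prod_(z <- rs) ('X - z%:P)).[x] != 0.
  rewrite e !hornerZ; split; first by apply: (veq_mul hV) => //; apply: veq_refl.
  by rewrite -e -lead_coef_eq0 => h; rewrite mulf_neq0.
elim: rs hr {e} => [|r rs ih] hr.
  by rewrite !big_nil !hornerC; split; [exact: veq_refl|exact: oner_neq0].
have [h1 h2] := ih (fun z hz => hr z (mem_behead (s := r :: rs) hz)).
have [h3 h4] := veq_sub_generic exy (hr r (mem_head r rs)).
rewrite !big_cons !hornerM !hornerXsubC; split; first exact: (veq_mul hV).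
exact: mulf_neq0.
Qed.

Variables (w : weierstrass K) (A : zmodType) (X Z : A -> K).
Hypothesis hk : kummer w X Z.
Hypothesis w2 : wb2 w = 0.
Variable j : K.
Hypotheses (hj : wc4 w ^+ 3 = j * wdisc w) (nVj : ~ V j).
Variables (alpha : A -> A) (b c : int).
Hypothesis alphaB : forall P Q, alpha (P - Q) = alpha P - alpha Q.
Hypothesis alpha_quad : forall P, alpha (alpha P) = - (alpha P *~ b) - P *~ c.
Hypothesis disc_neg : b ^+ 2 < 4 * c.
Hypothesis surj : forall x, exists2 P, Z P != 0 & X P / Z P = x.
Variables pA pB : {poly K}.
Hypothesis pB0 : pB != 0.
Hypothesis ratl : forall P, Z P != 0 ->
  (Z (alpha P) = 0 -> pB.[X P / Z P] = 0) /\
  (Z (alpha P) != 0 -> X (alpha P) / Z (alpha P) * pB.[X P / Z P] = pA.[X P / Z P]).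

(** Outside V, j is neither 0 nor 1728, so b4 and b6 are nonzero and a change of coordinates over K
    reaches the Tate model with k = 1 / (j - 1728); then [no_cm] applies. *)
Lemma cm_bad_reduction : False.
Proof.
have nz n : n.+1%:R != 0 :> K by apply: char0.
have [h8 hd _ _ _] := hk.
have d0 : wdisc w = - 8 * wb4 w ^+ 3 - 27 * wb6 w ^+ 2 by rewrite /wdisc w2; ring.
have cE : wc4 w = - 24 * wb4 w by rewrite /wc4 w2; ring.
have b40 : wb4 w != 0.
  apply/eqP => e; apply: nVj; move: hj; rewrite cE e mulr0 expr0n /= => /esym/eqP.
  by rewrite mulf_eq0 (negPf hd) orbF => /eqP ->; apply: val0.
have jE : j = - 24 ^+ 3 * wb4 w ^+ 3 / wdisc w.
  by apply: (mulIf hd); rewrite divfK // -hj cE; ring.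
have b60 : wb6 w != 0.
  apply/eqP => e; apply: nVj; rewrite jE d0 e expr0n /= mulr0 subr0.
  have -> : - 24 ^+ 3 * wb4 w ^+ 3 / (- 8 * wb4 w ^+ 3) = 1728.
    by field; rewrite ?oppr_eq0 ?b40 ?(nz 7%N).
  exact: val_nat.
pose k := wdisc w / ((216 * wb6 w) ^+ 2).
have n46 : 216 != 0 :> K by exact: (nz 215%N).
have k0 : k != 0 by rewrite mulf_neq0 // invr_eq0 expf_neq0 // mulf_neq0.
have kE : k = (j - 1728)^-1.
  have e : j - 1728 = (216 * wb6 w) ^+ 2 / wdisc w.
    by rewrite jE; apply: (mulIf hd); rewrite mulrBl !divfK // d0; ring.
  by rewrite e /k invf_div.
have k1 : vlt V k 1.
  rewrite kE; apply: not_val_inv => h; apply: nVj.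
  by rewrite -(subrK 1728 j); apply: (valD hV) => //; apply: val_nat.
(* With r = U / 12 the new b2 is 1, and this U makes the new b4 equal to 18 times the new b6, as in
   the Tate model. *)
pose U := - 9 * wb6 w / wb4 w.
have n9 : 9 != 0 :> K by exact: (nz 8%N).
have U0 : U != 0 by rewrite !mulf_neq0 ?invr_eq0 // oppr_eq0.
pose r := U / 12.
have n12 : 12 != 0 :> K by exact: (nz 11%N).
have n4 : 4 != 0 :> K by exact: (nz 3%N).
have n8 : 8 != 0 :> K by exact: (nz 7%N).
have e2 : wb2 (wchange w r U) = 1 by rewrite /= w2 /r; field; rewrite ?U0 ?n12.
have e4 : wb4 (wchange w r U) = - 72 * k.
  by rewrite /= w2 /r /U /k d0; field; rewrite ?oppr_eq0 ?b40 ?b60 ?n46 ?n12 ?n9.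
have e6 : wb6 (wchange w r U) = - 4 * k.
  by rewrite /= w2 /r /U /k d0; field; rewrite ?oppr_eq0 ?b40 ?b60 ?n46 ?n12 ?n9.
have e8 : wb8 (wchange w r U) = - k * (1 + 1296 * k).
  apply: (mulfI n4); rewrite (wchange_b8 r U0 h8) e2 e4 e6; ring.
have wE : wchange w r U = tate_model k.
  by move: e2 e4 e6 e8; case: (wchange w r U) => /= ? ? ? ? -> -> -> ->.
clearbody r U k.
have hk' := kummer_change r U0 hk; rewrite wE in hk'.
have [l [l0 hn]] := exists_normalized hV hk'.
have hk'' := kummer_rescale l0 hk'.
set X2 := (fun P => l P * (X P - r * Z P)) in hk'' hn.
set Z2 := (fun P => l P * (U * Z P)) in hk'' hn.
have Z2E P : (Z2 P == 0) = (Z P == 0).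
  by rewrite /Z2 mulf_eq0 (negPf (l0 P)) mulf_eq0 (negPf U0).
have xE P : Z P != 0 -> X2 P / Z2 P = (X P / Z P - r) / U.
  by move=> ZP; rewrite /X2 /Z2; field; rewrite ?ZP ?U0 ?l0.
have xE' P : Z P != 0 -> X P / Z P = U * (X2 P / Z2 P) + r.
  by move=> ZP; rewrite xE // (mulrC U) divfK // subrK.
pose q : {poly K} := U *: 'X + r%:P.
have qE y : q.[y] = U * y + r by rewrite /q hornerD hornerZ hornerX hornerC.
pose B' := U *: (pB \Po q); pose A' := (pA \Po q) - r *: (pB \Po q).
have B'0 : B' != 0.
  rewrite scaler_eq0 negb_or U0 /= comp_poly_eq0 //.
  by rewrite /q size_MXaddC_scale; [] || (rewrite size_addl ?size_scale ?size_polyX // size_polyC; case: (r != 0)).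
have ratl' P : Z P != 0 -> (Z (alpha P) = 0 -> B'.[X2 P / Z2 P] = 0) /\
  (Z (alpha P) != 0 -> X2 (alpha P) / Z2 (alpha P) * B'.[X2 P / Z2 P] = A'.[X2 P / Z2 P]).
  move=> ZP; have [h1 h2] := ratl ZP.
  rewrite /B' /A' hornerD hornerN !hornerZ !horner_comp qE -xE' //.
  split=> [/h1 ->|hZ]; first by rewrite mulr0.
  by rewrite xE // -h2 // mulrA divfK // mulrBl.
have [sk skE] := closed_root_ex k (isT : (0 < 2)%N).
have [rA hA] := veq_horner_generic A'; have [rB hB] := veq_horner_generic B'.
apply: (@no_cm K V hV k k0 k1 A X2 Z2 hk'' hn sk skE alpha b c alphaB alpha_quad disc_neg
  closed_root_ex _ (rA ++ rB)) => [x|P P' z1 z2 e hbad].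
  have [P ZP xP] := surj (U * x + r); exists P; first by rewrite Z2E.
  by rewrite xE // xP addrK (mulrC U) mulfK.
rewrite Z2E in z1; rewrite Z2E in z2; rewrite !Z2E.
have [|eA _] := hA _ _ e; first by move=> s hs; apply: (hbad s); rewrite mem_cat hs.
have [|eB /(_ B'0) nB] := hB _ _ e; first by move=> s hs; apply: (hbad s); rewrite mem_cat hs orbT.
have nB' : B'.[X2 P' / Z2 P'] != 0 by apply: veq_neq0 eB nB.
have [h1 h2] := ratl' _ z1; have [h3 h4] := ratl' _ z2.
have n1 : Z (alpha P) != 0 by apply/eqP => /h1 /eqP; rewrite (negPf nB).
have n2 : Z (alpha P') != 0 by apply/eqP => /h3 /eqP; rewrite (negPf nB').
split => //.
have -> : X2 (alpha P) / Z2 (alpha P) = A'.[X2 P / Z2 P] / B'.[X2 P / Z2 P] by rewrite -h2 // mulfK.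
have -> : X2 (alpha P') / Z2 (alpha P') = A'.[X2 P' / Z2 P'] / B'.[X2 P' / Z2 P'] by rewrite -h4 // mulfK.
by apply: (veq_mul hV) => //; apply: veq_inv.
Qed.

End ComplexMultiplication.

(** * Germs of analytic functions *)

Section ComplexNorm.
Variable R : realType.
Local Notation C := R[i].

Definition cn (z : C) : R := complex.Re `|z|.

Lemma cnE z : `|z| = (cn z)%:C%C.
Proof. by rewrite /cn normc_def. Qed.
Lemma cn_ge0 z : 0 <= cn z.
Proof. by rewrite -lecR -cnE; exact: normr_ge0. Qed.
Lemma cnM x y : cn (x * y) = cn x * cn y.
Proof. by apply: (@complexI R); rewrite rmorphM /= -!cnE normrM. Qed.
Lemma cnD x y : cn (x + y) <= cn x + cn y.
Proof. by rewrite -lecR rmorphD /= -!cnE ler_normD. Qed.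
Lemma cnN x : cn (- x) = cn x.
Proof. by rewrite /cn normrN. Qed.
Lemma cn0 : cn 0 = 0. Proof. by rewrite /cn normr0. Qed.
Lemma cn1 : cn 1 = 1. Proof. by rewrite /cn normr1. Qed.
Lemma cn_eq0 x : (cn x == 0) = (x == 0).
Proof.
apply/eqP/eqP => [h|->]; last exact: cn0.
by apply/eqP; rewrite -normr_eq0 cnE h.
Qed.
Lemma cn_gt0 x : (0 < cn x) = (x != 0).
Proof. by rewrite lt_def cn_ge0 andbT cn_eq0. Qed.
Lemma cnX x n : cn (x ^+ n) = cn x ^+ n.
Proof. by elim: n => [|n ih]; rewrite ?expr0 ?cn1 // !exprS cnM ih. Qed.
Lemma cnV x : cn x^-1 = (cn x)^-1.
Proof.
have [->|x0] := eqVneq x 0; first by rewrite invr0 cn0 invr0.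
have c0 : cn x != 0 by rewrite cn_eq0.
by apply: (mulfI c0); rewrite -cnM !divff // cn1.
Qed.
Lemma cn_real (x : R) : cn x%:C%C = `|x|.
Proof. by rewrite /cn normc_def /= expr0n /= addr0 sqrtr_sqr. Qed.
Lemma cn_nat n : cn n%:R = n%:R.
Proof. by rewrite -(rmorph_nat (real_complex R)) cn_real normr_nat. Qed.
Lemma cn_int (n : int) : cn n%:~R = `|n|%:~R.
Proof. by rewrite -(rmorph_int (real_complex R)) cn_real intr_norm. Qed.
Lemma cn_sum (I : Type) (r : seq I) (P : pred I) (F : I -> C) :
  cn (\sum_(i <- r | P i) F i) <= \sum_(i <- r | P i) cn (F i).
Proof.
apply: (big_ind2 (fun x y => cn x <= y)) => //; first by rewrite cn0.
by move=> x1 y1 x2 y2 h1 h2; apply: le_trans (cnD _ _) (lerD h1 h2).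
Qed.
Lemma cnB_ge x y : cn x - cn y <= cn (x - y).
Proof. by rewrite lerBlDr; apply: le_trans (cnD _ _); rewrite subrK. Qed.
Lemma cn_distC x y : cn (x - y) = cn (y - x).
Proof. by rewrite -cnN opprB. Qed.
Lemma Re_le_cn z : `|complex.Re z| <= cn z.
Proof. by rewrite -lecR -cnE normc_ge_Re. Qed.
Lemma Im_le_cn z : `|complex.Im z| <= cn z.
Proof.
case: z => x y; rewrite /cn normc_def /= -(sqrtr_sqr y); apply: ler_wsqrtr.
by rewrite lerDr sqr_ge0.
Qed.

End ComplexNorm.

Section Germs.
Variable R : realType.
Local Notation C := R[i].
Implicit Types (f g : C -> C) (a : nat -> C).

(* Convergence of the power series is replaced by geometric bounds on all the
   Taylor remainders. *)
Definition expands f a := exists M rho : R, [/\ 0 <= M, 0 < rho &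
  forall n h, rho * cn h < 1 ->
    cn (f h - \sum_(k < n.+1) a k * h ^+ k) <= M * (rho * cn h) ^+ n.+1].
Definition analytic f := exists a, expands f a.
Definition near0 (P : C -> Prop) := exists2 r : R, 0 < r & forall h, cn h < r -> P h.

Lemma near0_and P Q : near0 P -> near0 Q -> near0 (fun h => P h /\ Q h).
Proof.
move=> [r r0 h] [s s0 h']; exists (Num.min r s); first by rewrite lt_min r0.
by move=> x; rewrite lt_min => /andP[h1 h2]; split; [apply: h|apply: h'].
Qed.

Lemma near0_imp (P Q : C -> Prop) : (forall h, P h -> Q h) -> near0 P -> near0 Q.
Proof. by move=> i [r r0 h]; exists r => // x /h /i. Qed.

Lemma expands0 f a : expands f a -> f 0 = a 0%N.
Proof.
move=> [M [rho [M0 r0 H]]]; have := H 0%N 0; rewrite cn0 mulr0 ltr01 => /(_ isT).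
rewrite big_ord_recl big_ord0 expr0 mulr1 addr0 expr1 mulr0 => h.
apply/eqP; rewrite -subr_eq0 -cn_eq0 eq_le h; exact: cn_ge0.
Qed.

Lemma expands_mono f a M rho M' rho' : 0 <= M -> M <= M' -> 0 < rho -> rho <= rho' ->
  (forall n h, rho * cn h < 1 ->
    cn (f h - \sum_(k < n.+1) a k * h ^+ k) <= M * (rho * cn h) ^+ n.+1) ->
  (forall n h, rho' * cn h < 1 ->
    cn (f h - \sum_(k < n.+1) a k * h ^+ k) <= M' * (rho' * cn h) ^+ n.+1).
Proof.
move=> M0 MM r0 rr H n h hh; have c0 := cn_ge0 h.
have le1 : rho * cn h <= rho' * cn h by apply: ler_wpM2r.
apply: le_trans (H n h (le_lt_trans le1 hh)) _.
apply: ler_pM => //; first by apply: exprn_ge0; apply: mulr_ge0 => //; apply: ltW.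
by apply: lerXn2r => //; rewrite nnegrE mulr_ge0 // ltW //; apply: lt_le_trans rr.
Qed.

Lemma expands_ext f g a : near0 (fun h => f h = g h) -> expands f a -> expands g a.
Proof.
move=> [r r0 e] [M [rho [M0 p0 H]]].
exists M, (rho + r^-1); have ri : 0 < r^-1 by rewrite invr_gt0.
have p1 : 0 < rho + r^-1 by apply: addr_gt0.
split => // n h hh; rewrite -e.
  have le : rho <= rho + r^-1 by rewrite lerDl ltW.
  exact: (expands_mono M0 (lexx M) p0 le H).
have : r^-1 * cn h < 1.
  apply: le_lt_trans hh; apply: ler_wpM2r; first exact: cn_ge0.
  by rewrite lerDr ltW.
by rewrite mulrC ltr_pdivrMr // mul1r.
Qed.

Lemma analytic_ext f g : near0 (fun h => f h = g h) -> analytic f -> analytic g.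
Proof. by move=> e [a h]; exists a; apply: expands_ext h. Qed.

Lemma analytic_eq f g : f =1 g -> analytic f -> analytic g.
Proof. by move=> e; apply: analytic_ext; exists 1 => // h _; apply: e. Qed.

Lemma analytic_const c : analytic (fun=> c).
Proof.
exists (fun k => if k == 0%N then c else 0); exists 0, 1; split => // n h _.
rewrite big_ord_recl /= expr0 mulr1 big1 => [|i _]; last by rewrite mul0r.
by rewrite addr0 subrr cn0 mul0r.
Qed.

Lemma analytic_id : analytic id.
Proof.
exists (fun k => if k == 1%N then 1 else 0); exists 1, 1; split => // n h.
rewrite !mul1r => h1; case: n => [|n].
  by rewrite big_ord_recl big_ord0 /= mul0r add0r subr0 expr1.
rewrite 2!big_ord_recl /= mul0r add0r mul1r big1 => [|i _]; last by rewrite mul0r.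
by rewrite addr0 expr1 subrr cn0; apply: exprn_ge0; apply: cn_ge0.
Qed.

Lemma expands2 f g a b : expands f a -> expands g b -> exists M rho : R, [/\ 0 <= M, 0 < rho,
  forall n h, rho * cn h < 1 ->
    cn (f h - \sum_(k < n.+1) a k * h ^+ k) <= M * (rho * cn h) ^+ n.+1 &
  forall n h, rho * cn h < 1 ->
    cn (g h - \sum_(k < n.+1) b k * h ^+ k) <= M * (rho * cn h) ^+ n.+1].
Proof.
move=> [M [p [M0 p0 H]]] [N [q [N0 q0 H']]]; exists (M + N), (p + q).
have h1 : M <= M + N by rewrite lerDl.
have h2 : N <= M + N by rewrite lerDr.
have h3 : p <= p + q by rewrite lerDl ltW.
have h4 : q <= p + q by rewrite lerDr ltW.
split; [exact: addr_ge0|exact: addr_gt0|exact: expands_mono H|exact: expands_mono H'].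
Qed.

Lemma analyticD f g : analytic f -> analytic g -> analytic (fun h => f h + g h).
Proof.
move=> [a ha] [b hb]; have [M [p [M0 p0 H H']]] := expands2 ha hb.
exists (fun k => a k + b k), (M + M), p; split => //; first exact: addr_ge0.
move=> n h hh; have -> : f h + g h - \sum_(k < n.+1) (a k + b k) * h ^+ k =
  (f h - \sum_(k < n.+1) a k * h ^+ k) + (g h - \sum_(k < n.+1) b k * h ^+ k).
  rewrite (eq_bigr (fun k : 'I_n.+1 => a k * h ^+ k + b k * h ^+ k)) => [|i _]; last by rewrite mulrDl.
  by rewrite big_split /= opprD addrACA.
by apply: le_trans (cnD _ _) _; rewrite mulrDl; apply: lerD; [exact: H|exact: H'].
Qed.

(** Cauchy's estimate: consecutive remainders differ by one term of the series, and are compared at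
    |h| = 1 / (2 p). *)
Lemma coef_bound f a M p : 0 <= M -> 0 < p -> (forall n h, p * cn h < 1 ->
    cn (f h - \sum_(k < n.+1) a k * h ^+ k) <= M * (p * cn h) ^+ n.+1) ->
  forall n, cn (a n) <= (cn (a 0%N) + 2 * M) * p ^+ n.
Proof.
move=> M0 p0 H [|n].
  by rewrite expr0 mulr1 lerDl mulr_ge0.
pose h : C := ((2 * p)^-1)%:C%C.
have hh : cn h = (2 * p)^-1 by rewrite cn_real ger0_norm // invr_ge0 mulr_ge0 // ltW.
have p1 : p * cn h = 2^-1 by rewrite hh; field; rewrite gt_eqF.
have lt1 : p * cn h < 1 by rewrite p1; lra.
have e : a n.+1 * h ^+ n.+1 = (f h - \sum_(k < n.+1) a k * h ^+ k) - (f h - \sum_(k < n.+2) a k * h ^+ k).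
  rewrite [in RHS](big_ord_recr n.+1) /=; ring.
have b1 := H n h lt1; have b2 := H n.+1 h lt1.
have hpos : 0 < cn h by rewrite hh invr_gt0 mulr_gt0.
rewrite -(ler_pM2r (exprn_gt0 n.+1 hpos)) -cnX -cnM e.
apply: le_trans (cnD _ _) _; rewrite cnN cnX -mulrA -exprMn.
apply: le_trans (lerD b1 b2) _.
have pw : (p * cn h) ^+ n.+2 <= (p * cn h) ^+ n.+1.
  by rewrite exprS ler_piMl ?exprn_ge0 // ?p1 ?invr_ge0 //; lra.
have : M * (p * cn h) ^+ n.+2 <= M * (p * cn h) ^+ n.+1 by apply: ler_wpM2l.
have : 0 <= cn (a 0%N) * (p * cn h) ^+ n.+1.
  by apply: mulr_ge0; [exact: cn_ge0|apply: exprn_ge0; rewrite p1 invr_ge0].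
by nra.
Qed.

Lemma cauchy_product a b (h : C) n :
  \sum_(k < n.+1) (\sum_(i < k.+1) a i * b (k - i)%N) * h ^+ k =
  \sum_(i < n.+1) a i * h ^+ i * \sum_(j < (n - i).+1) b j * h ^+ j.
Proof.
elim: n => [|n ih].
  by rewrite !big_ord1 /= !expr0; ring.
rewrite big_ord_recr ih [in RHS]big_ord_recr /= subnn big_ord1 expr0.
rewrite [X in _ + X * _ = _]big_ord_recr /= subnn mulrDl addrA; congr (_ + _); last by ring.
rewrite mulr_suml -big_split /=; apply: eq_bigr => i _.
have le : (i <= n)%N by rewrite -ltnS.
rewrite (subSn le) [in RHS]big_ord_recr /= mulrDr; congr (_ + _).
have -> : h ^+ n.+1 = h ^+ i * h ^+ (n - i).+1 by rewrite -exprD addnS subnKC.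
by ring.
Qed.

Lemma analyticM f g : analytic f -> analytic g -> analytic (fun h => f h * g h).
Proof.
move=> [a ha] [b hb]; have [M [p [M0 p0 H H']]] := expands2 ha hb.
have ca := coef_bound M0 p0 H.
set A0 := cn (a 0%N) + 2 * M in ca.
have A00 : 0 <= A0 by apply: addr_ge0; [exact: cn_ge0|apply: mulr_ge0].
pose B := cn (b 0%N) + M.
have B0 : 0 <= B by apply: addr_ge0 => //; exact: cn_ge0.
have gb h : p * cn h < 1 -> cn (g h) <= B.
  move=> hh; have := H' 0%N h hh; rewrite big_ord_recl big_ord0 expr0 mulr1 addr0 expr1 => h1.
  have h2 := cnD (g h - b 0%N) (b 0%N); rewrite subrK in h2.
  apply: le_trans h2 _; rewrite /B addrC; apply: lerD => //.
  by apply: le_trans h1 _; rewrite ler_piMr //; exact: ltW.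
(* Doubling the rate absorbs the n + 1 terms of the Cauchy product, as n + 1 <= 2^(n+1). *)
exists (fun k => \sum_(i < k.+1) a i * b (k - i)%N), (A0 * M + M * B), (2 * p).
have N0 : 0 <= A0 * M + M * B by apply: addr_ge0; apply: mulr_ge0.
split => //; first exact: mulr_gt0.
move=> n h hh; rewrite cauchy_product.
have c0 := cn_ge0 h.
have pc0 : 0 <= p * cn h by apply: mulr_ge0 => //; apply: ltW.
have hh' : p * cn h < 1 by apply: le_lt_trans hh; rewrite -mulrA; lra.
have -> : f h * g h - \sum_(i < n.+1) a i * h ^+ i * \sum_(j < (n - i).+1) b j * h ^+ j =
  (f h - \sum_(i < n.+1) a i * h ^+ i) * g h +
  \sum_(i < n.+1) a i * h ^+ i * (g h - \sum_(j < (n - i).+1) b j * h ^+ j).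
  rewrite (eq_bigr (fun i : 'I_n.+1 => a i * h ^+ i * g h -
    a i * h ^+ i * \sum_(j < (n - i).+1) b j * h ^+ j) (F1 := fun i : 'I_n.+1 => _ * (_ - _))).
    by rewrite sumrB -mulr_suml; ring.
  by move=> i _; rewrite mulrBr.
apply: le_trans (cnD _ _) _; rewrite cnM.
set t := p * cn h in pc0 hh' *.
have e1 : cn (f h - \sum_(i < n.+1) a i * h ^+ i) * cn (g h) <= M * t ^+ n.+1 * B.
  apply: ler_pM; [exact: cn_ge0|exact: cn_ge0|exact: H|exact: gb].
have e2 : cn (\sum_(i < n.+1) a i * h ^+ i * (g h - \sum_(j < (n - i).+1) b j * h ^+ j)) <=
    \sum_(i < n.+1) A0 * M * t ^+ n.+1.
  apply: le_trans (cn_sum _ _ _) _; apply: ler_sum => i _; rewrite !cnM cnX.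
  have le : (i <= n)%N by rewrite -ltnS.
  have -> : A0 * M * t ^+ n.+1 = (A0 * p ^+ i) * cn h ^+ i * (M * t ^+ (n - i).+1).
    have -> : t ^+ n.+1 = t ^+ i * t ^+ (n - i).+1 by rewrite -exprD addnS subnKC.
    by rewrite {1}/t exprMn; ring.
  apply: ler_pM; [apply: mulr_ge0; [exact: cn_ge0|exact: exprn_ge0]|exact: cn_ge0| |exact: H'].
  by apply: ler_wpM2r; [exact: exprn_ge0|exact: ca].
apply: le_trans (lerD e1 e2) _.
have -> : (2 * p * cn h) ^+ n.+1 = 2 ^+ n.+1 * t ^+ n.+1 by rewrite -(mulrA 2) exprMn.
rewrite sumr_const card_ord -[_ *+ n.+1]mulr_natl -(mulrA M).
have n2 : n.+1%:R <= 2 ^+ n.+1 :> R by rewrite -natrX ler_nat ltnW // ltn_expl.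
have n1 : 1 <= 2 ^+ n.+1 :> R by rewrite exprn_ege1 //; lra.
have tn0 : 0 <= t ^+ n.+1 by apply: exprn_ge0.
have u1 : M * (t ^+ n.+1 * B) <= M * B * (2 ^+ n.+1 * t ^+ n.+1).
  have -> : M * (t ^+ n.+1 * B) = M * B * (1 * t ^+ n.+1) by ring.
  by apply: ler_wpM2l; [exact: mulr_ge0|apply: ler_wpM2r].
have u2 : n.+1%:R * (A0 * M * t ^+ n.+1) <= A0 * M * (2 ^+ n.+1 * t ^+ n.+1).
  have -> : n.+1%:R * (A0 * M * t ^+ n.+1) = A0 * M * (n.+1%:R * t ^+ n.+1) by ring.
  by apply: ler_wpM2l; [exact: mulr_ge0|apply: ler_wpM2r].
by rewrite (_ : (_ + _) * _ = M * B * (2 ^+ n.+1 * t ^+ n.+1) + A0 * M * (2 ^+ n.+1 * t ^+ n.+1)); [exact: lerD|ring].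
Qed.

Lemma analyticN f : analytic f -> analytic (fun h => - f h).
Proof.
move=> hf; apply: (analytic_eq (f := fun h => (-1) * f h)); first by move=> h; rewrite mulN1r.
exact: analyticM (analytic_const _) hf.
Qed.
Lemma analyticB f g : analytic f -> analytic g -> analytic (fun h => f h - g h).
Proof. by move=> hf hg; apply: analyticD => //; apply: analyticN. Qed.
Lemma analyticX f n : analytic f -> analytic (fun h => f h ^+ n).
Proof.
move=> hf; elim: n => [|n ih]; first exact: analytic_const.
apply: (analytic_eq (f := fun h => f h * f h ^+ n)); first by move=> h; rewrite exprS.
exact: analyticM.
Qed.

Lemma analytic_scale f c : analytic f -> analytic (fun h => f (c * h)).
Proof.
move=> [a [M [p [M0 p0 H]]]].
exists (fun k => a k * c ^+ k), M, (p * (cn c + 1)).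
have c0 := cn_ge0 c; have c1 : 0 < cn c + 1 by rewrite ltr_wpDl.
split => //; first exact: mulr_gt0.
move=> n h hh; have h0 := cn_ge0 h.
have le : p * cn (c * h) <= p * (cn c + 1) * cn h.
  by rewrite cnM -mulrA ler_pM2l // ler_wpM2r // lerDl.
have := H n (c * h) (le_lt_trans le hh).
rewrite (eq_bigr (fun k : 'I_n.+1 => a k * c ^+ k * h ^+ k)) => [h1|k _]; last by rewrite exprMn mulrA.
apply: le_trans h1 _; apply: ler_wpM2l => //; apply: lerXn2r => //; rewrite nnegrE.
  by apply: mulr_ge0; [exact: ltW|exact: cn_ge0].
by apply: mulr_ge0 => //; apply: mulr_ge0; exact: ltW.
Qed.

Lemma analytic_lip f : analytic f -> exists2 M : R, 0 <= M & near0 (fun h => cn (f h - f 0) <= M * cn h).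
Proof.
move=> [a ha]; have f0 := expands0 ha; have [M [p [M0 p0 H]]] := ha.
exists (M * p); first by apply: mulr_ge0 => //; apply: ltW.
exists p^-1; first by rewrite invr_gt0.
move=> h hh; have := H 0%N h; rewrite big_ord_recl big_ord0 expr0 mulr1 addr0 expr1 -f0 mulrA; apply.
by rewrite mulrC -ltr_pdivlMr // mul1r.
Qed.

Lemma analytic_cont f e : analytic f -> 0 < e -> near0 (fun h => cn (f h - f 0) < e).
Proof.
move=> /analytic_lip [M M0 [r r0 H]] e0.
have M1 : 0 < M + 1 by lra.
exists (Num.min r (e / (M + 1))); first by rewrite lt_min r0 divr_gt0.
move=> h; rewrite lt_min => /andP[h1 h2]; apply: le_lt_trans (H h h1) _.
have c0 := cn_ge0 h; rewrite ltr_pdivlMr // in h2.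
by apply: le_lt_trans h2; rewrite mulrC ler_wpM2l // lerDl.
Qed.

Lemma expands_factor f a : expands f a -> f 0 = 0 ->
  exists2 g, expands g (fun k => a k.+1) & forall h, f h = h * g h.
Proof.
move=> ha f0; have a0 := expands0 ha; rewrite f0 in a0.
exists (fun h => if h == 0 then a 1%N else f h / h); last first.
  by move=> h; case: eqP => [->|/eqP h0]; rewrite ?mul0r // mulrC divfK.
have [M [p [M0 p0 H]]] := ha; exists (M * p), p; split => //.
  by apply: mulr_ge0 => //; apply: ltW.
move=> n h hh; case: eqP => [->|/eqP h0].
  rewrite big_ord_recl /= expr0 mulr1 big1 => [|i _]; last by rewrite expr0n mulr0.
  by rewrite addr0 subrr cn0 mulr0 expr0n /= mulr0.
have hp : 0 < cn h by rewrite cn_gt0.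
rewrite -(ler_pM2r hp) -cnM mulrBl divfK // mulr_suml.
have -> : \sum_(i < n.+1) a i.+1 * h ^+ i * h = \sum_(i < n.+2) a i * h ^+ i.
  rewrite [RHS]big_ord_recl /= -a0 mul0r add0r; apply: eq_bigr => i _.
  by rewrite -mulrA -exprSr.
apply: le_trans (H n.+1 h hh) _.
by rewrite le_eqVlt; apply/orP; left; apply/eqP; rewrite [in LHS]exprSr; ring.
Qed.

Lemma analytic_factor f : analytic f -> f 0 = 0 ->
  exists2 g, analytic g & forall h, f h = h * g h.
Proof. by move=> [a ha] /(expands_factor ha) [g hg e]; exists g => //; exists (fun k => a k.+1). Qed.

Lemma small_pow_eq0 (x M t : R) : 0 <= x -> 0 <= t -> t <= 2^-1 ->
  (forall n : nat, x <= M * t ^+ n) -> x = 0.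
Proof.
move=> x0 t0 t2 H; apply/eqP; rewrite eq_le x0 andbT leNgt; apply/negP => xp.
have M0 : 0 < M by have := H 0%N; rewrite expr0 mulr1; apply: lt_le_trans.
have [n hn] : exists n : nat, M / x < n%:R.
  by exists (Num.bound (M / x)); apply: archi_boundP; apply: divr_ge0 => //; apply: ltW.
have := H n; apply/negP; rewrite -ltNge.
have tn : t ^+ n <= 2^-1 ^+ n by apply: lerXn2r => //; rewrite nnegrE // invr_ge0.
have n2 : n%:R < 2 ^+ n :> R by rewrite -natrX ltr_nat ltn_expl.
have p2 : 0 < 2 ^+ n :> R by apply: exprn_gt0.
apply: le_lt_trans (_ : M * 2^-1 ^+ n < x); first by apply: ler_wpM2l => //; apply: ltW.
rewrite exprVn ltr_pdivrMr // mulrC -ltr_pdivrMr //; exact: lt_trans hn n2.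
Qed.

(** If all Taylor coefficients vanish, the remainder bounds for all n force f = 0 near 0; otherwise
    factor out h up to the first nonzero coefficient. *)
Lemma analytic_order f : analytic f -> near0 (fun h => f h = 0) \/
  exists n g, [/\ analytic g, g 0 != 0 & forall h, f h = h ^+ n * g h].
Proof.
move=> [a ha]; have [allz|/existsNP [n0 hn0]] := EM (forall n, a n = 0).
  left; have [M [p [M0 p0 H]]] := ha; exists (2 * p)^-1; first by rewrite invr_gt0 mulr_gt0.
  move=> h hh; have c0 := cn_ge0 h.
  have t2 : p * cn h <= 2^-1.
    by move: hh; rewrite invfM -ltr_pdivrMr ?invr_gt0 // invrK mulrC => /ltW.
  have t0 : 0 <= p * cn h by apply: mulr_ge0 => //; apply: ltW.
  apply/eqP; rewrite -cn_eq0; apply/eqP.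
  apply: (@small_pow_eq0 _ (M + cn (f h)) (p * cn h)) => //; first exact: cn_ge0.
  case=> [|n]; first by rewrite expr0 mulr1 lerDr.
  have := H n h; rewrite big1 => [|i _]; last by rewrite allz mul0r.
  rewrite subr0 => h1; apply: le_trans (h1 _) _; first by apply: le_lt_trans t2 _; lra.
  by apply: ler_wpM2r; [exact: exprn_ge0|rewrite lerDl; exact: cn_ge0].
right; have exn : exists n, a n != 0 by exists n0; apply/eqP.
have [n an min] := ex_minnP exn.
exists n.
have : forall i, (i < n)%N -> a i = 0.
  by move=> i lt; apply/eqP; apply: contraTT lt => /min; rewrite -leqNgt.
elim: n f a ha an {exn min hn0} => [|n ih] f a ha an hz.
  by exists f; split; [exists a|rewrite (expands0 ha)|move=> h; rewrite expr0 mul1r].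
have f0 : f 0 = 0 by rewrite (expands0 ha) hz.
have [g hg e] := expands_factor ha f0.
have [q [q1 q2 q3]] := ih g _ hg an (fun i lt => hz i.+1 lt).
by exists q; split => // h; rewrite e q3 exprS mulrA.
Qed.

(** Write f(h) = f(0) + h^n g(h) with g(0) nonzero and solve h^n g(0) = s t f(0) for small t > 0: f
    moves in the prescribed direction s f(0) up to an error [d]. The directions 1 and -1 give the
    maximum and minimum principles. *)
Lemma analytic_not_extremal f (s : C) : analytic f -> f 0 != 0 -> cn s = 1 ->
  near0 (fun h => f h = f 0) \/
  forall r : R, 0 < r -> exists h, exists t : R, exists d : C,
    [/\ cn h < r, 0 < t, t <= 1, f h = f 0 * (1 + s * t%:C%C) + d & cn d <= cn (f 0) * (t / 2)].
Proof.
move=> hf f0 s1; have [hz|[n [g [hg g0 e]]]] := analytic_order (analyticB hf (analytic_const (f 0))).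
  by left; move: hz; apply: near0_imp => h /eqP; rewrite subr_eq0 => /eqP.
right => r r0.
have n0 : (0 < n)%N.
  case: n e => // e; move: (e 0); rewrite subrr expr0 mul1r => /esym/eqP.
  by rewrite (negPf g0).
pose z : C := n.-root (s * f 0 / g 0).
have zn : z ^+ n = s * f 0 / g 0 by rewrite rootCK.
have s0 : s != 0 by rewrite -cn_eq0 s1 oner_eq0.
have z0 : z != 0.
  by apply/eqP => z0; move/eqP: zn; rewrite z0 expr0n eqn0Ngt n0 /= eq_sym !mulf_eq0 invr_eq0 (negPf s0) (negPf f0) (negPf g0).
have zp : 0 < cn z by rewrite cn_gt0.
have g1 : 0 < cn (g 0) / 2 by rewrite divr_gt0 // cn_gt0.
have [q q0 hq] := analytic_cont hg g1.
pose m := Num.min 1 (Num.min r q / (2 * cn z)).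
have mz : 0 < Num.min r q / (2 * cn z) by rewrite divr_gt0 ?mulr_gt0 // lt_min r0.
have m0 : 0 < m by rewrite lt_min ltr01.
have mle : m * cn z < Num.min r q.
  have : m <= Num.min r q / (2 * cn z) by rewrite ge_min lexx orbT.
  rewrite ler_pdivlMr ?mulr_gt0 // => h.
  have : 0 < m * cn z by apply: mulr_gt0.
  have -> : m * cn z = m * (2 * cn z) / 2 by field.
  by rewrite ltr_pdivrMr // => h3; apply: le_lt_trans h _; rewrite ltr_pMr ?ltr1n // lt_min r0.
pose h := m%:C%C * z.
have ch : cn h = m * cn z by rewrite cnM cn_real gtr0_norm.
move: mle; rewrite lt_min -ch => /andP[hr hq'].
exists h, (m ^+ n), (h ^+ n * (g h - g 0)); split => //.
- exact: exprn_gt0.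
- by apply: exprn_ile1; [exact: ltW|rewrite ge_min lexx].
- have -> : f h = f 0 + h ^+ n * g h by rewrite -e; ring.
  have -> : h ^+ n = (m ^+ n)%:C%C * (s * f 0 / g 0) by rewrite exprMn zn rmorphXn.
  by field.
have -> : h ^+ n = (m ^+ n)%:C%C * (s * f 0 / g 0) by rewrite exprMn zn rmorphXn.
rewrite !cnM cnV cn_real s1 mul1r ger0_norm; last by apply: exprn_ge0; apply: ltW.
have := hq h hq'; set D := cn (g h - _) => hD.
have gp : 0 < cn (g 0) by rewrite cn_gt0.
have fp : 0 < cn (f 0) by rewrite cn_gt0.
have mp : 0 < m ^+ n by apply: exprn_gt0.
have -> : m ^+ n * (cn (f 0) / cn (g 0)) * D = (m ^+ n * cn (f 0)) * (D / cn (g 0)) by ring.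
have -> : cn (f 0) * (m ^+ n / 2) = (m ^+ n * cn (f 0)) * 2^-1 by ring.
apply: ler_wpM2l; first by apply: mulr_ge0; apply: ltW.
by rewrite ler_pdivrMr // mulrC; apply: ltW.
Qed.

Lemma analytic_max f : analytic f -> near0 (fun h => cn (f h) <= cn (f 0)) ->
  near0 (fun h => f h = f 0).
Proof.
move=> hf [r r0 hm]; have [f0|f0] := eqVneq (f 0) 0.
  exists r => // h /hm; rewrite f0 cn0 => h1; apply/eqP; rewrite -cn_eq0 eq_le h1; exact: cn_ge0.
have [//|/(_ r r0) [h [t [d [h1 h2 h3 h4 h5]]]]] := analytic_not_extremal hf f0 (cn1 R).
exfalso; have := hm h h1; rewrite h4 mul1r leNgt => /negP; apply.
have fp : 0 < cn (f 0) by rewrite cn_gt0.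
have e : cn (f 0 * (1 + t%:C%C)) = cn (f 0) * (1 + t).
  by rewrite cnM -(rmorph1 (real_complex R)) -rmorphD cn_real ger0_norm //; lra.
have := cnB_ge (f 0 * (1 + t%:C%C)) (- d); rewrite opprK cnN e => h6.
by apply: lt_le_trans h6; nra.
Qed.

Lemma analytic_min f : analytic f -> f 0 != 0 -> near0 (fun h => cn (f 0) <= cn (f h)) ->
  near0 (fun h => f h = f 0).
Proof.
move=> hf f0 [r r0 hm].
have s1 : cn (-1 : R[i]) = 1 by rewrite cnN cn1.
have [//|/(_ r r0) [h [t [d [h1 h2 h3 h4 h5]]]]] := analytic_not_extremal hf f0 s1.
exfalso; have := hm h h1; rewrite h4 mulN1r leNgt => /negP; apply.
have fp : 0 < cn (f 0) by rewrite cn_gt0.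
apply: le_lt_trans (cnD _ _) _.
have e : cn (f 0 * (1 - t%:C%C)) = cn (f 0) * (1 - t).
  by rewrite cnM -(rmorph1 (real_complex R)) -rmorphB cn_real ger0_norm //; lra.
by rewrite e; nra.
Qed.

Lemma analytic_eq0 f : analytic f -> (exists2 r : R, 0 < r & forall h, h != 0 -> cn h < r -> f h = 0) ->
  f 0 = 0.
Proof.
move=> hf [r r0 hz]; apply/eqP; rewrite -cn_eq0 eq_le cn_ge0 andbT leNgt; apply/negP => fp.
have [q q0 hq] := analytic_cont hf fp.
pose m := Num.min r q / 2; have mm : 0 < Num.min r q by rewrite lt_min r0.
have m0 : 0 < m by rewrite divr_gt0.
have cm : cn (m%:C%C : R[i]) = m by rewrite cn_real gtr0_norm.
have lt : m < Num.min r q by rewrite /m ltr_pdivrMr // ltr_pMr // ltr1n.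
move: lt; rewrite lt_min => /andP[l1 l2].
have := hq m%:C%C; rewrite cm => /(_ l2); rewrite hz ?cm // -?cn_eq0 ?cm ?gt_eqF //.
by rewrite sub0r cnN ltxx.
Qed.

End Germs.

(** * Sums over a lattice *)

Section UnorderedSums.
Variable R : realType.
Local Notation C := R[i].
Implicit Types (f g : C -> C) (J : {fset C}).

Definition sums f (S : C) := forall e : R, 0 < e -> exists J, forall J',
  fsubset J J' -> cn (\sum_(i <- J') f i - S) < e.

Definition csum f : C := summability.sum (f : C -> C^o).

Lemma sums_csum f S : sums f S -> csum f = S.
Proof.
move=> h; rewrite /csum /summability.sum; have pf : ProperFilter (@totally C) := @totally_filter C.
have ff : Filter (@totally C) := @filter_filter _ _ pf.
apply: (cvg_lim (@norm_hausdorff _ (C^o))).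
apply/cvgrPdist_lt => e e0.
have [er e1] : e = (complex.Re e)%:C%C /\ 0 < complex.Re e.
  by case: e e0 => x y; rewrite ltcE /= => /andP[/eqP -> hx].
have [J hJ] := h _ e1; exists J => //= J' hJ'.
have := hJ J' hJ'; rewrite /partial_sum big_seq_fsetE /= cn_distC => h2.
by rewrite er cnE ltcR.
Qed.

Lemma sums_uniq f S T : sums f S -> sums f T -> S = T.
Proof. by move=> /sums_csum <- /sums_csum. Qed.

Lemma sums_ext f g S : f =1 g -> sums f S -> sums g S.
Proof.
move=> e h r r0; have [J hJ] := h r r0; exists J => J' /hJ.
by rewrite (eq_bigr g) // => i _; rewrite e.
Qed.

Lemma sumsD f g S T : sums f S -> sums g T -> sums (fun w => f w + g w) (S + T).
Proof.
move=> hf hg e e0; have e2 : 0 < e / 2 by rewrite divr_gt0.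
have [J hJ] := hf _ e2; have [J1 hJ1] := hg _ e2; exists (fsetU J J1) => J' hJ'.
have h1 := hJ J' (fsubset_trans (fsubsetUl _ _) hJ').
have h2 := hJ1 J' (fsubset_trans (fsubsetUr _ _) hJ').
rewrite big_split /= opprD addrACA; apply: le_lt_trans (cnD _ _) _; lra.
Qed.

Lemma sumsZ c f S : sums f S -> sums (fun w => c * f w) (c * S).
Proof.
move=> hf e e0; have c1 : 0 < cn c + 1 by rewrite ltr_wpDl ?cn_ge0.
have [J hJ] := hf _ (divr_gt0 e0 c1); exists J => J' /hJ h.
rewrite -mulr_sumr -mulrBr cnM; rewrite ltr_pdivlMr // in h.
apply: le_lt_trans h; rewrite mulrC; apply: ler_wpM2l; first exact: cn_ge0.
by rewrite lerDl.
Qed.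

Lemma sums_le f S B : sums f S -> (forall J, cn (\sum_(i <- J) f i) <= B) -> cn S <= B.
Proof.
move=> h hB; rewrite leNgt; apply/negP => lt.
have e0 : 0 < cn S - B by rewrite subr_gt0.
have [J hJ] := h _ e0; have := hJ J (fsubset_refl J); rewrite cn_distC => h1.
have := cnB_ge S (\sum_(i <- J) f i); have := hB J => h2 h3.
by move: (lt_le_trans (le_lt_trans h3 h1) (lexx _)); lra.
Qed.

Lemma sums_bij f S (s t : C -> C) : cancel s t -> cancel t s ->
  sums f S -> sums (fun w => f (s w)) S.
Proof.
move=> st ts h e e0; have [J hJ] := h e e0.
exists [fset t x | x in J]%fset => J' hJ'.
have inj : injective s := can_inj st.
have := hJ [fset s x | x in J']%fset; rewrite big_imfset /=; last by move=> x y _ _; apply: inj.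
apply; apply/fsubsetP => x xJ; apply/imfsetP; exists (t x); rewrite ?ts //=.
by apply: (fsubsetP hJ'); apply/imfsetP; exists x.
Qed.

Lemma sums_single (a c : C) : sums (fun w => if w == a then c else 0) c.
Proof.
move=> e e0; exists [fset a]%fset => J' hJ'.
have aJ : a \in J' by apply: (fsubsetP hJ'); rewrite inE.
rewrite (bigD1_seq a) ?fset_uniq //= eqxx big1 ?addr0 ?subrr ?cn0 // => i ia.
by rewrite (negPf ia).
Qed.

Lemma sum_subset_le (g : C -> R) (s t : seq C) : (forall i, 0 <= g i) -> uniq s ->
  {subset s <= t} -> \sum_(i <- s) g i <= \sum_(i <- t) g i.
Proof.
move=> g0; elim: s t => [|x s ih] t /=.
  by move=> _ _; rewrite big_nil; apply: sumr_ge0.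
move=> /andP[xs us] sub; have xt : x \in t by apply: sub; rewrite mem_head.
rewrite big_cons (perm_big _ (perm_to_rem xt)) big_cons lerD2l; apply: ih => // y ys.
have : y \in t by apply: sub; rewrite in_cons ys orbT.
rewrite (perm_mem (perm_to_rem xt)) in_cons => /orP[/eqP e|//].
by move: xs; rewrite -e ys.
Qed.

Lemma sums_nonneg (g : C -> R) B : (forall i, 0 <= g i) ->
  (forall J, \sum_(i <- J) g i <= B) -> exists S, sums (fun w => (g w)%:C%C) S.
Proof.
move=> g0 hB; pose E : set R := [set x | exists J, x = \sum_(i <- J) g i]%classic.
have hs : has_sup E.
  split; first by exists (\sum_(i <- (fset0 : {fset C})) g i); exists fset0.
  by exists B => x [J ->].
exists (sup E)%:C%C => e e0; have [_ [J ->] hJ] := sup_adherent e0 hs.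
exists J => J' hJ'; rewrite -rmorph_sum -rmorphB cn_real.
have h1 : \sum_(i <- J) g i <= \sum_(i <- J') g i.
  by apply: sum_subset_le => //; [exact: fset_uniq|exact/fsubsetP].
have h2 : \sum_(i <- J') g i <= sup E by apply: ub_le_sup; [exact: hs.2|exists J'].
by rewrite ler0_norm ?subr_le0 //; lra.
Qed.

(** Split f into the positive and negative parts of its real and imaginary parts, whose partial sums
    are bounded by B. *)
Lemma abs_sums f B : (forall J, \sum_(i <- J) cn (f i) <= B) -> sums f (csum f).
Proof.
move=> hB; suff [S hS] : exists S, sums f S by rewrite (sums_csum hS).
have part (p : C -> R) : (forall z, `|p z| <= cn z) -> exists S, sums (fun w => (p (f w))%:C%C) S.
  move=> hp; have H (q : C -> R) : (forall z, 0 <= q z <= cn z) -> exists S, sums (fun w => (q (f w))%:C%C) S.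
    move=> hq; apply: (@sums_nonneg _ B) => [i|J]; first by have /andP[] := hq (f i).
    by apply: le_trans (hB J); apply: ler_sum => i _; have /andP[] := hq (f i).
  have [|S1 h1] := H (fun z => Num.max (p z) 0).
    move=> z; rewrite le_max lexx orbT /= ge_max cn_ge0 andbT.
    by apply: le_trans (hp z); apply: ler_norm.
  have [|S2 h2] := H (fun z => Num.max (- p z) 0).
    move=> z; rewrite le_max lexx orbT /= ge_max cn_ge0 andbT.
    by apply: le_trans (hp z); rewrite -normrN; apply: ler_norm.
  exists (S1 + (-1) * S2); apply: sums_ext (sumsD h1 (sumsZ (-1) h2)) => w.
  rewrite mulN1r -rmorphB; congr (_%:C%C).
  by case: (leP (p (f w)) 0) => h; case: (leP (- p (f w)) 0) => h'; lra.
have [S1 h1] := part (@complex.Re R) (@Re_le_cn R).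
have [S2 h2] := part (@complex.Im R) (@Im_le_cn R).
exists (S1 + 'i%C * S2); apply: sums_ext (sumsD h1 (sumsZ 'i%C h2)) => w.
by rewrite [RHS]complexE.
Qed.

End UnorderedSums.

Section LatticeSums.
Variables (R : realType) (tau : R[i]).
Hypothesis tau_up : 0 < complex.Im tau.
Local Notation C := R[i].
Implicit Types (f g : C -> C) (J : {fset C}).

Definition lat (w : C) : bool := w \in lattice tau.

Lemma latP w : reflect (exists m n : int, w = m%:~R + n%:~R * tau) (lat w).
Proof. by apply: (iffP idP) => [/set_mem|h] //; apply/mem_set. Qed.
Lemma lat0 : lat 0.
Proof. by apply/latP; exists 0, 0; rewrite mul0r addr0. Qed.
Lemma latB x y : lat x -> lat y -> lat (x - y).
Proof.
move=> /latP[m [n ->]] /latP[m' [n' ->]]; apply/latP; exists (m - m'), (n - n').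
by rewrite !intrB; ring.
Qed.
Lemma latN x : lat x = lat (- x).
Proof. by apply/idP/idP => h; [rewrite -sub0r|rewrite -(opprK x) -(sub0r (- x))]; apply: latB => //; apply: lat0. Qed.
Lemma latD x y : lat x -> lat y -> lat (x + y).
Proof. by move=> hx hy; rewrite -(opprK y); apply: latB => //; rewrite -latN. Qed.
Lemma latDr x y : lat y -> lat (x + y) = lat x.
Proof.
move=> hy; apply/idP/idP => h; last exact: latD.
by rewrite -(addrK y x); apply: latB.
Qed.
Lemma lat_subC x y : lat (x - y) = lat (y - x).
Proof. by rewrite latN opprB. Qed.

Lemma lattice_lower : exists2 c : R, 0 < c & forall m n : int,
  c * (`|m|%:~R + `|n|%:~R) <= cn (m%:~R + n%:~R * tau).
Proof.
pose y := complex.Im tau; pose D := 1 + (cn tau + 1) / y.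
have t0 := cn_ge0 tau.
have D0 : 0 < D by rewrite ltr_pwDl // divr_ge0 //; [exact: addr_ge0|exact: ltW].
exists D^-1; first by rewrite invr_gt0.
move=> m n; rewrite mulrC ler_pdivrMr //; set w := _ + _ : C.
have hn : `|n|%:~R * y <= cn w.
  apply: le_trans (Im_le_cn w).
  have -> : complex.Im w = n%:~R * y.
    rewrite /w -!(rmorph_int (real_complex R)) /y; case: (tau) => a b; simpc; by [].
  by rewrite normrM -intr_norm (gtr0_norm tau_up).
have hm : `|m|%:~R <= cn w + `|n|%:~R * cn tau.
  rewrite -!cn_int -cnM; have -> : m%:~R = w + - (n%:~R * tau) by rewrite /w addrK.
  by apply: le_trans (cnD _ _) _; rewrite cnN.
have hn' : `|n|%:~R <= cn w / y by rewrite ler_pdivlMr.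
have -> : cn w * D = cn w + cn w / y * cn tau + cn w / y by rewrite /D; ring.
apply: lerD => //; apply: le_trans hm _; rewrite lerD2l; exact: ler_wpM2r.
Qed.

(** Lattice points by absolute values and signs of their coefficients, with repetitions when a
    coefficient is 0; a finite box of naturals then covers a ball. *)
Definition quad (x : nat * nat * (bool * bool)) : C :=
  (-1) ^+ x.2.1 * x.1.1%:R + (-1) ^+ x.2.2 * x.1.2%:R * tau.

Definition box K : seq C := [seq quad (val x.1.1, val x.1.2, x.2) |
  x : 'I_K * 'I_K * (bool * bool)].

Lemma ball_box rho : exists K : nat, forall w, lat w -> cn w <= rho -> w \in box K.
Proof.
have [c c0 hc] := lattice_lower.
exists (Num.bound (`|rho| / c)) => w /latP[m [n e]] hw; set K := Num.bound _.
have hK : `|rho| / c < K%:R by apply: archi_boundP; rewrite divr_ge0 // ltW.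
have lt : `|m|%:~R + `|n|%:~R < K%:R :> R.
  apply: le_lt_trans hK; rewrite ler_pdivlMr // mulrC; apply: le_trans (hc m n) _.
  by rewrite -e; apply: le_trans hw (ler_norm _).
have lt' : (absz m + absz n < K)%N.
  by rewrite -(ltr_nat R) natrD !natr_absz; exact: lt.
have lm : (absz m < K)%N by apply: leq_ltn_trans lt'; rewrite leq_addr.
have ln : (absz n < K)%N by apply: leq_ltn_trans lt'; rewrite leq_addl.
apply/mapP; exists (Ordinal lm, Ordinal ln, ((m < 0)%R, (n < 0)%R)); first by rewrite mem_enum.
rewrite e /quad /=; have sgn (k : int) : k%:~R = (-1) ^+ (k < 0)%R * (absz k)%:R :> C.
  by rewrite {1}(intEsign k) intrM rmorphXn /= rmorphN1 -pmulrn.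
by rewrite -!sgn.
Qed.

(** The comparison series |w|^(-3); its value 1 at 0 lets one constant dominate the term at w = 0 as
    well. *)
Definition weight (w : C) : R :=
  if lat w then (if w == 0 then 1 else (cn w ^+ 3)^-1) else 0.

Lemma weight_ge0 w : 0 <= weight w.
Proof. by rewrite /weight; case: ifP => // _; case: ifP => // _; rewrite invr_ge0 exprn_ge0 // cn_ge0. Qed.

(** For x >= 1, 1/x^3 is at most 4/3 times 1/x^2 - 1/(x+1)^2, and the sum telescopes. *)
Lemma cube_sum a K : \sum_(b < K) ((1 + a%:R + b%:R) ^+ 3)^-1 <= 4 / 3 * ((1 + a%:R) ^+ 2)^-1 :> R.
Proof.
have a0 : 0 <= a%:R :> R by [].
suff H : \sum_(b < K) ((1 + a%:R + b%:R) ^+ 3)^-1 <=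
    4 / 3 * (((1 + a%:R) ^+ 2)^-1 - ((1 + a%:R + K%:R) ^+ 2)^-1) :> R.
  apply: le_trans H _; apply: ler_wpM2l; first by rewrite divr_ge0.
  by rewrite gerBl invr_ge0 exprn_ge0 // !addr_ge0.
elim: K => [|K ih]; first by rewrite big_ord0 addr0 subrr mulr0.
rewrite big_ord_recr /=; apply: le_trans (lerD ih (lexx _)) _.
have x1 : 1 <= 1 + a%:R + K%:R :> R by rewrite -addrA lerDl addr_ge0.
rewrite -[K.+1%:R]natr1 addrA; set x := 1 + a%:R + K%:R in x1 *.
rewrite -subr_ge0.
have -> : 4 / 3 * (((1 + a%:R) ^+ 2)^-1 - ((x + 1) ^+ 2)^-1) -
   (4 / 3 * (((1 + a%:R) ^+ 2)^-1 - (x ^+ 2)^-1) + (x ^+ 3)^-1) =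
   (5 * x ^+ 2 - 2 * x - 3) / (3 * x ^+ 3 * (x + 1) ^+ 2).
  have n1 : 1 + a%:R != 0 :> R by rewrite gt_eqF // ltr_wpDr.
  have n2 : x != 0 by rewrite gt_eqF //; lra.
  have n3 : x + 1 != 0 by rewrite gt_eqF //; lra.
  by field; rewrite ?n1 ?n2 ?n3.
by rewrite divr_ge0 //; [nra|rewrite !mulr_ge0 ?exprn_ge0 //; lra].
Qed.

Lemma square_sum K : \sum_(a < K) ((1 + a%:R) ^+ 2)^-1 <= 2 :> R.
Proof.
suff H : \sum_(a < K) ((1 + a%:R) ^+ 2)^-1 <= 2 * (1 - (1 + K%:R)^-1) :> R.
  apply: le_trans H _; have : 0 <= (1 + K%:R)^-1 :> R by rewrite invr_ge0 addr_ge0.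
  lra.
elim: K => [|K ih]; first by rewrite big_ord0 addr0 invr1 subrr mulr0.
rewrite big_ord_recr /=; apply: le_trans (lerD ih (lexx _)) _.
have x1 : 1 <= 1 + K%:R :> R by rewrite lerDl.
rewrite -[K.+1%:R]natr1 addrA; set x := 1 + K%:R in x1 *.
rewrite -subr_ge0.
have -> : 2 * (1 - (x + 1)^-1) - (2 * (1 - x^-1) + (x ^+ 2)^-1) = (x - 1) / (x ^+ 2 * (x + 1)).
  have n2 : x != 0 by rewrite gt_eqF //; lra.
  have n3 : x + 1 != 0 by rewrite gt_eqF //; lra.
  by field; rewrite ?n2 ?n3.
by rewrite divr_ge0 //; [lra|rewrite mulr_ge0 ?exprn_ge0 //; lra].
Qed.

Lemma weight_bound : exists2 B : R, 0 <= B & forall J, \sum_(w <- J) weight w <= B.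
Proof.
have [c c0 hc] := lattice_lower.
pose D : R := 1 + 8 / c ^+ 3.
have D0 : 0 <= D by rewrite addr_ge0 // divr_ge0 // exprn_ge0 // ltW.
(* Four choices of signs, and 8/3 is the 4/3 of [cube_sum] times the 2 of [square_sum]. *)
exists (4 * (D * (8 / 3))) => [|J]; first by rewrite !mulr_ge0.
pose rho := \sum_(w <- J) cn w.
have [K hK] := ball_box rho.
pose s := [seq w <- J | lat w].
have sE : \sum_(w <- J) weight w = \sum_(w <- s) weight w.
  rewrite /s big_filter [RHS]big_mkcond /=; apply: eq_bigr => w _.
  by rewrite /weight; case: (lat w).
have sub : {subset s <= box K}.
  move=> w; rewrite mem_filter => /andP[lw wJ]; apply: hK => //.
  rewrite /rho (bigD1_seq w) ?fset_uniq //= lerDl; apply: sumr_ge0 => i _; exact: cn_ge0.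
rewrite sE; apply: le_trans (sum_subset_le weight_ge0 (filter_uniq _ (fset_uniq J)) sub) _.
have wq x : weight (quad x) <= D * ((1 + x.1.1%:R + x.1.2%:R) ^+ 3)^-1.
  case: x => [[a b] [s1 s2]] /=; rewrite /weight; case: ifP => _; last first.
    by rewrite mulr_ge0 // invr_ge0 exprn_ge0 // !addr_ge0.
  have hq : c * (a%:R + b%:R) <= cn (quad (a, b, (s1, s2))).
    have := hc ((-1) ^+ s1 * a%:Z) ((-1) ^+ s2 * b%:Z).
    have an (e : bool) (k : nat) : `|(-1) ^+ e * k%:Z| = k%:Z by rewrite normrMsign.
    have ai (e : bool) (k : nat) : ((-1) ^+ e * k%:Z)%:~R = (-1) ^+ e * k%:R :> C.
      by rewrite intrM rmorph_sign -pmulrn.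
    by rewrite !an !ai.
  case: (posnP (a + b)) => [/eqP|ab].
    rewrite addn_eq0 => /andP[/eqP -> /eqP ->].
    by rewrite /quad /= !mulr0 mul0r addr0 eqxx !addr0 expr1n invr1 mulr1 lerDl divr_ge0 // exprn_ge0 // ltW.
  set q := quad _ in hq *.
  have ab1 : 1 <= a%:R + b%:R :> R by rewrite -natrD ler1n.
  have q0 : 0 < cn q by apply: lt_le_trans hq; rewrite mulr_gt0 //; lra.
  rewrite -cn_eq0 gt_eqF //.
  have t0 : 0 < a%:R + b%:R :> R by lra.
  apply: le_trans (_ : ((c * (a%:R + b%:R)) ^+ 3)^-1 <= _).
    rewrite lef_pV2 ?posrE ?exprn_gt0 // ?mulr_gt0 //.
    by apply: lerXn2r => //; rewrite nnegrE ltW // mulr_gt0.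
  apply: le_trans (_ : 8 / c ^+ 3 * ((1 + a%:R + b%:R) ^+ 3)^-1 <= _); last first.
    apply: ler_wpM2r; first by rewrite invr_ge0 exprn_ge0 // !addr_ge0.
    by rewrite /D lerDr.
  have t1 : 0 < 1 + a%:R + b%:R :> R by rewrite -addrA; lra.
  have -> : 8 / c ^+ 3 * ((1 + a%:R + b%:R) ^+ 3)^-1 = ((c * ((1 + a%:R + b%:R) / 2)) ^+ 3)^-1.
    by field; rewrite ?gt_eqF.
  rewrite lef_pV2 ?posrE ?exprn_gt0 ?mulr_gt0 ?divr_gt0 //.
  apply: lerXn2r; rewrite ?nnegrE; [by rewrite ltW // mulr_gt0 // divr_gt0|by rewrite ltW // mulr_gt0|].
  by apply: ler_wpM2l; [exact: ltW|lra].
rewrite /box big_image /=.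
apply: le_trans (_ : \sum_(x : 'I_K * 'I_K * (bool * bool)) D * ((1 + (val x.1.1)%:R + (val x.1.2)%:R) ^+ 3)^-1 <= _).
  by apply: ler_sum => x _; exact: (wq (val x.1.1, val x.1.2, x.2)).
rewrite -(pair_bigA _ (fun (p : 'I_K * 'I_K) (q : bool * bool) => D * ((1 + (val p.1)%:R + (val p.2)%:R) ^+ 3)^-1)) /=.
under eq_bigr do rewrite sumr_const card_prod card_bool.
rewrite sumrMnl; have -> : 4 * (D * (8 / 3)) = D * (8 / 3) *+ (2 * 2) by rewrite -[RHS]mulr_natl.
apply: ler_wMn2r; rewrite -mulr_sumr; apply: ler_wpM2l => //.
rewrite -(pair_bigA _ (fun (a b : 'I_K) => ((1 + (val a)%:R + (val b)%:R) ^+ 3)^-1)) /=.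
apply: le_trans (_ : \sum_(a < K) 4 / 3 * ((1 + a%:R) ^+ 2)^-1 <= _).
  by apply: ler_sum => a _; apply: cube_sum.
rewrite -mulr_sumr; have := square_sum K; lra.
Qed.

Definition dom f (D : R) := forall w, cn (f w) <= D * weight w.

Lemma dom_sums f D : 0 <= D -> dom f D -> sums f (csum f).
Proof.
move=> D0 h; have [B B0 hB] := weight_bound.
apply: (@abs_sums _ _ (D * B)) => J; apply: le_trans (ler_wpM2l D0 (hB J)).
by rewrite mulr_sumr; apply: ler_sum.
Qed.

Lemma csum_bound : exists2 B : R, 0 <= B & forall f D, 0 <= D -> dom f D -> cn (csum f) <= D * B.
Proof.
have [B B0 hB] := weight_bound; exists B => // f D D0 h.
apply: (sums_le (dom_sums D0 h)) => J; apply: le_trans (cn_sum _ _ _) _.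
apply: le_trans (ler_wpM2l D0 (hB J)); rewrite mulr_sumr; exact: ler_sum.
Qed.

Lemma discrete_list (s : seq C) u : exists2 d : R, 0 < d & forall w, w \in s -> w != u -> d <= cn (u - w).
Proof.
elim: s => [|x s [d d0 h]]; first by exists 1.
have [->|xu] := eqVneq x u.
  by exists d => // w; rewrite in_cons => /orP[/eqP ->|/h //]; rewrite eqxx.
exists (Num.min d (cn (u - x))); first by rewrite lt_min d0 cn_gt0 subr_eq0 eq_sym.
move=> w; rewrite in_cons => /orP[/eqP -> _|ws wu]; first by rewrite ge_min lexx orbT.
by rewrite ge_min h.
Qed.

(** Beyond the radius 2 |u| + 1 one has |u - w| >= |w| / 2; the finitely many lattice points within
    it, other than u, keep a positive distance d from u. *)
Lemma lat_sep u : exists d D : R, [/\ 0 < d, 0 <= D & forall w, lat w -> w != u ->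
  d <= cn (u - w) /\ (cn (u - w) ^+ 3)^-1 <= D * weight w].
Proof.
have u0 := cn_ge0 u; pose rho := 2 * cn u + 1; have r1 : 1 <= rho by rewrite lerDr mulr_ge0.
have r0 : 0 < rho by lra.
have [K hK] := ball_box rho; have [d d0 hd] := discrete_list (box K) u.
exists (Num.min d 2^-1), (8 + rho ^+ 3 / d ^+ 3).
have D1 : 0 <= rho ^+ 3 / d ^+ 3 by rewrite divr_ge0 // exprn_ge0 // ltW.
split; [by rewrite lt_min d0 invr_gt0 ltr0n|exact: addr_ge0|move=> w lw wu].
have [le|lt] := leP (cn w) rho.
  have dw := hd w (hK w lw le) wu; split; first by rewrite ge_min dw.
  rewrite mulrDl; apply: le_trans (_ : rho ^+ 3 / d ^+ 3 * weight w <= _); last first.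
    by rewrite lerDr mulr_ge0 // weight_ge0.
  have wr : (rho ^+ 3)^-1 <= weight w.
    rewrite /weight lw; case: eqVneq => [_|w0].
      by rewrite invf_le1 ?exprn_gt0 // exprn_ege1.
    have w1 : 0 < cn w by rewrite cn_gt0.
    rewrite lef_pV2 ?posrE ?exprn_gt0 //; apply: lerXn2r => //; rewrite nnegrE ltW //.
  apply: le_trans (_ : (d ^+ 3)^-1 <= _).
    have dp := lt_le_trans d0 dw.
    rewrite lef_pV2 ?posrE ?exprn_gt0 //; apply: lerXn2r => //; rewrite nnegrE ltW //.
  apply: le_trans (ler_wpM2l D1 wr).
  by rewrite le_eqVlt; apply/orP; left; apply/eqP; field; rewrite ?gt_eqF.
have h1 : cn w / 2 <= cn (u - w).
  by have := cnB_ge w u; rewrite cn_distC; rewrite /rho in lt; lra.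
have w1 : 0 < cn w by lra.
split; first by rewrite ge_min; apply/orP; right; lra.
rewrite /weight lw -cn_eq0 gt_eqF // mulrDl.
apply: le_trans (_ : 8 * (cn w ^+ 3)^-1 <= _); last first.
  by rewrite lerDl mulr_ge0 // invr_ge0 exprn_ge0 // ltW.
have -> : 8 * (cn w ^+ 3)^-1 = ((cn w / 2) ^+ 3)^-1 by field; rewrite gt_eqF.
have p2 : 0 < cn w / 2 by rewrite divr_gt0.
rewrite lef_pV2 ?posrE ?exprn_gt0 //; last exact: lt_le_trans h1.
apply: lerXn2r => //; rewrite nnegrE ltW //; exact: lt_le_trans h1.
Qed.

Lemma lat_isolated u : exists2 d : R, 0 < d & forall h, h != 0 -> cn h < d -> ~~ lat (u + h).
Proof.
have [d [D [d0 _ H]]] := lat_sep u; exists d => // h h0 hd; apply/negP => l.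
have [|+ _] := H _ l; first by rewrite -subr_eq0 addrAC subrr add0r.
by rewrite opprD addNKr cnN leNgt hd.
Qed.

End LatticeSums.

Section Expansions.
Variable R : realType.
Local Notation C := R[i].

Lemma expands_step (f : C -> C) a : expands f a ->
  exists2 g, expands g (fun k => a k.+1) & forall h, f h = a 0%N + h * g h.
Proof.
move=> ha; pose a' k := if k == 0%N then 0 else a k.
have ha' : expands (fun h => f h - a 0%N) a'.
  have [M [p [M0 p0 H]]] := ha; exists M, p; split => // n h hh.
  apply: le_trans (H n h hh); rewrite !big_ord_recl /= mul0r add0r expr0 mulr1 opprD addrA.
  exact: lexx.
have f00 : f 0 - a 0%N = 0 by rewrite (expands0 ha) subrr.
have [g hg e] := expands_factor ha' f00.
by exists g => // h; rewrite -e addrC subrK.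
Qed.

End Expansions.

(** * Expansions and periodicity of the Weierstrass function *)

Section Weierstrass.
Variables (R : realType) (tau : R[i]).
Hypothesis tau_up : 0 < complex.Im tau.
Local Notation C := R[i].
Local Notation L := (lat tau).
Local Notation P := (wp (lattice tau)).
Implicit Types (f g : C -> C).

Lemma csum_ext f g : f =1 g -> csum f = csum g.
Proof. by move=> e; rewrite (funext e). Qed.

(** Omitting the term w = u, which is singular at h = 0 when u is a period, lets one expansion serve
    both poles and regular points. *)
Definition rterm u h w : C := if L w && (w != u) then ((u + h - w) ^+ 2)^-1 - (w ^+ 2)^-1 else 0.
Definition reg u h : C := csum (rterm u h).
Definition ct (k : nat) u w : C := if L w && (w != u) then
  (if k == 0%N then ((u - w) ^+ 2)^-1 - (w ^+ 2)^-1 else (-1) ^+ k * k.+1%:R / (u - w) ^+ k.+2) else 0.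
(** The Taylor remainder of 1 / (a + h)^2 at a = u - w in closed form, so that expansion and
    summation are exchanged by bounding one explicit term. *)
Definition rem_term n u h w : C := if L w && (w != u) then
  (- h) ^+ n.+1 * (n.+2%:R * (u - w) + n.+1%:R * h) / ((u - w) ^+ n.+2 * (u - w + h) ^+ 2) else 0.

Lemma ct_dom u k : exists2 D : R, 0 <= D & dom tau (ct k u) D.
Proof.
have [d [D [d0 D0 H]]] := lat_sep tau_up u; case: k => [|k].
  have c0 := cn_ge0 u.
  exists (2 * cn u * (D + 1) + (cn u ^+ 2)^-1) => [|w].
    by rewrite addr_ge0 ?invr_ge0 ?exprn_ge0 // !mulr_ge0 // addr_ge0.
  rewrite /ct; case: ifP => [/andP[lw wu]|_]; last first.
    rewrite cn0 mulr_ge0 ?weight_ge0 // addr_ge0 ?invr_ge0 ?exprn_ge0 // !mulr_ge0 // addr_ge0 //.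
  have [hd hD] := H w lw wu; have ww := weight_ge0 tau w.
  have [w0|w0] := eqVneq w 0.
    rewrite w0 subr0 expr0n invr0 subr0 cnV cnX /weight lat0 eqxx mulr1 lerDr.
    by rewrite !mulr_ge0 // addr_ge0.
  set a := u - w in hd hD *; have ap : 0 < cn a by apply: lt_le_trans hd.
  have a0 : a != 0 by rewrite -cn_gt0.
  have wp0 : 0 < cn w by rewrite cn_gt0.
  (* Factoring out u shows decay like |w|^(-3); the mixed terms are bounded by 2 (x^3 + y^3)
     below. *)
  have -> : (a ^+ 2)^-1 - (w ^+ 2)^-1 = u * ((a ^+ 2)^-1 * w^-1 - a^-1 * (w ^+ 2)^-1).
    have -> : u = a + w by rewrite subrK.
    by field; rewrite a0 w0.
  have wE : (cn w ^+ 3)^-1 = weight tau w by rewrite /weight lw (negPf w0).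
  rewrite cnM.
  have b1 : cn ((a ^+ 2)^-1 * w^-1 - a^-1 * (w ^+ 2)^-1) <=
     ((cn a)^-1 ^+ 2 * (cn w)^-1) + (cn a)^-1 * (cn w)^-1 ^+ 2.
    by apply: le_trans (cnD _ _) _; rewrite cnN !cnM !cnV !cnX -!exprVn.
  have x0 : 0 < (cn a)^-1 by rewrite invr_gt0.
  have y0 : 0 < (cn w)^-1 by rewrite invr_gt0.
  rewrite -exprVn in hD; rewrite -exprVn in wE.
  move: b1 hD wE; set x := (cn a)^-1 in x0 *; set y := (cn w)^-1 in y0 * => b1 hD wE.
  have b2 : x ^+ 2 * y + x * y ^+ 2 <= 2 * (x ^+ 3 + y ^+ 3).
    have : 0 <= (x - y) ^+ 2 * (x + y) by rewrite mulr_ge0 ?sqr_ge0 // ltW // addr_gt0.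
    have : 0 <= x ^+ 3 by rewrite exprn_ge0 // ltW.
    have : 0 <= y ^+ 3 by rewrite exprn_ge0 // ltW.
    have -> : (x - y) ^+ 2 * (x + y) = x ^+ 3 + y ^+ 3 - (x ^+ 2 * y + x * y ^+ 2) by ring.
    lra.
  apply: le_trans (_ : cn u * (2 * (D * weight tau w + weight tau w)) <= _).
    apply: ler_wpM2l => //; apply: le_trans b1 _; apply: le_trans b2 _.
    by apply: ler_wpM2l => //; rewrite wE; apply: lerD.
  have : 0 <= (cn u ^+ 2)^-1 * weight tau w by rewrite mulr_ge0 // invr_ge0 exprn_ge0.
  by rewrite mulrDl => h; rewrite -subr_ge0; move: h; congr (0 <= _); ring.
exists (k.+2%:R * d^-1 ^+ k * D) => [|w]; first by rewrite !mulr_ge0 // exprn_ge0 // invr_ge0 ltW.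
rewrite /ct; case: ifP => [/andP[lw wu]|_]; last first.
  by rewrite cn0 !mulr_ge0 ?weight_ge0 // exprn_ge0 // invr_ge0 ltW.
have [hd hD] := H w lw wu; have ap := lt_le_trans d0 hd.
rewrite /= !cnM cnX cnN cn1 expr1n mul1r cn_nat cnV cnX -exprVn.
have -> : (cn (u - w))^-1 ^+ k.+3 = (cn (u - w))^-1 ^+ k * (cn (u - w))^-1 ^+ 3 by rewrite -exprD addn3.
rewrite -exprVn in hD; rewrite -!mulrA; apply: ler_wpM2l => //.
apply: ler_pM => //; try by rewrite exprn_ge0 // invr_ge0 ltW.
by apply: lerXn2r; [rewrite nnegrE invr_ge0 ltW|rewrite nnegrE invr_ge0 ltW|rewrite lef_pV2 // posrE].
Qed.

Lemma rem_termE n u h w : L w -> w != u -> u - w + h != 0 ->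
  ((u + h - w) ^+ 2)^-1 - (w ^+ 2)^-1 = \sum_(k < n.+1) ct k u w * h ^+ k + rem_term n u h w.
Proof.
move=> lw wu ah; have a0 : u - w != 0 by rewrite subr_eq0 eq_sym.
have ctE k : ct k u w = if k == 0%N then ((u - w) ^+ 2)^-1 - (w ^+ 2)^-1 else (-1) ^+ k * k.+1%:R / (u - w) ^+ k.+2.
  by rewrite /ct lw wu.
rewrite /rem_term lw wu /= (addrAC u h); move: (u - w) ctE a0 ah => a ctE a0 ah.
elim: n => [|n ih].
  rewrite big_ord1 ctE /= expr0 mulr1; move: (w ^+ 2)^-1 => y.
  by field; rewrite a0 ah.
rewrite ih [in RHS]big_ord_recr /= -addrA; congr (_ + _); rewrite ctE /=.
have an : a ^+ n.+2 != 0 by rewrite expf_neq0.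
rewrite (exprS (- h) n.+1) (exprS a n.+2) (exprNn h n.+1) -[n.+3%:R]natr1 -[n.+2%:R]natr1.
move: (a ^+ n.+2) an (h ^+ n.+1) ((-1) ^+ n.+1 : C) (n.+1%:R : C) => A A0 H e N.
by field; rewrite a0 ah A0.
Qed.

Lemma three_pow2_ge n : (n.+2 + n.+1 <= 3 * 2 ^ n)%N.
Proof. by elim: n => // n; rewrite expnS; move: (2 ^ n)%N => x; lia. Qed.

Lemma rem_dom u : exists d D : R, [/\ 0 < d, 0 <= D & forall n h, cn h < d / 2 ->
  (forall w, L w -> w != u -> u - w + h != 0) /\
  dom tau (rem_term n u h) (12 * D * cn h * (2 * cn h / d) ^+ n)].
Proof.
have [d [D [d0 D0 H]]] := lat_sep tau_up u; exists d, D; split => // n h hh.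
have h0 := cn_ge0 h.
have half w : L w -> w != u -> cn (u - w) / 2 <= cn (u - w + h).
  move=> lw wu; have [hd _] := H w lw wu.
  by have := cnB_ge (u - w) (- h); rewrite opprK cnN; lra.
split=> [w lw wu|w].
  rewrite -cn_gt0; apply: lt_le_trans (half w lw wu).
  by have [hd _] := H w lw wu; rewrite divr_gt0 //; apply: lt_le_trans hd.
have q0 : 0 <= 12 * D * cn h * (2 * cn h / d) ^+ n.
  by rewrite !mulr_ge0 // exprn_ge0 // divr_ge0 ?mulr_ge0 // ltW.
rewrite /rem_term; case: ifP => [/andP[lw wu]|_]; last by rewrite cn0 mulr_ge0 ?weight_ge0.
have [hd hD] := H w lw wu; have hf := half w lw wu.
set a := u - w in hd hD hf *; have ap : 0 < cn a by apply: lt_le_trans hd.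
have ahp : 0 < cn (a + h) by apply: lt_le_trans hf; rewrite divr_gt0.
have ha : cn h <= cn a by lra.
have -> : cn ((- h) ^+ n.+1 * (n.+2%:R * a + n.+1%:R * h) / (a ^+ n.+2 * (a + h) ^+ 2)) =
    cn h ^+ n.+1 * cn (n.+2%:R * a + n.+1%:R * h) / (cn a ^+ n.+2 * cn (a + h) ^+ 2).
  by rewrite cnM cnV (cnM ((- h) ^+ n.+1)) (cnX (- h)) cnN (cnM (a ^+ n.+2)) (cnX a) (cnX (a + h)).
have b1 : cn (n.+2%:R * a + n.+1%:R * h) <= 3 * 2 ^+ n * cn a.
  apply: le_trans (cnD _ _) _; rewrite (cnM _ a) (cnM _ h) !cn_nat.
  apply: le_trans (_ : (n.+2%:R + n.+1%:R) * cn a <= _).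
    by rewrite [leRHS]mulrDl lerD2l ler_wpM2l.
  apply: ler_wpM2r; first exact: ltW.
  by rewrite -natrD -natrX -natrM ler_nat three_pow2_ge.
have b2 : (cn (a + h) ^+ 2)^-1 <= 4 * ((cn a) ^+ 2)^-1.
  have -> : 4 * ((cn a) ^+ 2)^-1 = ((cn a / 2) ^+ 2)^-1 by field; rewrite gt_eqF.
  rewrite lef_pV2 ?posrE ?exprn_gt0 ?divr_gt0 //.
  by apply: lerXn2r => //; rewrite nnegrE ltW // divr_gt0.
have i0 : 0 < (cn a)^-1 by rewrite invr_gt0.
have id0 : 0 < d^-1 by rewrite invr_gt0.
rewrite invfM.
apply: le_trans (_ : cn h ^+ n.+1 * (3 * 2 ^+ n * cn a) * ((cn a ^+ n.+2)^-1 * (4 * (cn a ^+ 2)^-1)) <= _).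
  apply: ler_pM; rewrite ?mulr_ge0 ?exprn_ge0 ?invr_ge0 ?exprn_ge0 ?cn_ge0 //.
    by apply: ler_wpM2l => //; rewrite exprn_ge0.
  by apply: ler_wpM2l => //; rewrite invr_ge0 exprn_ge0 // ltW.
have -> : cn h ^+ n.+1 * (3 * 2 ^+ n * cn a) * ((cn a ^+ n.+2)^-1 * (4 * (cn a ^+ 2)^-1)) =
    (12 * cn h * (2 * cn h) ^+ n) * ((cn a)^-1 ^+ n * (cn a ^+ 3)^-1).
  rewrite !exprS exprMn exprVn; have an : cn a ^+ n != 0 by rewrite expf_neq0 // gt_eqF.
  move: (cn a ^+ n) an => A A0; field; rewrite A0 ?gt_eqF //.
have -> : 12 * D * cn h * (2 * cn h / d) ^+ n * weight tau w =
   (12 * cn h * (2 * cn h) ^+ n) * (d^-1 ^+ n * (D * weight tau w)).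
  by rewrite exprMn; ring.
apply: ler_wpM2l; first by rewrite !mulr_ge0 // exprn_ge0 // mulr_ge0.
apply: ler_pM => //; rewrite ?exprn_ge0 ?invr_ge0 ?exprn_ge0 ?(ltW ap) //.
by apply: lerXn2r; [rewrite nnegrE ltW|rewrite nnegrE ltW|rewrite lef_pV2 // posrE].
Qed.

Lemma sums_ct u h n : sums (fun w => \sum_(k < n) ct k u w * h ^+ k) (\sum_(k < n) csum (ct k u) * h ^+ k).
Proof.
elim: n => [|n ih].
  by apply: (sums_ext (f := fun=> 0)) => [w|e e0]; [rewrite big_ord0|exists fset0 => J' _; rewrite big1 // big_ord0 subrr cn0].
have [D D0 hD] := ct_dom u n.
rewrite big_ord_recr /= [csum _ * _]mulrC.
apply: sums_ext (sumsD ih (sumsZ (h ^+ n) (dom_sums tau_up D0 hD))) => w.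
by rewrite big_ord_recr /= [h ^+ n * _]mulrC.
Qed.

Lemma reg_expands u : expands (reg u) (fun k => csum (ct k u)) /\
  near0 (fun h => sums (rterm u h) (reg u h)).
Proof.
have [d [D [d0 D0 H]]] := rem_dom u; have [B B0 hB] := csum_bound tau_up.
have key n h : cn h < d / 2 -> sums (rterm u h)
    (\sum_(k < n.+1) csum (ct k u) * h ^+ k + csum (rem_term n u h)).
  move=> hh; have [nz hdom] := H n h hh.
  have q0 : 0 <= 12 * D * cn h * (2 * cn h / d) ^+ n.
    by rewrite !mulr_ge0 ?cn_ge0 // exprn_ge0 // divr_ge0 ?mulr_ge0 ?cn_ge0 // ltW.
  apply: sums_ext (sumsD (sums_ct u h n.+1) (dom_sums tau_up q0 hdom)) => w.
  rewrite /rterm; case: (boolP (L w && (w != u))) => [/andP[lw wu]|nw].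
    by rewrite (rem_termE n lw wu) // nz.
  by rewrite /rem_term (negPf nw) addr0 big1 // => k _; rewrite /ct (negPf nw) mul0r.
split; last first.
  exists (d / 2) => [|h hh]; first by rewrite divr_gt0.
  by rewrite /reg (sums_csum (key 0%N h hh)); apply: key.
exists (6 * D * B * d), (2 / d); split; [by rewrite !mulr_ge0 // ltW|by rewrite divr_gt0|].
move=> n h; have h0 := cn_ge0 h.
have -> : 2 / d * cn h = 2 * cn h / d by ring.
rewrite ltr_pdivrMr // mul1r => hh.
have hh' : cn h < d / 2 by lra.
rewrite {1}/reg (sums_csum (key n h hh')) addrC addKr.
have q0 : 0 <= 12 * D * cn h * (2 * cn h / d) ^+ n.
  by rewrite !mulr_ge0 // exprn_ge0 // divr_ge0 ?mulr_ge0 // ltW.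
apply: le_trans (hB _ _ q0 (proj2 (H n h hh'))) _.
rewrite exprS le_eqVlt; apply/orP; left; apply/eqP.
by move: ((2 * cn h / d) ^+ n) => X; field; rewrite gt_eqF.
Qed.

Lemma reg_analytic u : analytic (reg u).
Proof. by have [h _] := reg_expands u; eexists; exact: h. Qed.

Lemma wp_pole h : P h = (h ^+ 2)^-1 + reg 0 h.
Proof.
rewrite /wp; congr (_ + _); apply: (csum_ext (g := rterm 0 h)) => w.
by rewrite /rterm add0r.
Qed.

(** As the inverse of 0 is 0, the term at w = 0 is 1 / z^2, and the Weierstrass function becomes a
    single sum over the lattice. *)
Definition fterm z w : C := if L w then ((z - w) ^+ 2)^-1 - (w ^+ 2)^-1 else 0.

Lemma rterm_fterm u h : ~~ L u -> rterm u h =1 fterm (u + h).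
Proof.
move=> nu w; rewrite /rterm /fterm; case: (boolP (L w)) => //= lw; case: eqVneq => // e.
by move: nu; rewrite -e lw.
Qed.

Lemma wp_reg u : ~~ L u -> near0 (fun h => sums (fterm (u + h)) (P (u + h)) /\ P (u + h) = reg u h).
Proof.
move=> nu; have [_ hs] := reg_expands u; apply: near0_imp hs => h hs.
have hf := sums_ext (rterm_fterm h nu) hs.
have e : reg u h = P (u + h); last by rewrite e in hf.
rewrite wp_pole (_ : reg 0 (u + h) = reg u h + (-1) * ((u + h) ^+ 2)^-1); first by ring.
apply: sums_csum.
have h1 := sumsD hf (sumsZ (-1) (sums_single 0 (((u + h) ^+ 2)^-1))).
apply: sums_ext h1 => w; rewrite /fterm /rterm add0r.
case: eqVneq => [->|w0].
  by rewrite lat0 /= subr0 expr0n invr0 subr0 mulN1r subrr.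
by rewrite mulr0 addr0 andbT.
Qed.

Lemma wp_analytic u : ~~ L u -> analytic (fun h => P (u + h)).
Proof.
move=> /wp_reg hn; apply: analytic_ext (reg_analytic u).
by apply: near0_imp hn => h [_ ->].
Qed.

Lemma wp_sums u : ~~ L u -> sums (fterm u) (P u).
Proof. by move=> /wp_reg [r r0 /(_ 0)]; rewrite cn0 addr0 => /(_ r0) []. Qed.

Lemma wpN u : ~~ L u -> P (- u) = P u.
Proof.
move=> nu; have nu' : ~~ L (- u) by rewrite -latN.
apply: sums_uniq (wp_sums nu).
apply: sums_ext (sums_bij (@opprK _) (@opprK _) (wp_sums nu')) => w.
by rewrite /fterm -latN sqrrN -opprD sqrrN.
Qed.

(** After a shift of the summation, P(u) - P(u + l) is the sum of 1/(w + l)^2 - 1/w^2, which the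
    reflection w -> - w - l of the lattice changes into its opposite. *)
Lemma wpD u l : ~~ L u -> L l -> P (u + l) = P u.
Proof.
move=> nu ll; have nu' : ~~ L (u + l) by rewrite latDr.
have h1 := sums_bij (s := fun w => w + l) (addrK l) (subrK l) (wp_sums nu').
have h2 := sumsD (wp_sums nu) (sumsZ (-1) h1).
set q := (fun w => _) in h2; set c := _ + _ in h2.
have cs : cancel (fun w : C => - w - l) (fun w => - w - l).
  by move=> w; rewrite opprD !opprK addrK.
have h3 := sums_bij cs cs h2.
have e : (fun w => q (- w - l)) =1 (fun w => (-1) * q w).
  move=> w; rewrite /q /fterm subrK -latN !latDr -?latN // ?[L (- l)]latN ?opprK //.
  case: (L w); last by rewrite mulr0 addr0 mulr0.
  have -> : u + l - (w + l) = u - w by rewrite opprD addrACA subrr addr0.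
  have -> : u - (- w - l) = u + l + w by rewrite opprD !opprK; ring.
  have -> : (- w - l) ^+ 2 = (w + l) ^+ 2 by ring.
  by rewrite sqrrN; ring.
have h4 := sums_uniq (sums_ext e h3) (sumsZ (-1) h2).
have c0 : c = 0.
  have : c *+ 2 = 0 by rewrite mulr2n {1}h4 mulN1r addNr.
  by move/eqP; rewrite mulrn_eq0 /= => /eqP.
by apply/eqP; rewrite eq_sym -subr_eq0 -mulN1r -/c c0.
Qed.

Lemma ct_odd k : odd k -> csum (ct k 0) = 0.
Proof.
move=> ok; have [D D0 hD] := ct_dom 0 k; have h := dom_sums tau_up D0 hD.
have e : (fun w => ct k 0 (- w)) =1 (fun w => (-1) * ct k 0 w).
  move=> w; rewrite /ct -latN oppr_eq0; case: ifP; rewrite ?mulr0 //.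
  case: k ok {hD h} => // k /= ok _; have -> : (0 - w) ^+ k.+3 = - w ^+ k.+3.
    by rewrite sub0r exprNn -signr_odd /= negbK ok expr1 mulN1r.
  rewrite sub0r opprK.
  by rewrite invrN mulrN mulN1r opprK.
have h4 := sums_uniq (sums_ext e (sums_bij (@opprK _) (@opprK _) h)) (sumsZ (-1) h).
have : csum (ct k 0) *+ 2 = 0 by rewrite mulr2n {1}h4 mulN1r addNr.
by move/eqP; rewrite mulrn_eq0 /= => /eqP.
Qed.

(** For even k > 0 the coefficient of h^k is k + 1 times the lattice sum of w^(-k-2), hence 60 / 3 =
    20 and 140 / 5 = 28; the odd ones vanish by symmetry. *)
Lemma reg0_form : exists2 A, analytic A & forall h,
  reg 0 h = g2 (lattice tau) / 20%:R * h ^+ 2 + g3 (lattice tau) / 28%:R * h ^+ 4 + h ^+ 6 * A h.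
Proof.
have [h0 _] := reg_expands 0.
have [f1 h1 e1] := expands_step h0; have [f2 h2 e2] := expands_step h1.
have [f3 h3 e3] := expands_step h2; have [f4 h4 e4] := expands_step h3.
have [f5 h5 e5] := expands_step h4; have [f6 h6 e6] := expands_step h5.
exists f6 => [|h]; first by eexists; exact: h6.
have a0 : csum (ct 0 0) = 0.
  rewrite (csum_ext (g := fun=> 0)) => [|w]; last by rewrite /ct /= sub0r sqrrN subrr; case: ifP.
  by apply: sums_csum => e e0; exists fset0 => J _; rewrite big1 // subrr cn0.
have hk k : ~~ odd k -> (0 < k)%N -> csum (ct k 0) = k.+1%:R * lattice_sum (lattice tau) (fun w => (w ^+ k.+2)^-1).
  move=> ek k0; have k0' : (k == 0)%N = false by apply: gtn_eqF.
  have [D D0 hD] := ct_dom 0 k; have h' := dom_sums tau_up D0 hD.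
  have e : (fun w => ct k 0 w) =1 (fun w => k.+1%:R * (if L w && (w != 0) then (w ^+ k.+2)^-1 else 0)).
    move=> w; rewrite /ct k0' sub0r; case: ifP; rewrite ?mulr0 // => _.
    have -> : (- w) ^+ k.+2 = w ^+ k.+2 by rewrite exprNn -signr_odd /= negbK (negPf ek) expr0 mul1r.
    by rewrite -signr_odd (negPf ek) expr0 mul1r.
  have n0 : k.+1%:R != 0 :> C by rewrite pnatr_eq0.
  have := sumsZ (k.+1%:R^-1) (sums_ext e h') => h''.
  have : sums (fun w => if L w && (w != 0) then (w ^+ k.+2)^-1 else 0) (k.+1%:R^-1 * csum (ct k 0)).
    by apply: sums_ext h'' => w; rewrite mulKf.
  move=> /sums_csum e'; rewrite -[LHS](mulVKf n0); congr (_ * _); rewrite -e'.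
  by [].
rewrite e1 e2 e3 e4 e5 e6 a0 (@ct_odd 1) // (@ct_odd 3) // (@ct_odd 5) // (hk 2%N) // (hk 4%N) // /g2 /g3.
by field.
Qed.

End Weierstrass.

(** * Liouville's theorem for a lattice *)

Section Liouville.
Variables (R : realType) (tau : R[i]).
Hypothesis tau_up : 0 < complex.Im tau.
Local Notation C := R[i].
Local Notation L := (lat tau).

(** Connectedness of the plane, through the supremum of the good parameters on the segment from u0
    to u. *)
Lemma connected_plane (Q : C -> Prop) (u0 : C) : Q u0 ->
  (forall u, Q u -> near0 (fun h => Q (u + h))) ->
  (forall u, (forall r : R, 0 < r -> exists2 h, cn h < r & Q (u + h)) -> Q u) ->
  forall u, Q u.
Proof.
move=> q0 op cl u; pose g (t : R) : C := u0 + t%:C%C * (u - u0).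
have gd s t : g s = g t + (s - t)%:C%C * (u - u0) by rewrite /g rmorphB; ring.
have cg (s t : R) : cn ((s - t)%:C%C * (u - u0)) = `|s - t| * cn (u - u0) by rewrite cnM cn_real.
have c0 : 0 < cn (u - u0) + 1 by rewrite ltr_wpDl ?cn_ge0.
pose E : set R := [set t | [/\ 0 <= t, t <= 1 & Q (g t)]]%classic.
have E0 : E 0 by split=> //; rewrite /g mul0r addr0.
have hs : has_sup E by split; [exists 0|exists 1 => t []].
have s0 : 0 <= sup E by apply: ub_le_sup => //; exact: hs.2.
have s1 : sup E <= 1 by apply: ge_sup; [exact: hs.1|move=> t []].
have qs : Q (g (sup E)).
  apply: cl => r r0; have d0 := divr_gt0 r0 c0.
  have [t [t0 t1 qt] ht] := sup_adherent d0 hs.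
  have le : t <= sup E by apply: ub_le_sup; [exact: hs.2|split].
  exists ((t - sup E)%:C%C * (u - u0)); last by rewrite -gd.
  rewrite cg ler0_norm ?subr_le0 // opprB.
  have h1 : sup E - t < r / (cn (u - u0) + 1) by lra.
  rewrite ltr_pdivlMr // in h1; apply: le_lt_trans h1.
  by apply: ler_wpM2l; [rewrite subr_ge0|rewrite lerDl].
have [e|ne] := eqVneq (sup E) 1; first by move: qs; rewrite e /g mul1r addrC subrK.
have lt : sup E < 1 by rewrite lt_def eq_sym ne.
have [r r0 hr] := op _ qs; have d0 := divr_gt0 r0 c0.
pose m := Num.min (1 - sup E) (r / (cn (u - u0) + 1) / 2).
have m0 : 0 < m by rewrite lt_min subr_gt0 lt divr_gt0.
have m1 : m <= 1 - sup E by rewrite ge_min lexx.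
have m2 : m < r / (cn (u - u0) + 1).
  have : m <= r / (cn (u - u0) + 1) / 2 by rewrite ge_min lexx orbT.
  lra.
have : sup E + m <= sup E.
  apply: ub_le_sup; first exact: hs.2.
  split; [lra|lra|rewrite (gd _ (sup E)); apply: hr].
  rewrite cg addrAC subrr add0r gtr0_norm //; rewrite ltr_pdivlMr // in m2; apply: le_lt_trans m2.
  by apply: ler_wpM2l; [exact: ltW|rewrite lerDl].
by lra.
Qed.

Lemma fundamental_domain (u : C) : exists s t : R, [/\ 0 <= s <= 1, 0 <= t <= 1 &
  exists2 l, L l & u = s%:C%C + t%:C%C * tau + l].
Proof.
pose y := complex.Im u / complex.Im tau; pose x := complex.Re u - y * complex.Re tau.
have e : u = x%:C%C + y%:C%C * tau.
  rewrite /x /y; move: tau_up; case: (u) => a b; case: (tau) => c d /= d0.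
  apply/eqP; rewrite eq_complex /=; apply/andP; split; apply/eqP; field; by rewrite gt_eqF.
have fl (z : R) : 0 <= z - (Num.floor z)%:~R <= 1.
  have /andP[h1 h2] := floor_itv z; rewrite intrD in h2; apply/andP; split; lra.
exists (x - (Num.floor x)%:~R), (y - (Num.floor y)%:~R); split; rewrite ?fl //.
exists ((Num.floor x)%:~R + (Num.floor y)%:~R * tau); first by apply/latP; exists (Num.floor x), (Num.floor y).
by rewrite {1}e !rmorphB !rmorph_int; ring.
Qed.

Lemma periodic_max (m : C -> R) :
  (forall u (e : R), 0 < e -> near0 (fun h => `|m (u + h) - m u| < e)) ->
  (forall u l, L l -> m (u + l) = m u) -> exists u0, forall u, m u <= m u0.
Proof.
move=> mc mp; pose I : set R := `[0, 1]%classic.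
pose f (p : R * R) : R := m (p.1%:C%C + p.2%:C%C * tau).
have cpt : compact (I `*` I)%classic by apply: compact_setX; apply: segment_compact.
have fc : ({within I `*` I, continuous f})%classic.
  apply: continuous_subspaceT => p; apply/cvgrPdist_lt => e e0.
  have [r r0 hr] := mc (p.1%:C%C + p.2%:C%C * tau) e e0.
  have t0 := cn_ge0 tau; have d0 : 0 < r / (cn tau + 1) by rewrite divr_gt0 // ltr_wpDl.
  set d := r / (cn tau + 1) in d0.
  exists (ball p.1 d, ball p.2 d); first by split; apply: nbhsx_ballx.
  move=> [x y] [/= b1 b2]; rewrite /f /= distrC.
  have -> : x%:C%C + y%:C%C * tau = p.1%:C%C + p.2%:C%C * tau +
     ((x - p.1)%:C%C + (y - p.2)%:C%C * tau) by rewrite !rmorphB; ring.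
  apply: hr; apply: le_lt_trans (cnD _ _) _; rewrite cnM !cn_real.
  have e1 : `|x - p.1| < d by rewrite distrC.
  have e2 : `|y - p.2| < d by rewrite distrC.
  have t1 : cn tau + 1 != 0 by rewrite gt_eqF // ltr_wpDl.
  have -> : r = d + d * cn tau by rewrite /d; field.
  by apply: ltr_leD => //; apply: ler_wpM2r => //; apply: ltW.
have ne : ((I `*` I) !=set0)%classic by exists (0, 0); split; rewrite /I /= in_itv /= lexx ler01.
have [[s t] _ hmax] := compact_EVT_max ne cpt fc.
exists (s%:C%C + t%:C%C * tau) => u.
have [s' [t' [hs ht [l ll ->]]]] := fundamental_domain u.
rewrite mp //; apply: (hmax (s', t')); apply/mem_set; split; rewrite /I /= in_itv /=; by [].
Qed.

(** A removable singularity: A extends f across u, whatever the value of f at u. *)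
Definition reg_at (f : C -> C) (u : C) (A : C -> C) :=
  analytic A /\ exists2 r : R, 0 < r & forall h, h != 0 -> cn h < r -> f (u + h) = A h.
Definition hol_at (f : C -> C) (u : C) := analytic (fun h => f (u + h)).
Definition punctured (Q : C -> Prop) := exists2 r : R, 0 < r & forall h, h != 0 -> cn h < r -> Q h.

Lemma hol_reg f u : hol_at f u -> reg_at f u (fun h => f (u + h)).
Proof. by move=> h; split => //; exists 1. Qed.

Lemma liouville_continuous (f : C -> C) :
  (forall u, hol_at f u) -> (forall u l, L l -> f (u + l) = f u) -> forall u v, f u = f v.
Proof.
move=> hf hp.
have [|u0 hmax] := @periodic_max (fun u => cn (f u)) _ (fun u l ll => congr1 _ (hp u l ll)).
  move=> u e e0; have := analytic_cont (hf u) e0; rewrite addr0; apply: near0_imp => h.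
  apply: le_lt_trans; rewrite ler_norml; apply/andP; split; last exact: cnB_ge.
  by rewrite lerNl opprB cn_distC; apply: cnB_ge.
have loc u : near0 (fun h => f (u + h) = f u) -> f u = f u0 -> near0 (fun h => f (u + h) = f u0).
  by move=> h <-.
have : forall u, f u = f u0.
  apply: (@connected_plane _ u0) => // u.
    move=> e; apply: loc => //; have := @analytic_max _ _ (hf u); rewrite addr0; apply.
    by exists 1 => // h _; rewrite e.
  move=> h; apply/eqP; rewrite -subr_eq0 -cn_eq0 eq_le cn_ge0 andbT leNgt; apply/negP => lt.
  have [r r0 hr] := analytic_cont (hf u) lt; have [k kr e] := h r r0.
  by have := hr k kr; rewrite e addr0 cn_distC ltxx.
by move=> h u v; rewrite !h.
Qed.

(** [F], the value of the local extensions, repairs f at its removable singularities; it is analytic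
    because it agrees with f near every point, except possibly at the point itself. *)
Lemma liouville (f : C -> C) : (forall u, exists A, reg_at f u A) ->
  (forall u, punctured (fun h => hol_at f (u + h))) ->
  (forall u l, L l -> f (u + l) = f u) ->
  exists c, (forall u, hol_at f u -> f u = c) /\ forall u A, reg_at f u A -> near0 (fun h => A h = c).
Proof.
move=> hr hh hp; pose F u := projT1 (cid (hr u)) 0.
have FA u A : reg_at f u A -> F u = A 0.
  rewrite /F; case: (cid _) => B /= [hB [r r0 eB]] [hA [s s0 eA]].
  apply/eqP; rewrite -subr_eq0; apply/eqP; apply: (analytic_eq0 (analyticB hB hA)).
  exists (Num.min r s); first by rewrite lt_min r0.
  by move=> h h0; rewrite lt_min => /andP[h1 h2]; rewrite -eB // -eA // subrr.
have Fh u : hol_at f u -> F u = f u.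
  by move=> h; rewrite (FA _ _ (hol_reg h)) addr0.
have FhA u A : reg_at f u A -> near0 (fun h => F (u + h) = A h).
  move=> hA; have [_ [r r0 e]] := hA; have [s s0 hs] := hh u.
  exists (Num.min r s); first by rewrite lt_min r0.
  move=> h; rewrite lt_min => /andP[h1 h2]; have [->|h0] := eqVneq h 0; first by rewrite addr0 (FA _ _ hA).
  by rewrite Fh ?e //; apply: hs.
have Fhol u : hol_at F u.
  have [A hA] := hr u; apply: analytic_ext (hA.1).
  by apply: near0_imp (FhA u A hA) => h ->.
have Fp u l : L l -> F (u + l) = F u.
  move=> ll; have [A hA] := hr u; rewrite (FA _ _ hA); apply: FA; split; first exact: hA.1.
  have [_ [r r0 e]] := hA; exists r => // h h0 hh'; by rewrite -e // addrAC (hp _ l).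
have Fc := liouville_continuous Fhol Fp.
exists (F 0); split => [u hu|u A hA]; first by rewrite -(Fh u hu); apply: Fc.
by apply: near0_imp (FhA u A hA) => h <-; apply: Fc.
Qed.

End Liouville.

(** * The addition law of the Weierstrass function *)

Section Punctured.
Variable R : realType.
Local Notation C := R[i].
Implicit Types Q : C -> Prop.

Lemma punctured_and Q Q' : punctured Q -> punctured Q' -> punctured (fun h => Q h /\ Q' h).
Proof.
move=> [r r0 h] [s s0 h']; exists (Num.min r s); first by rewrite lt_min r0.
by move=> x x0; rewrite lt_min => /andP[h1 h2]; split; [apply: h|apply: h'].
Qed.
Lemma punctured_imp Q Q' : (forall h, h != 0 -> Q h -> Q' h) -> punctured Q -> punctured Q'.
Proof. by move=> i [r r0 h]; exists r => // x x0 hx; apply: i => //; apply: h. Qed.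
Lemma near0_punctured Q : near0 Q -> punctured Q.
Proof. by move=> [r r0 h]; exists r => // x _; apply: h. Qed.
Lemma punctured_scale Q (c : C) : c != 0 -> punctured Q -> punctured (fun h => Q (c * h)).
Proof.
move=> c0 [r r0 h]; have cp : 0 < cn c by rewrite cn_gt0.
exists (r / cn c) => [|x x0 hx]; first by rewrite divr_gt0.
by apply: h; rewrite ?mulf_neq0 // cnM mulrC -ltr_pdivlMr.
Qed.
Lemma punctured_ex Q : punctured Q -> exists2 h, h != 0 & Q h.
Proof.
move=> [r r0 h]; have r2 : 0 < r / 2 by rewrite divr_gt0.
have cr : cn ((r / 2)%:C%C : C) = r / 2 by rewrite cn_real gtr0_norm.
have n0 : (r / 2)%:C%C != 0 :> C by rewrite -cn_gt0 cr.
by exists (r / 2)%:C%C => //; apply: h => //; rewrite cr; lra.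
Qed.
Lemma analytic_punctured0 (A : C -> C) : analytic A -> punctured (fun h => A h = 0) -> A 0 = 0.
Proof. by move=> hA [r r0 h]; apply: analytic_eq0 => //; exists r. Qed.
Lemma analytic_neq0 (A : C -> C) : analytic A -> A 0 != 0 -> near0 (fun h => A h != 0).
Proof.
move=> hA; rewrite -cn_gt0 => /(analytic_cont hA); apply: near0_imp => h lt.
by apply/eqP => e; move: lt; rewrite e sub0r cnN ltxx.
Qed.
Lemma analyticZ c (f : C -> C) : analytic f -> analytic (fun h => c * f h).
Proof. by move=> hf; apply: analyticM => //; apply: analytic_const. Qed.
Lemma analytic_opp (f : C -> C) : analytic f -> analytic (fun h => f (- h)).
Proof.
move=> hf; apply: (analytic_eq (f := fun h => f ((-1) * h))); first by move=> h; rewrite mulN1r.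
exact: analytic_scale.
Qed.

End Punctured.

Ltac anl := lazymatch goal with
  | |- analytic (fun _ => ?c) => apply: analytic_const
  | |- analytic (fun h => h) => apply: analytic_id
  | |- analytic (fun h => @GRing.add _ (@?f h) (@?g h)) => apply (@analyticD _ f g); anl
  | |- analytic (fun h => @GRing.mul _ (@?f h) (@?g h)) => apply (@analyticM _ f g); anl
  | |- analytic (fun h => @GRing.opp _ (@?f h)) => apply (@analyticN _ f); anl
  | |- analytic (fun h => @GRing.exp _ (@?f h) ?n) => apply (@analyticX _ f n); anl
  | |- analytic (fun h => ?f (@GRing.opp _ h)) => apply (@analytic_opp _ f); anl
  | _ => assumption
  end.

Section Law.
Variables (R : realType) (tau : R[i]).
Hypothesis tau_up : 0 < complex.Im tau.
Local Notation C := R[i].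
Local Notation L := (lat tau).
Local Notation P := (wp (lattice tau)).

(* [wp] has a junk value at the poles; the value 1 makes [(pe : wz)], with [wz] 0
   at the poles and 1 elsewhere, a point of the projective line everywhere. *)
Definition pe (u : C) : C := if L u then 1 else P u.

Lemma pe_def u : pe u = if L u then 1 else P u.
Proof. by []. Qed.
Lemma peN u : pe (- u) = pe u.
Proof. by rewrite /pe -latN; case: ifPn => // /(wpN tau_up). Qed.
Lemma peD u l : L l -> pe (u + l) = pe u.
Proof. by move=> ll; rewrite /pe latDr //; case: ifPn => // /(wpD tau_up); apply. Qed.
Lemma pe_mod u v : L (u - v) -> pe u = pe v.
Proof. by move=> h; rewrite -(peD v h) addrC subrK. Qed.
Lemma pe_modN u v : L (u + v) -> pe u = pe v.
Proof. by move=> h; rewrite -(peN v); apply: pe_mod; rewrite opprK. Qed.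

Lemma nlat_near u : ~~ L u -> near0 (fun h => ~~ L (u + h)).
Proof.
move=> nu; have [r r0 h] := lat_isolated tau_up u; exists r => // k kr.
by have [->|k0] := eqVneq k 0; [rewrite addr0|apply: h].
Qed.
Lemma nlat_punctured u : punctured (fun h => ~~ L (u + h)).
Proof. by have [r r0 h] := lat_isolated tau_up u; exists r. Qed.
Lemma nlat_punctured0 : punctured (fun h => ~~ L h).
Proof. by apply: punctured_imp (nlat_punctured 0) => h _; rewrite add0r. Qed.

Lemma pe_hol u : ~~ L u -> analytic (fun h => pe (u + h)).
Proof.
move=> nu; apply: analytic_ext (wp_analytic tau_up nu).
by apply: near0_imp (nlat_near nu) => h; rewrite /pe => /negPf ->.
Qed.

Lemma pe_pole : exists2 A, analytic A & punctured (fun h => pe h = (h ^+ 2)^-1 +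
  (g2 (lattice tau) / 20%:R * h ^+ 2 + g3 (lattice tau) / 28%:R * h ^+ 4 + h ^+ 6 * A h)).
Proof.
have [A hA e] := reg0_form tau_up; exists A => //.
apply: punctured_imp nlat_punctured0 => h _ nh.
by rewrite /pe (negPf nh) wp_pole e.
Qed.

Lemma pe_pole2 : exists2 s, analytic s & punctured (fun h => pe h = (h ^+ 2)^-1 + h ^+ 2 * s h).
Proof.
have [A hA e] := pe_pole; exists (fun h => g2 (lattice tau) / 20%:R +
  g3 (lattice tau) / 28%:R * h ^+ 2 + h ^+ 4 * A h); first by anl.
by apply: punctured_imp e => h _ ->; ring.
Qed.

Lemma pe_neq c : punctured (fun h => pe h != c).
Proof.
have [s hs e] := pe_pole2.
have hA : analytic (fun h : C => 1 + h ^+ 4 * s h - c * h ^+ 2) by anl.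
have /near0_punctured h1 : near0 (fun h : C => 1 + h ^+ 4 * s h - c * h ^+ 2 != 0).
  by apply: (analytic_neq0 hA); rewrite !expr0n /= mul0r mulr0 addr0 subr0 oner_eq0.
apply: punctured_imp (punctured_and e h1) => h h0 [e1 n]; apply: contra_neq n => e2.
by rewrite -e2 e1; field.
Qed.

(** Sufficiently near the pole, pe avoids every root of a nonzero q. *)
Lemma poly_pole (q : {poly C}) : punctured (fun h => q.[pe h] = 0) -> q = 0.
Proof.
move=> hq; apply/eqP; apply: contraT => q0.
have [rs e] := closed_field_poly_normal q.
have : punctured (fun h => (\prod_(z <- rs) ('X - z%:P)).[pe h] != 0).
  elim: (rs) => [|z s ih].
    by exists 1 => // h _ _; rewrite big_nil hornerC oner_eq0.
  apply: punctured_imp (punctured_and ih (pe_neq z)) => h _ [h1 h2].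
  by rewrite big_cons hornerM hornerXsubC mulf_neq0 // subr_eq0.
move=> h; have [k _ [h1 h2]] := punctured_ex (punctured_and hq h).
move: h1; rewrite e hornerZ => /eqP; rewrite mulf_eq0 (negPf h2) orbF lead_coef_eq0.
by rewrite (negPf q0).
Qed.

Lemma quadratic_pole a b c : punctured (fun h => a * pe h ^+ 2 + b * pe h + c = 0) ->
  [/\ a = 0, b = 0 & c = 0].
Proof.
move=> h; have q0 : a *: 'X^2 + b *: 'X + c%:P = 0.
  apply: poly_pole; apply: punctured_imp h => h _.
  by rewrite !hornerD !hornerZ hornerXn hornerX hornerC.
have co i : (a *: 'X^2 + b *: 'X + c%:P)`_i = 0 by rewrite q0 coef0.
split; [have := co 2%N|have := co 1%N|have := co 0%N];
by rewrite !coefD !coefZ coefXn coefX coefC /= ?mulr1 ?mulr0 ?addr0 ?add0r.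
Qed.

Lemma pe_taylor v : ~~ L v -> exists a1 a2 t, analytic t /\
  near0 (fun h => pe (v + h) = pe v + a1 * h + a2 * h ^+ 2 + h ^+ 3 * t h).
Proof.
move=> nv; have [a ha] := pe_hol nv.
have [f1 h1 e1] := expands_step ha; have [f2 h2 e2] := expands_step h1.
have [f3 h3 e3] := expands_step h2.
exists (a 1%N), (a 2%N), f3; split; first by eexists; exact: h3.
exists 1 => // h _; rewrite e1 e2 e3 -(expands0 ha) addr0; ring.
Qed.

Lemma law_gen v (K e k d g : C -> C) (e0 e1 : C) : ~~ L v ->
  (forall u l, L l -> K (u + l) = K u) -> (forall u, K (- u) = K u) ->
  analytic e -> punctured (fun h => K h = e0 + e1 * h ^+ 2 + h ^+ 4 * e h) ->
  (forall u, ~~ L (u + v) -> ~~ L (u - v) -> hol_at K u) ->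
  analytic k -> analytic g -> (forall h, h != 0 -> d h != 0) ->
  punctured (fun h => K (v + h) = k h / d h ^+ 2) ->
  punctured (fun h => pe (v + h) - pe v = d h * g h) ->
  exists2 c, (forall u, ~~ L u -> ~~ L (u + v) -> ~~ L (u - v) ->
    (pe u - pe v) ^+ 2 * K u = e0 * pe u ^+ 2 + (e1 - 2 * pe v * e0) * pe u + c) &
  g 0 ^+ 2 * k 0 = e0 * pe v ^+ 2 + (e1 - 2 * pe v * e0) * pe v + c.
Proof.
move=> nv Kper Kev he K0 Khol hk hg d0 Kv gv; set x := pe v; set B := e1 - _.
pose f u := (pe u - x) ^+ 2 * K u - e0 * pe u ^+ 2 - B * pe u.
have fper u l : L l -> f (u + l) = f u by move=> ll; rewrite /f peD // Kper.
have fev u : f (- u) = f u by rewrite /f peN Kev.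
have fhol u : ~~ L u -> ~~ L (u + v) -> ~~ L (u - v) -> hol_at f u.
  move=> n1 n2 n3; have := Khol u n2 n3; have := pe_hol n1; rewrite /hol_at /f => h1 h2.
  by anl.
have fv : reg_at f v (fun h => g h ^+ 2 * k h - e0 * pe (v + h) ^+ 2 - B * pe (v + h)).
  split; first by have := pe_hol nv => ?; anl.
  apply: punctured_imp (punctured_and Kv gv) => h /d0 dh [e2 e3].
  by rewrite /f e2 e3; field.
have [s hs es] := pe_pole2.
have f0 : exists A, reg_at f 0 A.
  exists (fun h => - 2 * x * e0 * (h ^+ 2 * s h) + e0 * x ^+ 2 + e1 * (2 * h ^+ 2 * s h + h ^+ 6 * s h ^+ 2)
    + e h * (1 + h ^+ 4 * s h) ^+ 2 - 2 * x * (e1 + h ^+ 2 * e h) * (1 + h ^+ 4 * s h)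
    + (e1 * h ^+ 2 + h ^+ 4 * e h) * x ^+ 2 - B * (h ^+ 2 * s h)); split; first by anl.
  apply: punctured_imp (punctured_and K0 es) => h h0 [e2 e3].
  by rewrite /f add0r e2 e3 /B; field.
have freg u : exists A, reg_at f u A.
  have [lu|nu] := boolP (L u).
    have [A [hA [r r0 eA]]] := f0; exists A; split=> //; exists r => // h h0 hr.
    by rewrite addrC fper // -eA // add0r.
  have [l1|n1] := boolP (L (u - v)).
    have [hA [r r0 eA]] := fv; eexists; split; first exact: hA.
    exists r => // h h0 hr; rewrite -eA // -(fper (v + h) _ l1); congr f; ring.
  have [l2|n2] := boolP (L (u + v)).
    have [/analytic_opp hA [r r0 eA]] := fv; eexists; split; first exact: hA.
    exists r => // h h0 hr; rewrite -eA ?oppr_eq0 ?cnN //.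
    by rewrite -(fev (u + h)) -[RHS](fper _ (- (u + v))) -?latN //; congr f; ring.
  by eexists; apply: hol_reg; apply: fhol.
have [|c [h1 h2]] := liouville tau_up freg _ fper.
  move=> u; apply: punctured_imp (punctured_and (nlat_punctured u)
    (punctured_and (nlat_punctured (u + v)) (nlat_punctured (u - v)))) => h _ [n1 [n2 n3]].
  by apply: fhol => //; rewrite addrAC.
exists c => [u n1 n2 n3|].
  by rewrite -(h1 u (fhol u n1 n2 n3)) /f; ring.
have [r r0 hr] := h2 _ _ fv; have := hr 0; rewrite cn0 addr0 => /(_ r0) <-.
by rewrite -/x; ring.
Qed.

Lemma pe_sym_taylor v a1 a2 t : analytic t ->
  near0 (fun h => pe (v + h) = pe v + a1 * h + a2 * h ^+ 2 + h ^+ 3 * t h) ->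
  exists2 q, analytic q & near0 (fun h => pe (h - v) = pe v - a1 * h + a2 * h ^+ 2 - h ^+ 3 * t (- h)
    /\ t h - t (- h) = h * q h).
Proof.
move=> ht [r r0 e]; have hd : analytic (fun h => t h - t (- h)) by anl.
have [|q hq eq] := analytic_factor hd; first by rewrite oppr0 subrr.
exists q => //; exists r => // h hr; split => //.
by rewrite -peN opprB e ?cnN //; ring.
Qed.

(** pe is even about a half period, so the odd terms of order 1 cancel. *)
Lemma half_taylor v a1 a2 t : analytic t -> L (v + v) ->
  near0 (fun h => pe (v + h) = pe v + a1 * h + a2 * h ^+ 2 + h ^+ 3 * t h) -> a1 = 0.
Proof.
move=> ht l2 e; have [q hq eq] := pe_sym_taylor ht e.
have hA : analytic (fun h => 2 * a1 + h ^+ 2 * (t h + t (- h))) by anl.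
have := analytic_punctured0 hA; rewrite expr0n /= mul0r addr0 => H.
suff /eqP : 2 * a1 = 0 by rewrite mulf_eq0 pnatr_eq0 /= => /eqP.
apply: H; apply: punctured_imp (punctured_and (near0_punctured e) (near0_punctured eq)) => h h0 [e1 [e2 _]].
have e3 : pe (v + h) = pe (h - v) by apply: pe_mod; have -> : v + h - (h - v) = v + v by ring.
by apply: (mulfI h0); rewrite mulr0; move/eqP: e3; rewrite -subr_eq0 e1 e2 => /eqP <-; ring.
Qed.

Lemma sum_law v : ~~ L v -> exists a1 a2 c, [/\
  forall u, ~~ L u -> ~~ L (u + v) -> ~~ L (u - v) ->
    (pe u - pe v) ^+ 2 * (pe (u + v) + pe (u - v)) =
    2 * pe v * pe u ^+ 2 + (2 * a2 - 4 * pe v ^+ 2) * pe u + c,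
  (if L (v + v) then 0 else a1 ^+ 2) = 2 * a2 * pe v - 2 * pe v ^+ 3 + c &
  exists c', (forall u, ~~ L u -> ~~ L (u + v) -> ~~ L (u - v) ->
    (pe u - pe v) ^+ 2 * (pe (u + v) * pe (u - v)) =
    pe v ^+ 2 * pe u ^+ 2 + (2 * pe v * a2 - a1 ^+ 2 - 2 * pe v ^+ 3) * pe u + c') /\
    (~~ L (v + v) -> a1 ^+ 2 * pe (v + v) = pe v ^+ 4 + (2 * pe v * a2 - a1 ^+ 2 - 2 * pe v ^+ 3) * pe v + c')].
Proof.
move=> nv; have [a1 [a2 [t [ht et]]]] := pe_taylor nv.
have [q hq eq] := pe_sym_taylor ht et; have [s hs es] := pe_pole2.
exists a1, a2.
have K0 := punctured_and (near0_punctured et) (near0_punctured eq).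
have per u l : L l -> pe (u + l + v) = pe (u + v) /\ pe (u + l - v) = pe (u - v).
  by move=> ll; rewrite (addrAC u l v) (addrAC u l (- v)) (peD (u + v) ll) (peD (u - v) ll).
have ev u : pe (- u + v) = pe (u - v) /\ pe (- u - v) = pe (u + v).
  by rewrite -(peN (- u + v)) -(peN (- u - v)) !opprD !opprK.
have hol u : ~~ L (u + v) -> ~~ L (u - v) ->
    analytic (fun h => pe (u + h + v)) /\ analytic (fun h => pe (u + h - v)).
  move=> n1 n2; split; [apply: analytic_eq (pe_hol n1)|apply: analytic_eq (pe_hol n2)] => h;
  by rewrite addrAC.
pose d h : C := if L (v + v) then h ^+ 2 else h.
have d0 h : h != 0 -> d h != 0 by move=> h0; rewrite /d; case: ifP => // _; rewrite expf_neq0.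
pose g h := if L (v + v) then a2 + h * t h else a1 + a2 * h + h ^+ 2 * t h.
have hg : analytic g by rewrite /g; case: (L (v + v)); anl.
have gv : punctured (fun h => pe (v + h) - pe v = d h * g h).
  apply: punctured_imp (near0_punctured et) => h _ ->; rewrite /d /g.
  by case: (boolP (L (v + v))) => l2; rewrite ?(half_taylor ht l2 et); ring.
have g0 : g 0 = if L (v + v) then a2 else a1.
  by rewrite /g; case: ifP => _; rewrite ?mul0r ?mulr0 ?expr0n ?mul0r ?addr0.
pose ks h := if L (v + v) then 2 * h ^+ 2 * (1 + h ^+ 4 * s h) else h ^+ 2 * pe (v + v + h) + (1 + h ^+ 4 * s h).
pose kp h := if L (v + v) then (1 + h ^+ 4 * s h) ^+ 2 else pe (v + v + h) * (1 + h ^+ 4 * s h).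
have hk : analytic ks /\ analytic kp.
  rewrite /ks /kp; case: (boolP (L (v + v))) => [_|/pe_hol h2]; split; anl.
have kv : punctured (fun h => pe (v + h + v) + pe (v + h - v) = ks h / d h ^+ 2 /\
    pe (v + h + v) * pe (v + h - v) = kp h / d h ^+ 2).
  apply: punctured_imp es => h h0 e.
  have -> : v + h - v = h by ring.
  have -> : v + h + v = v + v + h by ring.
  rewrite /ks /kp /d; case: (boolP (L (v + v))) => l2.
    by rewrite [v + v + h]addrC peD // e; split; field.
  by rewrite e; split; field.
have Ks : punctured (fun h => pe (h + v) + pe (h - v) = 2 * pe v + 2 * a2 * h ^+ 2 + h ^+ 4 * q h).
  apply: punctured_imp K0 => h _ [e1 [e2 e3]]; rewrite [h + v]addrC.
  have e4 : t h = t (- h) + h * q h by rewrite -e3; ring.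
  by rewrite e1 e2 e4; ring.
pose ep h := pe v * q h - a1 * (t h + t (- h)) + a2 ^+ 2 + a2 * h ^+ 2 * q h - h ^+ 2 * t h * t (- h).
have hep : analytic ep by rewrite /ep; anl.
have Kp : punctured (fun h => pe (h + v) * pe (h - v) =
    pe v ^+ 2 + (2 * pe v * a2 - a1 ^+ 2) * h ^+ 2 + h ^+ 4 * ep h).
  apply: punctured_imp K0 => h _ [e1 [e2 e3]]; rewrite [h + v]addrC /ep.
  have e4 : t h = t (- h) + h * q h by rewrite -e3; ring.
  by rewrite e1 e2 e4; ring.
have kv1 : punctured (fun h => pe (v + h + v) + pe (v + h - v) = ks h / d h ^+ 2).
  by apply: punctured_imp kv => h _ [].
have kv2 : punctured (fun h => pe (v + h + v) * pe (v + h - v) = kp h / d h ^+ 2).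
  by apply: punctured_imp kv => h _ [].
have [|||c h1 h2] := @law_gen v (fun u => pe (u + v) + pe (u - v)) q ks d g (2 * pe v) (2 * a2) nv
  _ _ hq Ks _ hk.1 hg d0 kv1 gv.
- by move=> u l ll; have [-> ->] := per u l ll.
- by move=> u; have [-> ->] := ev u; rewrite addrC.
- by move=> u n1 n2; have [? ?] := hol u n1 n2; rewrite /hol_at; anl.
have [|||c' h1' h2'] := @law_gen v (fun u => pe (u + v) * pe (u - v)) ep kp d g (pe v ^+ 2)
  (2 * pe v * a2 - a1 ^+ 2) nv _ _ hep Kp _ hk.2 hg d0 kv2 gv.
- by move=> u l ll; have [-> ->] := per u l ll.
- by move=> u; have [-> ->] := ev u; rewrite mulrC.
- by move=> u n1 n2; have [? ?] := hol u n1 n2; rewrite /hol_at; anl.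
exists c; split.
- by move=> u n1 n2 n3; rewrite h1 //; ring.
- have -> : (if L (v + v) then 0 else a1 ^+ 2) = g 0 ^+ 2 * ks 0.
    by rewrite g0 /ks; case: ifP => _; rewrite !expr0n /= !(mul0r, mulr0, addr0, add0r, mulr1).
  by rewrite h2; ring.
exists c'; split; first by move=> u n1 n2 n3; rewrite h1' //; ring.
move=> n2; have := h2'; rewrite g0 /kp (negPf n2) expr0n /= !(mul0r, addr0, mulr1) => ->; ring.
Qed.

End Law.

(** * Determination of the addition laws by symmetry in u and v *)

Section SymmetricLaw.
Variables (R : realType) (tau : R[i]).
Hypothesis tau_up : 0 < complex.Im tau.
Local Notation C := R[i].
Local Notation L := (lat tau).
Local Notation pe := (pe tau).

Definition good u v := [/\ ~~ L u, ~~ L v, ~~ L (u + v) & ~~ L (u - v)].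

Lemma good_sym u v : good u v -> good v u.
Proof. by move=> [h1 h2 h3 h4]; split=> //; [rewrite addrC|rewrite lat_subC]. Qed.

Lemma good_punctured u v : ~~ L u -> punctured (fun h => good u (v + h)).
Proof.
move=> nu; apply: punctured_imp (punctured_and (nlat_punctured tau_up v) (punctured_and
  (nlat_punctured tau_up (u + v)) (nlat_punctured tau_up (v - u)))) => h _ [h1 [h2 h3]].
by split; rewrite // ?addrA // lat_subC addrAC.
Qed.

Lemma good_punctured0 v : ~~ L v -> punctured (fun h => good h v).
Proof.
move=> nv; apply: punctured_imp (good_punctured 0 nv) => h _ /good_sym.
by rewrite add0r.
Qed.

(** Symmetry turns the unknown coefficients into polynomials in pe v: exchanging v with two fixed
    points u1, u2 determines them for generic v, and analyticity reaches the other v. *)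
Lemma symmetric_law (Phi : C -> C -> C) (s t : C) (Bf Kf : C -> C) :
  (forall u v, Phi u v = Phi v u) ->
  (forall u v, good u v -> Phi u v = (s * pe v + t * pe v ^+ 2) * pe u ^+ 2 + Bf v * pe u + Kf v) ->
  (forall u v, good u v -> hol_at (Phi u) v) ->
  exists b c d, forall v, ~~ L v -> Bf v = s * pe v ^+ 2 + b * pe v + c /\ Kf v = c * pe v + d.
Proof.
move=> sym law hol.
have [u1 _ n1] := punctured_ex (nlat_punctured0 tau_up).
have [u2 _ [g12 ne]] := punctured_ex (punctured_and (good_punctured 0 n1) (pe_neq tau_up (pe u1))).
rewrite add0r in g12; have n2 : ~~ L u2 by case: g12.
have d0 : pe u1 - pe u2 != 0 by rewrite subr_eq0 eq_sym.
pose b := (Bf u1 - Bf u2) / (pe u1 - pe u2) - s * (pe u1 + pe u2).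
pose c := (Kf u1 - Kf u2) / (pe u1 - pe u2); pose d := Kf u1 - pe u1 * c.
have ok v : good u1 v -> good u2 v -> Bf v = s * pe v ^+ 2 + b * pe v + c /\ Kf v = c * pe v + d.
  move=> g1 g2.
  have A1 := law _ _ g1; rewrite sym (law _ _ (good_sym g1)) in A1.
  have A2 := law _ _ g2; rewrite sym (law _ _ (good_sym g2)) in A2.
  have A3 := law _ _ g12; rewrite sym (law _ _ (good_sym g12)) in A3.
  move/eqP: A1; rewrite -subr_eq0; set E1 := _ - _ => /eqP A1.
  move/eqP: A2; rewrite -subr_eq0; set E2 := _ - _ => /eqP A2.
  move/eqP: A3; rewrite -subr_eq0; set E3 := _ - _ => /eqP A3.
  split; apply/eqP; rewrite -subr_eq0; apply/eqP.
    have -> : Bf v - (s * pe v ^+ 2 + b * pe v + c) = (pe u1 - pe u2)^-1 * (E2 - E1).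
      by rewrite /b /c /E1 /E2; field.
    by rewrite A1 A2 subrr mulr0.
  have -> : Kf v - (c * pe v + d) = - E1 - pe u1 / (pe u1 - pe u2) * (E2 - E1) - pe v / (pe u1 - pe u2) * E3.
    by rewrite /d /c /E1 /E2 /E3; field.
  by rewrite A1 A2 A3 subrr !mulr0 oppr0 !addr0.
exists b, c, d => v nv.
pose Q u v := (s * pe v + t * pe v ^+ 2) * pe u ^+ 2 + (s * pe v ^+ 2 + b * pe v + c) * pe u + (c * pe v + d).
have ext u : good u v -> Phi u v = Q u v.
  move=> g; have [nu _ _ _] := g; have hv := pe_hol tau_up nv; have hp := hol u v g.
  apply/eqP; rewrite -subr_eq0; apply/eqP; rewrite -[v in LHS]addr0.
  have hA : analytic (fun h => Phi u (v + h) - Q u (v + h)).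
    by rewrite /hol_at in hp; rewrite /Q; anl.
  apply: (analytic_punctured0 hA).
  apply: punctured_imp (punctured_and (good_punctured v nu) (punctured_and
    (good_punctured v n1) (good_punctured v n2))) => h _ [h1 [h2 h3]].
  by have [e1 e2] := ok _ h2 h3; rewrite (law _ _ h1) e1 e2 subrr.
have [|_ e1 e2] := @quadratic_pole _ _ tau_up 0 (Bf v - (s * pe v ^+ 2 + b * pe v + c)) (Kf v - (c * pe v + d)).
  apply: punctured_imp (good_punctured0 nv) => h _ g.
  have /eqP := ext h g; rewrite (law _ _ g) -subr_eq0 => /eqP E; rewrite -[RHS]E /Q; ring.
by split; apply/eqP; rewrite -subr_eq0; [rewrite e1|rewrite e2].
Qed.

Local Notation G2 := (g2 (lattice tau)).
Local Notation G3 := (g3 (lattice tau)).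

(* Comparing Laurent coefficients in the law for the points [h] and [2h]. *)
Lemma law_constants (b c d : C) :
  (forall u v, good u v -> (pe u - pe v) ^+ 2 * (pe (u + v) + pe (u - v)) =
    2 * pe v * pe u ^+ 2 + (2 * pe v ^+ 2 + b * pe v + c) * pe u + (c * pe v + d)) ->
  [/\ b = 0, c = - (G2 / 2) & d = - G3].
Proof.
move=> law; have [A hA eA] := pe_pole tau_up.
pose al := G2 / 20; pose ep := G3 / 28.
have n2 : 2 != 0 :> C by rewrite pnatr_eq0.
have n3 : 3 != 0 :> C by rewrite pnatr_eq0.
pose w1 h := ep + h ^+ 2 * A h; pose w2 h := 16 * ep + 64 * h ^+ 2 * A (2 * h).
pose w3 h := 81 * ep + 729 * h ^+ 2 * A (3 * h).
have hA2 := analytic_scale 2 hA; have hA3 := analytic_scale 3 hA.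
have hw1 : analytic w1 by rewrite /w1; anl.
have hw2 : analytic w2 by rewrite /w2; anl.
have hw3 : analytic w3 by rewrite /w3; anl.
pose z1 h := al + h ^+ 2 * w1 h; pose z2 h := 4 * al + h ^+ 2 * w2 h; pose z3 h := 9 * al + h ^+ 2 * w3 h.
have hz1 : analytic z1 by rewrite /z1; anl.
have hz2 : analytic z2 by rewrite /z2; anl.
have hz3 : analytic z3 by rewrite /z3; anl.
(* The parts of degree 1, 2 and 3 in z1, z2, z3 of the law after clearing powers of h, with pe(i h)
   = (1 / i^2 + h^4 z_i) / h^2. *)
pose S1 (x y z : C) := 53 / 48 * x - 14 / 3 * y + 9 / 16 * z.
pose S2 h := (z1 h - z2 h) ^+ 2 * (10 / 9) + 3 / 2 * (z1 h - z2 h) * (z3 h + z1 h)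
  - 2 * (z1 h * z2 h * (5 / 4) + (z1 h / 4 + z2 h) * (z1 h + z2 h)).
pose S3 h := (z1 h - z2 h) ^+ 2 * (z3 h + z1 h) - 2 * z1 h * z2 h * (z1 h + z2 h).
have hS2 : analytic S2 by rewrite /S2; anl.
have hS3 : analytic S3 by rewrite /S3; anl.
have key : punctured (fun h => b * (1 + h ^+ 4 * z1 h) * (4^-1 + h ^+ 4 * z2 h)
   + c * h ^+ 2 * (5 / 4 + h ^+ 4 * (z1 h + z2 h)) + d * h ^+ 4
   - h ^+ 2 * S1 (z1 h) (z2 h) (z3 h) - h ^+ 6 * S2 h - h ^+ 10 * S3 h = 0).
  have L0 := nlat_punctured0 tau_up.
  apply: punctured_imp (punctured_and (punctured_and eA (punctured_and (punctured_scale n2 eA)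
     (punctured_scale n3 eA))) (punctured_and L0 (punctured_and (punctured_scale n2 L0)
     (punctured_scale n3 L0)))) => h h0 [[e1 [e2 e3]] [l1 [l2 l3]]].
  have g : good h (2 * h).
    split=> //; first by have -> : h + 2 * h = 3 * h by ring.
    have -> : h - 2 * h = - h by ring.
    by rewrite -latN.
  have := law _ _ g; have -> : h + 2 * h = 3 * h by ring.
  have -> : h - 2 * h = - h by ring.
  rewrite (peN tau_up).
  have f1 : pe h = (1 + h ^+ 4 * z1 h) / h ^+ 2 by rewrite e1 /z1 /w1 /al /ep; field.
  have f2 : pe (2 * h) = (4^-1 + h ^+ 4 * z2 h) / h ^+ 2 by rewrite e2 /z2 /w2 /al /ep; field; rewrite ?h0 ?n2.
  have f3 : pe (3 * h) = (9^-1 + h ^+ 4 * z3 h) / h ^+ 2 by rewrite e3 /z3 /w3 /al /ep; field; rewrite ?h0 ?n3.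
  rewrite f1 f2 f3 /S1 /S2 /S3 => e; apply: (mulfI (expf_neq0 2 h0)); rewrite mulr0.
  move/eqP: e; rewrite -subr_eq0 => /eqP e.
  apply: (mulfI (_ : - (h ^+ 6)^-1 != 0)); first by rewrite oppr_eq0 invr_eq0 expf_neq0.
  rewrite mulr0 -e; move: (z1 h) (z2 h) (z3 h) => x1 x2 x3; field.
  by rewrite h0 ?n3 ?n2.
have b0 : b = 0.
  have hE : analytic (fun h => b * (1 + h ^+ 4 * z1 h) * (4^-1 + h ^+ 4 * z2 h)
   + c * h ^+ 2 * (5 / 4 + h ^+ 4 * (z1 h + z2 h)) + d * h ^+ 4
   - h ^+ 2 * S1 (z1 h) (z2 h) (z3 h) - h ^+ 6 * S2 h - h ^+ 10 * S3 h) by rewrite /S1; anl.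
  have := analytic_punctured0 hE key; rewrite !expr0n /= !(mul0r, mulr0, addr0, subr0, mulr1).
  by move/eqP; rewrite mulf_eq0 invr_eq0 pnatr_eq0 orbF => /eqP.
have cE : c * (5 / 4) = - (25 / 2) * al.
  have hE : analytic (fun h => c * (5 / 4 + h ^+ 4 * (z1 h + z2 h)) + d * h ^+ 2
   - S1 (z1 h) (z2 h) (z3 h) - h ^+ 4 * S2 h - h ^+ 8 * S3 h) by rewrite /S1; anl.
  have := analytic_punctured0 hE; rewrite !expr0n /= /z1 /z2 /z3 !expr0n /= !(mul0r, mulr0, addr0, subr0, mulr1).
  move=> H; apply/eqP; rewrite -subr_eq0; apply/eqP; rewrite -[RHS]H; first by rewrite /S1; field.
  apply: punctured_imp key => h h0; rewrite b0 => e; apply: (mulfI (expf_neq0 2 h0)); rewrite mulr0 -e.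
  rewrite -/(z1 h) -/(z2 h) -/(z3 h); ring.
have cE' : c = - (G2 / 2) by apply: (mulIf (_ : 5 / 4 != 0)); [rewrite mulf_neq0 ?invr_eq0 ?pnatr_eq0|rewrite cE /al; field].
split=> //.
have hE : analytic (fun h => c * h ^+ 2 * (z1 h + z2 h) + d
   - S1 (w1 h) (w2 h) (w3 h) - h ^+ 2 * S2 h - h ^+ 6 * S3 h) by rewrite /S1; anl.
have := analytic_punctured0 hE; rewrite !expr0n /= /w1 /w2 /w3 !expr0n /= !(mul0r, mulr0, addr0, subr0, mulr1, add0r).
move=> H; apply/eqP; rewrite -subr_eq0; apply/eqP; rewrite -[RHS]H; first by rewrite /S1 /ep; field.
apply: punctured_imp key => h h0; rewrite b0 => e; apply: (mulfI (expf_neq0 4 h0)); rewrite mulr0 -e.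
rewrite -/(w1 h) -/(w2 h) -/(w3 h).
have -> : S1 (z1 h) (z2 h) (z3 h) = - (25 / 2) * al + h ^+ 2 * S1 (w1 h) (w2 h) (w3 h).
  by rewrite /S1 /z1 /z2 /z3; field.
rewrite -cE; ring.
Qed.

Lemma pe_laws : [/\
  forall u v, good u v -> (pe u - pe v) ^+ 2 * (pe (u + v) + pe (u - v)) =
    2 * pe v * pe u ^+ 2 + (2 * pe v ^+ 2 - G2 / 2) * pe u - G2 / 2 * pe v - G3,
  forall u v, good u v -> (pe u - pe v) ^+ 2 * (pe (u + v) * pe (u - v)) =
    (pe u * pe v) ^+ 2 + G2 / 2 * pe u * pe v + G3 * (pe u + pe v) + G2 ^+ 2 / 16,
  forall v, ~~ L v -> ~~ L (v + v) -> (4 * pe v ^+ 3 - G2 * pe v - G3) * pe (v + v) =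
    pe v ^+ 4 + G2 / 2 * pe v ^+ 2 + 2 * G3 * pe v + G2 ^+ 2 / 16 &
  forall v, ~~ L v -> L (v + v) -> 4 * pe v ^+ 3 - G2 * pe v - G3 = 0].
Proof.
have /choice [F hF] : forall v, exists q : C * C * C * C, ~~ L v -> [/\
    forall u, ~~ L u -> ~~ L (u + v) -> ~~ L (u - v) ->
    (pe u - pe v) ^+ 2 * (pe (u + v) + pe (u - v)) =
    2 * pe v * pe u ^+ 2 + (2 * q.1.1.2 - 4 * pe v ^+ 2) * pe u + q.1.2,
   (if L (v + v) then 0 else q.1.1.1 ^+ 2) = 2 * q.1.1.2 * pe v - 2 * pe v ^+ 3 + q.1.2,
   (forall u, ~~ L u -> ~~ L (u + v) -> ~~ L (u - v) ->
    (pe u - pe v) ^+ 2 * (pe (u + v) * pe (u - v)) =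
    pe v ^+ 2 * pe u ^+ 2 + (2 * pe v * q.1.1.2 - q.1.1.1 ^+ 2 - 2 * pe v ^+ 3) * pe u + q.2) &
    (~~ L (v + v) -> q.1.1.1 ^+ 2 * pe (v + v) = pe v ^+ 4 + (2 * pe v * q.1.1.2 - q.1.1.1 ^+ 2 - 2 * pe v ^+ 3) * pe v + q.2)].
  move=> v; have [lv|nv] := boolP (L v); first by exists 0.
  have [a1 [a2 [c [h1 h2 [c' [h3 h4]]]]]] := sum_law tau_up nv.
  by exists (a1, a2, c, c').
pose a1 v := (F v).1.1.1; pose a2 v := (F v).1.1.2; pose cc v := (F v).1.2; pose cp v := (F v).2.
have hol u v : good u v -> [/\ analytic (fun h => pe (v + h)), analytic (fun h => pe (u + (v + h))) &
    analytic (fun h => pe (u - (v + h)))].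
  move=> [n1 n2 n3 n4]; split; first exact: pe_hol.
    by apply: analytic_eq (pe_hol tau_up n3) => h; rewrite addrA.
  rewrite lat_subC in n4; apply: analytic_eq (pe_hol tau_up n4) => h.
  by rewrite -(peN tau_up); congr pe; ring.
have psym u v : pe (u - v) = pe (v - u) by rewrite -(peN tau_up) opprB.
have [b [c [d hS]]] : exists b c d, forall v, ~~ L v ->
    2 * a2 v - 4 * pe v ^+ 2 = 2 * pe v ^+ 2 + b * pe v + c /\ cc v = c * pe v + d.
  apply: (@symmetric_law (fun u v => (pe u - pe v) ^+ 2 * (pe (u + v) + pe (u - v))) 2 0 (fun v => 2 * a2 v - 4 * pe v ^+ 2)).
  - by move=> u v; rewrite (psym u v) (addrC u v) -[pe u - _]opprB sqrrN.
  - move=> u v [n1 n2 n3 n4]; have [h _ _ _] := hF v n2; rewrite h //; rewrite /a2 /cc; ring.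
  - by move=> u v /hol [h1 h2 h3]; rewrite /hol_at; anl.
have [b' [c' [d' hP]]] : exists b c d, forall v, ~~ L v ->
    2 * pe v * a2 v - a1 v ^+ 2 - 2 * pe v ^+ 3 = 0 * pe v ^+ 2 + b * pe v + c /\ cp v = c * pe v + d.
  apply: (@symmetric_law (fun u v => (pe u - pe v) ^+ 2 * (pe (u + v) * pe (u - v))) 0 1
    (fun v => 2 * pe v * a2 v - a1 v ^+ 2 - 2 * pe v ^+ 3)).
  - by move=> u v; rewrite (psym u v) (addrC u v) -[pe u - _]opprB sqrrN.
  - move=> u v [n1 n2 n3 n4]; have [_ _ h _] := hF v n2; rewrite h //; rewrite /a2 /a1 /cp; ring.
  - by move=> u v /hol [h1 h2 h3]; rewrite /hol_at; anl.
have lawS u v : good u v -> (pe u - pe v) ^+ 2 * (pe (u + v) + pe (u - v)) =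
    2 * pe v * pe u ^+ 2 + (2 * pe v ^+ 2 + b * pe v + c) * pe u + (c * pe v + d).
  move=> [n1 n2 n3 n4]; have [h _ _ _] := hF v n2; have [e1 e2] := hS v n2.
  by rewrite h // -e1 -e2.
have [b0 cE dE] := law_constants lawS.
have dup v : ~~ L v -> (if L (v + v) then 0 else a1 v ^+ 2) = 4 * pe v ^+ 3 + 2 * c * pe v + d.
  move=> nv; have [_ h _ _] := hF v nv; have [e1 e2] := hS v nv.
  rewrite h -/(a2 v) -/(cc v) e2.
  have -> : 2 * a2 v = 6 * pe v ^+ 2 + b * pe v + c by rewrite -[LHS](subrK (4 * pe v ^+ 2)) e1; ring.
  by rewrite b0; ring.
(* The sum law determines a2 and, by its value at u = v, a1^2. Put into the product law they leave a
   polynomial relation in pe near its pole, which must be trivial. *)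
have [_ e1 e2] : [/\ (0 : C) = 0, b' + c = 0 & c' + d = 0].
  apply: (quadratic_pole tau_up); have n2 : 2 != 0 :> C by rewrite pnatr_eq0.
  have L0 := nlat_punctured0 tau_up.
  apply: punctured_imp (punctured_and L0 (punctured_scale n2 L0)) => h _ [l1 l2].
  have hh : h + h = 2 * h by ring.
  have := dup h l1; rewrite hh (negPf l2) => ea; have [eS _] := hS h l1; have [eP _] := hP h l1.
  have e2a : 2 * a2 h = 6 * pe h ^+ 2 + b * pe h + c by rewrite -[LHS](subrK (4 * pe h ^+ 2)) eS; ring.
  have : 2 * pe h * a2 h = pe h * (6 * pe h ^+ 2 + b * pe h + c) by rewrite -e2a; ring.
  move=> e3; move: eP; rewrite e3 ea b0 => /eqP; rewrite eq_sym -subr_eq0 => /eqP E; rewrite -[RHS]E; ring.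
have b'E : b' = - c by apply/eqP; rewrite -addr_eq0 e1.
have c'E : c' = - d by apply/eqP; rewrite -addr_eq0 e2.
have lawP u v : good u v -> (pe u - pe v) ^+ 2 * (pe (u + v) * pe (u - v)) =
    (pe u * pe v) ^+ 2 - c * pe u * pe v - d * (pe u + pe v) + d'.
  move=> [n1 n2 n3 n4]; have [_ _ h _] := hF v n2; have [h1 h2] := hP v n2.
  by rewrite h // -/(a2 v) -/(a1 v) -/(cp v) h1 h2 b'E c'E; ring.
(* At the half period e = 1/2 the values pe(h + e) and pe(h - e) coincide, so the square of their
   sum is four times their product. *)
have d'E : d' = c ^+ 2 / 4.
  pose e : C := 2^-1; have ee : e + e = 1 by rewrite /e; field.
  have l1 : L 1 by apply/latP; exists 1, 0; rewrite mul0r addr0.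
  have ne : ~~ L e.
    apply/negP => /latP[m [n h]].
    have n0 : n = 0.
      have := congr1 (@complex.Im R) h; rewrite /e -(rmorph_nat (real_complex R)) -fmorphV.
      rewrite -!(rmorph_int (real_complex R)); move: tau_up; case: (tau) => x y /= y0.
      rewrite !(mul0r, add0r, addr0, mulr0, oppr0) => /esym/eqP; rewrite mulf_eq0 (gt_eqF y0) orbF.
      by rewrite intr_eq0 => /eqP.
    move: h; rewrite n0 mul0r addr0 => h.
    have : (1 : C) = (m + m)%:~R by rewrite intrD -h ee.
    by move=> /(@intr_inj C 1) => h'; lia.
  have f0 : 4 * pe e ^+ 3 + 2 * c * pe e + d = 0 by rewrite -dup // ee l1.
  have [e3 _ _] : [/\ c ^+ 2 - 4 * d' = 0,
     2 * (2 * pe e ^+ 2 + c) * (c * pe e + d) - 4 * (- 2 * pe e * (d' - d * pe e) + pe e ^+ 2 * (- c * pe e - d)) = 0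
     & (c * pe e + d) ^+ 2 - 4 * pe e ^+ 2 * (d' - d * pe e) = 0].
    apply: (quadratic_pole tau_up); apply: punctured_imp (good_punctured0 ne) => h _ g.
    have := lawS _ _ g; have := lawP _ _ g.
    have -> : pe (h - e) = pe (h + e) by rewrite -(peD tau_up (h - e) l1) -ee; congr pe; ring.
    rewrite b0 => hp hs.
    set X := pe (h + e) in hp hs; set x := pe e in hp hs f0 *; set p := pe h in hp hs *.
    have E1 : ((p - x) ^+ 2 * (X + X)) ^+ 2 - 4 * (p - x) ^+ 2 * ((p - x) ^+ 2 * (X * X)) = 0 by ring.
    rewrite hs hp in E1; rewrite -[RHS]E1.
    have -> : d = - (4 * x ^+ 3 + 2 * c * x) by apply/eqP; rewrite -addr_eq0 addrC f0.
    by ring.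
  by apply: (mulfI (_ : 4 != 0)); [rewrite pnatr_eq0|move/eqP: e3; rewrite subr_eq0 => /eqP <-; field].
split.
- by move=> u v /lawS ->; rewrite b0 cE dE; ring.
- by move=> u v /lawP ->; rewrite d'E cE dE; field.
- move=> v nv n2; have [_ _ _ h] := hF v nv; have [h1 h2] := hP v nv.
  have := dup v nv; rewrite (negPf n2) => ea.
  have -> : 4 * pe v ^+ 3 - G2 * pe v - G3 = a1 v ^+ 2 by rewrite ea cE dE; field.
  by rewrite h // -/(a2 v) -/(a1 v) -/(cp v) h1 h2 b'E c'E d'E cE dE; field.
- by move=> v nv l2; have := dup v nv; rewrite l2 => h; rewrite [RHS]h cE dE; field.
Qed.

End SymmetricLaw.

(** * The Weierstrass curve: discriminant, Kummer law, surjectivity *)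

Section WeierstrassCurve.
Variables (R : realType) (tau : R[i]).
Hypothesis tau_up : 0 < complex.Im tau.
Local Notation C := R[i].
Local Notation L := (lat tau).
Local Notation pe := (pe tau).
Local Notation G2 := (g2 (lattice tau)).
Local Notation G3 := (g3 (lattice tau)).

Definition wz (u : C) : C := if L u then 0 else 1.
Definition wpw : weierstrass C := Weierstrass 0 (- (G2 / 2)) (- G3) (- (G2 ^+ 2 / 16)).

Lemma lat_coord (x y : R) : L (x%:C%C + y%:C%C * tau) -> exists m n : int, x = m%:~R /\ y = n%:~R.
Proof.
move=> /latP[m [n e]]; exists m, n; move: e tau_up; case: (tau) => a b /=.
rewrite -!(rmorph_int (real_complex R)) => -[]; rewrite !(mul0r, add0r, addr0, mulr0, subr0) => e1 e2 b0.
have yn : y = n%:~R by apply: (mulIf (lt0r_neq0 b0)).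
by split=> //; move: e1; rewrite yn => /addIr.
Qed.

Lemma nat_half (m : int) : (2^-1 : R) <> m%:~R.
Proof.
move=> h; have : (1 : R) = (m * 2)%:~R by rewrite intrM -h mulVf // pnatr_eq0.
by move=> /(@intr_inj R 1) e; lia.
Qed.

Lemma half_points : exists e1 e2 : C, [/\ L (e1 + e1), L (e2 + e2) & good tau e1 e2].
Proof.
have c2 : (2^-1)%:C%C = 2^-1 :> C by rewrite fmorphV rmorph_nat.
have l1 : L 1 by apply/latP; exists 1, 0; rewrite mul0r addr0.
have l2 : L tau by apply/latP; exists 0, 1; rewrite mul1r add0r.
have ne1 : ~~ L 2^-1.
  apply/negP => h; have [|m [n [e _]]] := @lat_coord 2^-1 0; first by rewrite c2 mul0r addr0.
  exact: (nat_half e).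
have ne2 (x : R) : ~~ L (x%:C%C + (2^-1)%:C%C * tau).
  by apply/negP => /lat_coord [m [n [_ e]]]; apply: (nat_half e).
exists 2^-1, (2^-1 * tau); split.
- by have -> : 2^-1 + 2^-1 = 1 :> C by field.
- by have -> : 2^-1 * tau + 2^-1 * tau = tau by field.
split=> //; first by have := ne2 0; rewrite add0r c2.
  by have := ne2 2^-1; rewrite c2.
by rewrite lat_subC addrC -c2 -rmorphN; apply: ne2.
Qed.

Lemma wpw_bezout x : (4 * x ^+ 3 - G2 * x - G3 = 0) ->
  x ^+ 4 + G2 / 2 * x ^+ 2 + 2 * G3 * x + G2 ^+ 2 / 16 = 0 -> wdisc wpw = 0.
Proof.
move=> hf hg; have b8 : 4 * wb8 wpw = wb2 wpw * wb6 wpw - wb4 wpw ^+ 2 by rewrite /=; field.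
have := kum_bezout x b8.
have -> : kumF wpw x 1 x 1 = 0 by rewrite -hf /kumF /=; field.
have -> : kumG wpw x 1 x 1 = 0 by rewrite -hg /kumG /=; field.
by rewrite !mulr0 subrr => /esym.
Qed.

(** Suppose the cubic has a double root x0. Duplication shows that pe(2w) = x0 only if pe(w) = x0;
    halving down to the pole, near which x0 is not taken, pe omits x0. Half periods then take the
    remaining root -2 x0, and the product law at two of them gives x0 = 0, so that x0 is taken after
    all. *)
Lemma wpw_disc : wdisc wpw != 0.
Proof.
apply/eqP => hd; have dE : G2 ^+ 3 = 27 * G3 ^+ 2.
  by apply/eqP; rewrite -subr_eq0 -hd /wdisc /=; apply/eqP; field.
have [x0 e2 e3] : exists2 x0, G2 = 12 * x0 ^+ 2 & G3 = - 8 * x0 ^+ 3.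
  have [z|nz] := eqVneq G2 0.
    exists 0; rewrite expr0n /= mulr0 //.
    move/eqP: dE; rewrite z expr0n /= eq_sym mulf_eq0 pnatr_eq0 /= expf_eq0 /=.
    by move=> /eqP ->.
  exists (- 3 * G3 / (2 * G2)).
    apply: (mulIf (expf_neq0 2 nz)); rewrite -exprS dE; field; exact: nz.
  apply: (mulIf (expf_neq0 3 nz)); rewrite {1}dE; field; exact: nz.
have [S P D H] := pe_laws tau_up.
have ne u : ~~ L u -> pe u != x0.
  have [r r0 hr] := pe_neq tau_up x0.
  have dbl n v : ~~ L (v *+ 2 ^ n) -> (v == 0) || (cn v < r) -> pe (v *+ 2 ^ n) != x0.
    elim: n => [|n ih] nl.
      rewrite expn0 mulr1n => /orP[/eqP v0|hv]; last by apply: hr => //; apply: contra nl => /eqP ->; rewrite mul0rn lat0.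
      by move: nl; rewrite v0 mul0rn lat0.
    move: nl; rewrite expnS mulnC mulrnA; set w := v *+ 2 ^ n => nl hv.
    rewrite mulr2n in nl *.
    have nw : ~~ L w by apply: contra nl => h; apply: latD.
    have hw := ih nw hv; have := D w nw nl.
    rewrite e2 e3 => e; apply/eqP => e'; rewrite e' in e.
    have : (pe w - x0) ^+ 4 = 0.
      by move/eqP: e; rewrite eq_sym -subr_eq0 => /eqP <-; field.
    by move/eqP; rewrite expf_eq0 /= subr_eq0 (negPf hw).
  move=> nu; have u0 : u != 0 by apply: contra nu => /eqP ->; apply: lat0.
  pose n := Num.bound (cn u / r).
  have hn : cn u / r < n%:R by apply: archi_boundP; rewrite divr_ge0 ?cn_ge0 // ltW.
  have p0 : (2 ^ n)%:R != 0 :> C by rewrite pnatr_eq0 -lt0n expn_gt0.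
  have uE : u = (u / (2 ^ n)%:R) *+ 2 ^ n by rewrite -mulr_natr divfK.
  rewrite uE; apply: dbl; first by rewrite -uE.
  apply/orP; right; rewrite cnM cnV cn_nat ltr_pdivrMr ?ltr0n ?expn_gt0 // mulrC -ltr_pdivrMr //.
  by apply: lt_le_trans hn _; rewrite ler_nat ltnW // ltn_expl.
have [a1 [a2 [l1 l2 g]]] := half_points; have [n1 n2 _ _] := g.
have val a : ~~ L a -> L (a + a) -> pe a = - 2 * x0.
  move=> na la; have := H a na la; rewrite e2 e3 => e.
  have : 4 * (pe a - x0) ^+ 2 * (pe a + 2 * x0) = 0 by rewrite -e; ring.
  move/eqP; rewrite !mulf_eq0 pnatr_eq0 /= subr_eq0 (negPf (ne a na)) /= addr_eq0 => /eqP ->.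
  by ring.
have v1 := val _ n1 l1; have v2 := val _ n2 l2.
have := P _ _ g; rewrite v1 v2 e2 e3 subrr expr0n /= mul0r => e.
have : 81 * x0 ^+ 4 = 0 by rewrite [RHS]e; field.
move/eqP; rewrite mulf_eq0 pnatr_eq0 /= expf_eq0 /= => /eqP x00.
by have := ne a1 n1; rewrite v1 x00 mulr0 eqxx.
Qed.

Lemma wz_eq0 u : (wz u == 0) = L u.
Proof. by rewrite /wz; case: (L u); rewrite ?eqxx ?oner_eq0. Qed.
Lemma wzD u l : L l -> wz (u + l) = wz u.
Proof. by move=> h; rewrite /wz latDr. Qed.

Lemma wp_kummer : kummer wpw pe wz.
Proof.
have [S P D H] := pe_laws tau_up; have wd := wpw_disc.
split=> //; first by rewrite /=; field.
  by rewrite /wz lat0.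
- by move=> u; rewrite /wz /pe; case: (L u); rewrite ?oner_eq0 ?eqxx ?orbT //; left + right; rewrite ?oner_eq0.
move=> u v; have [lu|nu] := boolP (L u).
  exists 1; rewrite ?oner_eq0 //.
  have [e1 e2] : pe (u + v) = pe v /\ pe (u - v) = pe v.
    by split; rewrite addrC (peD tau_up) // (peN tau_up).
  have [e3 e4] : wz (u + v) = wz v /\ wz (u - v) = wz v.
    by split; rewrite addrC wzD // /wz -latN.
  have [e5 e6] : pe u = 1 /\ wz u = 0 by rewrite /wz pe_def lu.
  by rewrite e1 e2 e3 e4 e5 e6 /kumF /kumG /kumD; split; ring.
have [lv|nv] := boolP (L v).
  exists 1; rewrite ?oner_eq0 //.
  have lv' : L (- v) by rewrite -latN.
  have [e5 e6] : pe v = 1 /\ wz v = 0 by rewrite /wz pe_def lv.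
  by rewrite !(peD tau_up) // !wzD // e5 e6 /kumF /kumG /kumD; split; ring.
have zu : wz u = 1 by rewrite /wz (negPf nu).
have zv : wz v = 1 by rewrite /wz (negPf nv).
(* Duplication: c is the inverse of F, or of G when 2u is a period. The nonzero discriminant
   prevents F and G from vanishing together. *)
have dup s : pe s = pe u -> pe v = pe u -> exists2 c, c != 0 & [/\ pe (u + u) = c * kumG wpw (pe u) (wz u) (pe v) (wz v),
    wz (u + u) = c * kumF wpw (pe u) (wz u) (pe v) (wz v) & 0 = c * kumD (pe u) (wz u) (pe v) (wz v)].
  move=> _ ->; rewrite zu zv.
  have FE : kumF wpw (pe u) 1 (pe u) 1 = 4 * pe u ^+ 3 - G2 * pe u - G3 by rewrite /kumF /=; field.
  have GE : kumG wpw (pe u) 1 (pe u) 1 = pe u ^+ 4 + G2 / 2 * pe u ^+ 2 + 2 * G3 * pe u + G2 ^+ 2 / 16.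
    by rewrite /kumG /=; field.
  have DE : kumD (pe u) 1 (pe u) 1 = 0 by rewrite /kumD; ring.
  rewrite FE GE DE; have [l2|n2] := boolP (L (u + u)).
    have f0 := H u nu l2; set g := _ + G2 ^+ 2 / 16.
    have g0 : g != 0 by apply/eqP => g0; move: wd; rewrite (wpw_bezout f0 g0) eqxx.
    exists g^-1; first by rewrite invr_eq0.
    by rewrite f0 !mulr0 mulVf // /wz pe_def l2.
  have e := D u nu n2; move: e; set f := _ - G3; set g := _ + G2 ^+ 2 / 16 => e.
  have f0 : f != 0.
    apply/eqP => f0; move: e; rewrite f0 mul0r => /esym g0.
    by move: wd; rewrite (wpw_bezout f0 g0) eqxx.
  exists f^-1; first by rewrite invr_eq0.
  by rewrite mulr0 mulVf // -e mulKf // /wz (negPf n2).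
have [l1|n1] := boolP (L (u - v)).
  have e := esym (pe_mod tau_up l1).
  have [c c0 [e1 e2 e3]] := dup u (erefl _) e; exists c => //.
  have -> : u + v = u + u + - (u - v) by ring.
  have l1' : L (- (u - v)) by rewrite -latN.
  have [e5 e6] : pe (u - v) = 1 /\ wz (u - v) = 0 by rewrite /wz pe_def l1.
  by rewrite (peD tau_up (u + u) l1') (wzD (u + u) l1') e5 e6 -e1 -e2 -e3; split; ring.
have [l2|n2] := boolP (L (u + v)).
  have e := esym (pe_modN tau_up l2).
  have [c c0 [e1 e2 e3]] := dup u (erefl _) e; exists c => //.
  have -> : u - v = u + u + - (u + v) by ring.
  have l2' : L (- (u + v)) by rewrite -latN.
  have [e5 e6] : pe (u + v) = 1 /\ wz (u + v) = 0 by rewrite /wz pe_def l2.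
  by rewrite (peD tau_up (u + u) l2') (wzD (u + u) l2') e5 e6 -e1 -e2 -e3; split; ring.
have g : good tau u v by [].
have s := S _ _ g; have p := P _ _ g.
(* If pe u = pe v, the two laws make F and G vanish together on the diagonal. *)
have d0 : pe u - pe v != 0.
  apply/eqP => d0; move: s p; rewrite d0 expr0n /= !mul0r => s p.
  move/eqP: d0; rewrite subr_eq0 => /eqP uv; rewrite uv in s p.
  have h1 : 4 * pe v ^+ 3 - G2 * pe v - G3 = 0 by rewrite [RHS]s; field.
  have h2 : pe v ^+ 4 + G2 / 2 * pe v ^+ 2 + 2 * G3 * pe v + G2 ^+ 2 / 16 = 0 by rewrite [RHS]p; field.
  by move: wd; rewrite (wpw_bezout h1 h2) eqxx.
exists ((pe u - pe v) ^+ 2)^-1; first by rewrite invr_eq0 expf_neq0.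
have d2 : (pe u - pe v) ^+ 2 != 0 by rewrite expf_neq0.
have z1 : wz (u + v) = 1 by rewrite /wz (negPf n2).
have z2 : wz (u - v) = 1 by rewrite /wz (negPf n1).
rewrite z1 z2 zu zv; split; apply: (mulfI d2); rewrite mulVKf //.
- by rewrite p /kumG /=; field.
- by rewrite !mulr1 s /kumF /=; field.
- by rewrite /kumD !mulr1.
Qed.

Lemma jinv_wpw : wc4 wpw ^+ 3 = jinv tau * wdisc wpw.
Proof.
have := wpw_disc; have -> : wdisc wpw = G2 ^+ 3 - 27 * G3 ^+ 2 by rewrite /wdisc /=; field.
by move=> h; rewrite /jinv divfK // /wc4 /=; field.
Qed.

(** If x were omitted, the function 1 / |pe - x|, extended by 0 to the poles, would attain its
    maximum. There |pe - x| has a nonzero minimum, and the minimum principle with connectedness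
    makes pe constant, without poles. *)
Lemma pe_surj x : exists2 u, wz u != 0 & pe u / wz u = x.
Proof.
apply: contrapT => no; have ne u : ~~ L u -> pe u - x != 0.
  move=> nu; rewrite subr_eq0; apply/eqP => e; apply: no; exists u; first by rewrite wz_eq0.
  by rewrite /wz (negPf nu) divr1.
have cp u : ~~ L u -> 0 < cn (pe u - x) by move=> /ne; rewrite cn_gt0.
have hA u : ~~ L u -> analytic (fun h => pe (u + h) - x).
  by move=> nu; have := pe_hol tau_up nu => ?; anl.
pose m u : R := if L u then 0 else (cn (pe u - x))^-1.
have mper u l : L l -> m (u + l) = m u by move=> ll; rewrite /m latDr // (peD tau_up).
have mcont u (e : R) : 0 < e -> near0 (fun h => `|m (u + h) - m u| < e).
  move=> e0; have [lu|nu] := boolP (L u).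
    have [s hs es] := pe_pole2 tau_up.
    have hB : analytic (fun h => 1 + h ^+ 4 * s h - x * h ^+ 2) by anl.
    have half0 : 0 < 2^-1 :> R by rewrite invr_gt0.
    have [r r0 hr] := es; have [q q0 hq] := analytic_cont hB half0.
    have e2 : 0 < Num.min 1 (e / 2) by rewrite lt_min ltr01 divr_gt0.
    exists (Num.min (Num.min r q) (Num.min 1 (e / 2))); first by rewrite !lt_min r0 q0 ltr01 divr_gt0.
    move=> h; rewrite !lt_min => /andP[/andP[h1 h2] /andP[h3 h4]].
    rewrite [u + h]addrC mper // /m lu subr0; have c0 := cn_ge0 h.
    case: ifPn => [_|nh]; first by rewrite normr0.
    have h0 : h != 0 by apply: contraNneq nh => ->; apply: lat0.
    have hp : 0 < cn h by rewrite cn_gt0.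
    set B := 1 + h ^+ 4 * s h - x * h ^+ 2.
    have eB : pe h - x = B / h ^+ 2 by rewrite hr // /B; field.
    have := hq h h2; rewrite !expr0n /= !(mul0r, mulr0, addr0, subr0) -/B => hB1.
    have B2 : 2^-1 < cn B by have := cnB_ge 1 (1 - B); rewrite subKr cn1 cn_distC; lra.
    rewrite eB cnM cnV cnX invfM invrK ger0_norm; last by rewrite mulr_ge0 ?exprn_ge0 // invr_ge0 cn_ge0.
    have B0 : 0 < cn B by apply: lt_trans B2.
    rewrite mulrC ltr_pdivrMr //; apply: le_lt_trans (_ : cn h * 1 < _).
      by rewrite expr2 ler_pM2l // ltW.
    rewrite mulr1; apply: lt_trans h4 _; rewrite ltr_pM2l //.
  have p := cp u nu; set c := cn (pe u - x) in p.
  have d0 : 0 < Num.min (c / 2) (e * c ^+ 2 / 2) by rewrite lt_min !divr_gt0 // mulr_gt0 // exprn_gt0.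
  have := near0_and (nlat_near tau_up nu) (analytic_cont (hA u nu) d0).
  apply: near0_imp => h [nh]; rewrite addr0 lt_min => /andP[].
  rewrite /m (negPf nh) (negPf nu) -/c; set b := cn (pe (u + h) - x).
  have bp : 0 < b by apply: cp.
  have hd : `|b - c| <= cn (pe (u + h) - x - (pe u - x)).
    rewrite ler_norml; apply/andP; split; last exact: cnB_ge.
    by rewrite lerNl opprB cn_distC; apply: cnB_ge.
  move=> h1 h2; have bc : c / 2 < b.
    have := le_lt_trans hd h1; rewrite ltr_norml => /andP[h3 _]; lra.
  have -> : b^-1 - c^-1 = (c - b) / (b * c) by field; rewrite !gt_eqF.
  rewrite normrM normfV (gtr0_norm (mulr_gt0 bp p)) distrC ltr_pdivrMr ?mulr_gt0 //.
  apply: le_lt_trans hd _; apply: lt_trans h2 _.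
  have -> : e * c ^+ 2 / 2 = e * (c / 2 * c) by field.
  by rewrite ltr_pM2l // ltr_pM2r.
have [u0 hmax] := periodic_max tau_up mcont mper.
have [v nv0 nv] := punctured_ex (nlat_punctured0 tau_up).
have nu0 : ~~ L u0.
  apply/negP => l0; have := hmax v; rewrite {2}/m l0 /m (negPf nv) leNgt invr_gt0.
  by rewrite (cp v nv).
have hmin u : ~~ L u -> cn (pe u0 - x) <= cn (pe u - x).
  move=> nu; have := hmax u; rewrite /m (negPf nu) (negPf nu0) lef_pV2 ?posrE //; exact: cp.
suff H : forall u, ~~ L u /\ pe u = pe u0 by have [] := H 0; rewrite lat0.
apply: (connected_plane (u0 := u0)) => // u.
  move=> [nu eu]; have := analytic_min (hA u nu); rewrite addr0 => /(_ (ne u nu)) hm.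
  have h1 : near0 (fun h => cn (pe u - x) <= cn (pe (u + h) - x)).
    by apply: near0_imp (nlat_near tau_up nu) => h nh; rewrite eu; apply: hmin.
  by apply: near0_imp (near0_and (nlat_near tau_up nu) (hm h1)) => h [n /addIr ->].
move=> hc; have [lu|nu] := boolP (L u).
  have [r r0 hr] := pe_neq tau_up (pe u0); have [h hh [nh eh]] := hc r r0.
  have h0 : h != 0 by apply: contraNneq nh => ->; rewrite addr0.
  by have := hr h h0 hh; rewrite -eh addrC (peD tau_up) // eqxx.
split=> //; apply/eqP; rewrite -subr_eq0 -cn_eq0 eq_le cn_ge0 andbT leNgt; apply/negP => lt.
have [r r0 hr] := analytic_cont (pe_hol tau_up nu) lt; have [k kr [_ e]] := hc r r0.
by have := hr k kr; rewrite e addr0 cn_distC ltxx.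
Qed.

End WeierstrassCurve.

(** * Isogenies and complex multiplication *)

Section Isogeny.
Variables (R : realType) (tau : R[i]).
Hypothesis tau_up : 0 < complex.Im tau.
Local Notation C := R[i].
Local Notation L := (lat tau).
Local Notation pe := (pe tau).
Variables (alpha : C) (T : seq C).
Hypothesis alpha0 : alpha != 0.
Hypothesis alphaL : forall l, L l -> L (alpha * l).
Hypothesis T_uniq : uniq T.
Hypothesis T_ker : forall t, t \in T -> L (alpha * t).
Hypothesis T_full : forall z, L (alpha * z) -> exists2 t, t \in T & L (z + t).
Hypothesis T_sep : forall s t, s \in T -> t \in T -> L (s - t) -> s = t.
Hypothesis T0 : 0 \in T.

Lemma ker_translate z t : t \in T -> ~~ L (alpha * z) -> ~~ L (z + t).
Proof.
move=> /T_ker lt; apply: contra => /alphaL; rewrite mulrDr => h.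
by rewrite -(addrK (alpha * t) (alpha * z)); apply: latB.
Qed.

(** Both sides have the same double poles, at the kernel of alpha on C/L, which T represents; their
    difference is constant by Liouville. *)
Lemma isogeny : exists c, forall z, ~~ L (alpha * z) ->
  alpha ^+ 2 * pe (alpha * z) = \sum_(t <- T) pe (z + t) + c.
Proof.
pose f z := alpha ^+ 2 * pe (alpha * z) - \sum_(t <- T) pe (z + t).
have sum_an (s : seq C) z : (forall t, t \in s -> ~~ L (z + t)) -> analytic (fun h => \sum_(t <- s) pe (z + h + t)).
  elim: s => [|t s ih] hs.
    by apply: (analytic_eq (f := fun=> 0)); [move=> h; rewrite big_nil|exact: analytic_const].
  apply: (analytic_eq (f := fun h => pe (z + t + h) + \sum_(t <- s) pe (z + h + t))).
    by move=> h; rewrite big_cons (addrAC z h t).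
  apply: analyticD; first by apply: pe_hol => //; apply: hs; rewrite mem_head.
  by apply: ih => t' h'; apply: hs; rewrite in_cons h' orbT.
have fhol z : ~~ L (alpha * z) -> hol_at f z.
  move=> nz; rewrite /hol_at /f.
  have h1 := analytic_scale alpha (pe_hol tau_up nz).
  have h2 := sum_an T z (fun t tT => ker_translate tT nz).
  apply: (analytic_eq (f := fun h => alpha ^+ 2 * pe (alpha * z + alpha * h) - \sum_(t <- T) pe (z + h + t))).
    by move=> h; rewrite mulrDr.
  by apply: analyticB => //; apply: analyticZ.
have fper z l : L l -> f (z + l) = f z.
  move=> ll; rewrite /f mulrDr (peD tau_up) ?alphaL //; congr (_ - _).
  by apply: eq_bigr => t _; rewrite addrAC (peD tau_up).
have freg z : exists A, reg_at f z A.
  have [lz|nz] := boolP (L (alpha * z)); last by eexists; apply: hol_reg; apply: fhol.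
  have [t0 tT l0] := T_full lz; have [s hs es] := pe_pole2 tau_up.
  have hs' := analytic_scale alpha hs.
  have hr : analytic (fun h => \sum_(t <- rem t0 T) pe (z + h + t)).
    apply: sum_an => t; rewrite mem_rem_uniq // inE => /andP[tn tT']; apply: contra tn => lt.
    apply/eqP; apply: T_sep => //; have -> : t - t0 = z + t - (z + t0) by ring.
    exact: latB.
  exists (fun h => alpha ^+ 4 * h ^+ 2 * s (alpha * h) - h ^+ 2 * s h - \sum_(t <- rem t0 T) pe (z + h + t)).
  split; first by apply: analyticB => //; anl.
  apply: punctured_imp (punctured_and es (punctured_scale alpha0 es)) => h h0 [e1 e2].
  rewrite /f (perm_big _ (perm_to_rem tT)) big_cons /= mulrDr.
  have -> : z + h + t0 = h + (z + t0) by ring.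
  rewrite (addrC (alpha * z)) !(peD tau_up) // e1 e2.
  by move: (\sum_(_ <- _) _) => S; field; rewrite h0 alpha0.
have [|c [hc _]] := liouville tau_up freg _ fper.
  move=> z; apply: punctured_imp (punctured_scale alpha0 (nlat_punctured tau_up (alpha * z))) => h _ nl.
  by apply: fhol; rewrite mulrDr.
exists c => z nz; rewrite -(hc z (fhol z nz)) /f; ring.
Qed.

(** The sum law writes pe(z + t) + pe(z - t) through pe z with denominator (pe z - pe t)^2, which
    vanishes exactly where it should, when z + t is a period. *)
Lemma translates_rational (s : seq C) : (forall t, t \in s -> ~~ L t) -> exists D N : {poly C}, [/\ D != 0,
  forall z, ~~ L z -> (forall t, t \in s -> ~~ L (z + t) /\ ~~ L (z - t)) ->
    (\sum_(t <- s) (pe (z + t) + pe (z - t))) * D.[pe z] = N.[pe z] &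
  forall z t, t \in s -> L (z + t) -> D.[pe z] = 0].
Proof.
elim: s => [|t s ih] hs.
  exists 1, 0; split; rewrite ?oner_neq0 //.
  by move=> z _ _; rewrite big_nil mul0r horner0.
have [t' ht|D [N [D0 DN Dz]]] := ih; first by apply: hs; rewrite in_cons ht orbT.
have nt : ~~ L t by apply: hs; rewrite mem_head.
have [S _ _ _] := pe_laws tau_up.
pose d : {poly C} := ('X - (pe t)%:P) ^+ 2.
pose F : {poly C} := (2 * pe t) *: 'X^2 + (2 * pe t ^+ 2 - g2 (lattice tau) / 2) *: 'X
  - (g2 (lattice tau) / 2 * pe t + g3 (lattice tau))%:P.
have dE x : d.[x] = (x - pe t) ^+ 2 by rewrite /d horner_exp hornerXsubC.
have FE x : F.[x] = 2 * pe t * x ^+ 2 + (2 * pe t ^+ 2 - g2 (lattice tau) / 2) * x - (g2 (lattice tau) / 2 * pe t + g3 (lattice tau)).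
  by rewrite /F hornerD hornerN hornerD !hornerZ hornerXn hornerX hornerC.
have d0 : d != 0 by rewrite expf_neq0 // polyXsubC_eq0.
clearbody d F; exists (d * D), (F * D + d * N); split; first exact: mulf_neq0.
- move=> z nz hz; have [n1 n2] := hz t (mem_head _ _).
  have := DN z nz (fun t' h => hz t' (mem_behead (s := t :: s) h)).
  have g : good tau z t by [].
  have := S _ _ g; rewrite big_cons hornerD !hornerM dE FE => e1 <-.
  move: (\sum_(_ <- s) _) => Y; rewrite mulrDl [X in X + _ = _]mulrA [X in X * D.[_] + _ = _]mulrC e1; ring.
- move=> z t'; rewrite in_cons => /orP[/eqP ->|ht] lz; rewrite hornerM dE.
    by rewrite (pe_modN tau_up lz) subrr expr0n mul0r.
  by rewrite (Dz _ _ ht lz) mulr0.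
Qed.

(** Adding the formulas at P and -P replaces each translate by the symmetric sum of
    [translates_rational]; this is the origin of the factors 2. *)
Lemma isogeny_rational : exists pA pB : {poly C}, pB != 0 /\ forall P, wz tau P != 0 ->
  (wz tau (alpha * P) = 0 -> pB.[pe P / wz tau P] = 0) /\
  (wz tau (alpha * P) != 0 -> pe (alpha * P) / wz tau (alpha * P) * pB.[pe P / wz tau P] = pA.[pe P / wz tau P]).
Proof.
have [c hc] := isogeny; pose s := rem 0 T.
have sT t : t \in s -> t \in T /\ t != 0.
  by rewrite mem_rem_uniq // inE => /andP[].
have [t /sT [tT t0]|D [N [D0 DN Dz]]] := @translates_rational s.
  by apply: contra t0 => lt; apply/eqP; apply: T_sep; rewrite ?subr0.
pose q : {poly C} := 2 *: 'X + (2 * c)%:P.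
have qE x : q.[x] = 2 * x + 2 * c by rewrite /q hornerD hornerZ hornerX hornerC.
clearbody q; exists (q * D + N), ((2 * alpha ^+ 2) *: D); split.
  by rewrite scaler_eq0 negb_or D0 andbT mulf_neq0 ?pnatr_eq0 // expf_neq0.
move=> P; rewrite wz_eq0 => nP; have -> : wz tau P = 1 by rewrite /wz (negPf nP).
rewrite divr1; split.
  move/eqP; rewrite wz_eq0 => /T_full [t tT lt]; rewrite hornerZ (Dz P t) ?mulr0 //.
  rewrite mem_rem_uniq // inE tT andbT; apply: contra nP => /eqP t0.
  by move: lt; rewrite t0 addr0.
rewrite wz_eq0 => na; have -> : wz tau (alpha * P) = 1 by rewrite /wz (negPf na).
have nN : ~~ L (alpha * - P) by rewrite mulrN -latN.
have e1 := hc P na; have e2 := hc _ nN; rewrite mulrN (peN tau_up) in e2.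
have e3 : \sum_(t <- T) pe (- P + t) = \sum_(t <- T) pe (P - t).
  by apply: eq_bigr => t _; rewrite -(peN tau_up) opprD opprK.
have e4 : 2 * alpha ^+ 2 * pe (alpha * P) = 2 * pe P + \sum_(t <- s) (pe (P + t) + pe (P - t)) + 2 * c.
  have -> : 2 * alpha ^+ 2 * pe (alpha * P) = alpha ^+ 2 * pe (alpha * P) + alpha ^+ 2 * pe (alpha * P) by ring.
  rewrite e3 in e2.
  have s1 : \sum_(t <- T) pe (P + t) = pe P + \sum_(t <- s) pe (P + t) by rewrite (perm_big _ (perm_to_rem T0)) big_cons addr0.
  have s2 : \sum_(t <- T) pe (P - t) = pe P + \sum_(t <- s) pe (P - t) by rewrite (perm_big _ (perm_to_rem T0)) big_cons subr0.
  by rewrite {1}e1 e2 s1 s2 big_split /=; ring.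
have e5 := DN P nP; rewrite divr1 hornerZ hornerD hornerM qE -e5.
  have -> : pe (alpha * P) * (2 * alpha ^+ 2 * D.[pe P]) = 2 * alpha ^+ 2 * pe (alpha * P) * D.[pe P] by ring.
  by rewrite e4; ring.
move=> t /sT [tT _]; split; first exact: ker_translate.
by have := ker_translate tT nN; rewrite [in X in _ -> X]latN opprB addrC.
Qed.

End Isogeny.

(** * The kernel of a quadratic integer, and j at a quadratic point *)

Section ImaginaryQuadratic.
Variables (R : realType) (tau : R[i]).
Hypothesis tau_up : 0 < complex.Im tau.
Local Notation C := R[i].
Local Notation L := (lat tau).
Variables a b c : int.
Hypothesis a0 : a != 0.
Hypothesis quad_eq : a%:~R * tau ^+ 2 + b%:~R * tau + c%:~R = 0.

Lemma disc_neg : b ^+ 2 < 4 * (a * c).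
Proof.
have e : (4 * (a * c) - b ^+ 2)%:~R = 4 * (a%:~R * complex.Im tau) ^+ 2 :> R.
  move: quad_eq tau_up; case: tau => x y /=; rewrite -!(rmorph_int (real_complex R)) => h y0.
  have := congr1 (@complex.Re R) h; have := congr1 (@complex.Im R) h.
  rewrite expr2 /= !(mul0r, addr0, subr0, add0r) => hi hr.
  have hb : b%:~R = - (2 * a%:~R * x).
    apply: (mulIf (lt0r_neq0 y0)); apply/eqP; rewrite -subr_eq0 -[X in _ == X]hi; apply/eqP; ring.
  have hc : c%:~R = a%:~R * (x ^+ 2 + y ^+ 2).
    apply/eqP; rewrite -subr_eq0 -[X in _ == X]hr hb; apply/eqP; ring.
  by rewrite [b ^+ 2]expr2 intrB !intrM hb hc; ring.
rewrite -subr_gt0 -(ltr0z R) e mulr_gt0 // exprn_even_gt0 //= mulf_neq0 ?intr_eq0 //.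
exact: lt0r_neq0.
Qed.

(** al = a tau preserves the lattice and satisfies al^2 + b al + a c = 0. Hence N = a c equals - al
    (al + b), the kernel of al lies in the N-torsion, and T can be selected from the N^2 points
    [rp]. *)
Lemma cm_j_val (V : C -> Prop) : valuation_ring V -> V (jinv tau).
Proof.
move=> hV; apply: contrapT => nV.
have hn : 0 < a * c by have := disc_neg; have := sqr_ge0 b; lia.
pose al : C := a%:~R * tau; pose N := absz (a * c).
have N0 : (0 < N)%N by rewrite /N absz_gt0 gt_eqF.
have NE : (a * c)%:~R = N%:R :> C by rewrite pmulrn /N gtz0_abs.
have t0 : tau != 0 by apply/eqP => h; move: tau_up; rewrite h ltxx.
have al0 : al != 0 by rewrite mulf_neq0 // intr_eq0.
have al2 : al ^+ 2 = - (b%:~R * al) - N%:R.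
  rewrite -NE intrM; apply/eqP; rewrite -subr_eq0; apply/eqP.
  by rewrite -[RHS](mulr0 a%:~R) -quad_eq /al; ring.
have alL l : L l -> L (al * l).
  move=> /latP[m [n ->]]; apply/latP; exists (- n * c), (m * a - n * b).
  have e : a%:~R * tau ^+ 2 = - (b%:~R * tau) - c%:~R.
    by apply/eqP; rewrite -subr_eq0 -quad_eq; apply/eqP; ring.
  rewrite /al mulrDr !intrB !intrM !intrN.
  have -> : a%:~R * tau * (n%:~R * tau) = n%:~R * (a%:~R * tau ^+ 2) by ring.
  by rewrite e; ring.
have Nz : N%:R != 0 :> C by rewrite pnatr_eq0 -lt0n.
pose rp (x : 'I_N * 'I_N) : C := (x.1%:R + x.2%:R * tau) / N%:R.
have Nr : N%:R != 0 :> R by rewrite pnatr_eq0 -lt0n.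
have rpE x y : rp x - rp y = ((x.1%:R - y.1%:R) / N%:R)%:C%C + ((x.2%:R - y.2%:R) / N%:R)%:C%C * tau.
  by rewrite !rmorphM !fmorphV !rmorphB !rmorph_nat /rp; field.
have ordE (i j : 'I_N) (m : int) : (i%:R - j%:R) / N%:R = m%:~R :> R -> i = j.
  move=> e; have e' : (i%:Z - j%:Z) = m * N%:Z.
    apply: (@intr_inj R); rewrite intrB intrM -e -!pmulrn divfK //.
  have hi := ltn_ord i; have hj := ltn_ord j.
  have m0 : m = 0 by nia.
  by apply/val_inj => /=; lia.
have rp_sep x y : L (rp x - rp y) -> x = y.
  rewrite rpE => /(lat_coord tau_up) [m [n [e1 e2]]].
  by case: x y e1 e2 => [x1 x2] [y1 y2] /= /ordE -> /ordE ->.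
have rp_ex z : L (N%:R * z) -> exists x, L (z + rp x).
  move=> /latP[m [n e]].
  have md (k : int) : exists (i : 'I_N) (q : int), (k + i%:Z = q * N%:Z).
    have NZ : (N%:Z != 0) by rewrite eqz_nat -lt0n.
    have h1 := modz_ge0 (- k) NZ.
    have h2 : ((- k) %% N%:Z)%Z < N%:Z by apply: ltz_pmod; rewrite ltz_nat.
    have lt : (absz ((- k) %% N%:Z)%Z < N)%N by rewrite -ltz_nat gez0_abs.
    exists (Ordinal lt), (- ((- k) %/ N%:Z)%Z) => /=; rewrite gez0_abs //.
    by have := divz_eq (- k) N%:Z; lia.
  have [i [q1 h1]] := md m; have [j [q2 h2]] := md n.
  exists (i, j); apply/latP; exists q1, q2; apply: (mulfI Nz).
  have f1 := congr1 (intr : int -> C) h1; have f2 := congr1 (intr : int -> C) h2.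
  rewrite !intrD !intrM -!pmulrn in f1 f2.
  rewrite mulrDr e /rp /= [N%:R * (_ / _)]mulrC divfK // mulrDr.
  have -> : N%:R * (q2%:~R * tau) = (q2%:~R * N%:R) * tau by ring.
  by rewrite [N%:R * q1%:~R]mulrC -f1 -f2; ring.
pose T := [seq t <- [seq rp x | x <- enum {: 'I_N * 'I_N}] | L (al * t)].
have uT : uniq T.
  apply: filter_uniq; rewrite map_inj_uniq ?enum_uniq // => x y e.
  by apply: rp_sep; rewrite e subrr lat0.
have kT t : t \in T -> L (al * t) by rewrite mem_filter => /andP[].
have fT z : L (al * z) -> exists2 t, t \in T & L (z + t).
  move=> lz; have [|x hx] := rp_ex z.
    have -> : N%:R * z = - (b%:~R * (al * z)) - al * (al * z).
      have -> : al * (al * z) = al ^+ 2 * z by ring.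
      by rewrite al2; ring.
    apply: latB; last exact: alL.
    rewrite -latN; case/latP: lz => m [n ->]; apply/latP; exists (b * m), (b * n).
    by rewrite !intrM; ring.
  exists (rp x) => //; rewrite mem_filter; apply/andP; split; last by apply: map_f; rewrite mem_enum.
  have -> : al * rp x = al * (z + rp x) - al * z by ring.
  by apply: latB => //; apply: alL.
have sT s t : s \in T -> t \in T -> L (s - t) -> s = t.
  rewrite !mem_filter => /andP[_ /mapP[x _ ->]] /andP[_ /mapP[y _ ->]] /rp_sep -> //.
have T0 : 0 \in T.
  rewrite mem_filter mulr0 lat0 /=; apply/mapP.
  exists (Ordinal N0, Ordinal N0); first by rewrite mem_enum.
  by rewrite /rp /= mul0r addr0 mul0r.
have [pA [pB [pB0 rat]]] := isogeny_rational tau_up al0 alL uT kT fT sT T0.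
have ch n : n.+1%:R != 0 :> C by rewrite pnatr_eq0.
apply: (@cm_bad_reduction C ch V hV (wpw tau) C (pe tau) (wz tau) (wp_kummer tau_up) (erefl _)
  (jinv tau) (jinv_wpw tau_up) nV (fun z => al * z) b (a * c) _ _ disc_neg (pe_surj tau_up) pA pB pB0 rat).
- by move=> P Q; rewrite mulrBr.
- by move=> P; rewrite -[(al * P) *~ b]mulrzl -[P *~ _]mulrzl NE mulrA -expr2 al2; ring.
Qed.

End ImaginaryQuadratic.

(** * Integrality over Z[j] *)

Section Transfer.
Variable R : realType.
Local Notation C := R[i].
Local Notation F := (upper_half_plane R -> C).

Lemma poly_in_j_zmod : GRing.zmod_morphism (@poly_in_j R).
Proof. by move=> p q; apply/funext => t; rewrite /poly_in_j rmorphB hornerD hornerN. Qed.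
Lemma poly_in_j_monoid : GRing.monoid_morphism (@poly_in_j R).
Proof.
split=> [|p q]; apply/funext => t; rewrite /poly_in_j; first by rewrite rmorph1 hornerC.
by rewrite rmorphM hornerM.
Qed.
HB.instance Definition _ := GRing.isZmodMorphism.Build _ _ (@poly_in_j R) poly_in_j_zmod.
HB.instance Definition _ := GRing.isMonoidMorphism.Build _ _ (@poly_in_j R) poly_in_j_monoid.

Definition eval_at (t : upper_half_plane R) (x : F) : C := x t.
Lemma eval_at_zmod t : GRing.zmod_morphism (eval_at t). Proof. by []. Qed.
Lemma eval_at_monoid t : GRing.monoid_morphism (eval_at t). Proof. by []. Qed.
HB.instance Definition _ t := GRing.isZmodMorphism.Build _ _ (eval_at t) (eval_at_zmod t).
HB.instance Definition _ t := GRing.isMonoidMorphism.Build _ _ (eval_at t) (eval_at_monoid t).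

Lemma fun_regular (x : F) : exists y : F, x * x * y = x.
Proof.
exists (fun t => (x t)^-1); apply/funext => t; change (x t * x t * (x t)^-1 = x t).
by have [->|x0] := eqVneq (x t) 0; rewrite ?mul0r // mulfK.
Qed.

Variables (K : fieldType) (phi : {rmorphism F -> K}).

(** A nowhere vanishing function has a pointwise inverse in F. *)
Lemma phi_neq0 (x : F) : (forall t, x t != 0) -> phi x != 0.
Proof.
move=> h; apply/eqP => e; have : phi (x * (fun t => (x t)^-1)) = 1.
  by rewrite -[RHS](rmorph1 phi); congr (phi _); apply/funext => t; apply: divff.
by rewrite rmorphM /= e mul0r => /eqP; rewrite eq_sym oner_eq0.
Qed.

Lemma phi_char0 n : n.+1%:R != 0 :> K.
Proof.
rewrite -(rmorph_nat phi); apply: phi_neq0 => t.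
have -> : (n.+1%:R : F) t = n.+1%:R by exact: (rmorph_nat (eval_at t)).
by rewrite pnatr_eq0.
Qed.

Lemma eval_eq (x y : F) : (forall t, eval_at t x = eval_at t y) -> x = y.
Proof. by move=> h; apply/funext. Qed.

Section KummerExpressions.
Variables b2 b4 b6 b8 : F.
(** The Kummer forms are restated over F, which is not a field; [fk_morph] carries them to any
    field. *)
Definition fkF (x1 z1 x2 z2 : F) : F := 2 * x1 * x2 * (x1 * z2 + x2 * z1)
  + b2 * x1 * x2 * z1 * z2 + b4 * (x1 * z2 + x2 * z1) * z1 * z2 + b6 * z1 ^+ 2 * z2 ^+ 2.
Definition fkG (x1 z1 x2 z2 : F) : F := x1 ^+ 2 * x2 ^+ 2 - b4 * x1 * x2 * z1 * z2
  - b6 * (x1 * z2 + x2 * z1) * z1 * z2 - b8 * z1 ^+ 2 * z2 ^+ 2.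
Definition fkD (x1 z1 x2 z2 : F) : F := (x1 * z2 - x2 * z1) ^+ 2.
Definition fdisc : F := - b2 ^+ 2 * b8 - 8 * b4 ^+ 3 - 27 * b6 ^+ 2 + 9 * b2 * b4 * b6.
Definition fc4 : F := b2 ^+ 2 - 24 * b4.

Lemma fk_morph (K' : fieldType) (psi : {rmorphism F -> K'}) x1 z1 x2 z2 :
  let w := Weierstrass (psi b2) (psi b4) (psi b6) (psi b8) in
  [/\ psi (fkF x1 z1 x2 z2) = kumF w (psi x1) (psi z1) (psi x2) (psi z2),
      psi (fkG x1 z1 x2 z2) = kumG w (psi x1) (psi z1) (psi x2) (psi z2),
      psi (fkD x1 z1 x2 z2) = kumD (psi x1) (psi z1) (psi x2) (psi z2),
      psi fdisc = wdisc w & psi fc4 = wc4 w].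
Proof.
split; rewrite /fkF /fkG /fkD /fdisc /fc4 /kumF /kumG /kumD /wdisc /wc4 /=;
by rewrite !(rmorph_nat, rmorphXn, rmorphD, rmorphN, rmorphM).
Qed.
End KummerExpressions.

Variable M : nat.
Hypothesis M0 : (0 < M)%N.
Local Notation A := (int * int)%type.

Definition dpt (t : upper_half_plane R) (P : A) : C := (P.1%:~R * val t + P.2%:~R) / M%:R.
Definition inM (P : A) : bool := (M%:Z %| P.1)%Z && (M%:Z %| P.2)%Z.

Lemma dptB t P Q : dpt t (P - Q) = dpt t P - dpt t Q.
Proof. by rewrite /dpt /= !intrB -mulrBl; congr (_ / _); ring. Qed.
Lemma dptD t P Q : dpt t (P + Q) = dpt t P + dpt t Q.
Proof. by rewrite /dpt /= !intrD -mulrDl; congr (_ / _); ring. Qed.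

Lemma lat_dpt (t : upper_half_plane R) P : lat (val t) (dpt t P) = inM P.
Proof.
have Mr : M%:R != 0 :> R by rewrite pnatr_eq0 -lt0n.
have Mc : M%:R != 0 :> C by rewrite pnatr_eq0 -lt0n.
apply/idP/idP.
  have -> : dpt t P = (P.2%:~R / M%:R)%:C%C + (P.1%:~R / M%:R)%:C%C * val t.
    by rewrite !rmorphM !fmorphV !rmorph_nat !rmorph_int /dpt; field.
  move=> /(lat_coord (valP t)) [m [n [e1 e2]]].
  have div (k q : int) : k%:~R / M%:R = q%:~R :> R -> (M%:Z %| k)%Z.
    move=> e; apply/dvdzP; exists q; apply: (@intr_inj R).
    by rewrite intrM -e -pmulrn divfK.
  by rewrite /inM (div _ _ e1) (div _ _ e2).
move=> /andP[/dvdzP[m e1] /dvdzP[n e2]]; apply/latP; exists n, m.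
by rewrite /dpt e1 e2 !intrM -!pmulrn; field.
Qed.

Definition Xf (P : A) : F := fun t => pe (val t) (dpt t P).
Definition Zf (P : A) : F := fun t => wz (val t) (dpt t P).
Definition b2f : F := fun t => wb2 (wpw (val t)).
Definition b4f : F := fun t => wb4 (wpw (val t)).
Definition b6f : F := fun t => wb6 (wpw (val t)).
Definition b8f : F := fun t => wb8 (wpw (val t)).
Definition jf : F := fun t => jinv (val t).
Definition wK := Weierstrass (phi b2f) (phi b4f) (phi b6f) (phi b8f).

(** Whether [dpt t P] is a period does not depend on t, so Zf P is a constant function, 0 or 1. *)
Lemma ZfE P : phi (Zf P) = if inM P then 0 else 1.
Proof.
case: (boolP (inM P)) => h.
  rewrite -(rmorph0 phi); congr (phi _); apply/funext => t.
  by rewrite /Zf /wz lat_dpt h.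
rewrite -(rmorph1 phi); congr (phi _); apply/funext => t.
by rewrite /Zf /wz lat_dpt (negPf h).
Qed.

Lemma phi_disc : phi (fdisc b2f b4f b6f b8f) = wdisc wK.
Proof. by have [_ _ _ h _] := fk_morph b2f b4f b6f b8f phi 0 0 0 0. Qed.

Lemma eval_disc t : eval_at t (fdisc b2f b4f b6f b8f) = wdisc (wpw (val t)).
Proof. by have [_ _ _ h _] := fk_morph b2f b4f b6f b8f (eval_at t) 0 0 0 0; rewrite h. Qed.

Lemma jf_disc : wc4 wK ^+ 3 = phi jf * wdisc wK.
Proof.
have [_ _ _ _ h] := fk_morph b2f b4f b6f b8f phi 0 0 0 0.
rewrite -[wK]/(Weierstrass _ _ _ _) -phi_disc -h -rmorphXn -rmorphM; congr (phi _); apply: eval_eq => t.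
have [_ _ _ _ h'] := fk_morph b2f b4f b6f b8f (eval_at t) 0 0 0 0.
by rewrite rmorphXn rmorphM /= eval_disc h' -[eval_at t jf]/(jinv (val t)) -(jinv_wpw (valP t)).
Qed.

(** The law holds at each t with its own scalar; the chosen scalars form one element of F which
    vanishes nowhere, so phi maps it to a nonzero scalar of K. *)
Lemma fun_kummer : kummer wK (fun P => phi (Xf P)) (fun P => phi (Zf P)).
Proof.
split.
- rewrite /wK /= -!rmorphXn -!rmorphM -rmorphB -(rmorph_nat phi) -rmorphM; congr (phi _).
  apply: eval_eq => t; rewrite rmorphB rmorphXn !rmorphM rmorph_nat.
  by have [h _ _ _ _] := wp_kummer (valP t).
- rewrite -phi_disc; apply: phi_neq0 => t; rewrite -[X in X != 0]/(eval_at t _) eval_disc.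
  exact: (wpw_disc (valP t)).
- by rewrite ZfE /inM !dvdz0.
- move=> P; rewrite ZfE; case: (boolP (inM P)) => h; last by right; rewrite oner_eq0.
  left; apply: phi_neq0 => t; rewrite /Xf pe_def lat_dpt h; exact: oner_neq0.
move=> P Q.
have /choice [c hc] : forall t : upper_half_plane R, exists c : C, c != 0 /\
    [/\ pe (val t) (dpt t P + dpt t Q) * pe (val t) (dpt t P - dpt t Q) =
          c * kumG (wpw (val t)) (pe (val t) (dpt t P)) (wz (val t) (dpt t P)) (pe (val t) (dpt t Q)) (wz (val t) (dpt t Q)),
        pe (val t) (dpt t P + dpt t Q) * wz (val t) (dpt t P - dpt t Q) +
        pe (val t) (dpt t P - dpt t Q) * wz (val t) (dpt t P + dpt t Q) =
          c * kumF (wpw (val t)) (pe (val t) (dpt t P)) (wz (val t) (dpt t P)) (pe (val t) (dpt t Q)) (wz (val t) (dpt t Q)) &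
        wz (val t) (dpt t P + dpt t Q) * wz (val t) (dpt t P - dpt t Q) =
          c * kumD (pe (val t) (dpt t P)) (wz (val t) (dpt t P)) (pe (val t) (dpt t Q)) (wz (val t) (dpt t Q))].
  move=> t; have [_ _ _ _ h] := wp_kummer (valP t).
  by have [c c0 hc] := h (dpt t P) (dpt t Q); exists c.
exists (phi c); first by apply: phi_neq0 => t; have [] := hc t.
have [mF mG mD _ _] := fk_morph b2f b4f b6f b8f phi (Xf P) (Zf P) (Xf Q) (Zf Q).
rewrite /wK -mF -mG -mD -!rmorphM -rmorphD.
have ev t := fk_morph b2f b4f b6f b8f (eval_at t) (Xf P) (Zf P) (Xf Q) (Zf Q).
split; congr (phi _); apply: eval_eq => t; have [eF eG eD _ _] := ev t; have [_ [h1 h2 h3]] := hc t;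
  rewrite -?dptD -?dptB in h1 h2 h3.
- by rewrite (rmorphM (eval_at t) (Xf (P + Q))) (rmorphM (eval_at t) c) eG; exact: h1.
- rewrite (rmorphD (eval_at t)) (rmorphM (eval_at t) (Xf (P + Q))) (rmorphM (eval_at t) (Xf (P - Q))).
  by rewrite (rmorphM (eval_at t) c) eF; exact: h2.
- by rewrite (rmorphM (eval_at t) (Zf (P + Q))) (rmorphM (eval_at t) c) eD; exact: h3.
Qed.

End Transfer.

(** * Points of order N inside the 6N-torsion *)

Section TorsionBasis.
Variable N : nat.
Hypothesis N1 : (1 < N)%N.
Variables Q1 Q2 : ZNxZN N.
Hypothesis hQ : is_basis Q1 Q2.

Lemma basis_free (a b : 'Z_N) : a *: Q1 + b *: Q2 = 0 -> a = 0 /\ b = 0.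
Proof.
move=> e; have [ab [_ u]] := hQ 0.
have e1 := u (a, b) (esym e); have e2 := u (0, 0); rewrite /= !scale0r addr0 in e2.
by move: e1; rewrite (e2 (erefl _)) => -[-> ->].
Qed.

Lemma Zn_eq0 (n : nat) : (n%:R == 0 :> 'Z_N) = (N %| n)%N.
Proof. by rewrite Zp_nat -val_eqE /= Zp_cast. Qed.

(** With denominator 6 N, the factor 6 makes these the N-torsion points. *)
Definition zpt (x y : nat) : int * int := (6 * x%:Z, 6 * y%:Z).
Definition qpt (Q : ZNxZN N) : int * int := zpt Q.1 Q.2.

Lemma zptMn x y n : zpt x y *+ n = zpt (x * n) (y * n).
Proof.
elim: n => [|n ih]; first by rewrite !muln0 mulr0n /zpt !mulr0.
rewrite mulrSr ih /zpt !mulnS !PoszD; apply/eqP; rewrite xpair_eqE /=.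
by apply/andP; split; apply/eqP; ring.
Qed.

Lemma zptD x y x' y' : zpt x y + zpt x' y' = zpt (x + x') (y + y').
Proof. by rewrite /zpt !PoszD !mulrDr. Qed.

Lemma inM_zpt x y : inM (6 * N) (zpt x y) = (x%:R == 0 :> 'Z_N) && (y%:R == 0 :> 'Z_N).
Proof.
rewrite !Zn_eq0 /inM /zpt /= !dvdzE !abszM /=.
by rewrite !dvdn_pmul2l.
Qed.

Lemma inM_combination (a b n : nat) :
  inM (6 * N) (zpt (a * Q1.1 + b * Q2.1) (a * Q1.2 + b * Q2.2) *+ n) =
  ((a * n)%:R *: Q1 + (b * n)%:R *: Q2 == 0).
Proof.
rewrite zptMn inM_zpt !natrM !natrD !natrM !natr_Zp.
case: Q1 Q2 => [x1 y1] [x2 y2] /=.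
rewrite -[RHS]/((a%:R * n%:R * x1 + b%:R * n%:R * x2 == 0) && (a%:R * n%:R * y1 + b%:R * n%:R * y2 == 0)).
by congr (_ && _); congr (_ == _); ring.
Qed.

(** A primitive combination of a basis has order N. It is applied to Q1, Q2, Q1 + Q2 and Q1 + 2
    Q2. *)
Lemma inM_order (a b n : nat) : coprime a b -> 
  inM (6 * N) (zpt (a * Q1.1 + b * Q2.1) (a * Q1.2 + b * Q2.2) *+ n) = (N %| n)%N.
Proof.
move=> ab; rewrite inM_combination; apply/eqP/idP => [/basis_free [/eqP + /eqP]|h].
  rewrite !Zn_eq0 => h1 h2; have : (N %| gcdn (a * n) (b * n))%N by rewrite dvdn_gcd h1.
  by rewrite -muln_gcdl (eqP ab) mul1n.
have e k : (k * n)%:R = 0 :> 'Z_N by apply/eqP; rewrite Zn_eq0 dvdn_mull.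
by rewrite !e !scale0r addr0.
Qed.

Lemma qpt_comb (a b : nat) : qpt Q1 *+ a + qpt Q2 *+ b = zpt (a * Q1.1 + b * Q2.1) (a * Q1.2 + b * Q2.2).
Proof. by rewrite /qpt !zptMn zptD ![(_ * a)%N]mulnC ![(_ * b)%N]mulnC. Qed.

(** Residues are lifted to representatives below N, so [qpt] is additive only up to periods. *)
Lemma qptD_mod : inM (6 * N) (qpt Q1 + qpt Q2 - qpt (Q1 + Q2)).
Proof.
have N0 : (0 < N)%N by apply: ltnW.
have key (x y : 'Z_N) : ((6 * N)%:Z %| 6 * (x : nat)%:Z + 6 * (y : nat)%:Z - 6 * (nat_of_ord (x + y)%R)%:Z)%Z.
  apply/dvdzP; exists (((x : nat) + y) %/ N)%N%:Z.
  have -> : nat_of_ord (x + y)%R = (((x : nat) + y) %% N)%N by exact: (congr1 (modn ((x : nat) + y)) (Zp_cast N1)).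
  have := divn_eq (x + y) N; move: (_ %/ _)%N (_ %% _)%N => q s e.
  have : ((x : nat) + y)%N%:Z = (q * N + s)%N%:Z by rewrite -e.
  rewrite !PoszD !PoszM => e'; rewrite -mulrDr -mulrBr e'; ring.
by rewrite /inM /qpt /zpt /=; apply/andP; split; apply: key.
Qed.

End TorsionBasis.

Section PartOne.
Variable R : realType.
Local Notation C := R[i].
Local Notation F := (upper_half_plane R -> C).

Lemma pe_inj (tau u v : C) : 0 < complex.Im tau -> ~~ lat tau u -> ~~ lat tau v ->
  ~~ lat tau (u + v) -> ~~ lat tau (u - v) -> pe tau u != pe tau v.
Proof.
move=> h nu nv n1 n2; have [_ _ _ _ hk] := wp_kummer h; have [c c0 [_ _ e]] := hk u v.
apply/eqP => e'; move: e; rewrite /wz (negPf nu) (negPf nv) (negPf n1) (negPf n2) e' /kumD !mulr1 subrr expr0n mulr0.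
by move/eqP; rewrite oner_eq0.
Qed.

Variables (N : nat) (Q1 Q2 : ZNxZN N).
Hypotheses (N1 : (1 < N)%N) (hQ : is_basis Q1 Q2).
Let zf : F := fun tau => (CN N)%:R * Lambda (val tau) Q1 Q2.
Let M := (6 * N)%N.

Lemma phi_val (K : fieldType) (phi : {rmorphism F -> K}) (V : K -> Prop) : valuation_ring V ->
  V (phi (@jf R)) -> V (phi zf).
Proof.
move=> hV Vj; have N0 : (0 < N)%N by apply: ltnW.
have M0 : (0 < M)%N by rewrite muln_gt0.
have hk := fun_kummer phi M0.
set X := (fun P => phi (Xf M P)) in hk; set Z := (fun P => phi (Zf M P)) in hk.
have ZE P : Z P = if inM M P then 0 else 1 by apply: ZfE.
have Z0 P : (Z P == 0) = inM M P by rewrite ZE; case: (inM M P); rewrite ?eqxx ?oner_eq0.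
have Zn P : (Z P != 0) = ~~ inM M P by rewrite Z0.
pose q1 := qpt Q1; pose q2 := qpt Q2.
have comb a b : q1 *+ a + q2 *+ b = _ := qpt_comb Q1 Q2 a b.
have ord a b n : coprime a b -> inM M ((q1 *+ a + q2 *+ b) *+ n) = (N %| n)%N.
  by move=> h; rewrite comb inM_order.
have nN1 : ~~ (N %| 1)%N by rewrite dvdn1 gtn_eqF.
have o1 n : (Z (q1 *+ n) == 0) = (N %| n)%N.
  by rewrite Z0 -(ord 1%N 0%N) // mulr1n mulr0n addr0.
have o2 n : (Z ((q1 + q2 + q2) *+ n) == 0) = (N %| n)%N.
  by rewrite Z0 -(ord 1%N 2%N) // mulr1n mulr2n addrA.
have i1 : ~~ inM M q1 by have := o1 1%N; rewrite mulr1n Z0 => ->.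
have i4 : ~~ inM M (q1 + q2 + q2) by have := o2 1%N; rewrite mulr1n Z0 => ->.
have i2 : ~~ inM M q2 by have := ord 0%N 1%N 1%N isT; rewrite !mulr1n mulr0n add0r => ->.
have i3 : ~~ inM M (q1 + q2) by have := ord 1%N 1%N 1%N isT; rewrite !mulr1n => ->.
have inMP (x y : int) : inM M (x, y) = (M%:Z %| x)%Z && (M%:Z %| y)%Z by [].
pose h3 : int := (3 * N)%N%:Z; pose h2 : int := (2 * N)%N%:Z.
have d3 : (M%:Z %| h3)%Z = false.
  by rewrite /h3 dvdzE /= /M dvdn_pmul2r.
have d3' : (M%:Z %| - h3)%Z = false by rewrite dvdzE abszN -dvdzE d3.
have d2 : (M%:Z %| h2)%Z = false.
  by rewrite /h2 dvdzE /= /M dvdn_pmul2r.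
have d6 : (M%:Z %| h3 + h3)%Z.
  by rewrite /h3 -PoszD dvdzE /= /M -mulnDl.
pose E1 : int * int := (0, h3); pose E2 : int * int := (h3, 0); pose E3 : int * int := (h3, h3).
pose T : int * int := (h2, 0).
have ZT : ~~ inM M T by rewrite -[T]/(h2, 0) inMP d2.
have T3 : Z (T *+ 3) = 0.
  apply/eqP; rewrite Z0 mulrS mulr2n -[T + _]/(h2 + (h2 + h2), 0 + (0 + 0)) inMP !addr0 dvdz0 andbT.
  by rewrite /h2 -!PoszD dvdzE /= /M -!mulnDl.
(* A cube root taken pointwise; its image under phi is the scale of the Deuring model. *)
pose Uf : F := fun t => 3.-root (4 * pe (val t) (dpt M t T) ^+ 3 + wb2 (wpw (val t)) * pe (val t) (dpt M t T) ^+ 2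
  + 2 * wb4 (wpw (val t)) * pe (val t) (dpt M t T) + wb6 (wpw (val t))).
have kx P : ~~ inM M P -> kum_x X Z P = phi (Xf M P).
  by move=> nP; rewrite /kum_x ZE (negPf nP) divr1.
have hU : phi Uf ^+ 3 = 4 * phi (Xf M T) ^+ 3 + wb2 (wK phi) * phi (Xf M T) ^+ 2
    + 2 * wb4 (wK phi) * phi (Xf M T) + wb6 (wK phi).
  rewrite /wK /= -(rmorph_nat phi 4) -(rmorph_nat phi 2) -!rmorphXn -!rmorphM -!rmorphD; congr (phi _).
  apply: eval_eq => t; rewrite !rmorphD (rmorphXn (eval_at t) 3 Uf) !(rmorphM (eval_at t) _ (_ ^+ _)).
  rewrite (rmorphXn (eval_at t) 3 (Xf M T)) (rmorphXn (eval_at t) 2 (Xf M T)).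
  rewrite (rmorphM (eval_at t) _ (Xf M T)) (rmorphM (eval_at t) _ (@b4f R)) !rmorph_nat.
  exact: (rootCK (isT : (0 < 3)%N) _).
have res : V ((CN N)%:R * ((phi (Xf M q1) - phi (Xf M (q1 + q2))) / (phi (Xf M q2) - phi (Xf M (q1 + q2))))).
  rewrite -!kx //; apply: (@lambda_integral K V hV (phi_char0 phi) (wK phi) _ X Z hk N q1 q2 N1 o1 o2 _ _ _ Vj
    (jf_disc phi) E1 E2 E3 _ _ _ _ _ _ _ _ _ _ _ _ T (phi Uf)); rewrite ?Zn //; last by cbv zeta; rewrite kx.
  - by rewrite -[E1]/(0, h3) inMP d3 andbF.
  - by rewrite -[E2]/(h3, 0) inMP d3.
  - by rewrite -[E3]/(h3, h3) inMP d3.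
  - by apply/eqP; rewrite Z0 -[E1 + E1]/(0 + 0, h3 + h3) inMP d6 addr0 dvdz0.
  - by apply/eqP; rewrite Z0 -[E2 + E2]/(h3 + h3, 0 + 0) inMP d6 addr0 dvdz0.
  - by apply/eqP; rewrite Z0 -[E3 + E3]/(h3 + h3, h3 + h3) inMP d6.
  - by rewrite -[E1 + E2]/(0 + h3, h3 + 0) inMP addr0 d3 andbF.
  - by rewrite -[E1 - E2]/(0 - h3, h3 - 0) inMP subr0 d3 andbF.
  - by rewrite -[E1 + E3]/(0 + h3, h3 + h3) inMP add0r d3.
  - by rewrite -[E1 - E3]/(0 - h3, h3 - h3) inMP sub0r d3'.
  - by rewrite -[E2 + E3]/(h3 + h3, 0 + h3) inMP add0r d3 andbF.
  - by rewrite -[E2 - E3]/(h3 - h3, 0 - h3) inMP sub0r d3' andbF.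
have dq (t : upper_half_plane R) (Q : ZNxZN N) : dpt M t (qpt Q) = Defs.phi (val t) Q.
  have Nz : N%:R != 0 :> C by rewrite pnatr_eq0 -lt0n.
  by rewrite /dpt /Defs.phi /qpt /zpt /M /= natrM !intrM -!pmulrn; field.
have wq (t : upper_half_plane R) (Q : ZNxZN N) P : ~~ inM M P -> inM M (P - qpt Q) -> wp (lattice (val t)) (Defs.phi (val t) Q) = Xf M P t.
  move=> nP iP; rewrite /Xf; have l : lat (val t) (dpt M t P - dpt M t (qpt Q)) by rewrite -dptB lat_dpt.
  rewrite (pe_mod (valP t) l) pe_def -dq ifN //.
  by apply: contra nP => l'; rewrite -(lat_dpt M0 t) -(subrK (dpt M t (qpt Q)) (dpt M t P)) latD.
have i00 P : inM M (P - P) by rewrite subrr inMP dvdz0.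
have den (t : upper_half_plane R) : Xf M q2 t - Xf M (q1 + q2) t != 0.
  rewrite subr_eq0 /Xf; apply: (pe_inj (valP t)); rewrite -?dptD -?dptB (lat_dpt M0) //.
    by rewrite addrC.
  by rewrite opprD addrC addrNK -(lat_dpt M0 t) -sub0r dptB (_ : dpt M t 0 = 0) ?sub0r -?latN ?lat_dpt // /dpt /= mul0r addr0 mul0r.
(* The quotient is multiplied out in F before phi is applied; its denominator vanishes nowhere
   because Q1 and Q1 + 2 Q2 are not periods. *)
have eq : zf * (Xf M q2 - Xf M (q1 + q2)) = (CN N)%:R * (Xf M q1 - Xf M (q1 + q2)).
  apply: eval_eq => t; have eN : ((CN N)%:R : F) t = (CN N)%:R := rmorph_nat (eval_at t) _.
  rewrite -[LHS]/((CN N)%:R * Lambda (val t) Q1 Q2 * (Xf M q2 t - Xf M (q1 + q2) t)).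
  rewrite -[RHS]/(((CN N)%:R : F) t * (Xf M q1 t - Xf M (q1 + q2) t)) eN /Lambda.
  rewrite (wq t Q1 q1) ?i00 // (wq t Q2 q2) ?i00 // (wq t (Q1 + Q2) (q1 + q2)) //; last exact: qptD_mod.
  by rewrite mulrA divfK //; exact: den.
have dn : phi (Xf M q2) - phi (Xf M (q1 + q2)) != 0 by rewrite -rmorphB; apply: phi_neq0 => t; exact: den.
suff -> : phi zf = (CN N)%:R * ((phi (Xf M q1) - phi (Xf M (q1 + q2))) / (phi (Xf M q2) - phi (Xf M (q1 + q2)))) by [].
by apply: (mulIf dn); rewrite mulrA divfK // -!rmorphB -rmorphM eq rmorphM rmorph_nat.
Qed.

(** The values at [zf] of monic polynomials over Z[j] form a multiplicative set, without 0 if [zf]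
    is not integral. A field in which none of them becomes 0 keeps the image of [zf] nonintegral,
    and a valuation ring contradicts [phi_val]. *)
Lemma lambda_integral_j : integralOver (@poly_in_j R) zf.
Proof.
apply: contrapT => no.
pose S : set F := [set s | exists2 p : {poly {poly int}}, p \is monic & s = (map_poly (@poly_in_j R) p).[zf]]%classic.
have [|||K [phi hphi]] := @exists_field_quotient F S (@fun_regular R).
- by exists 1; [exact: monic1|rewrite rmorph1 hornerC].
- move=> x y [p mp ->] [q mq ->]; exists (p * q); first by rewrite monicMl.
  by rewrite rmorphM hornerM.
- by move=> [p mp e]; apply: no; exists p => //; apply/rootP.
have nf : ~ integralOver (phi \o (@poly_in_j R)) (phi zf).
  move=> [p mp /rootP e]; have := hphi _ (ex_intro2 _ _ p mp (erefl _)).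
  by rewrite -horner_map -map_poly_comp e eqxx.
have [V [hV Vf nV]] := exists_valuation_ring nf.
apply: nV; apply: phi_val => //; have := Vf 'X.
rewrite /= (_ : poly_in_j 'X = @jf R) //; apply/funext => t.
by rewrite /poly_in_j map_polyX hornerX.
Qed.

End PartOne.

(** * Integrality of j at imaginary quadratic points *)

Section PartTwo.
Variable R : realType.
Local Notation C := R[i].

Lemma quadratic_equation (theta : C) : 0 < complex.Im theta ->
  imaginary_quadratic_field (Q_adjoin theta) -> exists a b c : int,
  a != 0 /\ a%:~R * theta ^+ 2 + b%:~R * theta + c%:~R = 0.
Proof.
move=> th [[K1 KB KD] [u [v [_ _ hB]]] _].
have Kt : Q_adjoin theta theta by move=> A [_ sub]; apply: sub.
have inK x : Q_adjoin theta x -> exists p q : rat, x = ratr p * u + ratr q * v.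
  by move=> /hB [[p q] [e _]]; exists p, q.
have th0 : theta != 0 by apply/eqP => e; move: th; rewrite e ltxx.
have K1' : Q_adjoin theta 1 by have := K1; rewrite unfold_in /= => /set_mem.
have K2 : Q_adjoin theta (theta ^+ 2).
  have h1 : theta^-1 \in [in Q_adjoin theta].
    by rewrite -div1r; apply: KD => //; rewrite unfold_in /=; apply/mem_set.
  have : theta / theta^-1 \in [in Q_adjoin theta].
    by apply: KD => //; rewrite unfold_in /=; apply/mem_set.
  by rewrite invrK -expr2 unfold_in /= => /set_mem.
have [p1 [q1 e1]] := inK _ K1'; have [p2 [q2 e2]] := inK _ Kt; have [p3 [q3 e3]] := inK _ K2.
have notrat (r : rat) : theta <> ratr r.
  move=> e; move: th; rewrite e -(fmorph_eq_rat (real_complex R \o ratr) r) /=.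
  by rewrite ltxx.
(* The 2 by 2 minors of the coordinates of 1, theta, theta^2 in a plane over Q give their linear
   relation; A = 0 would make theta rational. *)
pose A := p1 * q2 - p2 * q1; pose B := p3 * q1 - p1 * q3; pose D := p2 * q3 - p3 * q2.
have eq : ratr A * theta ^+ 2 + ratr B * theta + ratr D = 0 :> C.
  transitivity (ratr A * (ratr p3 * u + ratr q3 * v) + ratr B * (ratr p2 * u + ratr q2 * v)
    + ratr D * (ratr p1 * u + ratr q1 * v) : C); first by rewrite -e1 -e2 -e3 mulr1.
  by rewrite /A /B /D !rmorphB !rmorphM /=; ring.
have A0 : A != 0.
  apply/eqP => A0.
  have z1 : ratr q2 - ratr q1 * theta = 0 :> C.
    transitivity (ratr q2 * (ratr p1 * u + ratr q1 * v) - ratr q1 * (ratr p2 * u + ratr q2 * v) : C).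
      by rewrite -e1 -e2 mulr1.
    have -> : ratr q2 * (ratr p1 * u + ratr q1 * v) - ratr q1 * (ratr p2 * u + ratr q2 * v) =
      (ratr p1 * ratr q2 - ratr p2 * ratr q1) * u by ring.
    by rewrite -!rmorphM -rmorphB -/A A0 rmorph0 mul0r.
  have z2 : ratr p2 - ratr p1 * theta = 0 :> C.
    transitivity (ratr p2 * (ratr p1 * u + ratr q1 * v) - ratr p1 * (ratr p2 * u + ratr q2 * v) : C).
      by rewrite -e1 -e2 mulr1.
    have -> : ratr p2 * (ratr p1 * u + ratr q1 * v) - ratr p1 * (ratr p2 * u + ratr q2 * v) =
      - (ratr p1 * ratr q2 - ratr p2 * ratr q1) * v by ring.
    by rewrite -!rmorphM -rmorphB -/A A0 rmorph0 oppr0 mul0r.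
  have quo (p q : rat) : ratr q - ratr p * theta = 0 :> C -> p = 0.
    move=> z; apply/eqP; apply: contraT => p0; exfalso; apply: (notrat (q / p)).
    have rp : ratr p != 0 :> C by rewrite fmorph_eq0.
    by apply: (mulfI rp); rewrite fmorph_div /= mulrCA divff // mulr1; apply/eqP; rewrite eq_sym -subr_eq0 z.
  move: e1; rewrite (quo _ _ z1) (quo _ _ z2) !rmorph0 !mul0r addr0 => /eqP.
  by rewrite oner_eq0.
have nd (r : rat) : ratr r * (denq r)%:~R = (numq r)%:~R :> C.
  by rewrite /ratr divfK // intr_eq0 denq_neq0.
exists (numq A * (denq B * denq D)), (numq B * (denq A * denq D)), (numq D * (denq A * denq B)); split.
  by rewrite !mulf_neq0 ?numq_eq0 ?denq_neq0.
rewrite !intrM -!nd -[RHS](mulr0 ((denq A)%:~R * (denq B)%:~R * (denq D)%:~R)) -eq; ring.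
Qed.

Lemma cm_j_integral (theta : C) : 0 < complex.Im theta ->
  imaginary_quadratic_field (Q_adjoin theta) -> algebraic_integer (jinv theta).
Proof.
move=> th /(quadratic_equation th) [a [b [c [a0 e]]]].
apply: contrapT => no; have [V [hV _ nV]] := @exists_valuation_ring int C intr _ no.
exact: (nV (cm_j_val th a0 e hV)).
Qed.

End PartTwo.

Theorem theorem4p4 (R : realType) (N : nat) (hN : (2 <= N)%N)
    (Q1 Q2 : ZNxZN N) (hQ : is_basis Q1 Q2) :
  integralOver (@poly_in_j R)
    (fun tau : upper_half_plane R => (CN N)%:R * Lambda (val tau) Q1 Q2)
  /\ (forall theta : upper_half_plane R,
        imaginary_quadratic_field (Q_adjoin (val theta)) ->
        algebraic_integer ((CN N)%:R * Lambda (val theta) Q1 Q2)).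
Proof.
have int := @lambda_integral_j R N Q1 Q2 hN hQ; split=> // theta hq.
have jint := cm_j_integral (valP theta) hq.
have [p mp /rootP e] := int.
pose ev := eval_at theta \o @poly_in_j R.
(* The integral equation over Z[j], specialized at theta, has coefficients polynomial in the
   algebraic integer j(theta). *)
apply: (@integral_root_monic _ _ intr _ (map_poly ev p)).
- exact: monic_map.
- apply/rootP; have := congr1 (eval_at theta) e; rewrite rmorph0 -horner_map -map_poly_comp => h.
  exact: h.
move=> x /(nthP 0) [i _ <-]; rewrite coef_map /= /eval_at /poly_in_j.
apply: integral_horner => // y /(nthP 0) [k _ <-]; rewrite coef_map /=.
exact: integral_id.
Qed.
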